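(* Let $n>2$ and let $\Sigma\subset\mathbb{R}^{n,+}$ be a Lipschitz graph whose distance to the boundary $\mathbb{R}^{n-1}=\{x:x_n=0\}$ of upper half space is strictly positive. For $\phi\in L^p(\Sigma)$ ($Cl_n$-valued) define, for $y\in\Sigma$, $$T_\Sigma\phi(y)=\frac{2^{n-2}}{\omega_n}\,PV\!\int_\Sigma y_n^{n-2}\Big(E(x,y)n(x)\phi(x)-F(x,y)\hat n(x)\hat\phi(x)\Big)\,d\sigma(x).$$ Then $T_\Sigma$ is bounded on $L^p(\Sigma)$ for every $1<p<\infty$.
   Context: $Cl_n$ is the real Clifford algebra generated by an orthonormal basis $e_1,\dots,e_n$ of $\mathbb{R}^n$ with $e_ie_j+e_je_i=-2\delta_{ij}$; vectors $x=\sum x_je_j$ are viewed in $Cl_n$, a nonzero vector has inverse $x^{-1}=-x/\|x\|^2$, $\|\cdot\|$ is the Euclidean norm, and $\mathbb{R}^{n,+}=\{x:x_n>0\}$. $Cl_{n-1}$ is the subalgebra generated by $e_1,\dots,e_{n-1}$; each $A\in Cl_n$ is uniquely $A=B+Ce_n$ with $B,C\in Cl_{n-1}$, and $\hat A:=B-Ce_n$ (so for a vector $y$, $\hat y=y_1e_1+\dots+y_{n-1}e_{n-1}-y_ne_n$); $\hat\phi(x)$ means $\widehat{\phi(x)}$ and $\hat n(x)=\widehat{n(x)}$. The kernels are $$E(x,y)=\frac{(x-y)^{-1}}{\|x-y\|^{n-2}\|x-\hat y\|^{n-2}},\qquad F(x,y)=\frac{(\hat x-y)^{-1}}{\|x-y\|^{n-2}\|\hat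 x-y\|^{n-2}}.$$ A Lipschitz graph is a set $\{x'+g(x')e_n: x'\in\mathbb{R}^{n-1}\}$ with $g$ Lipschitz; $n(x)$ is its unit normal vector (defined $\sigma$-a.e.), $\sigma$ its surface measure, $\omega_n$ the surface area of the unit sphere in $\mathbb{R}^n$, and $PV\int_\Sigma$ denotes $\lim_{\epsilon\to0}\int_{\Sigma\setminus B(y,\epsilon)}$. *)

(* Defs.v *)
From HB Require Import structures.
From mathcomp Require Import all_boot all_order all_algebra.
From mathcomp Require Import all_classical all_reals all_analysis.
Set Implicit Arguments. Unset Strict Implicit. Unset Printing Implicit Defensive.
Import Order.TTheory GRing.Theory Num.Theory.
Import numFieldNormedType.Exports.
Local Open Scope classical_set_scope.
Local Open Scope ring_scope.

Section Defs.
Variable R : realType.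

Definition enorm k (v : 'rV[R]_k) : R := Num.sqrt (\sum_(i < k) v 0 i ^+ 2).

(* ---------- The real Clifford algebra Cl_n ----------
   An element is a function from subsets A of {1..n} (here 'I_n) to R,
   the coefficient of the basis blade e_A = e_{a1}...e_{ak} (a1<...<ak). *)
Definition Cl (n : nat) := {set 'I_n} -> R.

(* sign of e_A e_B = sgn * e_{A Δ B}, using e_i e_j = - e_j e_i (i<>j), e_i^2 = -1 *)
Definition clsign n (A B : {set 'I_n}) : R :=
  (-1) ^+ (#|[set ab : 'I_n * 'I_n | (ab.1 \in A) && (ab.2 \in B) && (ab.2 < ab.1)%N]%SET|
           + #|A :&: B|).

Definition clmul n (u v : Cl n) : Cl n := fun C =>
  \sum_(A : {set 'I_n}) \sum_(B : {set 'I_n})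
     (if (A :\: B) :|: (B :\: A) == C then clsign A B * u A * v B else 0).

Definition cladd n (u v : Cl n) : Cl n := fun C => u C + v C.
Definition clsub n (u v : Cl n) : Cl n := fun C => u C - v C.
Definition clscale n (a : R) (u : Cl n) : Cl n := fun C => a * u C.

Definition clnorm n (u : Cl n) : R := Num.sqrt (\sum_(A : {set 'I_n}) u A ^+ 2).

Definition clvec n (x : 'rV[R]_n) : Cl n := fun A =>
  \sum_(i < n) (if A == [set i]%SET then x 0 i else 0).

Definition vinv n (x : 'rV[R]_n) : 'rV[R]_n := (- (enorm x ^+ 2)^-1) *: x.

(* the last basis vector e_n is ord_max in 'I_(m.+1) *)
(* hat : B + C e_n |-> B - C e_n; e_A contains e_n iff ord_max \in A *)
Definition clhat m (u : Cl m.+1) : Cl m.+1 := fun A =>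
  if ord_max \in A then - u A else u A.

Definition vhat m (y : 'rV[R]_m.+1) : 'rV[R]_m.+1 :=
  \row_(i < m.+1) (if i == ord_max then - y 0 i else y 0 i).

Definition kerE m (x y : 'rV[R]_m.+1) : Cl m.+1 :=
  clscale ((enorm (x - y) ^+ m.-1 * enorm (x - vhat y) ^+ m.-1)^-1)
          (clvec (vinv (x - y))).
Definition kerF m (x y : 'rV[R]_m.+1) : Cl m.+1 :=
  clscale ((enorm (x - y) ^+ m.-1 * enorm (vhat x - y) ^+ m.-1)^-1)
          (clvec (vinv (vhat x - y))).

(* ---------- omega_n = surface area of the unit sphere S^{n-1} in R^n ----------
   omega_1 = 2, omega_2 = 2 pi, omega_{k+2} = 2 pi omega_k / k. *)
Fixpoint omega (n : nat) : R :=
  match n with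
  | 0 => 0
  | 1 => 2
  | 2 => 2 * pi
  | (k.+2) as n' => 2 * pi * omega k / k%:R
  end.

Record mspace := MSpace { msdisp : measure_display; mscar :> measurableType msdisp }.

Fixpoint Rsp (k : nat) : mspace :=
  match k with
  | 0 => @MSpace _ R
  | k'.+1 => @MSpace _ (R * mscar (Rsp k'))%type
  end.

Fixpoint lebn (k : nat) : set (Rsp k) -> \bar R :=
  match k return set (Rsp k) -> \bar R with
  | 0 => (@lebesgue_measure R : set R -> \bar R)
  | k'.+1 => ((@lebesgue_measure R : set R -> \bar R) \x @lebn k')%E
  end.

Fixpoint rspcoords (k : nat) : Rsp k -> seq R :=
  match k return Rsp k -> seq R with
  | 0 => fun t => [:: t]
  | k'.+1 => fun t => t.1 :: @rspcoords k' t.2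
  end.

(* the point of R^m (m >= 1) corresponding to a point of Rsp m.-1 *)
Definition rsprow (m : nat) (t : Rsp m.-1) : 'rV[R]_m :=
  \row_(i < m) nth 0 (rspcoords t) i.

(* Lipschitz continuity of g : R^m -> R is the library notion [lipschitz g]
   (normedtype), w.r.t. the max norm on 'rV_m, equivalent to the Euclidean one. *)

Definition graphpt m (g : 'rV[R]_m -> R) (x' : 'rV[R]_m) : 'rV[R]_m.+1 :=
  \row_(i < m.+1) (if unlift ord_max i is Some j then x' 0 j else g x').

(* i-th partial derivative of g at x' (where g is differentiable; 0 elsewhere,
   a Lebesgue null set by Rademacher's theorem) *)
Definition pderiv m (g : 'rV[R]_m -> R) (x' : 'rV[R]_m) (i : 'I_m) : R :=
  if `[< differentiable g x' >] then 'D_(delta_mx 0 i) g x' else 0.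

Definition gradnorm2 m (g : 'rV[R]_m -> R) (x' : 'rV[R]_m) : R :=
  \sum_(i < m) pderiv g x' i ^+ 2.

Definition jac m (g : 'rV[R]_m -> R) (x' : 'rV[R]_m) : R :=
  Num.sqrt (1 + gradnorm2 g x').

Definition unormal m (g : 'rV[R]_m -> R) (x' : 'rV[R]_m) : 'rV[R]_m.+1 :=
  (jac g x')^-1 *: \row_(i < m.+1)
      (if unlift ord_max i is Some j then - pderiv g x' j else 1).

(* integral over Sigma w.r.t. the surface measure sigma, of f : Sigma -> \bar R
   (f may also depend on the normal), pulled back to the parameter space *)
Definition surfint m (g : 'rV[R]_m -> R) (D : set 'rV[R]_m.+1)
    (f : 'rV[R]_m.+1 -> 'rV[R]_m -> \bar R) : \bar R :=
  (\int[@lebn m.-1]_(t in [set t | D (graphpt g (rsprow t))])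
     (f (graphpt g (rsprow t)) (rsprow t) * (jac g (rsprow t))%:E))%E.

Definition sigma_ae m (g : 'rV[R]_m -> R) (P : 'rV[R]_m.+1 -> Prop) : Prop :=
  almost_everywhere (@lebn m.-1) (fun t => P (graphpt g (rsprow t))).

Definition inLp m (g : 'rV[R]_m -> R) (p : R) (phi : 'rV[R]_m.+1 -> Cl m.+1) : Prop :=
  (forall A, measurable_fun setT (fun t : Rsp m.-1 => phi (graphpt g (rsprow t)) A)) /\
  (surfint g setT (fun x _ => (powR (clnorm (phi x)) p)%:E) < +oo)%E.

Definition Tint m (g : 'rV[R]_m -> R) (phi : 'rV[R]_m.+1 -> Cl m.+1)
    (y : 'rV[R]_m.+1) (eps : R) : Cl m.+1 := fun C =>
  fine (surfint g [set x | eps <= enorm (x - y)]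
    (fun x x' => (y 0 ord_max ^+ m.-1 *
        clsub (clmul (clmul (kerE x y) (clvec (unormal g x'))) (phi x))
              (clmul (clmul (kerF x y) (clhat (clvec (unormal g x')))) (clhat (phi x))) C)%:E)).

Definition PVexists m (g : 'rV[R]_m -> R) (phi : 'rV[R]_m.+1 -> Cl m.+1)
    (y : 'rV[R]_m.+1) : Prop :=
  forall C, cvg ((fun eps => Tint g phi y eps C) @ 0^'+).

Definition TSigma m (g : 'rV[R]_m -> R) (phi : 'rV[R]_m.+1 -> Cl m.+1)
    (y : 'rV[R]_m.+1) : Cl m.+1 := fun C =>
  2 ^+ m.-1 / omega m.+1 * lim ((fun eps => Tint g phi y eps C) @ 0^'+).

End Defs.

(* Main.v *)
Require Import Defs.
From HB Require Import structures.
From mathcomp Require Import all_boot all_order all_algebra.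
From mathcomp Require Import boolp reals exp.
From mathcomp Require Import ring lra zify.
Set Implicit Arguments. Unset Strict Implicit. Unset Printing Implicit Defensive.
Import Order.TTheory GRing.Theory Num.Theory.
Local Open Scope ring_scope.

(** Integrating over the lines through y turns the surface integral into an
average, over the directions of the lines, of one-dimensional singular
integrals along Lipschitz graphs. In slope coordinates the kernel of such a
line integral is a smooth function of the difference quotient of the graph
divided by x - y, plus an error dominated by a Poisson kernel at height A x:
the reflected factors 1/|x - y^|^(n-2) only matter at distances above y_n,
where y_n^(n-2) normalises them. The Poisson part is controlled by a maximal
function. The singular part is handled on finite grids: in L^2 by
symmetrising the kernel over triples of points (second differences replace
the Menger curvature argument), then in L^p by a good-lambda inequality for
the truncations, and finally by passing to the limit in the grid. Principal
values exist almost everywhere because a Lipschitz function is differentiable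
almost everywhere. The directions are integrable against (1 + |v|^2)^(-n/2),
which recombines the line estimates into the bound for the Clifford operator. *)

(** The lines enter through the change of variables [x = z + (s - z.1) (1, v)] in the parameter
    space. Its Jacobian [|s - z.1|^(n-2)] cancels all but one power of the singularity of [E], and
    it cancels the whole factor [1/|x - y|^(n-2)] of [F], whose remaining pole sits at the mirror
    image. Dividing heights by the length of [(1, v)] gives every line a Lipschitz function with the
    same constant, so the one-dimensional bounds are uniform in [v]. Two obstacles shape the
    one-dimensional part. Sharp truncations do not fit the Lipschitz Riemann sums of the passage to
    the limit, so on the grid they are replaced by conjugate Poisson kernels of variable radius and
    recovered later at the cost of a Poisson kernel. And the truncation is Euclidean on the graph,
    so on a line it depends on the slope and is not symmetric about the base point; the existence of
    principal values therefore takes a blow-up at points of differentiability besides the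
    cancellation of the kernel. The final bound concerns only radii below the height of the point,
    which is enough for the limit. *)

Local Notation le_via y := (@le_trans _ _ y).
Local Ltac le_of_eq := rewrite le_eqVlt; apply/orP; left; apply/eqP.

(** * Layer-cake sums over geometric levels *)

Section LayerSums.
Variable R: realType.
Implicit Types (p d u X Y: R).

(** Discrete layer cake for the power [p] of [u]. The levels grow by the factor 4 because the
    good-lambda inequality compares the levels [t] and [4 * t]; the lowest level [d] is sent to 0 at
    the end. *)
Definition layer p d K u: R :=
 \sum_(k<K) (d*4^+k)`^p*(d*4^+k<u)%R%:R.

Lemma layerS p d K u :
 layer p d K.+1 u = layer p d K u+(d*4^+K)`^p*(d*4^+K<u)%R%:R.
Proof. by rewrite /layer big_ord_recr. Qed.

Lemma level_powRS p d k: 0<=d -> (d*4^+k.+1)`^p = 4`^p*(d*4^+k)`^p.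
Proof.
move=> d0; rewrite exprS mulrCA.
by rewrite [LHS]powRM// mulr_ge0// exprn_ge0.
Qed.

Lemma layer_lower p d K u: 0<=p -> 0<=d -> 0<=u -> u<=d*4^+K ->
 u`^p<=4`^p*layer p d K u+d`^p.
Proof.
move=> p0 d0 u0; elim: K => [|K IH] uK.
 by rewrite /layer big_ord0 mulr0 add0r ge0_ler_powR// ?nnegrE// -[d]mulr1 -(expr0 4).
rewrite layerS mulrDr.
have [uk|ku]:=leP u (d*4^+K).
 by rewrite mulr0 mulr0 addr0; exact: IH.
rewrite mulr1 -level_powRS //.
have: u`^p<=(d*4^+K.+1)`^p.
 by rewrite ge0_ler_powR// nnegrE// mulr_ge0// exprn_ge0.
move/le_trans; apply.
rewrite addrAC lerDr addr_ge0 ?powR_ge0// mulr_ge0 ?powR_ge0 //.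
by apply: sumr_ge0 => i _; rewrite mulr_ge0 ?powR_ge0.
Qed.

(** The levels below [u] form a geometric progression, so their powers add up to a multiple of the
    largest one, which is itself below [u]. *)
Lemma layer_upper p d K u: 0<p -> 0<d -> 0<=u ->
 layer p d K u<=4`^p/(4`^p-1)*u`^p.
Proof.
move=> p0 d0 u0.
have q1: 1<(4: R)`^p.
 by have /= := @gt0_ltr_powR R p p0 1 4; rewrite powR1; apply; rewrite ?nnegrE// ltr1n.
have q0: 0<(4: R)`^p-1 by lra.
have geom: layer p d K u<=(d*4^+K)`^p/(4`^p-1).
 elim: K => [|K IH]; first by rewrite /layer big_ord0 divr_ge0 ?powR_ge0// ltW.
 rewrite layerS level_powRS ?(ltW d0) //.
 set w:=(d*4^+K)`^p in IH *.
 have w0: 0<=w by exact: powR_ge0.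
 apply: (le_via (w/(4`^p-1)+w)).
  apply: lerD => //; rewrite ler_piMr// lern1; exact: leq_b1.
 le_of_eq; field; lra.
elim: K geom => [|K IH] geom.
 by rewrite /layer big_ord0 mulr_ge0 ?powR_ge0// divr_ge0 ?powR_ge0// ltW.
have [uk|ku]:=leP u (d*4^+K).
 rewrite layerS [_<_]ltNge uk mulr0 addr0; apply: IH.
 have {}geom:=geom.
 elim: K {uk geom} => [|K IH]; first by rewrite /layer big_ord0 divr_ge0 ?powR_ge0// ltW.
 rewrite layerS level_powRS ?(ltW d0) //.
 set w:=(d*4^+K)`^p in IH *.
 have w0: 0<=w by exact: powR_ge0.
 apply: (le_via (w/(4`^p-1)+w)).
  apply: lerD => //; rewrite ler_piMr// lern1; exact: leq_b1.
 le_of_eq; field; lra.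
apply: (le_trans geom); rewrite level_powRS ?(ltW d0)// mulrAC.
rewrite ler_wpM2l ?divr_ge0 ?powR_ge0 ?(ltW q0) //.
by rewrite ge0_ler_powR ?(ltW p0)// ?nnegrE// ?(ltW ku)// mulr_ge0 ?(ltW d0)// exprn_ge0.
Qed.

Lemma layer_upper_ex p: 0<p -> exists2 C: R, 0<C &
 forall d K u, 0<d -> 0<=u -> layer p d K u<=C*u`^p.
Proof.
move=> p0; exists (4`^p/(4`^p-1)); last by move=> *; exact: layer_upper.
have /= := @gt0_ltr_powR R p p0 1 4; rewrite powR1 => /(_ _ _ _).
by rewrite !nnegrE ltr1n => q; rewrite divr_gt0 ?powR_gt0// subr_gt0 q.
Qed.

Lemma powR_div (x t s: R) : 0<=x -> 0<t -> (x/t)`^s = x`^s/t`^s.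
Proof.
move=> x0 t0; rewrite powRM ?invr_ge0 ?(ltW t0)//; congr (_*_).
by rewrite -powR_inv1 ?(ltW t0)// -powRrM mulN1r powRN.
Qed.

(** Removes the error left by the part of the layer cake below the lowest level [d]. *)
Lemma powR_small_le p c X Y: 0<p ->
 (forall d: R, 0<d -> X<=Y+c*d`^p) -> X<=Y.
Proof.
move=> p0 H; apply/ler_addgt0Pr => e e0.
have c1: 0 < `|c| + 1 by rewrite ltr_wpDl.
have h: 0<e/(`|c| + 1) by rewrite divr_gt0.
have:=H ((e/(`|c| + 1))`^p^-1) (powR_gt0 _ h).
rewrite -powRrM mulVf ?gt_eqF// powRr1 ?(ltW h) //.
move/le_trans; apply; rewrite lerD2l mulrCA ger_pMr// ler_pdivrMr// mul1r.
by rewrite (le_trans (ler_norm c))// lerDl.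
Qed.

End LayerSums.

(** * The maximal function on a finite grid: weak type *)

Section DiscreteMaximal.
Variable R: realType.
Implicit Types (f: nat -> R) (p: R).

(** The uncentred Hardy-Littlewood maximal function of the grid {0, ..., N-1}, over half-open
    intervals containing [i]. *)
Definition Mx N f i: R :=
 \big[Num.max/0]_(a<i.+1) \big[Num.max/0]_(b<N.+1 | (i<b)%N)
  ((\sum_(a<=j<b) `|f j|)/(b-a)%:R).

Lemma Mx_ge0 N f i: 0<=Mx N f i.
Proof. exact: bigmax_ge_id. Qed.

Lemma Mx_sum N f i a b: (a<=i)%N -> (i<b)%N -> (b<=N)%N ->
 \sum_(a<=j<b) `|f j| <= Mx N f i*(b-a)%:R.
Proof.
move=> ai ib bN.
have ba: 0<(b-a)%:R :> R by rewrite ltr0n; lia.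
rewrite -ler_pdivrMr //.
have ai' : (a<i.+1)%N by lia.
have bN' : (b<N.+1)%N by lia.
apply: le_trans (le_bigmax _ _ (Ordinal ai')) => /=.
exact: (@le_bigmax_cond _ _ _ _ (Ordinal bN')).
Qed.

Lemma Mx_gt N f i u: 0<=u -> u<Mx N f i ->
 exists a b, [/\ (a<=i)%N, (i<b)%N, (b<=N)%N &
  u*(b-a)%:R < \sum_(a<=j<b) `|f j|].
Proof.
move=> u0 uM; apply: contrapT => H.
suff: Mx N f i<=u by rewrite leNgt uM.
apply/bigmax_leP; split => // a _; apply/bigmax_leP; split => // b ib.
rewrite leNgt; apply/negP => uab; apply: H; exists a, b; split => //.
- by rewrite -ltnS.
- by rewrite -ltnS.
- by rewrite -ltr_pdivlMr// ltr0n; have:=ltn_ord a; lia.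
Qed.

Lemma sum_split (b: nat) (F: nat -> R) a c: (a<=b)%N -> (b<=c)%N ->
 \sum_(a<=j<c) F j = \sum_(a<=j<b) F j + \sum_(b<=j<c) F j.
Proof. by move=> ab bc; rewrite (big_cat_nat ab bc). Qed.

(** A one-sided rising-sun argument: scanning from the left, each point of [B] that is met opens an
    interval of large average, and the scan resumes at its right end, so the chosen intervals are
    disjoint and cover [B]. *)
Lemma rising_right N (B: pred nat) f u: (forall j, 0<=f j) -> 0<=u ->
 (forall i, (i<N)%N -> B i ->
  exists b, [/\ (i<b)%N, (b<=N)%N & u*(b-i)%:R <= \sum_(i<=j<b) f j]) ->
 u * \sum_(0<=i<N) (B i)%:R <= \sum_(0<=i<N) f i.
Proof.
move=> f0 u0 H.
suff: forall n i, (i<=N)%N -> (N-i<=n)%N ->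
  u * \sum_(i<=j<N) (B j)%:R <= \sum_(i<=j<N) f j.
 by move=> /(_ N 0%N); apply; lia.
elim=> [|n IH] i iN Nin.
 by rewrite !big_geq ?mulr0//; lia.
have [->|iN']:=eqVneq i N; first by rewrite !big_geq// mulr0.
have {iN'}iN' : (i<N)%N by lia.
have [Bi|Bi]:=boolP (B i); last first.
 rewrite big_ltn// (negbTE Bi) add0r [leRHS]big_ltn //.
 apply: (le_via (\sum_(i.+1<=j<N) f j)); last by rewrite lerDr.
 by apply: IH; lia.
have [b [ib bN ub]]:=H i iN' Bi.
rewrite [X in _<=X](@sum_split b)//; last lia.
rewrite [X in _*X](@sum_split b)//; last lia.
rewrite mulrDr lerD//; last by apply: IH; lia.
apply: le_trans ub; apply: ler_wpM2l => //.
apply: (le_via (\sum_(i<=j<b) 1)).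
 by apply: ler_sum => j _; rewrite lern1 leq_b1.
by rewrite sumr_const_nat.
Qed.

Lemma rising_left N (B: pred nat) f u: (forall j, 0<=f j) -> 0<=u ->
 (forall i, (i<N)%N -> B i ->
  exists a, (a<=i)%N /\ u*(i.+1-a)%:R <= \sum_(a<=j<i.+1) f j) ->
 u * \sum_(0<=i<N) (B i)%:R <= \sum_(0<=i<N) f i.
Proof.
move=> f0 u0; elim/ltn_ind: N => -[|N] IH H.
 by rewrite !big_geq// mulr0.
have [BN|BN]:=boolP (B N); last first.
 rewrite !big_nat_recr//= (negbTE BN) addr0.
 apply: (le_via (\sum_(0<=i<N) f i)); last by rewrite lerDl.
 by apply: IH => // i iN; apply: H; lia.
have [a [aN ua]]:=H N (ltnSn N) BN.
rewrite [X in _<=X](@sum_split a)//; last lia.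
rewrite [X in _*X](@sum_split a)//; last lia.
rewrite mulrDr lerD//; first by apply: IH => // i ia; apply: H; lia.
apply: le_trans ua; apply: ler_wpM2l => //.
apply: (le_via (\sum_(a<=j<N.+1) 1)).
 by apply: ler_sum => j _; rewrite lern1 leq_b1.
by rewrite sumr_const_nat.
Qed.

(** An interval through [i] with average above [u] is split at [i] into a left and a right piece,
    both containing [i]; one of them has average at least [u/2]. The two one-sided coverings at
    level [u/2] give the constant 4. *)
Lemma Mx_weak N f u: 0<u ->
 u * \sum_(0<=i<N) (u<Mx N f i)%R%:R<=4 * \sum_(0<=i<N) `|f i|.
Proof.
move=> u0.
pose Br i:=`[< exists b, [/\ (i<b)%N, (b<=N)%N &
  (u/2)*(b-i)%:R <= \sum_(i<=j<b) `|f j|] >].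
pose Bl i:=`[< exists a, (a<=i)%N /\
  (u/2)*(i.+1-a)%:R <= \sum_(a<=j<i.+1) `|f j| >].
have u20: 0<=u/2 by lra.
have f0 j: 0 <= `|f j| by [].
have Hr := @rising_right N Br _ _ f0 u20 (fun i _ => @asboolW _).
have Hl := @rising_left N Bl _ _ f0 u20 (fun i _ => @asboolW _).
have HB: \sum_(0<=i<N) (u<Mx N f i)%R%:R <=
  \sum_(0<=i<N) (Br i)%:R + \sum_(0<=i<N) (Bl i)%:R :> R.
 rewrite -big_split/=; apply: ler_sum_nat => i /andP[_ iN].
 have [uM|uM]:=ltP u (Mx N f i); last by rewrite addr_ge0.
 have [a [b [ai ib bN uab]]]:=Mx_gt (ltW u0) uM.
 rewrite -natrD ler1n addn_gt0 !lt0b; apply/orP; apply: contrapT => /not_orP[nr nl].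
 have {}nr: \sum_(i<=j<b) `|f j| < (u/2)*(b-i)%:R.
  by rewrite ltNge; apply/negP => h; apply: nr; apply/asboolP; exists b.
 have {}nl: \sum_(a<=j<i.+1) `|f j| < (u/2)*(i.+1-a)%:R.
  by rewrite ltNge; apply/negP => h; apply: nl; apply/asboolP; exists a.
 move: uab; rewrite (@sum_split i)//; last lia.
 move: nr nl; rewrite big_nat_recr//=.
 rewrite !natrB; [|lia..]; rewrite (_: i.+1%:R = i%:R+1 :> R); last by rewrite natr1.
 have fi:=f0 i.
 have: i%:R+1<=b%:R :> R by rewrite natr1 ler_nat.
 have: a%:R<=i%:R :> R by rewrite ler_nat.
 by nra.
have:=ler_wpM2l (ltW u0) HB; nra.
Qed.

(** Values with [|f j| <= u/2] cannot raise an average by more than [u/2], so the weak bound at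
    level [u/2] for the large values alone suffices. This sharper form can be summed over the
    levels. *)
Lemma Mx_weak_above N f u: 0<u ->
 u * \sum_(0<=i<N) (u<Mx N f i)%R%:R <=
 8 * \sum_(0<=i<N) `|f i| * (u<2 * `|f i|)%R%:R.
Proof.
move=> u0.
pose g i:=f i*(u<2 * `|f i|)%R%:R.
have u2: 0<u/2 by lra.
have:=Mx_weak N g u2.
have -> : \sum_(0<=i<N) `|g i| = \sum_(0<=i<N) `|f i| * (u<2 * `|f i|)%R%:R.
 by apply: eq_bigr => i _; rewrite normrM (ger0_norm (ler0n _ _)).
suff: \sum_(0<=i<N) (u<Mx N f i)%R%:R <=
  \sum_(0<=i<N) (u/2<Mx N g i)%R%:R :> R by move=> h1 h2; nra.
apply: ler_sum => i _.
have [uM|uM]:=ltP u (Mx N f i); last by rewrite ler0n.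
have [a [b [ai ib bN uab]]]:=Mx_gt (ltW u0) uM.
rewrite ler1n lt0b ltNge; apply/negP => Mg.
have:=Mx_sum g ai ib bN.
have ba: 0<(b-a)%:R :> R by rewrite ltr0n; lia.
move=> h; have {}h:=le_trans h (ler_wpM2r (ltW ba) Mg).
suff: \sum_(a<=j<b) `|f j| <= \sum_(a<=j<b) `|g j| + u/2*(b-a)%:R by lra.
rewrite mulr_natr -sumr_const_nat -big_split/=; apply: ler_sum => j _.
rewrite /g normrM (ger0_norm (ler0n _ _)).
have [_|]:=ltP u (2 * `|f j|); first by rewrite mulr1 lerDl; lra.
by move=> h'; rewrite mulr0 add0r; lra.
Qed.

End DiscreteMaximal.

(** * Strong type of the maximal function and the good-lambda principle *)

Section LayerCake.
Variable R: realType.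
Implicit Types (u v: nat -> R) (p d t: R).

Definition cnt N u t: R:=\sum_(0<=i<N) (t<u i)%R%:R.

Lemma sum_layer p d K N u :
 \sum_(0<=i<N) layer p d K (u i) =
 \sum_(k<K) (d*4^+k)`^p*cnt N u (d*4^+k).
Proof.
by rewrite exchange_big/=; apply: eq_bigr => k _; rewrite mulr_sumr.
Qed.

Lemma pow4_ge (x d: R) : 0<d -> exists K, x<=d*4^+K.
Proof.
move=> d0; exists (Num.truncn (`|x| / d)).+1.
rewrite mulrC -ler_pdivrMr //.
have: `|x| / d<=(Num.truncn (`|x| / d)).+1%:R.
 by rewrite ltW// truncnS_gt.
set n:=(_).+1 => h.
apply: (le_via n%:R).
 by apply: le_trans h; rewrite ler_pM2r ?invr_gt0// ler_norm.
by rewrite -natrX ler_nat ltnW// ltn_expl.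
Qed.

Lemma sum_powR_layer p d N u: 0<p -> 0<d -> (forall i, 0<=u i) ->
 exists K0, forall K, (K0<=K)%N -> \sum_(0<=i<N) u i`^p <=
  4`^p*(\sum_(0<=i<N) layer p d K (u i))+N%:R*d`^p.
Proof.
move=> p0 d0 u0.
have [K0 HK]:=pow4_ge (\sum_(0<=i<N) u i) d0.
exists K0 => K KK0.
apply: (le_via (\sum_(0<=i<N) (4`^p*layer p d K (u i)+d`^p))).
 apply: ler_sum_nat => i /andP[_ iN].
 apply: layer_lower => //; try exact: ltW.
 apply: (le_via (d*4^+K0)); last first.
  by rewrite ler_pM2l// ler_weXn2l// ler1n.
 apply: le_trans HK.
 rewrite (@sum_split _ i)//; last exact: ltnW.
 rewrite [X in _+X]big_ltn// addrCA lerDl addr_ge0//; exact: sumr_ge0.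
rewrite big_split/= -mulr_sumr lerD2l.
by rewrite sumr_const_nat subn0 mulr_natl.
Qed.

(** Marcinkiewicz interpolation: [Mx_weak_above] is summed over the levels with weight of exponent
    [p-1]; exchanging the sums leaves a layer sum of exponent [p-1] at [2 * |f i|], which converges
    geometrically because [p > 1]. *)
Lemma Mx_strong p: 1<p -> exists2 C: R, 0<C & forall N (f: nat -> R),
 \sum_(0<=i<N) Mx N f i`^p<=C * \sum_(0<=i<N) `|f i| `^ p.
Proof.
move=> p1; have q0: 0<p-1 by lra.
have p0: 0<p by lra.
have [C1 C10 HC1]:=layer_upper_ex q0.
exists (4`^p*(8*(C1*2`^(p-1)))) => [|N f].
 by rewrite mulr_gt0 ?powR_gt0// mulr_gt0// mulr_gt0 ?powR_gt0.
apply: (@powR_small_le _ p N%:R) => // d d0.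
have M0 i: 0<=Mx N f i:=Mx_ge0 N f i.
have [K /(_ K (leqnn K))/le_trans]:=sum_powR_layer N p0 d0 M0; apply.
rewrite lerD2r -mulrA ler_pM2l ?powR_gt0// sum_layer.
apply: (le_via (\sum_(k<K) 8*((d*4^+k)`^(p-1) *
  \sum_(0<=i<N) `|f i| * (d*4^+k<2 * `|f i|)%R%:R))).
 apply: ler_sum => k _.
 have dk: 0<d*4^+k by rewrite mulr_gt0// exprn_gt0.
 have:=ler_wpM2l (powR_ge0 (d*4^+k) (p-1)) (Mx_weak_above N f dk).
 rewrite -/(cnt N (Mx N f) _) -(mulr_powRB1 (ltW dk) p0); lra.
rewrite -mulr_sumr -[8*_*_]mulrA ler_pM2l //.
under eq_bigr do rewrite mulr_sumr.
rewrite exchange_big/= mulr_sumr; apply: ler_sum => i _.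
under eq_bigr do rewrite mulrCA.
rewrite -mulr_sumr -/(layer _ _ _ _).
have:=HC1 d K (2 * `|f i|) d0 (mulr_ge0 (ler0n _ 2) (normr_ge0 _)).
move/(ler_wpM2l (normr_ge0 (f i))); rewrite powRM //.
by rewrite -(mulr_powRB1 (normr_ge0 (f i)) p0); lra.
Qed.

(** The layer sum of [u] reappears on the right with a factor at most [1/2] and is absorbed; all
    sums are finite, so the absorption is legitimate. The lowest level is counted trivially by [N]
    and disappears with [d]. *)
Lemma good_lambda p a c: 0<p -> 0<=a -> 4`^p*a<=1/2 -> 0<c ->
 exists2 C: R, 0<C & forall N u v, (forall i, 0<=u i) -> (forall i, 0<=v i) ->
 (forall t, 0<t -> cnt N u (4 * t)<=a*cnt N u t+cnt N v (c * t)) ->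
 \sum_(0<=i<N) u i`^p<=C * \sum_(0<=i<N) v i`^p.
Proof.
move=> p0 a0 pa c0.
have [C1 C10 HC1]:=layer_upper_ex p0.
exists (4`^p*(2*4`^p*C1*(c^-1)`^p)) => [|N u v u0 v0 H].
 by rewrite mulr_gt0 ?powR_gt0// mulr_gt0 ?powR_gt0 ?invr_gt0// mulr_gt0// mulr_gt0 ?powR_gt0.
apply: (@powR_small_le _ p (4`^p*2*N%:R+N%:R)) => // d d0.
have [K0 /(_ K0.+1 (leqnSn _))/le_trans]:=sum_powR_layer N p0 d0 u0; apply.
rewrite [leRHS](_: _ = 4`^p*(2*(4`^p*(C1*(c^-1`^p *
 \sum_(0<=i<N) v i`^p)))+2*(N%:R*d`^p))+N%:R*d`^p); last by ring.
rewrite lerD2r ler_pM2l ?powR_gt0 //.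
pose w k:=(d*4^+k)`^p.
have w0 k: 0<=w k by exact: powR_ge0.
set S:=\sum_(0<=i<N) layer p d K0.+1 (u i).
pose S':=\sum_(0<=i<N) layer p d K0 (u i).
have S'S: S'<=S.
 apply: ler_sum => i _; rewrite layerS lerDl mulr_ge0// ?powR_ge0 //.
pose V:=\sum_(k<K0) w k*cnt N v (c*(d*4^+k)).
have VE: V<=C1*((c^-1)`^p * \sum_(0<=i<N) v i`^p).
 apply: (le_via (\sum_(0<=i<N) layer p d K0 (c^-1*v i))).
  rewrite sum_layer; apply: ler_sum => k _.
  apply: ler_wpM2l => //; apply: ler_sum => i _.
  by rewrite (mulrC _ (v i)) ltr_pdivlMr// (mulrC c).
 rewrite mulr_sumr mulr_sumr; apply: ler_sum => i _.
 rewrite -powRM ?invr_ge0 ?(ltW c0) //.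
 by apply: HC1; rewrite // mulr_ge0// invr_ge0 ltW.
have HS: S<=d`^p*N%:R+4`^p*a*S'+4`^p*V.
 rewrite /S sum_layer big_ord_recl expr0 mulr1 -addrA; apply: lerD.
  apply: ler_wpM2l; first exact: powR_ge0.
  apply: (le_via (\sum_(0<=i<N) 1)).
  by apply: ler_sum => j _; rewrite lern1 leq_b1.
  by rewrite sumr_const_nat subn0.
 rewrite /S' sum_layer /V -mulrA !mulr_sumr -big_split/=; apply: ler_sum => k _.
 rewrite /bump/= add1n level_powRS ?(ltW d0)// -/(w k) -mulrA.
 have -> : d*4^+k.+1 = 4*(d*4^+k) by rewrite exprS mulrCA.
 have:=H (d*4^+k) (mulr_gt0 d0 (exprn_gt0 k (ltr0n _ 4))).
 move/(ler_wpM2l (w0 k)) => h.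
 rewrite -mulrDr ler_pM2l ?powR_gt0//; apply: le_trans h _.
 by le_of_eq; ring.
have S'0: 0<=S'.
 by apply: sumr_ge0 => i _; apply: sumr_ge0 => k _; rewrite mulr_ge0// ?powR_ge0.
have HV:=ler_wpM2l (powR_ge0 4 p) VE.
have h2: 4`^p*(a*S')<=1/2*S by rewrite mulrA; nra.
move: HS HV h2; rewrite -[4`^p*a*S']mulrA.
set X:=4`^p*V; set Y:=4`^p*(C1*_); set Z:=d`^p*N%:R => HS HV h2.
rewrite -/Y (mulrC N%:R) -/Z; lra.
Qed.

End LayerCake.

(** * Symmetrisation of kernels over triples *)

Section Symmetrization.
Variable R: realType.
Implicit Types (k: nat -> nat -> R) (f: nat -> R).

Definition trip k x y z: R:=k x y*k x z+k y x*k y z+k z x*k z y.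

Lemma tripC k x y z: trip k x y z = trip k y x z.
Proof. by rewrite /trip; ring. Qed.

Lemma tripA k x y z: trip k x y z = trip k x z y.
Proof. by rewrite /trip; ring. Qed.

(** Expanding the square gives the products [k x y * k x z]. The mixed sum, written once as it
    stands and once with two variables exchanged, supplies the other two products of [trip]; this
    accounts for its coefficient 2. *)
Lemma sym_identity (s: seq nat) k f :
 \sum_(x <- s) (\sum_(y <- s) k x y*f y)^+2 +
 2 * \sum_(x <- s) f x*(\sum_(y <- s) k x y)*(\sum_(y <- s) k x y*f y) =
 \sum_(x <- s) \sum_(y <- s) \sum_(z <- s) trip k x y z*(f y*f z).
Proof.
have E1: \sum_(x <- s) (\sum_(y <- s) k x y*f y)^+2 =
  \sum_(x <- s) \sum_(y <- s) \sum_(z <- s) (k x y*k x z)*(f y*f z).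
 apply: eq_bigr => x _; rewrite expr2 big_distrlr/=.
 by apply: eq_bigr => y _; apply: eq_bigr => z _; ring.
have E2: \sum_(x <- s) f x*(\sum_(y <- s) k x y)*(\sum_(y <- s) k x y*f y) =
  \sum_(x <- s) \sum_(y <- s) \sum_(z <- s) (k y x*k y z)*(f y*f z).
 rewrite [RHS]exchange_big/=; apply: eq_bigr => y _.
 rewrite -mulrA big_distrlr/= mulr_sumr; apply: eq_bigr => x _.
 by rewrite mulr_sumr; apply: eq_bigr => z _; ring.
have E3: \sum_(x <- s) f x*(\sum_(y <- s) k x y)*(\sum_(y <- s) k x y*f y) =
  \sum_(x <- s) \sum_(y <- s) \sum_(z <- s) (k z x*k z y)*(f y*f z).
 rewrite E2; apply: eq_bigr => x _; rewrite exchange_big/=.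
 by apply: eq_bigr => y _; apply: eq_bigr => z _; ring.
rewrite mulrDl !mul1r {1}E2 E3 E1 -!big_split/=.
apply: eq_bigr => x _; rewrite -!big_split/=; apply: eq_bigr => y _.
by rewrite -!big_split/=; apply: eq_bigr => z _; rewrite /trip; ring.
Qed.

Lemma sym_identity1 (s: seq nat) k :
 3 * \sum_(x <- s) (\sum_(y <- s) k x y)^+2 =
 \sum_(x <- s) \sum_(y <- s) \sum_(z <- s) trip k x y z.
Proof.
have:=sym_identity s k (fun=> 1).
under eq_bigr do under eq_bigr do rewrite mulr1.
under [X in 2*X]eq_bigr do under [X in _*X]eq_bigr do rewrite mulr1.
under [X in 2*X]eq_bigr do rewrite mul1r -expr2.
under [RHS]eq_bigr do under eq_bigr do under eq_bigr do rewrite !mulr1.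
by move=> <-; ring.
Qed.

Definition dq (A: nat -> R) i j: R:=(A i-A j)/(i%:R-j%:R).
(** The case of [kP] where [P] is the identity. Its triple sums are exact squares ([trip_lin]), and
    they dominate those of a general smooth [P] ([trip_kP]). *)
Definition kL A c i j: R:=(dq A i j-c)/(i%:R-j%:R).
Definition kP (P: R -> R) A c i j: R:=(P (dq A i j)-c)/(i%:R-j%:R).

Definition lipseq (L: R) (A: nat -> R) :=
 forall i j, `|A i-A j| <= L * `|i%:R-j%:R|.

Lemma dqC A i j: dq A i j = dq A j i.
Proof. by rewrite /dq -opprB -(opprB j%:R) invrN mulrNN. Qed.

Lemma dq_bound L A i j: 0<=L -> lipseq L A -> `|dq A i j| <= L.
Proof.
move=> L0 AL; rewrite /dq.
have [->|ij]:=eqVneq i j; first by rewrite subrr mul0r normr0.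
have ij' : 0 < `|i%:R-j%:R| :> R by rewrite normr_gt0 subr_eq0 eqr_nat.
by rewrite normrM normfV ler_pdivrMr.
Qed.

(* The third condition is a quantitative form of "P'' is bounded by K"; it is
  stable under products, which makes it easy to check for (1+s^2)^(-n/2). *)
Definition smooth (L K: R) (P: R -> R) :=
 [/\ forall s, `|s| <= L -> `|P s| <= K,
  forall s t, `|s| <= L -> `|t| <= L -> `|P s-P t| <= K * `|s-t| &
  forall s t h, `|s| <= L -> `|t| <= L -> 0<=h<=1 ->
  `|P (h*s+(1-h) * t)-(h*P s+(1-h)*P t)|
  <= K*(h*(1-h))*(s-t)^+2].

(** With gaps [al] and [be], the quotient over the outer pair is the weighted mean of the two inner
    quotients. The right side is then the square of the second divided difference of [A]. *)
Lemma trip_lin (al be q1 q2: R) : al != 0 -> be != 0 -> al+be != 0 ->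
 q1/al*((q1*al+q2*be)/(al+be)/(al+be))-q1/al*(q2/be) +
  (q1*al+q2*be)/(al+be)/(al+be)*(q2/be) =
 ((q1-q2)/(al+be))^+2.
Proof. by move=> a0 b0 s0; field; apply/and3P. Qed.

Lemma trip_err (al be a b c: R) : al != 0 -> be != 0 -> al+be != 0 ->
 a/al*(c/(al+be))-a/al*(b/be)+c/(al+be)*(b/be) =
 ((a-b)/(al+be))^+2 +
 (c-(a*al+b*be)/(al+be))*((a*be+b*al)/(al*be*(al+be))).
Proof. by move=> *; field; apply/and3P; split. Qed.

(** The error in [trip_err] carries the singular factor [1/(al * be)]. The convexity defect in the
    third condition of [smooth] is proportional to [al * be], which cancels it, so that square and
    error are both bounded by the same second divided difference. *)
Lemma trip_bound (al be q1 q2 a b c K: R) : 0<=K -> 0<al*be ->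
 `|a-b| <= K * `|q1-q2| -> `|a| <= 2*K -> `|b| <= 2*K ->
 `|c-(al/(al+be)*a+(1-al/(al+be))*b)| <=
  K*(al/(al+be)*(1-al/(al+be)))*(q1-q2)^+2 ->
 `|a/al*(c/(al+be))-a/al*(b/be)+c/(al+be)*(b/be)| <=
 3*K^+2*((q1-q2)/(al+be))^+2.
Proof.
move=> K0 ab0 abK aK bK.
have al0: al != 0 by apply: contraTneq ab0 => ->; rewrite mul0r ltxx.
have be0: be != 0 by apply: contraTneq ab0 => ->; rewrite mulr0 ltxx.
have s2: 0<(al+be)^+2 by nra.
have s0: al+be != 0 by apply: contraTneq s2 => ->; rewrite expr0n ltxx.
have -> : al/(al+be)*a+(1-al/(al+be))*b = (a*al+b*be)/(al+be).
 by field.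
have -> : al/(al+be)*(1-al/(al+be)) = al*be/(al+be)^+2 by field.
rewrite trip_err//; set e:=c-_ => He.
have h1: ((a-b)/(al+be))^+2<=K^+2*((q1-q2)/(al+be))^+2.
 rewrite !expr_div_n mulrA ler_pM2r ?invr_gt0 //.
 by rewrite -exprMn -[leLHS]real_normK ?num_real// -[leRHS]real_normK ?num_real//
  ler_sqr ?nnegrE// normrM (ger0_norm K0).
have h2: `|e*((a*be+b*al)/(al*be*(al+be)))| <=
  2*K^+2*((q1-q2)/(al+be))^+2.
 have n0: 0 < `|al+be| by rewrite normr_gt0.
 have hs: `|a*be+b*al| <= 2*K * `|al+be|.
  apply: (le_trans (ler_normD _ _)); rewrite !normrM.
  have -> : `|al+be| = `|al| + `|be|.
  have [a0|a0]:=ltP 0 al.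
  have b0: 0<be by rewrite -(pmulr_rgt0 be a0).
  by rewrite !gtr0_norm ?addr_gt0.
  have a0' : al<0 by rewrite lt_neqAle al0.
  have b0: be<0 by nra.
  by rewrite !ltr0_norm ?opprD//; lra.
  have:=normr_ge0 al; have:=normr_ge0 be; nra.
 rewrite normrM [X in _*X]normrM normfV (normrM (al*be)) (gtr0_norm ab0).
 have w0: 0<al*be * `|al+be| by rewrite mulr_gt0.
 apply: (le_via ((K*(al*be/(al+be)^+2)*(q1-q2)^+2) *
  (2*K * `|al+be| / (al*be * `|al+be|)))).
  apply: ler_pM => //; first by rewrite mulr_ge0 ?invr_ge0 ?(ltW w0).
  by rewrite ler_pM2r ?invr_gt0.
 le_of_eq; field.
 by rewrite (gt_eqF n0) s0 al0 be0.
apply: (le_trans (ler_normD _ _)); rewrite (ger0_norm (sqr_ge0 _)); lra.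
Qed.

Lemma kL_diag A c i: kL A c i i = 0.
Proof. by rewrite /kL subrr invr0 mulr0. Qed.

Lemma kP_diag P A c i: kP P A c i i = 0.
Proof. by rewrite /kP subrr invr0 mulr0. Qed.

Lemma kLC A c i j: kL A c i j = - kL A c j i.
Proof. by rewrite /kL dqC -(opprB j%:R) invrN mulrN. Qed.

Lemma kPC P A c i j: kP P A c i j = - kP P A c j i.
Proof. by rewrite /kP dqC -(opprB j%:R) invrN mulrN. Qed.

Lemma natB_neq0 i j: i != j -> i%:R-j%:R != 0 :> R.
Proof. by rewrite subr_eq0 eqr_nat. Qed.

Lemma kP_kL2 L K P A c i j: 0<=L -> smooth L K P -> lipseq L A -> `|c| <= L ->
 kP P A (P c) i j^+2<=K^+2*kL A c i j^+2.
Proof.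
move=> L0 [_ PL _] AL cL; rewrite /kP /kL.
rewrite !expr_div_n mulrA ler_wpM2r ?invr_ge0 ?sqr_ge0 //.
rewrite -exprMn -[leLHS]real_normK ?num_real// -[leRHS]real_normK ?num_real //.
rewrite ler_sqr ?nnegrE// normrM (le_trans (PL _ _ (dq_bound i j L0 AL) cL)) //.
by rewrite ler_wpM2r// ler_norm.
Qed.

Lemma trip_kP_mid L K P A c x y z: 0<=L -> 0<=K -> smooth L K P -> lipseq L A ->
 `|c| <= L -> (x<y)%N && (y<z)%N ->
 `|trip (kP P A (P c)) x y z| <= 3*K^+2*trip (kL A c) x y z.
Proof.
move=> L0 K0 [Pb PL P2] AL cL /andP[xy yz].
set al:=x%:R-y%:R :> R; set be:=y%:R-z%:R :> R.
have al0: al<0 by rewrite subr_lt0 ltr_nat.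
have be0: be<0 by rewrite subr_lt0 ltr_nat.
have alN: al != 0 by rewrite lt_eqF.
have beN: be != 0 by rewrite lt_eqF.
have sN: al+be != 0 by rewrite lt_eqF//; lra.
have sE: x%:R-z%:R = al+be by rewrite /al /be; ring.
have q3E: dq A x z = (dq A x y*al+dq A y z*be)/(al+be).
 by rewrite /dq sE -/al -/be; field; apply/and3P.
have tE (k: nat -> nat -> R) : (forall i j, k i j = - k j i) ->
  trip k x y z = k x y*k x z-k x y*k y z+k x z*k y z.
 by move=> kN; rewrite /trip (kN y x) (kN z x) (kN z y); ring.
rewrite (tE _ (kPC P A (P c))) (tE _ (kLC A c)).
have -> : kL A c x y*kL A c x z-kL A c x y*kL A c y z+kL A c x z*kL A c y z =
  ((dq A x y-dq A y z)/(al+be))^+2.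
 have -> : dq A x y-dq A y z = (dq A x y-c)-(dq A y z-c) by ring.
 rewrite -trip_lin// /kL sE -/al -/be q3E.
 have -> : (dq A x y*al+dq A y z*be)/(al+be)-c =
  ((dq A x y-c)*al+(dq A y z-c)*be)/(al+be) by field.
 by [].
have qx:=dq_bound x y L0 AL; have qz:=dq_bound y z L0 AL.
have ab: 0<al*be by nra.
have PD s: `|s| <= L -> `|P s-P c| <= 2*K.
 move=> sL; apply: (le_trans (ler_normB _ _)).
 by have:=Pb _ sL; have:=Pb _ cL; lra.
rewrite /kP sE -/al -/be; apply: trip_bound => //.
- have -> : P (dq A x y)-P c-(P (dq A y z)-P c) = P (dq A x y)-P (dq A y z) by ring.
 exact: PL.
- exact: PD.
- exact: PD.
- have h01: 0<=al/(al+be)<=1.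
  have n0: 0 < - (al+be) by lra.
  by rewrite -mulrNN -invrN divr_ge0 ?(ltW n0) ?ler_pdivrMr//; lra.
 have:=P2 _ _ _ qx qz h01.
 have -> : al/(al+be)*dq A x y+(1-al/(al+be))*dq A y z = dq A x z.
  by rewrite q3E; field.
 move=> h; apply: le_trans h; le_of_eq; congr `|_|.
 by field.
Qed.

(** [trip] is symmetric, so three distinct points may be ordered and handled by [trip_kP_mid]. When
    two points coincide, the kernels vanish on the diagonal and [trip] reduces to a single
    square. *)
Lemma trip_kP L K P A c x y z: 0<=L -> 0<=K -> smooth L K P -> lipseq L A ->
 `|c| <= L ->
 `|trip (kP P A (P c)) x y z| <= 3*K^+2*trip (kL A c) x y z.
Proof.
move=> L0 K0 PS AL cL.
have coin (k: nat -> nat -> R) u v: (forall i, k i i = 0) -> trip k u u v = k v u^+2.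
 by move=> k0; rewrite /trip k0; ring.
have C1 u v: `|trip (kP P A (P c)) u u v| <= 3*K^+2*trip (kL A c) u u v.
 rewrite !coin; [|exact: kL_diag|exact: kP_diag].
 rewrite ger0_norm ?sqr_ge0//; apply: (le_trans (kP_kL2 _ _ L0 PS AL cL)).
 have h:=sqr_ge0 (kL A c v u); have:=sqr_ge0 K; nra.
pose Q u v w:=`|trip (kP P A (P c)) u v w| <= 3*K^+2*trip (kL A c) u v w.
have M u v w: (u<v)%N && (v<w)%N -> Q u v w.
 exact: (@trip_kP_mid L K P A c u v w L0 K0 PS AL cL).
have QC u v w: Q u v w -> Q v u w by rewrite /Q tripC [X in _<=_*X]tripC.
have QA u v w: Q u v w -> Q u w v by rewrite /Q tripA [X in _<=_*X]tripA.
rewrite -/(Q x y z).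
have [->|xy]:=eqVneq x y; first exact: C1.
have [<-|xz]:=eqVneq x z; first by apply: QA; exact: C1.
have [->|yz]:=eqVneq y z; first by apply: QC; apply: QA; exact: C1.
have [xy'|xy']:=ltnP x y.
 have [yz'|yz']:=ltnP y z; first by apply: M; rewrite xy'.
 have [xz'|xz']:=ltnP x z; first by apply/QA/M; rewrite xz' ltn_neqAle eq_sym yz.
 by apply/QA/QC/M; rewrite xy' andbT ltn_neqAle eq_sym xz.
have {}xy' : (y<x)%N by rewrite ltn_neqAle eq_sym xy.
have [xz'|xz']:=ltnP x z; first by apply/QC/M; rewrite xy'.
have {}xz' : (z<x)%N by rewrite ltn_neqAle eq_sym xz.
have [yz'|yz']:=ltnP y z; first by apply/QC/QA/M; rewrite yz'.
by apply/QA/QC/QA/M; rewrite xy' ltn_neqAle eq_sym yz yz'.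
Qed.

End Symmetrization.

(** * The discrete Hilbert transform on L^2 *)

Section HilbertBound.
Variable R: realType.
Implicit Types (f: nat -> R).

Lemma sum_inv_sqr_lt n m: (0<n)%N ->
 \sum_(n<=t<m) (t%:R^+2)^-1<=(n%:R^+2)^-1+n%:R^-1 :> R.
Proof.
move=> n0; have x0: 0<n%:R :> R by rewrite ltr0n.
have [mn|nm]:=leqP m n; first by rewrite big_geq// addr_ge0 ?invr_ge0 ?sqr_ge0 ?ltW.
elim: m nm => // m IH nm.
suff: \sum_(n<=t<m.+1) (t%:R^+2)^-1<=(n%:R^+2)^-1+n%:R^-1-m%:R^-1 :> R.
 by move/le_trans; apply; rewrite gerBl invr_ge0.
elim: m {IH} nm => [|m IH]; first by move=> h; exfalso; lia.
rewrite ltnS leq_eqVlt => /predU1P[->|nm].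
 by rewrite big_nat1 addrK.
rewrite big_nat_recr//=; last exact: ltnW.
apply: le_trans (lerD (IH nm) (lexx _)) _.
have y0: 0<m%:R :> R by rewrite ltr0n (leq_trans n0).
rewrite -addrA lerD2l -(natr1 m).
have -> : (m%:R+1: R)^-1 = m%:R^-1-(m%:R*(m%:R+1))^-1.
 by field; rewrite !gt_eqF//; lra.
suff: ((m%:R+1)^+2)^-1<=(m%:R*(m%:R+1) : R)^-1 by lra.
by rewrite lef_pV2 ?posrE ?mulr_gt0 ?exprn_gt0//; nra.
Qed.

Lemma sum_inv_sqr_gt n m: (0<n)%N -> (n<=m)%N ->
 n%:R^-1-m%:R^-1 <= \sum_(n<=t<m) (t%:R^+2)^-1 :> R.
Proof.
move=> n0; elim: m => [|m IH nm]; first by lia.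
have [->|nm']:=eqVneq n m.+1; first by rewrite subrr big_geq.
have {}nm: (n<=m)%N by lia.
rewrite big_nat_recr//=; apply: le_trans _ (lerD (IH nm) (lexx _)).
have y0: 0<m%:R :> R by rewrite ltr0n (leq_trans n0).
rewrite -addrA lerD2l -(natr1 m).
have -> : (m%:R+1: R)^-1 = m%:R^-1-(m%:R*(m%:R+1))^-1.
 by field; rewrite !gt_eqF//; lra.
suff: (m%:R*(m%:R+1) : R)^-1<=(m%:R^+2)^-1 by lra.
by rewrite lef_pV2 ?posrE ?mulr_gt0 ?exprn_gt0//; nra.
Qed.

Lemma sum_inv_sqr n: \sum_(0<=t<n) (t%:R^+2)^-1<=2 :> R.
Proof.
case: n => [|n]; first by rewrite big_geq.
rewrite big_ltn// expr0n invr0 add0r.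
by apply: le_trans (sum_inv_sqr_lt _ (ltnSn 0)) _; rewrite expr1n !invr1.
Qed.

Lemma sum_reflect (F: nat -> R) l i: (l<=i)%N ->
 \sum_(l<=j<i) F j = \sum_(0<=t<i-l) F (i.-1-t)%N.
Proof.
move=> li; rewrite -{1}(add0n l) big_addn big_nat_rev/=.
apply: eq_big_nat => t /andP[_ ti]; congr F; lia.
Qed.

Lemma sum_left (F: nat -> R) l i: (l<=i)%N ->
 \sum_(l<=j<i) F j = \sum_(1<=t<(i-l).+1) F (i-t)%N.
Proof.
move=> li; rewrite sum_reflect// big_add1/=.
by apply: eq_big_nat => t /andP[_ ti]; congr F; lia.
Qed.

Lemma sum_right (F: nat -> R) i r: \sum_(i<=j<r) F j = \sum_(0<=t<r-i) F (i+t)%N.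
Proof. by rewrite -{1}(add0n i) big_addn; apply: eq_bigr => t _; rewrite addnC. Qed.

Lemma sum_inv_sqr_dist y l r: \sum_(l<=x<r) ((x%:R-y%:R)^+2)^-1<=4 :> R.
Proof.
have le l' r' : (l'<=r')%N -> (r'<=y)%N ->
  \sum_(l'<=x<r') ((x%:R-y%:R)^+2)^-1<=2 :> R.
 move=> lr ry; apply: le_trans (sum_inv_sqr y.+1).
 apply: (le_via (\sum_(0<=x<y) ((x%:R-y%:R)^+2)^-1)).
  rewrite (@sum_split _ l' _ 0)//; last exact: leq_trans ry.
  rewrite (@sum_split _ r' _ l')// addrCA lerDl addr_ge0// sumr_ge0// => i _;
  by rewrite invr_ge0 sqr_ge0.
 rewrite sum_left// subn0 [leRHS]big_ltn// expr0n invr0 add0r.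
 apply: ler_sum_nat => t /andP[t0 ty].
 rewrite natrB; last by rewrite -ltnS.
 by rewrite addrAC subrr add0r sqrrN.
have ge l' r' : (y<=l')%N -> (l'<=r')%N ->
  \sum_(l'<=x<r') ((x%:R-y%:R)^+2)^-1<=2 :> R.
 move=> yl lr; apply: le_trans (sum_inv_sqr (r'-y)).
 apply: (le_via (\sum_(y<=x<r') ((x%:R-y%:R)^+2)^-1)).
  rewrite (@sum_split _ l' _ y)// lerDr sumr_ge0// => i _.
  by rewrite invr_ge0 sqr_ge0.
 rewrite sum_right; apply: ler_sum_nat => t _.
 by rewrite natrD addrAC subrr add0r.
have [rl|lr]:=leqP r l; first by rewrite big_geq.
have [ry|yr]:=leqP r y.
 by apply: le_trans (le _ _ (ltnW lr) ry) _; lra.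
have [yl|ly]:=leqP y l.
 by apply: le_trans (ge _ _ yl (ltnW lr)) _; lra.
rewrite (@sum_split _ y)//; [|exact: ltnW..].
have:=le l y (ltnW ly) (leqnn y); have:=ge y r (leqnn y) (ltnW yr); lra.
Qed.

Let h (i j: nat) : R:=(i%:R-j%:R)^-1.

(** The flat case: for three distinct indices the sum vanishes identically, and only coincident
    indices contribute. *)
Lemma trip_hilbert x y z: trip h x y z =
 (y == z)%:R*h x y^+2+(x == y)%:R*h z x^+2+(x == z)%:R*h y x^+2.
Proof.
rewrite /trip /h.
have [->|xy]:=eqVneq x y.
 have [->|yz]:=eqVneq y z; first by rewrite /= !subrr !invr0 ?mulr0n ?mulr1n; ring.
 by rewrite /= !subrr !invr0 ?mulr0n ?mulr1n; ring.
have xyN:=natB_neq0 R xy.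
have [<-|xz]:=eqVneq x z.
 rewrite (negbTE (_: y != x)); last by rewrite eq_sym.
 by rewrite /= !subrr !invr0 ?mulr0n ?mulr1n; ring.
have xzN:=natB_neq0 R xz.
have [->|yz]:=eqVneq y z; first by rewrite /= !subrr !invr0 ?mulr0n ?mulr1n; ring.
have yzN:=natB_neq0 R yz.
rewrite /= !mul0r !addr0; field.
by rewrite xyN xzN yzN (natB_neq0 R (_: y != x)) ?(natB_neq0 R (_: z != x)) ?(natB_neq0 R (_: z != y)) // eq_sym.
Qed.

(** Support in the middle third keeps the row sums of [h] bounded where [f] lives: the parts of the
    window symmetric about [x] cancel, and the rest consists of at most [n] reciprocals, each at
    most [1/n]. *)
Lemma hilbert_mid n f: (forall j, ~~ (n<=j<2*n)%N -> f j = 0) ->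
 \sum_(0<=i<3*n) (\sum_(0<=j<3*n) h i j*f j)^+2 <=
 28 * \sum_(0<=j<3*n) f j^+2.
Proof.
move=> supp.
have:=sym_identity (index_iota 0 (3*n)) h f.
set X:=(X in X+_ = _ -> _); set Y:=\sum_(x <- _) _*_*_.
set Z:=(X in _ = X -> _); set F:=(X in _<=28*X).
have ZF: Z<=12*F.
 have -> : Z = \sum_(0<=x<3*n) \sum_(0<=y<3*n)
  (h x y^+2*f y^+2+2*(h y x^+2*(f x*f y))).
  rewrite /Z.
  under eq_bigr do under eq_bigr do under eq_bigr do rewrite trip_hilbert !mulrDl.
  under eq_bigr do under eq_bigr do rewrite !big_split/=.
  under eq_bigr do rewrite !big_split/=.
  rewrite !big_split/=.
  under [RHS]eq_bigr do rewrite !big_split/=.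
  rewrite [RHS]big_split/= -addrA; congr (_+_).
  apply: eq_big_nat => x /andP[_ xn]; apply: eq_big_nat => y /andP[_ yn].
  rewrite (bigD1_seq y)/= ?mem_index_iota ?iota_uniq //.
  rewrite eqxx mul1r expr2 big1 ?addr0// => z zy.
  by rewrite eq_sym (negbTE zy) !mul0r.
  under [RHS]eq_bigr do under eq_bigr do rewrite mulr_natl mulr2n.
  under [RHS]eq_bigr do rewrite big_split/=.
  rewrite [RHS]big_split/=; congr (_+_).
  apply: eq_big_nat => x /andP[_ xn].
  rewrite (bigD1_seq x)/= ?mem_index_iota ?iota_uniq //.
  rewrite [X in _+X]big1 ?addr0; last first.
  move=> y yx; rewrite big1// => z _; by rewrite eq_sym (negbTE yx) !mul0r.
  by apply: eq_bigr => z _; rewrite eqxx mul1r.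
  apply: eq_big_nat => x /andP[_ xn]; apply: eq_bigr => y _.
  rewrite (bigD1_seq x)/= ?mem_index_iota ?iota_uniq //.
  rewrite [X in _+X]big1 ?addr0; last first.
  by move=> z zx; rewrite eq_sym (negbTE zx) !mul0r.
  by rewrite eqxx mul1r (mulrC (f y)).
 apply: (le_via (\sum_(0<=x<3*n) \sum_(0<=y<3*n)
  (2*(h x y^+2*f y^+2)+h y x^+2*f x^+2))).
  apply: ler_sum => x _; apply: ler_sum => y _.
  have -> : h x y^+2 = h y x^+2.
  by rewrite /h -opprB invrN sqrrN.
  have:=sqr_ge0 (h y x); have:=sqr_ge0 (f x-f y).
  set p:=h y x^+2; nra.
 under eq_bigr do rewrite big_split/=.
 rewrite big_split/=.
 have D: \sum_(0<=x<3*n) \sum_(0<=y<3*n) h y x^+2*f x^+2<=4*F.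
  rewrite /F mulr_sumr; apply: ler_sum => x _.
  rewrite -mulr_suml ler_wpM2r ?sqr_ge0 //.
  apply: le_trans (sum_inv_sqr_dist x 0 (3*n)).
  by apply: ler_sum => y _; rewrite /h exprVn.
 have: \sum_(0<=x<3*n) \sum_(0<=y<3*n) 2*(h x y^+2*f y^+2)<=2*(4*F).
  under eq_bigr do rewrite -mulr_sumr.
  by rewrite -mulr_sumr ler_pM2l// exchange_big.
 by lra.
have H1 x: (n<=x<2*n)%N -> `|\sum_(0<=y<3*n) h x y| <= 1.
 move=> /andP[nx x2n].
 pose u (t: nat) : R:=t%:R^-1.
 have -> : \sum_(0<=y<3*n) h x y =
  \sum_(0<=t<x.+1) u t - \sum_(0<=t<3*n-x) u t.
  rewrite (@sum_split _ x)//; last lia.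
  congr (_+_).
  rewrite sum_left// subn0 [RHS]big_ltn// /u invr0 add0r.
  apply: eq_big_nat => t /andP[t0 tx]; rewrite /h natrB; last by rewrite -ltnS.
  by congr (_^-1); ring.
  rewrite sum_right -sumrN; apply: eq_bigr => t _.
  by rewrite /h /u natrD opprD addrA subrr add0r invrN.
 have u0 t: 0<=u t by rewrite invr_ge0.
 have small a b: (n<a)%N -> (a<=b)%N -> (b<=2*n)%N -> \sum_(a<=t<b) u t<=1.
  move=> na ab b2n.
  apply: (le_via (\sum_(a<=t<b) n%:R^-1)).
  apply: ler_sum_nat => t /andP[at_ tb].
  by rewrite lef_pV2 ?posrE ?ltr0n ?ler_nat//; lia.
  rewrite sumr_const_nat -[_ *+ _]mulr_natr mulrC ler_pdivrMr ?ltr0n; last lia.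
  by rewrite mul1r ler_nat; lia.
 have [xa|xa]:=leqP x.+1 (3*n-x).
  rewrite [X in _-X](@sum_split _ x.+1)// opprD addrA subrr add0r normrN.
  rewrite ger0_norm ?sumr_ge0//; apply: small; lia.
 rewrite (@sum_split _ (3*n-x) _ 0)//; last exact: ltnW.
 rewrite addrAC subrr add0r ger0_norm ?sumr_ge0//; apply: small; lia.
(* Half of [X] is absorbed; with [Z <= 12 * F] the constant becomes [28 = 2 * (12 + 2)]. *)
have XY: - (2*Y)<=2*F+1/2*X.
 rewrite /Y /F /X -mulrN -sumrN !mulr_sumr -big_split/=.
 apply: ler_sum => x _; set T:=\sum_(y <- _) h x y*f y.
 have [xn|xn]:=boolP (n<=x<2*n)%N; last first.
  rewrite supp//; have:=sqr_ge0 T; nra.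
 have:=H1 x xn; rewrite ler_norml; set s:=\sum_(_<=_<_) h x _ => /andP[s1 s2].
 have h1: s^+2<=1 by nra.
 have:=sqr_ge0 (2*f x*s+T); have:=sqr_ge0 (f x); nra.
rewrite -/X; lra.
Qed.

(** The window is padded with zeros on both sides by its own length, which puts it in the middle
    third. *)
Lemma hilbert_l2 l r f :
 \sum_(l<=i<r) (\sum_(l<=j<r) f j/(i%:R-j%:R))^+2 <=
 28 * \sum_(l<=j<r) f j^+2.
Proof.
have [rl|lr]:=leqP r l; first by rewrite !big_geq ?mulr0.
pose n:=(r-l)%N.
pose g j:=if (n<=j<2*n)%N then f (j-n+l)%N else 0.
have gs j: ~~ (n<=j<2*n)%N -> g j = 0 by rewrite /g => /negbTE ->.
have shift (F: nat -> R) : \sum_(l<=i<r) F i = \sum_(n<=i<2*n) F (i-n+l)%N.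
 rewrite -{1}(add0n l) big_addn -/n -{2}(add0n n) big_addn.
 rewrite (_: 2*n-n = n)%N; last lia.
 by apply: eq_bigr => i _; rewrite addnK.
have ext (F: nat -> R) : (forall j, 0<=F j) ->
  \sum_(n<=i<2*n) F i <= \sum_(0<=i<3*n) F i.
 move=> F0; rewrite (@sum_split _ n _ 0 (3*n))//; last lia.
 rewrite (@sum_split _ (2*n) _ n (3*n))//; [|lia..].
 by rewrite addrCA lerDl addr_ge0// sumr_ge0.
have ext0 (F: nat -> R) : (forall j, ~~ (n<=j<2*n)%N -> F j = 0) ->
  \sum_(n<=i<2*n) F i = \sum_(0<=i<3*n) F i.
 move=> F0; rewrite (@sum_split _ n _ 0 (3*n))//; last lia.
 rewrite (@sum_split _ (2*n) _ n (3*n))//; [|lia..].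
 have Z1: \sum_(0<=j<n) F j = 0.
  by rewrite big_nat big1// => j jn; apply: F0; lia.
 have Z2: \sum_(2*n<=j<3*n) F j = 0.
  by rewrite big_nat big1// => j jn; apply: F0; lia.
 by rewrite Z1 Z2 add0r addr0.
have -> : \sum_(l<=j<r) f j^+2 = \sum_(0<=j<3*n) g j^+2.
 rewrite shift -ext0; last by move=> j jn; rewrite gs// expr0n.
 by apply: eq_big_nat => j jn; rewrite /g jn.
apply: le_trans (hilbert_mid gs).
rewrite shift.
apply: le_trans (ext (fun i => (\sum_(0<=j<3*n) h i j*g j)^+2) _); last first.
 by move=> j; exact: sqr_ge0.
le_of_eq.
apply: eq_big_nat => i /andP[ni i2n]; congr (_^+2).
rewrite -(ext0 (fun j => h i j*g j)); last by move=> j jn; rewrite gs// mulr0.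
rewrite shift; apply: eq_big_nat => j /andP[nj j2n].
rewrite /g nj j2n/= mulrC /h; congr (_^-1*_).
by rewrite !natrD (natrB _ ni) (natrB _ nj); ring.
Qed.

End HilbertBound.

(** * Poisson sums and the total curvature of a Lipschitz sequence *)

Section CurvatureBound.
Variable R: realType.
Implicit Types (f: nat -> R) (A: nat -> R).

Definition poi (r: R) (t: R) : R:=r/(r^+2+t^+2).

Lemma poi_gt0 r t: 0<r -> 0<poi r t.
Proof. by move=> r0; rewrite divr_gt0// ltr_wpDr ?sqr_ge0 ?exprn_gt0. Qed.

Lemma poiN r t: poi r (- t) = poi r t.
Proof. by rewrite /poi sqrrN. Qed.

Lemma abel_sum (w g: nat -> R) M: (forall t, w t.+1<=w t) ->
 forall n, (forall k, (k<=n)%N -> \sum_(0<=t<k) g t<=M*k%:R) ->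
 \sum_(0<=t<n) w t*g t <=
  M * \sum_(0<=t<n) w t+w n*(\sum_(0<=t<n) g t-M*n%:R).
Proof.
move=> wd; elim=> [|n IH] H; first by rewrite !big_geq// !mulr0 subrr mulr0 addr0.
have {}IH:=IH (fun k kn => H k (leqW kn)).
rewrite !big_nat_recr//=; have:=H n.+1 (leqnn _); rewrite !big_nat_recr//=.
rewrite -(natr1 n); move: IH; set S:=\sum_(0<=t<n) g t.
set Wg:=\sum_(0<=t<n) w t*g t; set W:=\sum_(0<=t<n) w t.
have:=wd n; nra.
Qed.

Lemma abel_sum_le (w g: nat -> R) M n: (forall t, w t.+1<=w t) -> (forall t, 0<=w t) ->
 (forall k, (k<=n)%N -> \sum_(0<=t<k) g t<=M*k%:R) ->
 \sum_(0<=t<n) w t*g t<=M * \sum_(0<=t<n) w t.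
Proof.
move=> wd w0 H; apply: (le_trans (abel_sum wd H)).
by rewrite gerDl mulr_ge0_le0// subr_le0 H.
Qed.

Lemma poi_sum r n: 1<=r -> \sum_(0<=t<n) poi r t%:R<=4.
Proof.
move=> r1.
suff: \sum_(0<=t<n) poi r t%:R<=4-4*r/(r+n%:R).
 move/le_trans; apply; rewrite gerBl divr_ge0// ?addr_ge0//; lra.
elim: n => [|n IH]; first by rewrite big_geq// addr0 mulfK ?subrr//; lra.
rewrite big_nat_recr//=; apply: le_trans (lerD IH (lexx _)) _.
have n0: 0<=n%:R :> R by [].
rewrite /poi -(natr1 n); set t:=n%:R in n0 *.
rewrite -subr_ge0.
have -> : 4-4*r/(r+(t+1))-(4-4*r/(r+t)+r/(r^+2+t^+2)) =
  r*(4*(r^+2+t^+2)-(r+t)*(r+t+1)) /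
  ((r+t)*(r+t+1)*(r^+2+t^+2)).
 field; rewrite !gt_eqF//; nra.
apply: divr_ge0; last by apply: mulr_ge0; [apply: mulr_ge0|]; nra.
apply: mulr_ge0; first lra.
have h1: (r+t)*(r+t+1)<=(r+t)*(2*(r+t)) by rewrite ler_wpM2l; lra.
by have:=sqr_ge0 (r-t); lra.
Qed.

Lemma poi_dec r (t: nat) : 0<r -> poi r t.+1%:R<=poi r t%:R.
Proof.
move=> r0; rewrite /poi ler_pM2l// lef_pV2 ?posrE ?ltr_wpDr ?sqr_ge0 ?exprn_gt0 //.
by rewrite lerD2l ler_sqr ?nnegrE// ler_nat.
Qed.

(** The Poisson weights decrease away from [i] and have mass at most 4 on each side, so Abel
    summation bounds the sum by averages over intervals with one end at [i]. The mass is bounded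
    because the radius is at least one grid step. *)
Lemma poi_Mx N f i r: (i<N)%N -> 1<=r ->
 \sum_(0<=j<N) poi r (i%:R-j%:R) * `|f j| <= 8*Mx N f i.
Proof.
move=> iN r1; have r0: 0<r by lra.
have M0:=Mx_ge0 N f i.
have w0 t: 0<=poi r t%:R by apply: ltW; exact: poi_gt0.
have wd (t: nat):=poi_dec t r0.
rewrite (@sum_split _ i)//; last exact: ltnW.
have L: \sum_(0<=j<i) poi r (i%:R-j%:R) * `|f j| <= 4*Mx N f i.
 rewrite sum_left// subn0.
 apply: (le_via (\sum_(0<=t<i.+1) poi r t%:R * `|f (i-t)%N|)).
  rewrite [leRHS]big_ltn// -[leLHS]add0r; apply: lerD; first by rewrite mulr_ge0.
  le_of_eq.
  apply: eq_big_nat => t /andP[t0 ti]; rewrite natrB; last by rewrite -ltnS.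
  by congr (poi _ _*_); ring.
 apply: (le_via (Mx N f i * \sum_(0<=t<i.+1) poi r t%:R)).
  apply: abel_sum_le => // -[|k] ki; first by rewrite big_geq// mulr0.
  have := @Mx_sum _ N f i (i-k) i.+1; rewrite leq_subr ltnSn iN => /(_ isT isT isT).
  rewrite [X in X<=_ -> _]sum_reflect; last lia.
  by rewrite (_: i.+1-(i-k) = k.+1)%N; last lia.
 by rewrite mulrC ler_wpM2r// poi_sum.
have U: \sum_(i<=j<N) poi r (i%:R-j%:R) * `|f j| <= 4*Mx N f i.
 rewrite sum_right.
 rewrite (eq_bigr (fun t => poi r t%:R * `|f (i+t)%N|)) => [|t _]; last first.
  by rewrite natrD opprD addrA subrr add0r poiN.
 apply: (le_via (Mx N f i * \sum_(0<=t<N-i) poi r t%:R)).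
  apply: abel_sum_le => // -[|k] ki; first by rewrite big_geq// mulr0.
  have := @Mx_sum _ N f i i (i+k.+1); rewrite leqnn => /(_ isT).
  rewrite (_: (i<i+k.+1)%N); last lia.
  rewrite (_: (i+k.+1<=N)%N); last lia.
  move=> /(_ isT isT); rewrite [X in X<=_ -> _]sum_right.
  by rewrite (_: i+k.+1-i = k.+1)%N; last lia.
 by rewrite mulrC ler_wpM2r// poi_sum.
by move: L U; lra.
Qed.

Lemma sum_nat0 f a b: (forall s, (a<=s<b)%N -> f s = 0) -> \sum_(a<=s<b) f s = 0.
Proof. by move=> f0; rewrite big_nat big1. Qed.

Lemma telescope_nat A i j: (i<=j)%N -> \sum_(i<=s<j) (A s.+1-A s) = A j-A i.
Proof. by move=> ij; rewrite telescope_sumr. Qed.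

(** The weight of the increment [A s.+1 - A s] after [A i - A j] has been telescoped and the sums
    exchanged: a signed tail of the series of inverse squares, hence close to [1/(i-s)]. *)
Definition wt l r i s: R :=
 if (s<i)%N then \sum_(l<=j<s.+1) ((i%:R-j%:R)^+2)^-1
 else - \sum_(s.+1<=j<r) ((i%:R-j%:R)^+2)^-1.

Lemma kL_wt A l r i: (l<=i)%N -> (i<r)%N ->
 \sum_(l<=j<r) kL A 0 i j = \sum_(l<=s<r) (A s.+1-A s)*wt l r i s.
Proof.
move=> li ir; pose d s:=A s.+1-A s.
have E j: kL A 0 i j = (A i-A j)*((i%:R-j%:R)^+2)^-1.
 by rewrite /kL /dq subr0 expr2 invfM mulrA.
under eq_bigr do rewrite E.
rewrite (@sum_split _ i)//; last exact: ltnW.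
rewrite [RHS](@sum_split _ i)//; last exact: ltnW.
congr (_+_).
 rewrite (eq_big_nat _ _ (F2:=fun j => \sum_(l<=s<i)
  (j<=s)%N%:R*(d s*((i%:R-j%:R)^+2)^-1))); last first.
  move=> j /andP[lj ji]; rewrite -telescope_nat ?(ltnW ji) //.
  rewrite [RHS](@sum_split _ j)//; last exact: ltnW.
  rewrite [X in _ = X+_]sum_nat0 ?add0r => [|s /andP[_ sj]]; last first.
  by rewrite leqNgt sj mul0r.
  rewrite mulr_suml; apply: eq_big_nat => s /andP[js _].
  by rewrite js mul1r.
 rewrite exchange_big/=; apply: eq_big_nat => s /andP[ls si].
 rewrite /wt si -/(d s) mulr_sumr [LHS](@sum_split _ s.+1)//; last exact: leqW.
 rewrite [X in _+X = _]sum_nat0 ?addr0 => [|j /andP[sj _]]; last first.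
  by rewrite leqNgt sj mul0r.
 by apply: eq_big_nat => j /andP[_ js]; rewrite -ltnS js mul1r.
rewrite (eq_big_nat _ _ (F2:=fun j => \sum_(i<=s<r)
  (s<j)%N%:R*(- d s*((i%:R-j%:R)^+2)^-1))); last first.
 move=> j /andP[ij jr]; rewrite -opprB -telescope_nat //.
 rewrite [RHS](@sum_split _ j)//; last exact: ltnW.
 rewrite [X in _ = _+X]sum_nat0 ?addr0 => [|s /andP[js _]]; last first.
  by rewrite ltnNge js mul0r.
 rewrite -sumrN mulr_suml; apply: eq_big_nat => s /andP[_ sj].
 by rewrite sj mul1r.
rewrite exchange_big/=; apply: eq_big_nat => s /andP[is_ sr].
rewrite /wt ltnNge is_/= -/(d s) mulrN -mulNr mulr_sumr [LHS](@sum_split _ s.+1)//; last exact: leqW.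
rewrite [X in X+_ = _]sum_nat0 ?add0r => [|j /andP[_ js]]; last first.
 by rewrite ltnNge -ltnS js mul0r.
by apply: eq_big_nat => j /andP[sj _]; rewrite sj mul1r.
Qed.

Lemma poi1_ge (t: nat) : (0<t)%N -> (t%:R^+2)^-1<=2*poi 1 t%:R.
Proof.
move=> t0; have t1: 1<=t%:R :> R by rewrite ler1n.
rewrite /poi div1r expr1n -[X in X*_]invrK -invfM lef_pV2 ?posrE ?mulr_gt0 ?invr_gt0//; nra.
Qed.

Let close_le (S a b c e: R) : S<=b+a -> a-c<=S -> b<=2*e -> 0<=c -> 0<=e ->
 `|S-a| <= 2*e+c.
Proof. by move=> *; rewrite ler_norml; apply/andP; split; lra. Qed.

(** A tail of inverse squares starting at [n] equals [1/n] up to [1/n^2], which is of Poisson size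
    at radius 1. The last two terms come from cutting the tail at the ends of the window. *)
Lemma wt_close l r i s: (l<=i)%N -> (i<r)%N -> (l<=s)%N -> (s<r)%N ->
 `|wt l r i s-(i%:R-s%:R)^-1| <= 2*poi 1 (i%:R-s%:R) +
  (s<i)%N%:R/(i.+1-l)%:R+(i<=s)%N%:R/(r-i)%:R.
Proof.
move=> li ir ls sr; rewrite /wt.
have [si|is_]:=ltnP s i.
 rewrite mul1r mul0r addr0.
 have isN: i%:R-s%:R = (i-s)%:R :> R by rewrite natrB// ltnW.
 rewrite isN sum_left; last lia.
 rewrite (_: \sum_(_<=_<_) _ = \sum_(i-s<=t<(i-l).+1) (t%:R^+2)^-1 :> R); last first.
  rewrite (_: (i-l).+1 = (s.+1-l).+1+(i-s.+1))%N; last lia.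
  rewrite (_: i-s = 1+(i-s.+1))%N; last lia.
  rewrite big_addn addnK; apply: eq_big_nat => t /andP[t1 t2].
  congr ((_^+2)^-1); rewrite natrB; last lia.
  by rewrite natrD natrB// -(natr1 s); ring.
 set n:=(i-s)%N; have n0: (0<n)%N by rewrite /n; lia.
 have h1 := @sum_inv_sqr_lt R n (i-l).+1 n0.
 have h2 := @sum_inv_sqr_gt R n (i-l).+1 n0 ltac:(rewrite /n; lia).
 have h3:=poi1_ge n0.
 rewrite (subSn li).
 have h4: 0<=((i-l).+1%:R)^-1 :> R by rewrite invr_ge0.
 have h5: 0<=poi 1 n%:R by apply/ltW/poi_gt0.
 exact: close_le h1 h2 h3 h4 h5.
rewrite mul0r addr0 mul1r.
have -> : \sum_(s.+1<=j<r) ((i%:R-j%:R)^+2)^-1 = \sum_(s.+1-i<=t<r-i) (t%:R^+2)^-1 :> R.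
 rewrite -{1}(@subnK i s.+1) ?leqW //.
 rewrite big_addn; apply: eq_big_nat => t _; rewrite natrD.
 by congr (_^-1); ring.
set n:=(s.+1-i)%N; have n0: (0<n)%N by rewrite /n; lia.
have h1 := @sum_inv_sqr_lt R n (r-i) n0.
have h2 := @sum_inv_sqr_gt R n (r-i) n0 ltac:(rewrite /n; lia).
have h4: 0<=((r-i)%:R)^-1 :> R by rewrite invr_ge0.
have sE: i%:R-s%:R = 1-n%:R :> R by rewrite /n natrB ?leqW// -(natr1 s); ring.
rewrite sE.
have [n1|n1]:=leqP n 1.
 have -> : n = 1%N by lia.
 rewrite subrr invr0 subr0 normrN /poi expr0n/= addr0 !expr1n divr1.
 move: h1 h2; rewrite (_: n = 1%N); last lia.
 rewrite expr1n invr1; set S:=\sum_(_<=_<_) _ => h1 h2.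
 have S0: 0<=S by apply: sumr_ge0 => t _; rewrite invr_ge0 sqr_ge0.
 by rewrite ger0_norm//; lra.
have -> : 1-n%:R = - (n.-1)%:R :> R by rewrite -{1}(prednK n0) -natr1; ring.
have m0: (0<n.-1)%N by lia.
have h3:=poi1_ge m0; rewrite poiN invrN opprK.
move: h1 h2; set S:=\sum_(_<=_<_) _ => h1 h2.
have n2: 0<n.-1%:R :> R by rewrite ltr0n.
have h6: n%:R^-1<=(n.-1)%:R^-1 :> R by rewrite lef_pV2 ?posrE ?ltr0n ?ler_nat; lia.
have h7: (n.-1)%:R^-1-n%:R^-1<=(n.-1%:R^+2)^-1 :> R.
 rewrite -{2}(prednK n0) -natr1; set m:=n.-1%:R in n2 *.
 have -> : m^-1-(m+1)^-1 = (m*(m+1))^-1 by field; rewrite !gt_eqF//; lra.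
 by rewrite lef_pV2 ?posrE ?mulr_gt0 ?exprn_gt0//; nra.
have h8: (n%:R^+2)^-1<=(n.-1%:R^+2)^-1 :> R.
 by rewrite lef_pV2 ?posrE ?exprn_gt0 ?ltr0n// ler_sqr ?nnegrE// ler_nat; lia.
rewrite -normrN opprD !opprK.
have h5: 0<=poi 1 n.-1%:R by apply/ltW/poi_gt0.
have h9: S<=(n.-1%:R^+2)^-1+n.-1%:R^-1 by move: h1 h6 h8; lra.
have h10: n.-1%:R^-1-((n.-1%:R^+2)^-1+(r-i)%:R^-1)<=S by move: h2 h7; lra.
have h11: 0<=(n.-1%:R^+2)^-1 :> R by rewrite invr_ge0 sqr_ge0.
move: h9 h10 h11 h3 h4 h5; move: (n.-1%:R ^- 2) (n.-1%:R^-1) ((r-i)%:R^-1) (poi 1 _) => *.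
by rewrite ler_norml; apply/andP; split; lra.
Qed.

(** Summation by parts turns the row sums of this commutator kernel into the Hilbert transform of
    the increments of [A], up to [18 = 2 * 8 + 1 + 1] maximal functions, one contribution for each
    error term of [wt_close]. *)
Lemma kL_sum_l2: exists2 C: R, 0<C & forall A l r,
 \sum_(l<=i<r) (\sum_(l<=j<r) kL A 0 i j)^+2 <=
 C * \sum_(l<=s<r) (A s.+1-A s)^+2.
Proof.
have [C0 C00 HC] := @Mx_strong R 2 (ltr1n _ 2).
exists (56+2*(18^+2*C0)) => [|A l r].
 by rewrite addr_gt0// !mulr_gt0// exprn_gt0.
pose d s:=A s.+1-A s.
pose D s:=if (l<=s)%N then d s else 0.
have Dd s: (l<=s)%N -> D s = d s by rewrite /D => ->.
pose u i:=\sum_(l<=j<r) kL A 0 i j.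
pose H i:=\sum_(l<=s<r) d s/(i%:R-s%:R).
have uH i: (l<=i<r)%N -> `|u i-H i| <= 18*Mx r D i.
 move=> /andP[li ir]; rewrite /u kL_wt// /H -sumrB.
 apply: (le_trans (ler_norm_sum _ _ _)).
 apply: (le_via (\sum_(l<=s<r) (2*(poi 1 (i%:R-s%:R) * `|D s|) +
  ((s<i)%N%:R/(i.+1-l)%:R * `|D s| + (i<=s)%N%:R/(r-i)%:R * `|D s|)))).
  apply: ler_sum_nat => s /andP[ls sr]; rewrite -mulrBr normrM Dd// -/(d s).
  have:=wt_close li ir ls sr; have:=normr_ge0 (d s); nra.
 rewrite !big_split/= -mulr_sumr.
 have h1: \sum_(l<=s<r) poi 1 (i%:R-s%:R) * `|D s| <= 8*Mx r D i.
  apply: le_trans (poi_Mx D ir (lexx 1)).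
  rewrite (@sum_split _ l _ 0)//; last by rewrite ltnW// (leq_ltn_trans li).
  by rewrite lerDr sumr_ge0// => s _; rewrite mulr_ge0// ltW// poi_gt0.
 have h2: \sum_(l<=s<r) (s<i)%N%:R/(i.+1-l)%:R * `|D s| <= Mx r D i.
  under eq_bigr do rewrite mulrAC.
  rewrite -mulr_suml ler_pdivrMr ?ltr0n; last lia.
  apply: le_trans (Mx_sum D li (ltnSn i) ir).
  rewrite (@sum_split _ i.+1)//; [|lia..].
  rewrite [X in _+X<=_]sum_nat0 ?addr0 => [|s /andP[js _]]; last first.
  by rewrite (_: (s<i)%N = false) ?mul0r//; lia.
  by apply: ler_sum => s _; rewrite ler_piMl// lern1 leq_b1.
 have h3: \sum_(l<=s<r) (i<=s)%N%:R/(r-i)%:R * `|D s| <= Mx r D i.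
  under eq_bigr do rewrite mulrAC.
  rewrite -mulr_suml ler_pdivrMr ?ltr0n; last lia.
  apply: le_trans (Mx_sum D (leqnn i) ir (leqnn r)).
  rewrite (@sum_split _ i)//; [|lia..].
  rewrite [X in X+_<=_]sum_nat0 ?add0r => [|s /andP[_ si]]; last first.
  by rewrite (_: (i<=s)%N = false) ?mul0r//; lia.
  by apply: ler_sum => s _; rewrite ler_piMl// lern1 leq_b1.
 by lra.
have MxD: \sum_(l<=i<r) Mx r D i^+2<=C0 * \sum_(l<=s<r) d s^+2.
 have [rl|lr]:=leqP r l; first by rewrite !big_geq ?mulr0.
 have -> : \sum_(l<=s<r) d s^+2 = \sum_(0<=s<r) `|D s| `^ 2.
  rewrite [RHS](@sum_split _ l)//; last exact: ltnW.
  rewrite [X in _ = X+_]sum_nat0 ?add0r => [|s /andP[_ sl]]; last first.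
  by rewrite /D leqNgt sl/= normr0 powR0// pnatr_eq0.
  apply: eq_big_nat => s /andP[ls _].
  by rewrite Dd// (powR_mulrn 2)// real_normK ?num_real.
 apply: le_trans (HC r D).
 rewrite [leRHS](@sum_split _ l)//; last exact: ltnW.
 rewrite (eq_bigr (fun i => Mx r D i`^2)) => [|i _]; last first.
  by rewrite (powR_mulrn 2)// Mx_ge0.
 by rewrite lerDr sumr_ge0// => i _; rewrite powR_ge0.
have Hl:=hilbert_l2 l r d; rewrite -/(H _) in Hl.
apply: (le_via (\sum_(l<=i<r) (2*H i^+2+2*18^+2*Mx r D i^+2))).
 apply: ler_sum_nat => i ir; rewrite -/(u i).
 have:=uH i ir; set e:=u i-H i; have -> : u i = H i+e by rewrite /e; ring.
 have M0:=Mx_ge0 r D i; rewrite ler_norml => /andP[e1 e2].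
 have: e^+2<=18^+2*Mx r D i^+2 by nra.
 by have:=sqr_ge0 (H i-e); nra.
rewrite big_split/= -mulr_sumr -mulr_sumr.
move: Hl MxD; rewrite -/d.
set X:=\sum_(_<=_<_) d _^+2; set Y:=\sum_(_<=_<_) Mx _ _ _^+2.
rewrite -/(H _); set Z:=\sum_(_<=_<_) H _^+2 => Hl MxD.
by lra.
Qed.

(** Subtracting the linear sequence of slope [c] from [A] reduces to [c = 0], where [sym_identity1]
    reads the triple sum as three times the L^2 norm of the row sums. *)
Lemma curvature: exists2 C: R, 0<C & forall A c l r,
 \sum_(l<=x<r) \sum_(l<=y<r) \sum_(l<=z<r) trip (kL A c) x y z <=
 C * \sum_(l<=s<r) (A s.+1-A s-c)^+2.
Proof.
have [C C0 HC]:=kL_sum_l2; exists (3*C) => [|A c l r]; first by rewrite mulr_gt0.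
pose B i:=A i-c*i%:R.
have E i j: kL A c i j = kL B 0 i j.
 have [->|ij]:=eqVneq i j; first by rewrite !kL_diag.
 by have ijN:=natB_neq0 R ij; rewrite /kL /dq /B; field.
have -> : \sum_(l<=s<r) (A s.+1-A s-c)^+2 = \sum_(l<=s<r) (B s.+1-B s)^+2.
 by apply: eq_bigr => s _; rewrite /B -(natr1 s); congr (_^+2); ring.
rewrite -sym_identity1 -mulrA ler_pM2l //.
by under eq_bigr do under eq_bigr do rewrite E; exact: HC.
Qed.

End CurvatureBound.

(** * Local L^2 bounds for the smooth kernels *)

Section LocalL2.
Variable R: realType.
Implicit Types (f: nat -> R) (A: nat -> R) (P: R -> R).

(** [sym_identity] is used twice: with the constant 1 for the row sums, then with [f], whose mixed
    term contains those row sums. The bound is by the oscillation of the increments about [c] and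
    not by the length of the window; this is what makes flat graphs give small operators. *)
Lemma kP_sum_l2: exists2 C: R, 0<C & forall L K P A c l r f,
 0<=L -> 0<=K -> smooth L K P -> lipseq L A -> `|c| <= L ->
 (forall j, `|f j| <= 1) ->
 \sum_(l<=i<r) (\sum_(l<=j<r) kP P A (P c) i j*f j)^+2 <=
 C*K^+2 * \sum_(l<=s<r) (A s.+1-A s-c)^+2.
Proof.
have [C C0 HC]:=curvature R; exists (10*C) => [|L K P A c l r f L0 K0 PS AL cL f1].
 by rewrite mulr_gt0.
have tb x y z:=trip_kP x y z L0 K0 PS AL cL.
have {HC}:=HC A c l r; set V:=\sum_(l<=s<r) _^+2; set W:=(X in X<=_) => HC.
set k:=kP P A (P c).
have KC: K^+2*W<=K^+2*(C*V) by rewrite ler_wpM2l ?sqr_ge0.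
have S1: 3 * \sum_(l<=i<r) (\sum_(l<=j<r) k i j)^+2<=3*K^+2*W.
 rewrite sym_identity1 /W mulr_sumr; apply: ler_sum => x _.
 rewrite mulr_sumr; apply: ler_sum => y _; rewrite mulr_sumr; apply: ler_sum => z _.
 exact: le_trans (ler_norm _) (tb x y z).
have:=sym_identity (index_iota l r) k f.
set X:=(X in X+_ = _ -> _); set Y:=\sum_(x <- _) _*_*_.
set Z:=(X in _ = X -> _) => E.
have ZW: Z<=3*K^+2*W.
 rewrite /Z /W mulr_sumr; apply: ler_sum => x _.
 rewrite mulr_sumr; apply: ler_sum => y _; rewrite mulr_sumr; apply: ler_sum => z _.
 apply: (le_trans (ler_norm _)); rewrite normrM.
 apply: le_trans (tb x y z); rewrite ler_piMr// normrM.
 by rewrite mulr_ile1.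
have XY: - (2*Y)<=2 * \sum_(l<=i<r) (\sum_(l<=j<r) k i j)^+2+1/2*X.
 rewrite /Y /X -mulrN -sumrN !mulr_sumr -big_split/=.
 apply: ler_sum => x _; set T:=\sum_(y <- _) k x y*f y; set s:=\sum_(y <- _) _.
 have fx: f x^+2<=1 by have:=f1 x; rewrite ler_norml => /andP[? ?]; nra.
 have:=sqr_ge0 (2*(f x*s)+T); have:=sqr_ge0 s; nra.
by rewrite -/X; lra.
Qed.

(** The kernel is split as [kP P A (P 0)], covered by [kP_sum_l2] at slope 0, plus [P 0] times the
    Hilbert kernel. *)
Lemma kP0_local_l2 L K: 0<=L -> 0<=K -> exists2 C: R, 0<C & forall P A l r f,
 smooth L K P -> lipseq L A -> (forall j, `|f j| <= 1) ->
 \sum_(l<=i<r) (\sum_(l<=j<r) kP P A 0 i j*f j)^+2<=C*(r-l)%:R.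
Proof.
move=> L0 K0; have [C C0 HC]:=kP_sum_l2.
exists (2*(C*K^+2*L^+2)+56*K^+2+1) => [|P A l r f PS AL f1].
 by rewrite ltr_wpDl// addr_ge0// ?mulr_ge0 ?sqr_ge0// ltW.
have n0: `|0: R| <= L by rewrite normr0.
have:=HC L K P A 0 l r f L0 K0 PS AL n0 f1.
have:=hilbert_l2 l r f.
have f2: \sum_(l<=j<r) f j^+2<=(r-l)%:R.
 rewrite -sumr_const_nat; apply: ler_sum => j _.
 by have:=f1 j; rewrite ler_norml => /andP[? ?]; nra.
have d2: \sum_(l<=s<r) (A s.+1-A s-0)^+2<=L^+2*(r-l)%:R.
 rewrite mulr_natr -sumr_const_nat; apply: ler_sum => j _.
 have:=AL j.+1 j; rewrite -(natr1 j) addrAC subrr add0r normr1 mulr1 subr0.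
 by rewrite ler_norml => /andP[? ?]; nra.
set H:=\sum_(l<=i<r) _^+2; set F:=\sum_(l<=j<r) f j^+2.
set S:=\sum_(l<=i<r) _^+2; set D:=\sum_(l<=s<r) _^+2 => hH hS.
have P0: P 0^+2<=K^+2.
 by have [h _ _]:=PS; have:=h 0 n0; rewrite ler_norml => /andP[? ?]; nra.
have HK: P 0^+2*H<=K^+2*(28*(r-l)%:R).
 apply: ler_pM => //; rewrite ?sqr_ge0//; first by apply: sumr_ge0 => i _; exact: sqr_ge0.
 by move: hH f2; rewrite -/F; lra.
have SD: S<=C*K^+2*(L^+2*(r-l)%:R).
 apply: (le_trans hS); rewrite ler_wpM2l// mulr_ge0 ?sqr_ge0// ltW //.
apply: (le_via (2*S+2*(P 0^+2*H))).
 rewrite /S /H !mulr_sumr -big_split/=; apply: ler_sum => i _.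
 have -> : \sum_(l<=j<r) kP P A 0 i j*f j =
  \sum_(l<=j<r) kP P A (P 0) i j*f j+P 0 * \sum_(l<=j<r) f j/(i%:R-j%:R).
  rewrite mulr_sumr -big_split/=; apply: eq_bigr => j _; rewrite /kP; ring.
 set a:=\sum_(_<=_<_) _; set b:=\sum_(_<=_<_) _.
 by have:=sqr_ge0 (a-P 0*b); nra.
have: 0<=(r-l)%:R :> R by [].
by lra.
Qed.

End LocalL2.

(** * Discrete Calderon-Zygmund kernels and Cotlar's inequality *)

Section CZ.
Variable R: realType.
Implicit Types (f: nat -> R) (k: nat -> nat -> R).

(** Size and regularity are multiplied out, so that the diagonal is no exception. Regularity in the
    second index follows from antisymmetry. *)
Definition czk (B: R) k :=
 [/\ forall i j, k i j = - k j i,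
  forall i j, `|k i j| * `|i%:R-j%:R| <= B &
  forall i i' j, 2 * `|i%:R-i'%:R| <= `|i%:R-j%:R| :> R ->
  `|k i j-k i' j| * (i%:R-j%:R)^+2<=B * `|i%:R-i'%:R|].

Lemma kP_czk L K P A c: 0<=L -> 0<=K -> smooth L K P -> lipseq L A -> `|c| <= K ->
 czk (4*K*(L+1)) (@kP R P A c).
Proof.
move=> L0 K0 [Pb PL _] AL cK.
have q i j:=dq_bound i j L0 AL.
have Pc i j: `|P (dq A i j)-c| <= 2*K.
 by apply: (le_trans (ler_normB _ _)); have:=Pb _ (q i j); lra.
split.
- by move=> i j; exact: kPC.
- move=> i j; have [->|ij]:=eqVneq i j.
  by rewrite kP_diag normr0 mul0r !mulr_ge0// addr_ge0.
 have:=natB_neq0 R ij; rewrite -normr_gt0 => ijN.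
 rewrite /kP normrM normfV divfK ?gt_eqF //.
 by apply: (le_trans (Pc i j)); nra.
- move=> i i' j; set x:=i%:R-j%:R; set y:=i'%:R-j%:R: R.
 have xyE: i%:R-i'%:R = x-y by rewrite /x /y; ring.
 rewrite xyE => hxy.
 have [x0|x0]:=eqVneq x 0.
  by rewrite x0 expr0n mulr0 mulr_ge0// !mulr_ge0// addr_ge0.
 have xp: 0 < `|x| by rewrite normr_gt0.
 have yx: `|x| / 2 <= `|y|.
  have: `|x| <= `|x-y| + `|y| by rewrite -{1}(subrK y x) ler_normD.
  lra.
 have yp: 0 < `|y| by lra.
 have y0: y != 0 by rewrite -normr_gt0.
 have dqd: `|dq A i j-dq A i' j| * `|x| <= 2*L * `|x-y|.
  have -> : dq A i j-dq A i' j = ((A i-A i')*y+(A i'-A j)*(y-x))/(x*y).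
  by rewrite /dq -/x -/y; field; rewrite x0 y0.
  rewrite normrM normfV (normrM x) invfM mulrA mulrAC divfK ?gt_eqF// ler_pdivrMr //.
  apply: (le_trans (ler_normD _ _)); rewrite !normrM (distrC y x).
  have h1:=AL i i'; have h2:=AL i' j; rewrite xyE in h1; rewrite -/y in h2.
  have:=normr_ge0 (x-y); nra.
 have Pd: `|P (dq A i j)-P (dq A i' j)| * `|x| <= K*(2*L * `|x-y|).
  apply: (le_via (K*(`|dq A i j-dq A i' j| * `|x|))).
  by rewrite mulrA ler_wpM2r// PL.
  by rewrite ler_wpM2l.
 have -> : kP P A c i j-kP P A c i' j =
  (P (dq A i j)-P (dq A i' j))/x+(P (dq A i' j)-c)*((y-x)/(x*y)).
  by rewrite /kP -/x -/y; field; rewrite x0 y0.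
 rewrite -[x^+2]real_normK ?num_real //.
 apply: (le_via ((`|P (dq A i j)-P (dq A i' j)| / `|x| +
  2*K*(`|x-y| / (`|x| * `|y|))) * `|x| ^+ 2)).
  rewrite ler_wpM2r ?sqr_ge0//; apply: (le_trans (ler_normD _ _)).
  rewrite !normrM !normfV (normrM x) (distrC y x); apply: lerD => //.
  by rewrite ler_wpM2r// divr_ge0// mulr_ge0.
 have -> : (`|P (dq A i j)-P (dq A i' j)| / `|x| +
  2*K*(`|x-y| / (`|x| * `|y|))) * `|x| ^+ 2 =
  `|P (dq A i j)-P (dq A i' j)| * `|x| + 2*K*(`|x-y| * (`|x| / `|y|)).
  by field; rewrite !gt_eqF.
 have h: `|x| / `|y| <= 2 by rewrite ler_pdivrMr//; lra.
 have h' : `|x-y| * (`|x| / `|y|) <= `|x-y| * 2 by rewrite ler_wpM2l.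
 have K2: 0<=2*K by lra.
 have h'':=ler_wpM2l K2 h'.
 have h3: 0<=K*(2*L * `|x-y|) by rewrite !mulr_ge0.
 lra.
Qed.

(** A local form of L^s boundedness: on every window, an s-mean of [f] at most [t] forces an L^1
    mean of the image at most [D * t]. Together with its dual form [LB] it is what the bootstrap of
    [cz_strong] carries from one exponent to the next. *)
Definition LH k (s D: R):=forall l r f t, 0<t ->
 \sum_(l<=j<r) `|f j| `^ s<=t`^s*(r-l)%:R ->
 \sum_(l<=i<r) `|\sum_(l<=j<r) k i j*f j| <= D * t*(r-l)%:R.

Definition LB k (q D: R):=forall l r f, (forall j, `|f j| <= 1) ->
 \sum_(l<=i<r) `|\sum_(l<=j<r) k i j*f j| `^ q<=D*(r-l)%:R.

(** Duality: the L^1 norm is tested against the signs of the image, antisymmetry moves the kernel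
    onto the signs, where [LB] applies, and Young's inequality at scale [t] separates the two
    factors. *)
Lemma LB_LH k B s q D: czk B k -> 0<s -> 0<q -> s^-1+q^-1 = 1 -> 1<=s -> 1<=q ->
 LB k q D -> LH k s (1+D).
Proof.
move=> [kN _ _] s0 q0 sq s1 q1 HB l r f t t0 Hf.
pose sg i:=Num.sg (\sum_(l<=j<r) k i j*f j).
have -> : \sum_(l<=i<r) `|\sum_(l<=j<r) k i j*f j| =
  \sum_(l<=j<r) f j * - (\sum_(l<=i<r) k j i*sg i).
 transitivity (\sum_(l<=i<r) \sum_(l<=j<r) sg i*(k i j*f j)).
  by apply: eq_bigr => i _; rewrite normrEsg mulr_sumr.
 rewrite exchange_big/=; apply: eq_bigr => j _; rewrite -sumrN mulr_sumr.
 by apply: eq_bigr => i _; rewrite kN; ring.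
have sg1 i: `|sg i| <= 1.
 by rewrite /sg normr_sg lern1; case: (_ == _).
have:=HB l r sg sg1.
set G:=fun j => \sum_(l<=i<r) k j i*sg i => HG.
have ts: 0<t`^s by rewrite powR_gt0.
apply: (le_via (\sum_(l<=j<r) t*(`|f j| `^ s/t`^s + `|G j| `^ q))).
 apply: ler_sum => j _; rewrite -/(G j).
 apply: (le_trans (ler_norm _)); rewrite normrM normrN.
 have := @conjugate_powR R (`|f j| / t) `|G j| s q (divr_ge0 (normr_ge0 _) (ltW t0)) (normr_ge0 _) s0 q0 sq.
 rewrite powR_div// => h.
 have -> : `|f j| * `|G j| = t*(`|f j| / t * `|G j|) by field; rewrite gt_eqF.
 rewrite ler_pM2l//; apply: (le_trans h); apply: lerD.
  by rewrite ler_pdivrMr// ler_peMr// divr_ge0 ?powR_ge0.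
 by rewrite ler_pdivrMr// ler_peMr// powR_ge0.
rewrite -mulr_sumr big_split/= -mulr_suml.
rewrite (mulrC (1+D)) -mulrA ler_pM2l// mulrDl mul1r; apply: lerD => //.
by rewrite ler_pdivrMr// mulrC.
Qed.

Definition ndist i j:=((i-j)+(j-i))%N.

Lemma ndistE i j: `|i%:R-j%:R| = (ndist i j)%:R :> R.
Proof.
have [ij|ji]:=leqP i j.
 by rewrite distrC -natrB// ger0_norm// /ndist (eqP ij).
by rewrite -natrB ?(ltnW ji)// ger0_norm// /ndist (eqP (ltnW ji)) addn0.
Qed.

Definition Tr k N r f i: R:=\sum_(0<=j<N) (r<=ndist i j)%N%:R*(k i j*f j).
Definition TT k N f i: R:=\sum_(0<=j<N) k i j*f j.
Definition Tmax k N f i: R:=\big[Num.max/0]_(r<N) `|Tr k N r.+1 f i|.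

Lemma Tmax_ge0 k N f i: 0<=Tmax k N f i.
Proof. exact: bigmax_ge_id. Qed.

Lemma Tr_Tmax k N f i r: (i<N)%N -> (0<r)%N -> `|Tr k N r f i| <= Tmax k N f i.
Proof.
move=> iN r0; have [rN|Nr]:=ltnP r.-1 N.
 by have := @le_bigmax _ _ _ 0 (fun r: 'I_N => `|Tr k N r.+1 f i|) (Ordinal rN); rewrite /= prednK.
rewrite /Tr sum_nat0 ?normr0 ?Tmax_ge0// => j jN.
by rewrite (_: (r<=ndist i j)%N = false) ?mul0r// /ndist; lia.
Qed.

Lemma ball_sum (F: nat -> R) N i r: (i<N)%N -> (0<r)%N ->
 \sum_(0<=j<N) (r<=ndist i j)%N%:R*F j =
 \sum_(0<=j<N) F j - \sum_(i.+1-r<=j<minn (i+r) N) F j.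
Proof.
move=> iN r0.
have h1: (i.+1-r<=minn (i+r) N)%N by lia.
have h2: (minn (i+r) N<=N)%N by lia.
have split3 (G: nat -> R) : \sum_(0<=j<N) G j = \sum_(0<=j<i.+1-r) G j +
  (\sum_(i.+1-r<=j<minn (i+r) N) G j + \sum_(minn (i+r) N<=j<N) G j).
 rewrite (@sum_split _ (i.+1-r) _ 0)//; last lia.
 by rewrite (@sum_split _ (minn (i+r) N) _ (i.+1-r)).
rewrite !split3.
rewrite [X in _+(X+_) = _]sum_nat0 => [|j hj]; last first.
 by rewrite (_: (r<=ndist i j)%N = false) ?mul0r// /ndist; lia.
rewrite add0r addrA addrAC addrK; congr (_+_).
 apply: eq_big_nat => j hj; rewrite (_: (r<=ndist i j)%N) ?mul1r// /ndist; lia.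
apply: eq_big_nat => j hj; rewrite (_: (r<=ndist i j)%N) ?mul1r// /ndist; lia.
Qed.

Lemma poi_ge_inv (r t: R) : 0<r -> r <= `|t| -> (t^+2)^-1<=2/r*poi r t.
Proof.
move=> r0 rt; have t0: 0 < `|t| by lra.
have t2: r^+2<=t^+2.
 by rewrite -[t^+2]real_normK ?num_real// ler_sqr ?nnegrE// ltW.
have r2: 0<r^+2 by rewrite exprn_gt0.
rewrite /poi mulrA divfK ?gt_eqF// -div1r ler_pdivrMr; last by lra.
rewrite mulrAC ler_pdivlMr ?mul1r; lra.
Qed.

Lemma reg_sum k B N f i i' r: czk B k -> 0<=B -> (i<N)%N -> (0<r)%N ->
 (2*ndist i i'<=r)%N ->
 \sum_(0<=j<N) (r<=ndist i j)%N%:R*(`|k i j-k i' j| * `|f j|) <=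
 16*B*((ndist i i')%:R/r%:R)*Mx N f i.
Proof.
move=> [_ _ kreg] B0 iN r0 ir.
have rp: 0<r%:R :> R by rewrite ltr0n.
have r1: 1<=r%:R :> R by rewrite ler1n.
apply: (le_via (\sum_(0<=j<N) (2*B*((ndist i i')%:R/r%:R)) *
  (poi r%:R (i%:R-j%:R) * `|f j|))).
 apply: ler_sum_nat => j jN.
 have [rj|rj]:=leqP r (ndist i j); last first.
  rewrite mul0r; apply: mulr_ge0; first by rewrite !mulr_ge0// invr_ge0 ltW.
  by rewrite mulr_ge0// ltW// poi_gt0.
 rewrite mul1r mulrA ler_wpM2r //.
 have h1: r%:R <= `|i%:R-j%:R| :> R by rewrite ndistE ler_nat.
 have h2: 2 * `|i%:R-i'%:R| <= `|i%:R-j%:R| :> R.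
  by rewrite !ndistE -natrM ler_nat (leq_trans ir).
 have:=kreg i i' j h2; rewrite ndistE.
 have x2: 0<(i%:R-j%:R)^+2 :> R.
  by rewrite -real_normK ?num_real// exprn_gt0// (lt_le_trans rp h1).
 rewrite -ler_pdivlMr// => h3; apply: (le_trans h3).
 have h4:=poi_ge_inv rp h1.
 have h5: 0<=B*(ndist i i')%:R by rewrite mulr_ge0.
 have:=ler_wpM2l h5 h4; lra.
rewrite -mulr_sumr.
have h:=poi_Mx f iN r1.
have h5: 0<=2*B*((ndist i i')%:R/r%:R) by rewrite !mulr_ge0// invr_ge0 ltW.
have:=ler_wpM2l h5 h; lra.
Qed.

Lemma window_card i n N r E: (i<N)%N -> (0<r)%N -> (2*n<=r)%N -> (r<=E*n.+1)%N ->
 (minn (i+r) N-(i.+1-r)<=2*E*(minn (i+n.+1) N-(i-n)))%N.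
Proof.
move=> iN r0 nr rE; have E0: (0<E)%N by case: E rE => //; lia.
set a:=(i-n)%N; set b:=minn (i+n.+1) N.
have ai: (a<=i)%N by rewrite /a; lia.
have ib: (i<b)%N by rewrite /b; lia.
have h1: (i-(i.+1-r)<=E*(i-a).+1)%N.
 have [h|h]:=leqP i n; rewrite /a.
  by rewrite (eqP h) subn0; nia.
 by rewrite subKn ?(ltnW h)//; nia.
have h2: (minn (i+r) N-i<=E*(b-i))%N.
 have [h|h]:=leqP (i+n.+1) N; rewrite /b.
  by rewrite (minn_idPl h); nia.
 by rewrite (minn_idPr (ltnW h)); nia.
have: (minn (i+r) N-(i.+1-r)<=E*(i-a).+1+E*(b-i))%N by lia.
move/leq_trans; apply; rewrite -mulnDr (mulnC 2) -mulnA leq_mul2l; apply/orP; right; lia.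
Qed.

(** The truncated sum at [i] is compared with the full sum at every [i'] within [n] of [i] and
    averaged: the far parts differ by the regularity of the kernel, the near parts are small in mean
    by [HM]. The averaging radius is about [r/E]; a large [E] makes the regularity error small at
    the expense of the middle term, a freedom used in [flat_Tr]. *)
Lemma cotlar k B N r n E M f i: czk B k -> 0<=B -> 0<=M -> (i<N)%N -> (0<r)%N ->
 (2*n<=r)%N -> (r<=E*n.+1)%N ->
 (forall a b, (a<=i)%N -> (i<b)%N -> (b<=N)%N ->
  \sum_(a<=i'<b) `|\sum_(a<=j<b) k i' j*f j| <= M*(b-a)%:R) ->
 `|Tr k N r f i| <= Mx N (TT k N f) i+2*E%:R*M +
  16*B*(n%:R/r%:R)*Mx N f i.
Proof.
move=> kB B0 M0 iN r0 nr rE HM.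
set a:=(i-n)%N; set b:=minn (i+n.+1) N.
set a':=(i.+1-r)%N; set b':=minn (i+r) N.
have ai: (a<=i)%N by rewrite /a; lia.
have ib: (i<b)%N by rewrite /b; lia.
have bN: (b<=N)%N by rewrite /b; lia.
have ba: 0<(b-a)%:R :> R by rewrite ltr0n; lia.
have rp: 0<r%:R :> R by rewrite ltr0n.
have Mf0:=Mx_ge0 N f i.
have key i' : (a<=i'<b)%N -> `|Tr k N r f i| <=
  `|TT k N f i'| + `|\sum_(a'<=j<b') k i' j*f j| + 16*B*(n%:R/r%:R)*Mx N f i.
 move=> hi'.
 have hn: (ndist i i'<=n)%N by move: hi'; rewrite /ndist /a /b; lia.
 have -> : Tr k N r f i = TT k N f i' - \sum_(a'<=j<b') k i' j*f j +
  \sum_(0<=j<N) (r<=ndist i j)%N%:R*((k i j-k i' j)*f j).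
  rewrite /TT -(ball_sum (fun j => k i' j*f j) iN r0) -big_split/=.
  by apply: eq_bigr => j _; ring.
 apply: (le_trans (ler_normD _ _)); apply: lerD; first exact: ler_normB.
 apply: (le_trans (ler_norm_sum _ _ _)).
 apply: (le_via (16*B*((ndist i i')%:R/r%:R)*Mx N f i)).
  apply: le_trans (reg_sum f kB B0 iN r0 _); last lia.
  by apply: ler_sum => j _; rewrite !normrM (ger0_norm (ler0n _ _)).
 rewrite ler_wpM2r// ler_wpM2l ?mulr_ge0// ler_wpM2r ?invr_ge0 ?(ltW rp) //.
 by rewrite ler_nat.
rewrite -(ler_pM2r ba).
have -> : `|Tr k N r f i| * (b-a)%:R = \sum_(a<=i'<b) `|Tr k N r f i|.
 by rewrite sumr_const_nat mulr_natr.
apply: (le_trans (ler_sum_nat key)); rewrite !big_split/= sumr_const_nat -[_ *+ (b-a)]mulr_natr.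
rewrite [leRHS]mulrDl lerD2r [leRHS]mulrDl; apply: lerD.
 exact: (Mx_sum (TT k N f) ai ib bN).
apply: (le_via (\sum_(a'<=i'<b') `|\sum_(a'<=j<b') k i' j*f j|)).
 have h1: (a'<=a)%N by rewrite /a' /a; lia.
 have h2: (b<=b')%N by rewrite /b' /b; lia.
 rewrite [leRHS](@sum_split _ a)//; last by lia.
 rewrite [X in _<=_+X](@sum_split _ b)//; last by lia.
 by rewrite addrCA lerDl addr_ge0// sumr_ge0.
apply: (le_via (M*(b'-a')%:R)); first by apply: HM; rewrite /a' /b'; lia.
rewrite mulrAC mulrC ler_wpM2r// -!natrM ler_nat.
exact: window_card.
Qed.

Lemma Mx_le N f i u: 0<=u -> (forall a b, (a<=i)%N -> (i<b)%N -> (b<=N)%N ->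
 \sum_(a<=j<b) `|f j| <= u*(b-a)%:R) -> Mx N f i<=u.
Proof.
move=> u0 H; rewrite leNgt; apply/negP => /(Mx_gt u0)[a [b [ai ib bN]]].
by rewrite ltNge H.
Qed.

Lemma le_add_powR (x t s: R) : 0<=x -> 0<t -> 1<=s ->
 x<=t+t/t`^s*x`^s.
Proof.
move=> x0 t0 s1; have ts: 0<t`^s by rewrite powR_gt0.
have [xt|tx]:=leP x t.
 by apply: (le_trans xt); rewrite lerDl mulr_ge0 ?powR_ge0// divr_ge0// ltW.
have h: 1<=x/t by rewrite ler_pdivlMr// mul1r ltW.
have:=le1r_powR h s1; rewrite powR_div// => h2.
have:=ler_wpM2l (ltW t0) h2.
have -> : t*(x/t) = x by field; rewrite gt_eqF.
have -> : t*(x`^s/t`^s) = t/t`^s*x`^s by ring.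
by lra.
Qed.

(** A substitute for Holder's inequality on averages: [|f j|] is at most [t] plus a multiple of its
    power [s]. *)
Lemma Mx_powR N f i s t: 1<=s -> 0<t ->
 Mx N (fun j => `|f j| `^ s) i<=t`^s -> Mx N f i<=2 * t.
Proof.
move=> s1 t0 H; have ts: 0<t`^s by rewrite powR_gt0.
apply: Mx_le => [|a b ai ib bN]; first lra.
have hs: \sum_(a<=j<b) `|f j| `^ s<=Mx N (fun j => `|f j| `^ s) i*(b-a)%:R.
 apply: le_trans (Mx_sum (fun j => `|f j| `^ s) ai ib bN).
 by apply: ler_sum => j _; exact: ler_norm.
apply: (le_via (\sum_(a<=j<b) (t+t/t`^s * `|f j| `^ s))).
 by apply: ler_sum => j _; exact: le_add_powR.
rewrite big_split/= sumr_const_nat -mulr_sumr -[_ *+ _]mulr_natr.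
have h2: \sum_(a<=j<b) `|f j| `^ s<=t`^s*(b-a)%:R.
 by apply: (le_trans hs); rewrite ler_wpM2r.
have:=ler_wpM2l (divr_ge0 (ltW t0) (ltW ts)) h2.
by rewrite mulrA divfK ?gt_eqF//; lra.
Qed.

Lemma Tmax_cotlar k B s D N f i t: czk B k -> 0<=B -> LH k s D -> 0<=D -> 1<=s ->
 (i<N)%N -> 0<t -> Mx N (fun j => `|f j| `^ s) i<=t`^s ->
 Tmax k N f i<=Mx N (TT k N f) i+(4*D+16*B) * t.
Proof.
move=> kB B0 HL D0 s1 iN t0 H.
have h2:=Mx_powR s1 t0 H.
have Mf0:=Mx_ge0 N f i; have MT0:=Mx_ge0 N (TT k N f) i.
apply/bigmax_leP; split => [|r _]; first by rewrite addr_ge0// mulr_ge0 ?(ltW t0)// addr_ge0// mulr_ge0.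
have HM a b: (a<=i)%N -> (i<b)%N -> (b<=N)%N ->
  \sum_(a<=i'<b) `|\sum_(a<=j<b) k i' j*f j| <= D * t*(b-a)%:R.
 move=> ai ib bN; apply: HL => //.
 have:=Mx_sum (fun j => `|f j| `^ s) ai ib bN.
 under eq_bigr do rewrite ger0_norm ?powR_ge0 //.
 by move/le_trans; apply; rewrite ler_wpM2r.
have [n n1 n2] : exists2 n, (2*n<=r.+1)%N & (r.+1<=2*n.+1)%N.
 by exists (r.+1 %/ 2)%N; move: (nat_of_ord r) => q; lia.
apply: (le_trans (@cotlar k B N r.+1 n 2 (D * t) f i kB B0 (mulr_ge0 D0 (ltW t0)) iN isT n1 n2 HM)).
have h3: n%:R/r.+1%:R<=1/2 :> R.
 by rewrite ler_pdivrMr ?ltr0n// mulrAC ler_pdivlMr// mul1r -natrM ler_nat mulnC.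
set w:=_%:R/_ in h3 *.
have h4: w*Mx N f i<=1/2*(2 * t) by apply: ler_pM => //; rewrite divr_ge0.
have h5:=ler_wpM2l B0 h4.
have -> : 16*B*w*Mx N f i = 16*(B*(w*Mx N f i)) by ring.
move: (Mx N _ i) (B*(w*_)) h5 => ? ?; lra.
Qed.

End CZ.

(** * The good-lambda inequality and L^p bounds for all exponents *)

Section GoodLambda.
Variable R: realType.
Implicit Types (f: nat -> R) (k: nat -> nat -> R).

(** Maximal runs of [W] stand in for a Whitney decomposition: on a grid the level set is a disjoint
    union of intervals whose neighbouring points lie outside it. *)
Lemma run_sum (W: pred nat) (B: nat -> R) a N: 0<=a ->
 (forall i, (i<N)%N -> ~~ W i -> B i<=0) ->
 (forall l r, (l<r)%N -> (r<=N)%N -> (l = 0%N \/ ~~ W l.-1) -> (r = N \/ ~~ W r) ->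
  \sum_(l<=i<r) B i<=a*(r-l)%:R) ->
 \sum_(0<=i<N) B i<=a * \sum_(0<=i<N) (W i)%:R.
Proof.
move=> a0 BW H.
suff: forall n i, (i<=N)%N -> (N-i<=n)%N -> (W i -> i = 0%N \/ ~~ W i.-1) ->
  \sum_(i<=j<N) B j<=a * \sum_(i<=j<N) (W j)%:R.
 by move=> /(_ N 0%N); apply; rewrite ?subn0//; left.
elim=> [|n IH] i iN Nin Wi; first by rewrite !big_geq ?mulr0//; lia.
have [->|iN']:=eqVneq i N; first by rewrite !big_geq// mulr0.
have {iN'}iN' : (i<N)%N by lia.
have [wi|wi]:=boolP (W i); last first.
 rewrite big_ltn// [X in _*X]big_ltn// (negbTE wi) add0r.
 apply: (le_via (0 + \sum_(i.+1<=j<N) B j)).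
  by rewrite lerD2r; exact: BW.
 rewrite add0r; apply: IH; [lia|lia|] => _; by right.
have ex: exists r, (i<r)%N && ((r == N) || ~~ W r) by exists N; rewrite iN' eqxx.
have [r /andP[ir rW] rmin]:=ex_minnP ex.
have rN: (r<=N)%N by apply: rmin; rewrite iN' eqxx.
have Wir j: (i<=j<r)%N -> W j.
 move=> /andP[ij jr]; have [<-//|ij']:=eqVneq i j.
 apply: contraLR jr => nW; rewrite -leqNgt; apply: rmin.
 by rewrite nW orbT andbT ltn_neqAle ij'.
rewrite (@sum_split _ r)//; last exact: ltnW.
rewrite [X in _*X](@sum_split _ r)//; last exact: ltnW.
rewrite mulrDr; apply: lerD.
 have -> : \sum_(i<=j<r) (W j)%:R = (r-i)%:R :> R.
  rewrite (eq_big_nat _ _ (F2:=fun=> 1)) => [|j /Wir ->//].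
  by rewrite sumr_const_nat.
 apply: H => //; first exact: Wi.
 by case/orP: rW => [/eqP|]; [left|right].
case/orP: rW => [/eqP ->|rW]; first by rewrite !big_geq ?mulr0.
apply: IH => //; first lia.
by move=> Wr; rewrite Wr in rW.
Qed.

Definition kS (l: nat) k i j: R:=k (i+l)%N (j+l)%N.

Lemma czk_shift B l k: czk B k -> czk B (kS l k).
Proof.
move=> [k1 k2 k3]; have sh i j: (i+l)%:R-(j+l)%:R = i%:R-j%:R :> R.
 by rewrite !natrD; ring.
split=> [i j|i j|i i' j]; rewrite /kS.
- exact: k1.
- by rewrite -sh; exact: k2.
- by rewrite -(sh i j) -(sh i i'); exact: k3.
Qed.

Lemma sum_shift (F: nat -> R) a b l :
 \sum_(a+l<=i<b+l) F i = \sum_(a<=i<b) F (i+l)%N.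
Proof. by rewrite big_addn addnK. Qed.

Lemma sum_from (F: nat -> R) a b :
 \sum_(a<=i<b) F i = \sum_(0<=i<b-a) F (i+a)%N.
Proof. by rewrite -{1}(add0n a) big_addn. Qed.

Lemma LH_shift l k s D: LH k s D -> LH (kS l k) s D.
Proof.
move=> H a b f t t0 Hf.
have:=H (a+l)%N (b+l)%N (fun j => f (j-l)%N) t t0.
rewrite subnDr !sum_shift.
under eq_bigr do rewrite addnK.
move=> /(_ Hf); move/(le_trans _); apply.
apply: ler_sum => i _; rewrite sum_shift.
by le_of_eq; congr `|_|; apply: eq_bigr => j _; rewrite addnK.
Qed.

Lemma cnt_weak N f u: 0<u ->
 u*cnt N (Mx N f) u<=4 * \sum_(0<=i<N) `|f i|.
Proof. exact: Mx_weak. Qed.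

Lemma cnt_le N (u: nat -> R) t: cnt N u t<=N%:R.
Proof.
apply: (le_via (\sum_(0<=i<N) 1)); last by rewrite sumr_const_nat subn0.
by apply: ler_sum => i _; rewrite lern1 leq_b1.
Qed.

(** By Cotlar's inequality, a large [Tmax] forces one of two maximal functions to be large, and both
    are of weak type. The gain of the factor [c] is the source of the smallness in the good-lambda
    inequality. *)
Lemma local_weak k B s D N f c t: czk B k -> 0<=B -> LH k s D -> 0<=D -> 1<=s ->
 0<c -> 0<t -> \sum_(0<=j<N) `|f j| `^ s<=(c * t)`^s*N%:R ->
 cnt N (Tmax k N f) t<=(40*D+128*B+8)*c*N%:R.
Proof.
move=> kB B0 HL D0 s1 c0 t0 Hf.
pose C2:=4*D+16*B+1.
have C20: 1<=C2 by rewrite /C2; lra.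
have ct: 0<c * t by rewrite mulr_gt0.
(* Chosen so that the last term of [Tmax_cotlar] at level [t'] is at most [t/2]. *)
pose t':=t/(2*C2).
have t'0: 0<t' by rewrite divr_gt0// mulr_gt0// (lt_le_trans _ C20).
have step: cnt N (Tmax k N f) t <=
  cnt N (Mx N (TT k N f)) (t/2)+cnt N (Mx N (fun j => `|f j| `^ s)) (t' `^ s).
 rewrite /cnt -big_split/=; apply: ler_sum_nat => i /andP[_ iN].
 have [tT|tT]:=ltP t (Tmax k N f i); last by rewrite addr_ge0.
 have [h1|h1]:=ltP (t/2) (Mx N (TT k N f) i); first by rewrite lerDl.
 have [h2|h2]:=ltP (t' `^ s) (Mx N (fun j => `|f j| `^ s) i); first by rewrite lerDr.
 exfalso; have:=Tmax_cotlar kB B0 HL D0 s1 iN t'0 h2; apply/negP; rewrite -ltNge.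
 apply: le_lt_trans tT.
 have: (4*D+16*B) * t'<=C2 * t' by rewrite ler_wpM2r ?(ltW t'0)// /C2; lra.
 have -> : C2 * t' = t/2 by rewrite /t'; field; lra.
 lra.
apply: (le_trans step).
have T1: cnt N (Mx N (TT k N f)) (t/2)<=8*D*c*N%:R.
 have t2: 0<t/2 by lra.
 have h1:=cnt_weak N (TT k N f) t2.
 have h2: \sum_(0<=i<N) `|TT k N f i| <= D*(c * t)*N%:R.
  by have := @HL 0%N N f (c * t) ct; rewrite subn0 => /(_ Hf).
 rewrite -(ler_pM2l t2); lra.
have T2: cnt N (Mx N (fun j => `|f j| `^ s)) (t' `^ s)<=8*C2*c*N%:R.
 have [cC|cC]:=leP 1 (2*C2*c).
  apply: (le_trans (cnt_le _ _ _)); rewrite -[leLHS]mul1r ler_wpM2r//; lra.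
 have ts: 0<t' `^ s by rewrite powR_gt0.
 have:=cnt_weak N (fun j => `|f j| `^ s) ts.
 rewrite (eq_bigr (fun j => `|f j| `^ s)) => [h|j _]; last by rewrite ger0_norm ?powR_ge0.
 have: (c * t)`^s<=2*C2*c * t' `^ s.
  have -> : c * t = 2*C2*c * t' by rewrite /t'; field; lra.
  rewrite powRM ?(ltW t'0)//; last by rewrite mulr_ge0 ?(ltW c0)//; lra.
  rewrite ler_pM2r//; apply: ge1r_powR => //.
  by rewrite (ltW cC) andbT !mulr_gt0//; lra.
 move=> h2; rewrite -(ler_pM2l ts); apply: (le_trans h).
 have:=ler_wpM2r (ler0n R N) h2; lra.
have:=lerD T1 T2; rewrite /C2 => h; apply: (le_trans h).
by le_of_eq; ring.
Qed.

Lemma ndistC i j: ndist i j = ndist j i.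
Proof. by rewrite /ndist addnC. Qed.

Lemma ndist_tri (a b c: nat) : (ndist a c<=ndist a b+ndist b c)%N.
Proof. by rewrite /ndist; lia. Qed.

(** Outside the window ([~~ b]) the kernel at [x] is compared with the kernel at a nearby point [z],
    truncated at [maxn q (3 * n)]. Beyond four times this radius regularity applies; closer, the two
    terms are at most [3/2] and [1] times [B] over the radius, while the Poisson kernel is at least
    [1/26] of its inverse, whence [65 = 26 * (3/2 + 1)]. *)
Lemma far_kernel k B x z i0 j n q (b: bool) : czk B k -> 0<=B -> (0<n)%N -> (0<q)%N ->
 (ndist x z<=n)%N -> (ndist i0 x<=n)%N ->
 (b -> (ndist x j<=3*n)%N) -> (~~ b -> (2*n<=ndist x j)%N) ->
 `|((q<=ndist x j)%N && ~~ b)%:R*k x j-(maxn q (3*n)<=ndist z j)%N%:R*k z j|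
 <= 65*B*poi (maxn q (3*n))%:R (i0%:R-j%:R).
Proof.
move=> [kN kb kreg] B0 n0 q0 xz i0x b1 b2.
set Q:=maxn q (3*n).
have [qQ nQ] : (q<=Q)%N /\ (3*n<=Q)%N by rewrite /Q leq_maxl leq_maxr.
have QE: Q = q \/ Q = (3*n)%N by rewrite /Q; case: (leqP q (3*n)) => h; [right|left].
have t1:=ndist_tri x z j; have t2:=ndist_tri i0 x j; have t3:=ndist_tri z x j.
rewrite (ndistC z x) in t3.
have Q0: (0<Q)%N by exact: leq_trans qQ.
have Qp: 0<Q%:R :> R by rewrite ltr0n.
have kinv a y: 0<a -> a<=(ndist y j)%:R -> `|k y j| <= B/a.
 move=> a0 ha; rewrite ler_pdivlMr//; apply: le_trans (kb y j).
 by rewrite ler_wpM2l// ndistE.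
have sqE y: (y%:R-j%:R)^+2 = (ndist y j)%:R^+2 :> R.
 by rewrite -ndistE real_normK ?num_real.
have dE: `|x%:R-z%:R| = (ndist x z)%:R :> R by rewrite ndistE.
have dE' : `|x%:R-j%:R| = (ndist x j)%:R :> R by rewrite ndistE.
have hreg:=kreg x z j; rewrite dE dE' sqE in hreg.
rewrite /poi sqE.
move: (ndist x j) (ndist z j) (ndist i0 j) (ndist x z) (ndist i0 x) (kinv ^~ x) (kinv ^~ z)
 hreg xz i0x b1 b2 t1 t2 t3 => dx dz di xz ix kx kz hreg hxz hix b1 b2 t1 t2 t3.
have nQr: 3*n%:R<=Q%:R :> R by rewrite -natrM ler_nat.
have hi: di%:R<=dx%:R+n%:R :> R.
 by rewrite -natrD ler_nat; move: t2 hix; clear; lia.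
have n0' : 0<=n%:R :> R by [].
have di0: 0<=di%:R :> R by [].
have dx0: 0<=dx%:R :> R by [].
have sp: 0<Q%:R^+2+di%:R^+2 :> R by rewrite ltr_wpDr ?sqr_ge0 ?exprn_gt0.
have [ff|nn]:=leqP (4*Q) dx.
 have i1: (q<=dx)%N by move: ff qQ; clear; lia.
 have i2: ~~ b by apply/negP => /b1; move: ff nQ Q0; clear; lia.
 have i3: (Q<=dz)%N by move: ff t1 hxz nQ; clear; lia.
 rewrite i1 i2 i3/= !mul1r.
 have ffr: 4*Q%:R<=dx%:R :> R by rewrite -natrM ler_nat.
 have h2: 2*xz%:R<=dx%:R :> R.
  by rewrite -natrM ler_nat; move: ff hxz nQ; clear; lia.
 have:=hreg h2.
 have xzr: xz%:R<=n%:R :> R by rewrite ler_nat.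
 have dx2: 0<dx%:R^+2 :> R by rewrite exprn_gt0//; lra.
 rewrite -ler_pdivlMr// => h3; apply: (le_trans h3).
 have s2: Q%:R^+2+di%:R^+2<=2*dx%:R^+2 :> R.
  by move: hi ffr nQr; move: (dx%:R: R) (di%:R: R) (Q%:R: R) (n%:R: R) di0 dx0 n0' Qp => *; nra.
 rewrite ler_pdivrMr //.
 have -> : 65*B*(Q%:R/(Q%:R^+2+di%:R^+2))*dx%:R^+2 =
  B*(Q%:R*(65*(dx%:R^+2/(Q%:R^+2+di%:R^+2)))) by ring.
 rewrite ler_wpM2l//; apply: (le_via (Q%:R*1)); first by rewrite mulr1; lra.
 rewrite ler_wpM2l ?(ltW Qp) //.
 have: 1/2<=dx%:R^+2/(Q%:R^+2+di%:R^+2) :> R by rewrite ler_pdivlMr//; lra.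
 lra.
have nnr: dx%:R<=4*Q%:R :> R by rewrite -natrM ler_nat ltnW.
have pb: 1/(26*Q%:R)<=Q%:R/(Q%:R^+2+di%:R^+2) :> R.
 rewrite ler_pdivlMr// mulrC mulrA mulr1 ler_pdivrMr; last lra.
 by move: nnr hi nQr; move: (dx%:R: R) (di%:R: R) (Q%:R: R) (n%:R: R) di0 dx0 n0' Qp => *; nra.
apply: (le_via (65*B*(1/(26*Q%:R)))); last first.
 by rewrite ler_wpM2l// mulr_ge0.
have -> : 65*B*(1/(26*Q%:R)) = 3/2*(B/Q%:R)+B/Q%:R.
 by field; rewrite gt_eqF.
have BQ: 0<=B/Q%:R by rewrite divr_ge0// ltW.
apply: (le_trans (ler_normB _ _)); apply: lerD.
 case: (boolP ((q<=dx)%N && ~~ b)) => [/andP[i1 i2]|_]; last first.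
  by rewrite mul0r normr0; lra.
 rewrite mul1r.
 have a0: 0<2/3*Q%:R :> R by lra.
 apply: (le_trans (kx _ a0 _)).
  have: (2*Q<=3*dx)%N.
  by have:=b2 i2; case: QE => -> h; [move: i1|move: h]; clear; lia.
  by rewrite -(ler_nat R) !natrM => ?; lra.
 by le_of_eq; field; rewrite gt_eqF.
case: leqP => hz; last by rewrite mul0r normr0.
by rewrite mul1r; apply: kz => //; rewrite ler_nat.
Qed.

(** At [z] every truncation is at most [t]. Moving from [z] to [x] costs a Poisson sum of [f], and
    [1040 = 65 * 8 * 2] is the factor that makes this cost at most another [t]. *)
Lemma far_part k B N f c t x z i0 n q (inJ: pred nat) : czk B k -> 0<=B ->
 1040*B*c<=1 -> 0<t -> (0<n)%N -> (0<q)%N -> (i0<N)%N -> (z<N)%N ->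
 Mx N f i0<=2*(c * t) -> Tmax k N f z<=t ->
 (ndist x z<=n)%N -> (ndist i0 x<=n)%N ->
 (forall j, (j<N)%N -> inJ j -> (ndist x j<=3*n)%N) ->
 (forall j, (j<N)%N -> ~~ inJ j -> (2*n<=ndist x j)%N) ->
 `|\sum_(0<=j<N) ((q<=ndist x j)%N && ~~ inJ j)%:R*(k x j*f j)| <= 2 * t.
Proof.
move=> kB B0 cB t0 n0 q0 i0N zN Mf zt xz ix J1 J2.
pose Q:=maxn q (3*n).
have Q0: (0<Q)%N by rewrite leq_max q0.
have Q1: 1<=Q%:R :> R by rewrite ler1n.
have -> : \sum_(0<=j<N) ((q<=ndist x j)%N && ~~ inJ j)%:R*(k x j*f j) =
  Tr k N Q f z + \sum_(0<=j<N) (((q<=ndist x j)%N && ~~ inJ j)%:R*k x j -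
  (Q<=ndist z j)%N%:R*k z j)*f j.
 by rewrite /Tr -big_split/=; apply: eq_bigr => j _; ring.
apply: (le_trans (ler_normD _ _)).
have -> : 2 * t = t+t by ring.
apply: lerD; first exact: le_trans (Tr_Tmax k f zN Q0) zt.
apply: (le_trans (ler_norm_sum _ _ _)).
apply: (le_via (65*B*(8*Mx N f i0))).
 apply: (le_via (\sum_(0<=j<N) 65*B*(poi Q%:R (i0%:R-j%:R) * `|f j|))).
  apply: ler_sum_nat => j /andP[_ jN]; rewrite normrM mulrA ler_wpM2r //.
  exact: (far_kernel kB B0 n0 q0 xz ix (J1 j jN) (J2 j jN)).
 rewrite -mulr_sumr ler_wpM2l ?mulr_ge0//; exact: poi_Mx.
have h: 65*B*(8*Mx N f i0)<=65*B*(8*(2*(c * t))).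
 by rewrite ler_wpM2l ?mulr_ge0// ler_wpM2l.
apply: (le_trans h).
have -> : 65*B*(8*(2*(c * t))) = (1040*B*c) * t by ring.
by rewrite ler_piMl// ltW.
Qed.

Lemma Tr_split k N q f x l' r' : (l'<=x)%N -> (x<r')%N -> (r'<=N)%N ->
 Tr k N q f x = Tr (kS l' k) (r'-l') q (fun j => f (j+l')%N) (x-l') +
  \sum_(0<=j<N) ((q<=ndist x j)%N && ~~ (l'<=j<r')%N)%:R*(k x j*f j).
Proof.
move=> lx xr rN.
have -> : Tr (kS l' k) (r'-l') q (fun j => f (j+l')%N) (x-l') =
  \sum_(0<=j<N) ((q<=ndist x j)%N && (l'<=j<r')%N)%:R*(k x j*f j).
 rewrite [RHS](@sum_split _ l' _ 0)//; last lia.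
 rewrite [X in _ = _+X](@sum_split _ r' _ l')//; last lia.
 rewrite [X in _ = X+_]sum_nat0 => [|j /andP[_ hj]]; last first.
  by rewrite (leqNgt l') hj andbF mul0r.
 rewrite [X in _ = _+(_+X)]sum_nat0 => [|j /andP[hj _]]; last first.
  by rewrite (ltnNge j) hj !andbF mul0r.
 rewrite add0r addr0 [RHS]sum_from /Tr.
 apply: eq_big_nat => j /andP[_ hj].
 have hj' : (l'<=j+l'<r')%N by lia.
 rewrite /kS subnK// hj' andbT; congr (_%:R*_).
 by rewrite /ndist; congr nat_of_bool; congr (_<=_)%N; lia.
rewrite /Tr -big_split/=; apply: eq_bigr => j _.
by case: (q<=ndist x j)%N; case: (l'<=j<r')%N => /=; rewrite ?mul0r ?mul1r ?addr0 ?add0r.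
Qed.

(** On one run, [f] is split at the run enlarged by twice its length on each side. The outer part
    contributes at most [2 * t] by comparison with the point [z] adjoining the run, so a value above
    [4 * t] forces the inner part above [2 * t], and [local_weak] counts such points in a window at
    most five times as long. A run that fills the grid has no outer part. *)
Lemma good_lambda_run k B s D N f c t l r: czk B k -> 0<=B -> LH k s D -> 0<=D ->
 1<=s -> 0<c -> 1040*B*c<=1 -> 0<t -> (l<r)%N -> (r<=N)%N ->
 (l = 0%N /\ r = N) \/ (exists z, [/\ (z<N)%N, z.+1 = l \/ z = r & Tmax k N f z<=t]) ->
 \sum_(l<=i<r) ((4 * t<Tmax k N f i) &&
  ~~ ((c * t)`^s<Mx N (fun j => `|f j| `^ s) i))%R%:R <=
 (40*D+128*B+8)*5*c*(r-l)%:R.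
Proof.
move=> kB B0 HL D0 s1 c0 cB t0 lr rN hz.
set V:=Mx N _; pose n:=(r-l)%N.
have ct: 0<c * t by rewrite mulr_gt0.
have n0: (0<n)%N by rewrite subn_gt0.
have [|/existsNP[i0]]:=pselect (forall i, (l<=i<r)%N -> (c * t)`^s<V i).
 move=> all; rewrite sum_nat0 => [|i /all ->]; last by rewrite andbF.
 by rewrite !mulr_ge0 ?(ltW c0)// !addr_ge0// mulr_ge0.
move/not_implyP => -[/andP[li0 i0r] /negP]; rewrite -leNgt => Vi0.
have i0N: (i0<N)%N by exact: leq_trans rN.
have Mf0:=Mx_powR s1 ct Vi0.
pose l':=(l-2*n)%N; pose r':=minn (r+2*n) N.
have [l'l rr' r'N] : [/\ (l'<=l)%N, (r<=r')%N & (r'<=N)%N].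
 by rewrite /l' /r' leq_subr geq_minr leq_min leq_addr rN.
have N'5: (r'-l'<=5*n)%N by rewrite /r' /l' /n; clear -lr rN; lia.
pose f' j:=f (j+l')%N.
have Hf' : \sum_(0<=j<r'-l') `|f' j| `^ s<=(c * t)`^s*(r'-l')%:R.
 have -> : \sum_(0<=j<r'-l') `|f' j| `^ s = \sum_(l'<=j<r') `|f j| `^ s.
  by rewrite [RHS]sum_from.
 have:=Mx_sum (fun j => `|f j| `^ s) (leq_trans l'l li0) (leq_trans i0r rr') r'N.
 under eq_bigr do rewrite ger0_norm ?powR_ge0 //.
 by move/le_trans; apply; rewrite ler_wpM2r.
have t20: 0<2 * t by lra.
have c20: 0<c/2 by lra.
have Hw: cnt (r'-l') (Tmax (kS l' k) (r'-l') f') (2 * t) <=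
  (40*D+128*B+8)*(c/2)*(r'-l')%:R.
 apply: (@local_weak (kS l' k) B s D (r'-l') f' (c/2) (2 * t)) => //.
 - exact: czk_shift.
 - exact: LH_shift.
 -  by rewrite (_: c/2*(2 * t) = c * t)//; field.
have far x q: (l<=x<r)%N -> (0<q)%N ->
  `|\sum_(0<=j<N) ((q<=ndist x j)%N && ~~ (l'<=j<r')%N)%:R*(k x j*f j)| <= 2 * t.
 move=> hx q0; case: hz => [[l0 rN']|[z [zN zlr zt]]].
  rewrite sum_nat0 ?normr0 ?(ltW t20)// => j jN.
  have -> : (l'<=j<r')%N by rewrite /l' /r' l0 rN' leq_min (leq_trans _ (leq_addr _ _)); case/andP: jN.
  by rewrite andbF mul0r.
 apply: (@far_part k B N f c t x z i0 n q (fun j => (l'<=j<r')%N)) => //.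
 - by move: hx zlr; rewrite /ndist /n; clear -lr; lia.
 - by move: hx li0 i0r; rewrite /ndist /n; clear; lia.
 - by move=> j jN; move: hx; rewrite /ndist /n /l' /r' /n; clear; lia.
 - by move=> j jN; move: hx; rewrite /ndist /n /l' /r' /n; move: jN; clear; lia.
have step x: (l<=x<r)%N ->
  ((4 * t<Tmax k N f x) && ~~ ((c * t)`^s<V x))%R%:R <=
  (2 * t<Tmax (kS l' k) (r'-l') f' (x-l'))%R%:R :> R.
 move=> hx; have [/=|//]:=ltP (4 * t) (Tmax k N f x).
 have [/= _ _|h1 h2 /=]:=ltP (2 * t) (Tmax (kS l' k) (r'-l') f' (x-l')).
  by rewrite lern1 leq_b1.
 exfalso; move: h2; apply/negP; rewrite -leNgt.
 apply/bigmax_leP; split => [|q _]; first lra.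
 have lx: (l'<=x)%N by apply: leq_trans l'l _; case/andP: hx.
 have xr: (x<r')%N by apply: leq_trans rr'; case/andP: hx.
 rewrite (@Tr_split _ _ _ _ _ l' r') //.
 apply: (le_trans (ler_normD _ _)).
 have -> : 4 * t = 2 * t+2 * t by ring.
 apply: lerD; last exact: far.
 by apply: le_trans h1; apply: Tr_Tmax => //; rewrite ltn_sub2r// (leq_ltn_trans lx).
apply: (le_trans (ler_sum_nat step)).
apply: (le_via (cnt (r'-l') (Tmax (kS l' k) (r'-l') f') (2 * t))).
 rewrite /cnt.
 have -> : \sum_(0<=i<r'-l') (2 * t<Tmax (kS l' k) (r'-l') f' i)%R%:R =
  \sum_(l'<=i<r') (2 * t<Tmax (kS l' k) (r'-l') f' (i-l'))%R%:R :> R.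
  by rewrite [RHS]sum_from; apply: eq_bigr => i _; rewrite addnK.
 rewrite [leRHS](@sum_split _ l)//; last exact: leq_trans (ltnW lr) rr'.
 rewrite [X in _<=_+X](@sum_split _ r)//; last exact: ltnW.
 by rewrite addrCA lerDl addr_ge0// sumr_ge0.
apply: (le_trans Hw).
rewrite -[_*5*c*_](_: (40*D+128*B+8)*c*(5*n%:R) = _); last by rewrite /n; ring.
have Z0: 0<=(40*D+128*B+8)*c by rewrite mulr_ge0 ?(ltW c0)// !addr_ge0// mulr_ge0.
have -> : (40*D+128*B+8)*(c/2)*(r'-l')%:R =
 (40*D+128*B+8)*c*(1/2*(r'-l')%:R) by field.
rewrite ler_wpM2l //.
have: (r'-l')%:R<=5*n%:R :> R by rewrite -natrM ler_nat.
have: 0<=n%:R :> R by [].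
lra.
Qed.

Lemma LH_strong B s D p: 0<=B -> 0<=D -> 1<=s -> s<p ->
 exists2 C: R, 0<C & forall k, czk B k -> LH k s D -> forall N f,
 \sum_(0<=i<N) Tmax k N f i`^p<=C * \sum_(0<=i<N) `|f i| `^ p.
Proof.
move=> B0 D0 s1 sp.
have p0: 0<p by lra.
have s0: 0<s by lra.
have [E E0 EE] : exists2 E, 0<E & E = (40*D+128*B+8)*5.
 by exists ((40*D+128*B+8)*5) => //; rewrite mulr_gt0// ltr_wpDl// addr_ge0// mulr_ge0.
(* The first bound serves the comparison in [far_part], the second the absorption in
   [good_lambda]. *)
pose c:=Num.min (1040*B+1)^-1 (4`^p*E*2)^-1.
have B1: 0<1040*B+1:=ltr_wpDl (mulr_ge0 (ler0n _ _) B0) ltr01.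
have F0: 0<4`^p*E*2 by rewrite mulr_gt0// mulr_gt0// powR_gt0.
have c0: 0<c by rewrite lt_min !invr_gt0 B1 F0.
have cB: 1040*B*c<=1.
 apply: (le_via (1040*B*(1040*B+1)^-1)).
  by apply: ler_wpM2l; [exact: mulr_ge0 (ler0n _ _) B0|rewrite ge_min lexx].
 by rewrite ler_pdivrMr//; lra.
have cE: 4`^p*(E*c)<=1/2.
 rewrite mulrA ler_pdivlMr// mulrAC mulrC.
 apply: (le_via ((4`^p*E*2)^-1*(4`^p*E*2))).
  by rewrite ler_wpM2r ?(ltW F0)// ge_min lexx orbT.
 by rewrite mulVf// gt_eqF.
have ps: 1<p/s by rewrite ltr_pdivlMr// mul1r.
have Ec0: 0<=E*c by rewrite mulr_ge0// ltW.
have [C1 C10 H1]:=good_lambda p0 Ec0 cE c0.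
have [C2 C20 H2]:=Mx_strong ps.
exists (C1*C2) => [|k kB HL N f]; first by rewrite mulr_gt0.
pose V i:=Mx N (fun j => `|f j| `^ s) i.
have V0 i: 0<=V i by exact: Mx_ge0.
apply: (le_trans (H1 N (Tmax k N f) (fun i => V i`^s^-1) (Tmax_ge0 k N f) _ _)).
- by move=> i; exact: powR_ge0.
- move=> t t0.
 have ct: 0<c * t by rewrite mulr_gt0.
 have VE i: (c * t<V i`^s^-1) = ((c * t)`^s<V i).
  apply/idP/idP => h.
  have := @gt0_ltr_powR _ s s0 (c * t) (V i`^s^-1).
  by rewrite !nnegrE powR_ge0 (ltW ct) => /(_ isT isT h); rewrite -powRrM mulVf ?gt_eqF// powRr1.
  have s'0: 0<s^-1 by rewrite invr_gt0.
  have := @gt0_ltr_powR _ s^-1 s'0 ((c * t)`^s) (V i).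
  by rewrite !nnegrE powR_ge0 V0 => /(_ isT isT h); rewrite -powRrM mulfV ?gt_eqF// powRr1// ltW.
 apply: (le_via (\sum_(0<=i<N) ((4 * t<Tmax k N f i) && ~~ ((c * t)`^s<V i))%R%:R
  + cnt N (fun i => V i`^s^-1) (c * t))).
  rewrite /cnt -big_split/=; apply: ler_sum => i _; rewrite VE.
  by case: (4 * t<_); case: (_`^s<_) => //=; rewrite ?addr0 ?add0r.
 rewrite lerD2r /cnt.
 apply: (@run_sum (fun i => t<Tmax k N f i)) => //.
  move=> i iN; rewrite -leNgt => h.
  by rewrite (_: 4 * t<_ = false) ?lern1//; apply/negbTE; rewrite -leNgt; lra.
 move=> l r lr rN hl hr; rewrite EE; apply: (good_lambda_run kB B0 HL D0 s1 c0 cB t0 lr rN).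
 case: hr => [rE|hr]; last first.
  have [rN'|rN']:=ltnP r N.
  by right; exists r; split => //; [right|rewrite leNgt].
  case: hl => [l0|hl]; first by left; split => //; apply/eqP; rewrite eqn_leq rN.
  have [l0|l0]:=posnP l; first by left; split => //; apply/eqP; rewrite eqn_leq rN.
  right; exists l.-1; split; [|by left; rewrite prednK|by rewrite leNgt].
  by rewrite (leq_trans _ rN)// prednK// ltnW.
 have [l0|l0]:=posnP l; first by left.
 case: hl => [l0'|hl]; first by rewrite l0' in l0.
 right; exists l.-1; split; [|by left; rewrite prednK|by rewrite leNgt].
 by rewrite (leq_trans _ rN)// prednK// ltnW.
rewrite -mulrA ler_pM2l //.
have -> : \sum_(0<=i<N) `|f i| `^ p = \sum_(0<=i<N) `| (`|f i| `^ s) | `^ (p/s).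
 apply: eq_bigr => i _; rewrite (ger0_norm (powR_ge0 _ _)) -powRrM mulrC divfK //.
 by rewrite gt_eqF.
apply: le_trans (H2 N _).
by apply: ler_sum => i _; rewrite -powRrM (mulrC s^-1).
Qed.

Lemma TT_Tmax k B N f i: czk B k -> (i<N)%N -> `|TT k N f i| <= Tmax k N f i.
Proof.
move=> [kN _ _] iN; rewrite (_: TT k N f i = Tr k N 1 f i); first exact: Tr_Tmax.
apply: eq_big_nat => j _; have [->|ij]:=eqVneq i j.
 by rewrite (_: k j j = 0) ?mul0r ?mulr0//; have:=kN j j; lra.
by rewrite (_: (0<ndist i j)%N) ?mul1r//; move: ij; rewrite /ndist; lia.
Qed.

Lemma LH_LB B s D q: 0<=B -> 0<=D -> 1<=s -> s<q ->
 exists2 C: R, 0<C & forall k, (forall l, czk B (kS l k)) -> LH k s D -> LB k q C.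
Proof.
move=> B0 D0 s1 sq; have [C C0 HC]:=LH_strong B0 D0 s1 sq.
have q0: 0<=q by lra.
exists C => // k kB HL l r f f1.
have [rl|lr]:=leqP r l.
 by rewrite big_geq// mulr_ge0// ltW.
have:=HC (kS l k) (kB l) (LH_shift l HL) (r-l)%N (fun j => f (j+l)%N).
set X:=\sum_(_<=_<_) Tmax _ _ _ _`^q => HX.
apply: (le_via X).
 rewrite sum_from; apply: ler_sum_nat => i /andP[_ ir].
 rewrite ge0_ler_powR ?nnegrE ?Tmax_ge0 //.
 by apply: le_trans (TT_Tmax _ (kB l) ir); rewrite sum_from.
apply: (le_trans HX); rewrite ler_wpM2l ?(ltW C0) //.
apply: (le_via (\sum_(0<=i<r-l) 1)).
 apply: ler_sum => i _; have <- : 1`^q = 1 :> R by rewrite powR1.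
 by rewrite ge0_ler_powR ?nnegrE.
by rewrite sumr_const_nat subn0.
Qed.

(** A bootstrap between two dual conditions: [LB] at 2 gives [LH] at 2, good-lambda gives [LB] at
    every exponent above 2, duality gives [LH] at an exponent [s] close to 1, and good-lambda once
    more gives L^p for [p > s]. *)
Theorem cz_strong B D p: 0<=B -> 0<=D -> 1<p -> exists2 C: R, 0<C &
 forall k, czk B k -> LB k 2 D -> forall N f,
 \sum_(0<=i<N) Tmax k N f i`^p<=C * \sum_(0<=i<N) `|f i| `^ p.
Proof.
move=> B0 D0 p1.
(* The bound [3/2] keeps the conjugate exponent [q] above 2, the other one keeps [s] below [p]. *)
pose s:=Num.min ((1+p)/2) (3/2).
have s1: 1<s by rewrite lt_min; apply/andP; split; lra.
have sp: s<p by apply: (@le_lt_trans _ _ ((1+p)/2)); [rewrite ge_min lexx|lra].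
have s32: s<=3/2 by rewrite ge_min lexx orbT.
pose q:=s/(s-1).
have q2: 2<q by rewrite /q ltr_pdivlMr; lra.
have sq: s^-1+q^-1 = 1 by rewrite /q; field; apply/andP; split; lra.
have [C1 C10 H1] := @LH_LB B 2 (1+D) q B0 (addr_ge0 ler01 D0) (ler1n _ 2) q2.
have [C2 C20 H2] := @LH_strong B s (1+C1) p B0 (addr_ge0 ler01 (ltW C10)) (ltW s1) sp.
exists C2 => // k kB HB N f; apply: H2 => //.
apply: (@LB_LH _ _ B s q) => //; try lra.
apply: H1; first by move=> l; exact: czk_shift.
by apply: (@LB_LH _ _ B 2 2) => //; lra.
Qed.

End GoodLambda.

(** * Discrete theorems with variable truncation radius *)

Section DiscreteTheorems.
Variable R: realType.
Implicit Types (f: nat -> R) (A: nat -> R) (P: R -> R).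

(** The conjugate Poisson kernel without its constant, a smooth truncation of [1/t] at scale [r]. It
    differs from the sharp truncation by a Poisson kernel ([cpoi_close]). *)
Definition cpoi (r t: R) : R:=t/(r^+2+t^+2).

Lemma cpoi_close (r t: R) (b: bool) : 0<r -> (b -> r <= `|t|) -> (~~ b -> `|t| <= r) ->
 `|cpoi r t-b%:R/t| <= poi r t.
Proof.
move=> r0 h1 h2.
have r2: 0<r^+2 by rewrite exprn_gt0.
have s0: 0<r^+2+t^+2 by rewrite ltr_wpDr ?sqr_ge0.
rewrite /cpoi /poi; case: b h1 h2 => h1 h2.
 have:=h1 isT => rt.
 have t0: t != 0 by rewrite -normr_gt0; lra.
 have -> : t/(r^+2+t^+2)-true%:R/t = - (r^+2/(t*(r^+2+t^+2))).
  by rewrite /=; field; rewrite t0 gt_eqF.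
 rewrite normrN normrM normfV (normrM t) (gtr0_norm r2) (gtr0_norm s0) invfM mulrA.
 rewrite ler_pM2r ?invr_gt0// ler_pdivrMr ?normr_gt0// expr2.
 by rewrite ler_pM2l.
rewrite mul0r subr0 normrM normfV (gtr0_norm s0) ler_pM2r ?invr_gt0 //.
exact: h2.
Qed.

Lemma cpoi_Tr (kap: nat -> nat -> R) (b: R) N f i r: (i<N)%N -> 1<=r ->
 (forall j, (j<N)%N -> `|kap i j| <= b) ->
 exists q, [/\ (0<q)%N & `|\sum_(0<=j<N) kap i j*cpoi r (i%:R-j%:R)*f j -
  Tr (fun i j => kap i j/(i%:R-j%:R)) N q f i| <= 8*b*Mx N f i].
Proof.
move=> iN r1 kb; exists (Num.truncn r).+1; split => //.
have r0: 0<r by lra.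
have b0: 0<=b by apply: le_trans (kb i iN).
rewrite /Tr -sumrB; apply: (le_trans (ler_norm_sum _ _ _)).
apply: (le_via (\sum_(0<=j<N) b*(poi r (i%:R-j%:R) * `|f j|))); last first.
 rewrite -mulr_sumr (_: 8*b*_ = b*(8*Mx N f i)); last by ring.
 by rewrite ler_wpM2l// poi_Mx.
apply: ler_sum_nat => j /andP[_ jN].
set q:=(Num.truncn r).+1.
have -> : kap i j*cpoi r (i%:R-j%:R)*f j -
  (q<=ndist i j)%N%:R*(kap i j/(i%:R-j%:R)*f j) =
  kap i j*((cpoi r (i%:R-j%:R)-(q<=ndist i j)%N%:R/(i%:R-j%:R))*f j).
 by ring.
rewrite normrM [X in _*X]normrM; apply: ler_pM; [by []|by rewrite mulr_ge0|exact: kb|].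
rewrite ler_wpM2r//; apply: cpoi_close => //.
 move=> h; rewrite ndistE; apply: (le_via q%:R); last by rewrite ler_nat.
 by rewrite ltW// truncnS_gt.
rewrite -ltnNge ltnS => h; rewrite ndistE; apply: (le_via (Num.truncn r)%:R).
 by rewrite ler_nat.
by rewrite truncn_le//; exact: ltW.
Qed.

Lemma powRD_le (a b p: R) : 0<=a -> 0<=b -> 0<=p ->
 (a+b)`^p<=2`^p*(a`^p+b`^p).
Proof.
move=> a0 b0 p0; wlog ab: a b a0 b0/a<=b.
 move=> H; have [ab|ba]:=leP a b; first exact: H.
 by rewrite addrC [X in _*X]addrC; apply: H => //; exact: ltW.
apply: (le_via ((2*b)`^p)).
 by rewrite ge0_ler_powR ?nnegrE ?addr_ge0 ?mulr_ge0//; lra.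
by rewrite powRM// ler_wpM2l ?powR_ge0// lerDr powR_ge0.
Qed.

(** The radius may depend on the point, so the estimate is one for the maximal truncation;
    [sup_select] will exploit this. The condition on [r] says that no truncation is finer than the
    grid. *)
Theorem discrete_singular L K p: 0<=L -> 0<=K -> 1<p -> exists2 C: R, 0<C &
 forall P A N f (r: nat -> R), smooth L K P -> lipseq L A -> (forall i, 1<=r i) ->
 \sum_(0<=i<N)
  `|\sum_(0<=j<N) P (dq A i j)*cpoi (r i) (i%:R-j%:R)*f j| `^ p <=
 C * \sum_(0<=i<N) `|f i| `^ p.
Proof.
move=> L0 K0 p1; have p0: 0<p by lra.
have [D D0 HD]:=kP0_local_l2 L0 K0.
have B0: 0<=4*K*(L+1) by rewrite !mulr_ge0// addr_ge0.
have [C1 C10 H1]:=cz_strong B0 (ltW D0) p1.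
have [C2 C20 H2]:=Mx_strong p1.
exists (2`^p*(C1+(8*K)`^p*C2)) => [|P A N f r PS AL r1].
 by rewrite mulr_gt0 ?powR_gt0// ltr_wpDr// mulr_ge0 ?powR_ge0// ltW.
have k0: `|0: R| <= K by rewrite normr0.
have kcz:=kP_czk L0 K0 PS AL k0.
have kLB: LB (kP P A 0) 2 D.
 move=> l' r' g g1; apply: le_trans (HD P A l' r' g PS AL g1).
 apply: ler_sum => i _; rewrite (powR_mulrn 2)// real_normK ?num_real //.
have Pb i j: `|P (dq A i j)| <= K.
 by have [h _ _]:=PS; apply: h; exact: dq_bound.
have key i: (i<N)%N ->
  `|\sum_(0<=j<N) P (dq A i j)*cpoi (r i) (i%:R-j%:R)*f j| `^ p <=
  2`^p*(Tmax (kP P A 0) N f i`^p+(8*K)`^p*Mx N f i`^p).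
 move=> iN.
 have [q [q0 hq]] := @cpoi_Tr (fun i j => P (dq A i j)) K N f i (r i) iN (r1 i) (fun j _ => Pb i j).
 have K8: 0<=8*K by rewrite mulr_ge0.
 rewrite -(powRM _ K8 (Mx_ge0 N f i)).
 apply: le_trans (powRD_le (Tmax_ge0 _ _ _ _) (mulr_ge0 K8 (Mx_ge0 N f i)) (ltW p0)).
 rewrite ge0_ler_powR ?nnegrE ?(ltW p0) //.
  by rewrite addr_ge0 ?Tmax_ge0// mulr_ge0// Mx_ge0.
 have:=Tr_Tmax (kP P A 0) f iN q0.
 have -> : Tr (kP P A 0) N q f i = Tr (fun i j => P (dq A i j)/(i%:R-j%:R)) N q f i.
  by apply: eq_bigr => j _; rewrite /kP subr0.
 move: hq; set X:=\sum_(_<=_<_) _; set T:=Tr _ _ _ _ _ => h1 h2.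
 rewrite -(subrK T X); apply: (le_trans (ler_normD _ _)); rewrite addrC.
 exact: lerD.
apply: (le_via (\sum_(0<=i<N)
  2`^p*(Tmax (kP P A 0) N f i`^p+(8*K)`^p*Mx N f i`^p))).
 by apply: ler_sum_nat => i /andP[_]; exact: key.
rewrite -mulr_sumr -[leRHS]mulrA ler_wpM2l ?powR_ge0// big_split/= -mulr_sumr.
have h1:=H1 _ kcz kLB N f; have:=ler_wpM2l (powR_ge0 (8*K) p) (H2 N f); lra.
Qed.

Theorem discrete_poisson p: 1<p -> exists2 C: R, 0<C &
 forall N f (r: nat -> R), (forall i, 1<=r i) ->
 \sum_(0<=i<N) `|\sum_(0<=j<N) poi (r i) (i%:R-j%:R)*f j| `^ p <=
 C * \sum_(0<=i<N) `|f i| `^ p.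
Proof.
move=> p1; have [C C0 HC]:=Mx_strong p1; have p0: 0<=p by lra.
exists (8`^p*C) => [|N f r r1]; first by rewrite mulr_gt0 ?powR_gt0.
apply: (le_via (\sum_(0<=i<N) 8`^p*Mx N f i`^p)).
 apply: ler_sum_nat => i /andP[_ iN]; rewrite -powRM ?Mx_ge0 //.
 rewrite ge0_ler_powR ?nnegrE ?mulr_ge0 ?Mx_ge0 //.
 apply: le_trans (poi_Mx f iN (r1 i)); apply: (le_trans (ler_norm_sum _ _ _)).
 apply: ler_sum => j _; rewrite normrM ger0_norm// ltW// poi_gt0 //.
 by have:=r1 i; lra.
by rewrite -mulr_sumr -[leRHS]mulrA ler_wpM2l ?powR_ge0.
Qed.

Lemma sum_norm_sqr (F: nat -> R) a b: (a<b)%N ->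
 (\sum_(a<=i<b) `|F i|)^+2<=(b-a)%:R * \sum_(a<=i<b) F i^+2.
Proof.
move=> ab; set S:=\sum_(_<=_<_) `|_|; set n:=(b-a)%:R.
have n0: 0<n :> R by rewrite ltr0n subn_gt0.
have: 0 <= \sum_(a<=i<b) (`|F i| - S/n)^+2 by apply: sumr_ge0 => i _; exact: sqr_ge0.
have -> : \sum_(a<=i<b) (`|F i| - S/n)^+2 =
  \sum_(a<=i<b) F i^+2-S^+2/n.
 under eq_bigr do rewrite sqrrB real_normK ?num_real// -mulr_natr.
 rewrite big_split/= sumrB -2!mulr_suml sumr_const_nat -mulr_natr -/n -/S.
 by field; rewrite gt_eqF.
by rewrite subr_ge0 ler_pdivrMr// mulrC.
Qed.

Lemma dq_Mx A c N i j: (i<N)%N -> (j<N)%N -> i != j ->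
 `|dq A i j-c| <= 2*Mx N (fun s => A s.+1-A s-c) i.
Proof.
set d:=fun s => _; move=> iN jN ij.
have S (u v: nat) : (u<v)%N -> dq A u v-c = (\sum_(u<=s<v) d s)/(v-u)%:R.
 move=> uv; have vu: 0<v%:R-u%:R :> R by rewrite subr_gt0 ltr_nat.
 rewrite /d sumrB sumr_const_nat telescope_nat ?(ltnW uv)// -[_ *+ _]mulr_natr natrB ?(ltnW uv) //.
 have uv0: u%:R-v%:R != 0 :> R by rewrite -opprB oppr_eq0 gt_eqF.
 by rewrite /dq; field; rewrite uv0 gt_eqF.
have M0:=Mx_ge0 N d i.
have [lt|]:=ltnP i j.
 rewrite S// normrM normfV (ger0_norm (ler0n _ _)) ler_pdivrMr ?ltr0n ?subn_gt0 //.
 apply: (le_trans (ler_norm_sum _ _ _)).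
 apply: (le_trans (Mx_sum d (leqnn i) lt (ltnW jN))).
 by rewrite ler_wpM2r//; lra.
rewrite leq_eqVlt eq_sym (negbTE ij)/= => ji.
rewrite dqC S// normrM normfV (ger0_norm (ler0n _ _)) ler_pdivrMr ?ltr0n ?subn_gt0 //.
apply: (le_via (\sum_(j<=s<i.+1) `|d s|)).
 rewrite big_nat_recr ?(ltnW ji)//=; apply: (le_trans (ler_norm_sum _ _ _)).
 by rewrite lerDl.
apply: (le_trans (Mx_sum d (ltnW ji) (ltnSn i) iN)).
rewrite mulrAC mulrC ler_wpM2r// -natrM ler_nat; move: ji; clear; lia.
Qed.

(** Cotlar's inequality for the constant function 1 and the kernel recentred at slope [c]. The local
    means are controlled by the oscillation of the increments about [c]; since [|d s| <= 2 * L], its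
    square is bounded by a multiple of [|d s|], and the maximal function enters only linearly. The
    regularity error decreases with [E]. *)
Lemma flat_Tr L K (E: nat) : 0<=L -> 0<=K -> (1<E)%N -> exists2 C: R, 0<C &
 forall P A c N i q, smooth L K P -> lipseq L A -> `|c| <= L -> (i<N)%N -> (0<q)%N ->
 Tr (kP P A (P c)) N q (fun=> 1) i^+2 <=
  3*Mx N (TT (kP P A (P c)) N (fun=> 1)) i^+2+C*Mx N (fun s => A s.+1-A s-c) i +
  3*(16*(4*K*(L+1))/E%:R)^+2.
Proof.
move=> L0 K0 E1; have [C C0 HC]:=kP_sum_l2 R.
have E0: (0<E)%N by exact: ltnW.
have Ep: 0<E%:R :> R by rewrite ltr0n.
exists (3*(2*E%:R)^+2*(C*K^+2*(2*L))+1).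
 by rewrite ltr_wpDl// !mulr_ge0 ?sqr_ge0 ?exprn_ge0 ?mulr_ge0 ?(ltW C0).
move=> P A c N i q PS AL cL iN q0; pose d s:=A s.+1-A s-c; rewrite -/d.
set k:=kP P A (P c).
have cK: `|P c| <= K by have [h _ _]:=PS; exact: h.
have kcz: czk (4*K*(L+1)) k:=kP_czk L0 K0 PS AL cK.
have B0: 0<=4*K*(L+1) by rewrite !mulr_ge0// addr_ge0.
have M0:=Mx_ge0 N d i.
pose W:=C*K^+2*(2*L)*Mx N d i.
have W0: 0<=W by rewrite /W !mulr_ge0 ?sqr_ge0 ?(ltW C0).
have d2 s: `|d s| <= 2*L.
 apply: (le_trans (ler_normB _ _)); have:=AL s.+1 s.
 by rewrite -(natr1 s) addrAC subrr add0r normr1 mulr1; lra.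
have HM a b: (a<=i)%N -> (i<b)%N -> (b<=N)%N ->
  \sum_(a<=i'<b) `|\sum_(a<=j<b) k i' j*1| <= Num.sqrt W*(b-a)%:R.
 move=> ai ib bN.
 have ab: (a<b)%N by exact: leq_ltn_trans ib.
 rewrite -[leLHS]ger0_norm ?sumr_ge0// -(@ger0_norm _ (_*(b-a)%:R)) ?mulr_ge0 ?sqrtr_ge0 //.
 rewrite -ler_sqr ?nnegrE// !real_normK ?num_real// exprMn sqr_sqrtr //.
 apply: (le_trans (sum_norm_sqr _ ab)).
 rewrite expr2 mulrA mulrC ler_wpM2r //.
 have f1: forall j: nat, `|(fun=> 1: R) j| <= 1 by move=> j; rewrite normr1.
 apply: (le_trans (HC L K P A c a b (fun=> 1) L0 K0 PS AL cL f1)).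
 have -> : W*(b-a)%:R = C*K^+2*(2*L*(Mx N d i*(b-a)%:R)).
  by rewrite /W; ring.
 rewrite ler_wpM2l ?mulr_ge0 ?sqr_ge0 ?(ltW C0) //.
 apply: (le_via (2*L * \sum_(a<=s<b) `|d s|)).
  rewrite mulr_sumr; apply: ler_sum => s _; rewrite -/(d s).
  by rewrite -[leLHS]real_normK ?num_real// expr2 ler_wpM2r.
 by rewrite ler_wpM2l ?mulr_ge0//; exact: Mx_sum.
have n1: (2*(q %/ E)<=q)%N by apply: leq_trans (leq_trunc_div q E); rewrite mulnC leq_mul2l E1 orbT.
have n2: (q<=E*(q %/ E).+1)%N by rewrite mulnC ltnW// ltn_ceil.
have:=cotlar kcz B0 (sqrtr_ge0 W) iN q0 n1 n2 HM.
have Mx1: Mx N (fun=> 1: R) i<=1.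
 apply: Mx_le => // a b ai ib bN; rewrite (eq_bigr (fun=> 1)) => [|j _]; last by rewrite normr1.
 by rewrite sumr_const_nat mul1r.
have Mx10:=Mx_ge0 N (fun=> 1: R) i.
have qE: (q %/ E)%:R/q%:R<=E%:R^-1 :> R.
 rewrite ler_pdivrMr ?ltr0n// mulrC ler_pdivlMr// -natrM ler_nat; exact: leq_trunc_div.
have qE0: 0<=(q %/ E)%:R/q%:R :> R by rewrite divr_ge0.
set T:=Tr _ _ _ _ _; set m:=Mx N (TT _ _ _) i; set w:=_%:R/_ in qE qE0 *.
have m0: 0<=m by exact: Mx_ge0.
have h1: 16*(4*K*(L+1))*w*Mx N (fun=> 1) i<=16*(4*K*(L+1))/E%:R.
 rewrite -mulrA ler_wpM2l ?(mulr_ge0 (ler0n R 16) B0) //.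
 by apply: le_trans qE; rewrite ler_piMr.
set e:=16*(4*K*(L+1))/E%:R in h1 *.
move=> h2; have h3: `|T| <= m+2*E%:R*Num.sqrt W+e by apply: (le_trans h2); rewrite lerD2l.
have h4: T^+2<=(m+2*E%:R*Num.sqrt W+e)^+2.
 rewrite -[leLHS]real_normK ?num_real// ler_sqr ?nnegrE//; exact: le_trans h3.
apply: (le_trans h4).
have h5: (2*E%:R*Num.sqrt W)^+2 = (2*E%:R)^+2*W by rewrite exprMn sqr_sqrtr.
set g:=2*E%:R*Num.sqrt W in h5 *.
have h6: (m+g+e)^+2<=3 * m^+2+3*g^+2+3*e^+2.
 by have:=sqr_ge0 (m-g); have:=sqr_ge0 (m-e); have:=sqr_ge0 (g-e); lra.
apply: (le_trans h6); rewrite lerD2r lerD2l h5 /W.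
by move: M0; lra.
Qed.

(** A nearly linear sequence has small maximal truncations: the price per point is an arbitrarily
    small [e], the rest being paid by the squared oscillation about [c]. This becomes almost
    everywhere convergence in [V_conv]. *)
Theorem discrete_flat L K e: 0<=L -> 0<=K -> 0<e -> exists2 C: R, 0<C &
 forall P A c N (r: nat -> R), smooth L K P -> lipseq L A -> `|c| <= L ->
 (forall i, 1<=r i) ->
 \sum_(0<=i<N)
  (\sum_(0<=j<N) (P (dq A i j)-P c)*cpoi (r i) (i%:R-j%:R))^+2 <=
 e*N%:R+C * \sum_(0<=s<N) (A s.+1-A s-c)^+2.
Proof.
move=> L0 K0 e0.
have [C0 C00 HC0]:=kP_sum_l2 R.
have [C2 C20 H2] := @Mx_strong R 2 (ltr1n _ 2).
pose B:=16*(4*K*(L+1)).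
have B0: 0<=B by rewrite !mulr_ge0// addr_ge0.
(* Half of [e] pays for the regularity error of [flat_Tr]; the other half is used in [um] to turn
   the linear maximal term into a quadratic one. *)
have [E E1 HE] : exists2 E: nat, (1<E)%N & 6*(B/E%:R)^+2<=e/2.
 pose E:=(Num.truncn (12*(B+1)^+2/e)).+2; exists E => //.
 have Eg: 12*(B+1)^+2/e<=E%:R.
  by rewrite (le_trans (ltW (truncnS_gt _)))// ler_nat.
 have Ep: 1<=E%:R :> R by rewrite ler1n.
 move: Eg; rewrite ler_pdivrMr// => Eg.
 rewrite expr_div_n mulrA ler_pdivrMr; last by rewrite exprn_gt0//; lra.
 have h1: B^+2<=(B+1)^+2 by rewrite ler_sqr ?nnegrE//; lra.
 have h2: E%:R<=E%:R^+2 :> R by rewrite expr2 ler_peMl//; lra.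
 have:=ler_wpM2l (ltW e0) h2; lra.
have [C1 C10 H1]:=flat_Tr L0 K0 E1.
pose C3:=6*C2*(C0*K^+2)+2*(16*K)^+2*C2+2*C1^+2/e*C2+1.
exists C3 => [|P A c N r PS AL cL r1].
 rewrite ltr_wpDl// !addr_ge0// !mulr_ge0 ?sqr_ge0 ?(ltW C20) ?(ltW C00) ?(ltW C10)// ?invr_ge0 ?(ltW e0) //.
set d:=fun s => A s.+1-A s-c.
set k:=kP P A (P c).
pose m i:=Mx N (TT k N (fun=> 1)) i.
pose u i:=Mx N d i.
have key i: (i<N)%N ->
  (\sum_(0<=j<N) (P (dq A i j)-P c)*cpoi (r i) (i%:R-j%:R))^+2 <=
  6 * m i^+2+2*(C1*u i)+e/2+2*(16*K)^+2*u i^+2.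
 move=> iN.
 have u0: 0<=u i by exact: Mx_ge0.
 have kb j: (j<N)%N -> `|(fun i j => if i == j then 0 else P (dq A i j)-P c) i j| <= K*(2*u i).
  move=> jN /=; case: eqVneq => [_|ij]; first by rewrite normr0 mulr_ge0// mulr_ge0.
  have [_ PL _]:=PS; apply: (le_trans (PL _ _ (dq_bound i j L0 AL) cL)).
  by rewrite ler_wpM2l//; exact: dq_Mx.
 have [q [q0 hq]] := @cpoi_Tr (fun i j => if i == j then 0 else P (dq A i j)-P c)
  _ N (fun=> 1) i (r i) iN (r1 i) kb.
 have Mx1: Mx N (fun=> 1: R) i<=1.
  apply: Mx_le => // a b ai ib bN; rewrite (eq_bigr (fun=> 1)) => [|j _]; last by rewrite normr1.
  by rewrite sumr_const_nat mul1r.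
 have:=H1 P A c N i q PS AL cL iN q0; rewrite -/d -/k -/(m i) -/(u i) -/B.
 have -> : Tr k N q (fun=> 1) i =
  Tr (fun i j => (if i == j then 0 else P (dq A i j)-P c)/(i%:R-j%:R)) N q (fun=> 1) i.
  apply: eq_bigr => j _; rewrite /k /kP; case: eqVneq => [->|//].
  by rewrite subrr invr0 !mulr0.
 have -> : \sum_(0<=j<N) (P (dq A i j)-P c)*cpoi (r i) (i%:R-j%:R) =
  \sum_(0<=j<N) (if i == j then 0 else P (dq A i j)-P c)*cpoi (r i) (i%:R-j%:R)*1.
  apply: eq_bigr => j _; rewrite mulr1; case: eqVneq => [->|//].
  by rewrite subrr /cpoi mul0r !mulr0.
 move: hq => /=; set T:=Tr _ _ _ _ _; set X:=\sum_(_<=_<_) _ => hq hT.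
 have hq' : `|X-T| <= 16*K*u i.
  apply: (le_trans hq).
  have -> : 16*K*u i = 8*(K*(2*u i))*1 by ring.
  by rewrite ler_wpM2l// !mulr_ge0.
 have hq2: (X-T)^+2<=(16*K)^+2*u i^+2.
  by rewrite -exprMn -[leLHS]real_normK ?num_real// ler_sqr ?nnegrE// mulr_ge0// mulr_ge0.
 have:=sqr_ge0 (X-2*T); move: HE hT hq2; lra.
have um (v: R) : 0<=v -> 2*(C1*v)<=e/2+2*C1^+2/e*v^+2.
 move=> v0; rewrite -subr_ge0.
 have -> : e/2+2*C1^+2/e*v^+2-2*(C1*v) =
  (e-2*C1*v)^+2/(2*e) by field; rewrite gt_eqF.
 by rewrite divr_ge0 ?sqr_ge0// mulr_ge0// ltW.
apply: (le_via (\sum_(0<=i<N) (e+(6 * m i^+2 +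
  (2*(16*K)^+2+2*C1^+2/e)*u i^+2)))).
 apply: ler_sum_nat => i /andP[_ iN]; apply: (le_trans (key i iN)).
 have:=um (u i) (Mx_ge0 _ _ _); lra.
rewrite !big_split/= sumr_const_nat subn0 mulr_natr lerD2l -!mulr_sumr.
have sq (F: nat -> R) : \sum_(0<=i<N) Mx N F i^+2<=C2 * \sum_(0<=i<N) F i^+2.
 have:=H2 N F.
 rewrite (eq_bigr (fun i => Mx N F i^+2)) => [|i _]; last first.
  by rewrite (powR_mulrn 2)// Mx_ge0.
 rewrite [X in _<=_*X](eq_bigr (fun i => F i^+2))// => i _.
 by rewrite (powR_mulrn 2)// real_normK ?num_real.
have f1: forall j: nat, `|(fun=> 1: R) j| <= 1 by move=> j; rewrite normr1.
have hm:=sq (TT k N (fun=> 1)); have hu:=sq d.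
have ht:=HC0 L K P A c 0%N N (fun=> 1) L0 K0 PS AL cL f1.
rewrite -/d -/k in ht; move: hm hu; rewrite -/(m _) -/(u _).
set Sm:=\sum_(_<=_<_) m _^+2; set Su:=\sum_(_<=_<_) u _^+2.
set Sd:=\sum_(_<=_<_) d _^+2 in ht *; rewrite -/Sd => hm hu.
have Sd0: 0<=Sd by apply: sumr_ge0 => i _; exact: sqr_ge0.
have hm' : Sm<=C2*(C0*K^+2*Sd) by apply: (le_trans hm); rewrite ler_wpM2l// ltW.
have Z0: 0<=2*(16*K)^+2+2*C1^+2/e.
 apply: addr_ge0; first exact: mulr_ge0 (ler0n _ _) (sqr_ge0 _).
 by apply: divr_ge0 (ltW e0); exact: mulr_ge0 (ler0n _ _) (sqr_ge0 _).
have:=ler_wpM2l Z0 hu; rewrite /C3 -!(mulrA 2 (C1^+2)).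
move: (C1^+2/e) (16*K) (K^+2) hm' Sd0 => w K' K2.
by clear ht hm hu; clearbody Sm Su Sd; clear; lra.
Qed.

End DiscreteTheorems.

From mathcomp Require Import all_classical all_reals all_analysis.
From mathcomp Require Import measurable_realfun simple_functions measurable_fun_approximation.
Import numFieldNormedType.Exports.
Local Open Scope classical_set_scope.
Local Open Scope ring_scope.

Local Notation mfun T := (measurable_fun [set: T]).
Local Notation mcomp := measurableT_comp.
Local Notation mfunM := measurable_funM.
Local Notation mfunB := measurable_funB.
Local Notation mfunD := measurable_funD.
Local Notation mfunX := measurable_funX.
Local Notation mfunN := measurable_funN.
Local Notation mfunTS := measurable_funTS.
Local Notation mpair := measurable_fun_pair.
Local Notation mEFinP := measurable_EFinP.
Local Notation mcst := measurable_cst.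
Local Notation mnorm := (measurableT_comp (@normr_measurable _ _)).
Local Notation msqrt := (measurableT_comp (continuous_measurable_fun (@sqrt_continuous _))).
Local Notation Lpi p f := (\int[lebesgue_measure]_y (`|f y| `^ p)%:E)%E.

(** * Affine changes of variable and tiling of integrals *)

Section Affine.
Context {R: realType}.
Local Notation mu:=(@lebesgue_measure R).

Lemma m_affine (c b: R) : mfun R (fun x => c*x+b).
Proof. by apply: mfunD => //; apply: mfunM. Qed.

Lemma lebesgue_affine (c b: R) (A: set R) : c != 0 -> measurable A ->
 mu A = (`|c|%:E*pushforward mu (fun x: R => (c*x+b)%R: measurableTypeR R) A)%E.
Proof.
move=> c0 mA.
have mf: mfun R (fun x: R => c*x+b: measurableTypeR R) by exact: m_affine.
pose k: {nonneg R}:=NngNum (normr_ge0 c).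
rewrite (_: (_*_)%E = mscale k (pushforward mu (fun x: R => c*x+b: measurableTypeR R)) A) //.
apply: (@lebesgue_measure_unique R (mscale k (pushforward mu (fun x: R => c*x+b: measurableTypeR R)))) => //.
move=> _ [[u v]] _ <- /=; rewrite /mscale /= /pushforward.
case: (ltgtP c 0) c0 => [c0|c0|->] // _.
- rewrite (_: _ @^-1` _ = `[(v-b)/c, (u-b)/c[%classic); last first.
  apply/seteqP; split => x /=; rewrite !in_itv /= => /andP[h1 h2].
  by rewrite ler_ndivrMr // ltr_ndivlMr // mulrC; apply/andP; split; lra.
  move: h1 h2; rewrite ler_ndivrMr // ltr_ndivlMr // mulrC => h1 h2.
  by apply/andP; split; lra.
 rewrite !lebesgue_measure_itv /= !lte_fin ltr_ndivlMr // mulrVK ?unitfE ?lt_eqF // ltrBlDr subrK.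
 case: ifP => _; last by rewrite mule0.
 rewrite -!EFinB -EFinM ltr0_norm //; congr (_%:E); field; by rewrite lt_eqF.
- rewrite (_: _ @^-1` _ = `](u-b)/c, (v-b)/c]%classic); last first.
  apply/seteqP; split => x /=; rewrite !in_itv /= => /andP[h1 h2].
  by rewrite ltr_pdivrMr // ler_pdivlMr // mulrC; apply/andP; split; lra.
  move: h1 h2; rewrite ltr_pdivrMr // ler_pdivlMr // mulrC => h1 h2.
  by apply/andP; split; lra.
 rewrite !lebesgue_measure_itv /= !lte_fin ltr_pdivlMr // mulrVK ?unitfE ?gt_eqF // ltrBlDr subrK.
 case: ifP => _; last by rewrite mule0.
 rewrite -!EFinB -EFinM gtr0_norm //; congr (_%:E); field; by rewrite gt_eqF.
Qed.

Lemma ge0_integral_affine (c b: R) (D: set R) (f: R -> \bar R) : c != 0 ->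
 measurable D -> measurable_fun D f -> (forall x, D x -> (0<=f x)%E) ->
 (\int[mu]_(x in D) f x =
  `|c|%:E * \int[mu]_(x in (fun x => c*x+b)%R @^-1` D) f (c*x+b)%R)%E.
Proof.
move=> c0 mD mf f0.
have mg: mfun R (fun x: R => c*x+b: measurableTypeR R) by exact: m_affine.
pose k: {nonneg R}:=NngNum (normr_ge0 c).
pose pm:=measure_function_pushforward__canonical__measure_function_Measure mu mg.
transitivity (\int[mscale k pm]_(x in D) f x)%E.
 by apply: eq_measure_integral => A mA AD; exact: lebesgue_affine.
rewrite ge0_integral_mscale //; congr (_*_)%E.
rewrite ge0_integral_pushforward //.
by move=> y /set_mem; exact: f0.
Qed.

(** Writes an integral as an integral over the offset of a grid, so that a discrete bound valid for
    every offset integrates to a continuous bound. *)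
Lemma integral_tile (a h: R) (n: nat) (f: R -> \bar R) : 0<=h ->
 mfun R f -> (forall x, (0<=f x)%E) ->
 (\int[mu]_(x in `[a, (a+n%:R*h)%R[) f x =
  \int[mu]_(x in `[0%R, h[) \sum_(0<=i<n) f (a+i%:R*h+x)%R)%E.
Proof.
move=> h0 mf f0.
rewrite ge0_integral_sum //; last first.
 move=> i; apply: mfunTS; apply: mcomp => //.
 by apply: mfunD.
elim: n => [|n IH].
 by rewrite mul0r addr0 set_itvco0 integral_set0 big_nil.
rewrite big_nat_recr //= -IH.
rewrite (_: `[a, a+n.+1%:R*h[ = `[a, a+n%:R*h[ `|` `[a+n%:R*h, a+n.+1%:R*h[)%classic; last first.
 have h1: a<=a+n%:R*h by rewrite lerDl mulr_ge0.
 have h2: a+n%:R*h<=a+n.+1%:R*h by rewrite lerD2l ler_wpM2r // ler_nat.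
 apply/seteqP; split => x /=; rewrite !in_itv /=; last by case=> /andP[? ?]; apply/andP; split; lra.
 by case/andP => x1 x2; case: (ltrP x (a+n%:R*h)) => x3; [left|right]; rewrite ?x1.
rewrite ge0_integral_setU //=.
- congr (_+_)%E.
 rewrite (@ge0_integral_affine 1 (a+n%:R*h)) ?oner_eq0 //.
  rewrite normr1 mul1e.
  rewrite (_: _ @^-1` _ = `[0, h[%classic); last first.
  rewrite -(natr1 n) mulrDl mul1r.
  by apply/seteqP; split => x /=; rewrite !in_itv /= => /andP[? ?]; apply/andP; split; lra.
  by apply: eq_integral => x _; rewrite mul1r addrC.
 exact: mfunTS.
- exact: mfunTS.
- apply/disj_setPS => x /= []; rewrite !in_itv /= => /andP[_ h1] /andP[h2 _]; lra.
Qed.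
End Affine.

Lemma m_comp2 d d1 d2 d3 (T: measurableType d) (T1: measurableType d1)
  (T2: measurableType d2) (T3: measurableType d3) (K: T1 -> T2 -> T3) (f: T -> T1) (g: T -> T2) :
 measurable_fun [set: T1*T2] (fun z => K z.1 z.2) ->
 mfun T f -> mfun T g ->
 mfun T (fun x => K (f x) (g x)).
Proof. by move=> mK mf mg; exact: (mcomp mK (mpair mf mg)). Qed.

(** * From Riemann sums to integrals *)

Section Basics.
Context {R: realType}.
Local Notation mu:=(@lebesgue_measure R).

Lemma cvg_powR_seq (p a: R) (u: nat -> R) : 0<p -> (forall n, 0<=u n) ->
 u n @[n --> \oo] --> a -> u n`^p @[n --> \oo] --> a`^p.
Proof.
move=> p0 u0 ua.
have a0: 0<=a by rewrite -(cvg_lim _ ua)//; apply: limr_ge; [apply/cvg_ex; exists a | near=> n].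
move: a0; rewrite le_eqVlt => /predU1P[/esym az|a0].
 rewrite az in ua *; rewrite powR0 ?gt_eqF //; apply/cvgrPdist_lt => e e0.
 have e1: 0<e`^p^-1 by rewrite powR_gt0.
 near=> n; rewrite sub0r normrN ger0_norm ?powR_ge0 //.
 have -> : e = (e`^p^-1)`^p by rewrite -powRrM mulVf ?gt_eqF // powRr1 // ltW.
 rewrite gt0_ltr_powR ?nnegrE ?powR_ge0 //; near: n.
 move/cvgrPdist_lt: ua => /(_ _ e1); apply: filterS => n.
 by rewrite sub0r normrN ger0_norm.
have upos: \forall n \near \oo, 0<u n.
 exact: (cvgr_gt a).
have -> : a`^p = expR (p*ln a) by rewrite /powR gt_eqF.
apply: (@cvg_trans _ ((fun n => expR (p*ln (u n))) @ \oo)).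
 apply: near_eq_cvg; near=> n; rewrite /powR gt_eqF //; near: n; exact: upos.
apply: (cvg_comp (fun n => p*ln (u n)) expR _ (@continuous_expR R _)).
by apply: cvgMr; exact: (cvg_comp u (@ln R) ua (continuous_ln a0)).
Unshelve. all: end_near.
Qed.

Lemma bounded_integrable (D: set R) (f: R -> R) (M: R) : measurable D -> (mu D < +oo)%E ->
 measurable_fun D f -> (forall x, D x -> `|f x| <= M) -> mu.-integrable D (EFin \o f).
Proof.
move=> mD Doo mf fM; apply: measurable_bounded_integrable => //.
exists M; split; first by rewrite num_real.
move=> y My x Dx /=; apply: le_trans (fM x Dx) (ltW My).
Qed.

Lemma mu_itv (a b: R) : a<=b -> mu `[a, b[ = (b-a)%:E.
Proof.
move=> ab; rewrite lebesgue_measure_itv /= lte_fin.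
by case: (ltrP a b) => h; rewrite -?EFinB //; congr (_%:E); lra.
Qed.

Lemma mu_itv_lty (a b: R) : (mu `[a, b[ < +oo)%E.
Proof. by rewrite lebesgue_measure_itv /=; case: ifP => _; rewrite -?EFinB ltry. Qed.

Lemma cell_error (a b L s: R) (f: R -> R) : a<=b -> 0<=L ->
 mfun R f -> s \in `[a, b[ ->
 (forall y z, y \in `[a, b[ -> z \in `[a, b[ -> `|f y-f z| <= L * `|y-z|) ->
 `|(b-a)*f s - \int[mu]_(y in `[a, b[) f y| <= L*(b-a)^+2.
Proof.
move=> ab L0 mf sI fL.
have mI: measurable (`[a, b[%classic: set R) by [].
have Ioo:=mu_itv_lty a b.
have i1 (g: R -> R) M: mfun R g -> (forall x, x \in `[a,b[ -> `|g x| <= M) ->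
  mu.-integrable `[a, b[ (EFin \o g).
 move=> mg gM; apply: (bounded_integrable (M:=M)) => //; exact: mfunTS.
have d1 y z: y \in `[a, b[ -> z \in `[a, b[ -> `|y-z| <= b-a.
 rewrite !in_itv /= => /andP[? ?] /andP[? ?].
 by rewrite ler_norml; apply/andP; split; lra.
have fM x: x \in `[a, b[ -> `|f x| <= `|f s| + L*(b-a).
 move=> xI; rewrite -lerBlDl; apply: le_trans (lerB_dist _ _) _.
 by apply: le_trans (fL _ _ xI sI) _; rewrite ler_wpM2l // d1.
have E1: (b-a)*f s = \int[mu]_(y in `[a, b[) f s.
 by rewrite Rintegral_cst //= mu_itv //= mulrC.
have m2: mfun R (fun y => f s-f y) by apply: mfunB.
have b2 x: x \in `[a, b[ -> `|f s-f x| <= L*(b-a).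
 by move=> xI; apply: le_trans (fL _ _ sI xI) _; rewrite ler_wpM2l // d1.
have ics c: mu.-integrable `[a, b[ (EFin \o (fun _: R => c)).
 by apply: (i1 _ `|c|).
rewrite E1 -RintegralB //; last first.
- by apply: i1 fM.
apply: le_trans (le_normr_Rintegral _ _) _ => //; first by apply: i1 b2.
apply: (le_via (\int[mu]_(y in `[a, b[) (L*(b-a)))).
 apply: le_Rintegral => //.
 - apply: (i1 _ (L*(b-a))); first exact: mcomp.
  by move=> x xI; rewrite normr_id; exact: b2.
by rewrite Rintegral_cst //= mu_itv //= -mulrA expr2.
Qed.

Lemma riemann_sum (a h L th: R) (n: nat) (f: R -> R) : 0<=h -> 0<=L ->
 mfun R f -> 0<=th<h ->
 (forall y z, y \in `[a, a+n%:R*h[ -> z \in `[a, a+n%:R*h[ -> `|f y-f z| <= L * `|y-z|) ->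
 `|h*(\sum_(0<=j<n) f (a+j%:R*h+th)) - \int[mu]_(y in `[a, a+n%:R*h[) f y|
  <= L*h*(n%:R*h).
Proof.
move=> h0 L0 mf /andP[th0 thh].
elim: n => [|n IH] fL.
 by rewrite mul0r addr0 set_itvco0 Rintegral_set0 big_nil !mulr0 subr0 normr0.
have En: n.+1%:R*h = n%:R*h+h :> R by rewrite -natr1 mulrDl mul1r.
have h1: 0<=n%:R*h by rewrite mulr_ge0.
have sub1 y: y \in `[a, a+n%:R*h[ -> y \in `[a, a+n.+1%:R*h[.
 by rewrite En !in_itv /= => /andP[? ?]; apply/andP; split; lra.
have sub2 y: y \in `[a+n%:R*h, a+n%:R*h+h[ -> y \in `[a, a+n.+1%:R*h[.
 by rewrite En !in_itv /= => /andP[? ?]; apply/andP; split; lra.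
have IHn:=IH (fun y z hy hz => fL y z (sub1 y hy) (sub1 z hz)).
have sI: a+n%:R*h+th \in `[a+n%:R*h, a+n%:R*h+h[.
 by rewrite in_itv /=; apply/andP; split; lra.
have hh: a+n%:R*h<=a+n%:R*h+h by lra.
have:=cell_error hh L0 mf sI (fun y z hy hz => fL y z (sub2 y hy) (sub2 z hz)).
rewrite (_: a+n%:R*h+h-(a+n%:R*h) = h); last by ring.
set X:=Rintegral _ _ _ => c1.
rewrite big_nat_recr //= mulrDr.
have -> : \int[mu]_(y in `[a, a+n.+1%:R*h[) f y = \int[mu]_(y in `[a, a+n%:R*h[) f y+X.
 rewrite -Rintegral_setU //.
 - congr (Rintegral _ _ _); rewrite En.
  move: h0 h1; clear; move: (n%:R*h) => u h0 h1.
  apply/seteqP; split => x /=; rewrite !in_itv /=; last by case=> /andP[? ?]; apply/andP; split; lra.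
  case/andP => x1 x2; case: (ltrP x (a+u)) => x3; [left|right]; rewrite ?x1 ?x3 //=; lra.
 - apply: (bounded_integrable (M:=`|f (a+n%:R*h+th)| + L*(n.+1%:R*h))) => //.
  + exact: measurableU.
  + apply: (@le_lt_trans _ _ (mu `[a, a+n.+1%:R*h[)); last exact: mu_itv_lty.
  apply: le_measure; rewrite ?inE //; first exact: measurableU.
  by move=> x [] ?; [exact: sub1|exact: sub2].
  + exact: mfunTS.
  + move=> x xU.
  have xI: x \in `[a, a+n.+1%:R*h[ by case: xU => /= ?; [apply: sub1|apply: sub2].
  rewrite -lerBlDl; apply: le_trans (lerB_dist _ _) _.
  apply: le_trans (fL _ _ xI (sub2 _ sI)) _; rewrite ler_wpM2l //.
  move: (sub2 _ sI) xI; rewrite !in_itv /= => /andP[? ?] /andP[? ?].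
  by rewrite ler_norml; apply/andP; split; lra.
 - apply/disj_setPS => x /= []; rewrite !in_itv /= => /andP[_ h1'] /andP[h2 _]; lra.
rewrite (_: _-_ = (h*(\sum_(0<=j<n) f (a+j%:R*h+th)) - \int[mu]_(y in `[a, a+n%:R*h[) f y)
  + (h*f (a+n%:R*h+th)-X)); last by ring.
apply: le_trans (ler_normD _ _) _.
apply: le_trans (lerD IHn c1) _.
by rewrite En mulrDr expr2 (mulrA L).
Qed.

(* Riemann sum over the points of [x+h Z] lying in [a, b[, h = (b-a)/l *)
Definition rsum (a b: R) (l: nat) (x: R) (f: R -> R) : R :=
 (b-a)/l%:R * \sum_(0<=d<l.*2.+1) f (x+(d%:R-l%:R)*((b-a)/l%:R)) *
  \1_(`[a, b[%classic) (x+(d%:R-l%:R)*((b-a)/l%:R)).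

Lemma m_rsum (a b: R) (l: nat) (K: R -> R -> R) :
 measurable_fun [set: R*R] (fun z => K z.1 z.2) ->
 mfun R (fun x => rsum a b l x (K x)).
Proof.
move=> mK; apply: mfunM => //; apply: measurable_sum => d.
have ms: mfun R (fun x => x+(d%:R-l%:R)*((b-a)/l%:R)) by exact: mfunD.
apply: mfunM.
 exact: m_comp2.
exact: (mcomp (measurable_indic (measurable_itv `[a, b[)) ms).
Qed.

Lemma rsum_grid (a b th: R) (l i: nat) (f: R -> R) : a<b -> (0<l)%N -> (i<l)%N ->
 0<=th<(b-a)/l%:R ->
 rsum a b l (a+i%:R*((b-a)/l%:R)+th) f =
 (b-a)/l%:R * \sum_(0<=j<l) f (a+j%:R*((b-a)/l%:R)+th).
Proof.
move=> ab l0 il /andP[th0 thh]; rewrite /rsum; congr (_*_).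
have l0' : 0<l%:R :> R by rewrite ltr0n.
set h:=(b-a)/l%:R in thh *.
have h0: 0<h by rewrite /h divr_gt0 // subr_gt0.
have Eb: b = a+l%:R*h by rewrite /h mulrC divfK ?gt_eqF //; lra.
have pt d: a+i%:R*h+th+(d%:R-l%:R)*h = a+(i%:R+d%:R-l%:R)*h+th by ring.
rewrite (big_cat_nat (n:=(l-i)%N)) //=; last by lia.
rewrite [X in X+_]big1_seq ?add0r; last first.
 move=> d /andP[_]; rewrite mem_index_iota => /andP[_ dl].
 rewrite pt indicE memNset ?mulr0 //= in_itv /= => /andP[+ _].
 have: i%:R+d%:R-l%:R <= -1 :> R.
  have: (i+d)%:R+1<=l%:R :> R by rewrite natr1 ler_nat; lia.
  by rewrite natrD; lra.
 by move=> h1 h2; have:=ler_wpM2r (ltW h0) h1; lra.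
rewrite (big_cat_nat (n:=(l-i+l)%N)) //=; [|lia|lia].
rewrite [X in _+X]big1_seq ?addr0; last first.
 move=> d /andP[_]; rewrite mem_index_iota => /andP[dl _].
 rewrite pt indicE memNset ?mulr0 //= in_itv /= => /andP[_ +].
 have: l%:R<=i%:R+d%:R-l%:R :> R.
  by rewrite lerBrDr -!natrD ler_nat; lia.
 by move=> h1 h2; have:=ler_wpM2r (ltW h0) h1; lra.
rewrite -{1}[(l-i)%N]add0n big_addn [(l-i+l)%N]addnC addnK.
apply: eq_big_nat => j /andP[_ jl].
have -> : a+i%:R*h+th+((j+(l-i))%:R-l%:R)*h = a+j%:R*h+th.
 by rewrite natrD natrB 1?ltnW //; ring.
rewrite indicE mem_set ?mulr1 //= in_itv /=.
have h1: 0<=j%:R*h by rewrite mulr_ge0 // ltW.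
have h2: j%:R*h+h<=l%:R*h.
 have: j.+1%:R*h<=l%:R*h by rewrite ler_pM2r // ler_nat.
 by rewrite -natr1 mulrDl mul1r.
by apply/andP; split; lra.
Qed.

Lemma grid_point (a b x: R) (l: nat) : a<b -> (0<l)%N -> x \in `[a, b[ ->
 exists i th, [/\ (i<l)%N, 0<=th<(b-a)/l%:R & x = a+i%:R*((b-a)/l%:R)+th].
Proof.
move=> ab l0; rewrite in_itv /= => /andP[ax xb].
have l0' : 0<l%:R :> R by rewrite ltr0n.
set h:=(b-a)/l%:R.
have h0: 0<h by rewrite /h divr_gt0 // subr_gt0.
have Eb: b = a+l%:R*h by rewrite /h mulrC divfK ?gt_eqF //; lra.
have q0: 0<=(x-a)/h by apply: divr_ge0; [rewrite subr_ge0|exact: ltW].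
have:=Num.Theory.truncn_itv q0; set i:=Num.truncn _ => /andP[]; rewrite ler_pdivlMr // ltr_pdivrMr // => i1 i2.
exists i, (x-a-i%:R*h); split; last by ring.
 rewrite -(ltr_nat R) -(ltr_pM2r h0); lra.
by move: i2; rewrite -natr1 mulrDl mul1r => i2; apply/andP; split; lra.
Qed.

Lemma rsum_error (a b L x: R) (l: nat) (f: R -> R) : a<b -> (0<l)%N -> 0<=L ->
 mfun R f -> x \in `[a, b[ ->
 (forall y z, y \in `[a, b[ -> z \in `[a, b[ -> `|f y-f z| <= L * `|y-z|) ->
 `|rsum a b l x f - \int[mu]_(y in `[a, b[) f y| <= L*((b-a)/l%:R)*(b-a).
Proof.
move=> ab l0 L0 mf xI fL.
have [i [th [il th0 ->]]]:=grid_point ab l0 xI.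
rewrite rsum_grid //.
have l0' : 0<l%:R :> R by rewrite ltr0n.
have h0: 0<=(b-a)/l%:R by rewrite divr_ge0 ?ltW // subr_gt0.
have Eb: l%:R*((b-a)/l%:R) = b-a by rewrite mulrC divfK ?gt_eqF.
have := @riemann_sum a _ L th l f h0 L0 mf th0.
by rewrite Eb addrCA subrr addr0; apply.
Qed.

Lemma cvg_rsum (a b L x: R) (f: R -> R) : a<b -> 0<=L ->
 mfun R f -> x \in `[a, b[ ->
 (forall y z, y \in `[a, b[ -> z \in `[a, b[ -> `|f y-f z| <= L * `|y-z|) ->
 rsum a b n.+1 x f @[n --> \oo] --> \int[mu]_(y in `[a, b[) f y.
Proof.
move=> ab L0 mf xI fL; apply/subr_cvg0.
apply/norm_cvg0P.
apply: (@squeeze_cvgr _ _ _ _ (fun=> 0) (fun n => L*(b-a)*(b-a)*n.+1%:R^-1)).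
- near=> n; rewrite normr_ge0 /=; apply: le_trans (rsum_error _ _ L0 mf xI fL) _ => //.
 by le_of_eq; ring.
- exact: cvg_cst.
- rewrite -(mulr0 (L*(b-a)*(b-a))); apply: cvgMr; exact: cvg_harmonic.
Unshelve. all: end_near.
Qed.

(** Fatou's lemma along the meshes [(b-a)/n.+1]: the Riemann sums converge pointwise since [K x] is
    Lipschitz, and the discrete bound is integrated over the offset [th]. The majorant [B] may
    depend on the mesh, which lets difference quotients stand for a derivative in [flat_window]. *)
Lemma transfer (a b p: R) (K: R -> R -> R) (B: nat -> R -> \bar R) (beta: \bar R) :
 a<b -> 0<p ->
 measurable_fun [set: R*R] (fun z => K z.1 z.2) ->
 (forall x, exists2 L, 0<=L & forall y z, y \in `[a, b[ -> z \in `[a, b[ ->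
  `|K x y-K x z| <= L * `|y-z|) ->
 (forall n, mfun R (B n)) -> (forall n x, (0<=B n x)%E) ->
 (\forall n \near \oo, forall th, 0<=th<(b-a)/n.+1%:R ->
  (\sum_(0<=i<n.+1) (`|(b-a)/n.+1%:R * \sum_(0<=j<n.+1)
  K (a+i%:R*((b-a)/n.+1%:R)+th)
  (a+j%:R*((b-a)/n.+1%:R)+th)| `^ p)%:E
  <= \sum_(0<=i<n.+1) B n (a+i%:R*((b-a)/n.+1%:R)+th)%R)%E) ->
 (\int[mu]_(x in `[a, b[) B n x)%E @[n --> \oo] --> beta ->
 (\int[mu]_(x in `[a, b[) (`|\int[mu]_(y in `[a, b[) K x y| `^ p)%:E<=beta)%E.
Proof.
move=> ab p0 mK KL mB B0 Hd Bb.
pose G n x:=(`|rsum a b n.+1 x (K x)| `^ p)%:E.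
have mG n: mfun R (G n).
 apply/mEFinP; apply: (mcomp (measurable_powR p)).
 by apply: mnorm; exact: m_rsum.
have G0 n x: (0<=G n x)%E by rewrite lee_fin powR_ge0.
have mI: measurable (`[a, b[%classic: set R) by [].
have <- : (\int[mu]_(x in `[a, b[) limn_einf (G^~ x) =
  \int[mu]_(x in `[a, b[) (`|\int[mu]_(y in `[a, b[) K x y| `^ p)%:E)%E.
 apply: eq_integral => x /set_mem xI.
 have [L L0 Lx]:=KL x.
 have mKx: mfun R (K x).
  by apply: m_comp2.
 have cG: G n x @[n --> \oo] --> (`|\int[mu]_(y in `[a, b[) K x y| `^ p)%:E.
  apply: cvg_EFin; first by near=> n.
  rewrite /G /=; apply: cvg_powR_seq => //.
  apply: cvg_norm; exact: cvg_rsum Lx.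
 by have [->]:=cvg_limn_einf_sup cG.
apply: le_trans (fatou mu mI _ _) _.
- by move=> n; apply: mfunTS; exact: mG.
- by move=> n x _; exact: G0.
have <- := (cvg_limn_einf_sup Bb).1.
rewrite !limn_einf_lim; apply: lee_lim; [exact: is_cvg_einfs|exact: is_cvg_einfs|].
have [N _ HN]:=Hd.
near=> n; apply: le_ereal_inf_tmp => _ [m /= nm <-].
apply: (le_via (\int[mu]_(x in `[a, b[) G m x)%E); first by apply: ereal_inf_lbound; exists m.
have Nm: (N<=m)%N by apply: leq_trans nm; near: n; exact: nbhs_infty_ge.
have h0: 0<=(b-a)/m.+1%:R by rewrite divr_ge0 // subr_ge0 ltW.
have Eb: a+m.+1%:R*((b-a)/m.+1%:R) = b by rewrite mulrC divfK ?gt_eqF //; lra.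
rewrite -[X in `[a, X[]Eb !(integral_tile _ _ h0) //.
apply: ge0_le_integral => //.
- by move=> x _; apply: sume_ge0.
- apply: mfunTS; apply: emeasurable_sum => i.
 by apply: mcomp => //; apply: mfunD.
- apply: mfunTS; apply: emeasurable_sum => i.
 by apply: mcomp => //; apply: mfunD.
move=> th; rewrite /= in_itv /= => thI.
apply: le_trans (HN m Nm th thI); le_of_eq.
apply: eq_big_nat => i /andP[_ im]; rewrite /G rsum_grid //.
Unshelve. all: end_near.
Qed.
End Basics.

(** * Lipschitz estimates for the continuous kernels *)

Section Kernels.
Context {R: realType}.
Local Notation mu:=(@lebesgue_measure R).

Definition slp (A: R -> R) (x y: R) : R:=(A y-A x)/(y-x).

Definition lipr (L: R) (A: R -> R):=forall x y, `|A x-A y| <= L * `|x-y|.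

Lemma lipr_continuous L A: lipr L A -> continuous A.
Proof.
move=> AL x; apply/cvgrPdist_lt => e e0.
have L0: 0 < `|L| + 1 by rewrite ltr_wpDl.
near=> y; apply: le_lt_trans (AL x y) _.
apply: (@le_lt_trans _ _ ((`|L| + 1) * `|x-y|)).
 by rewrite ler_wpM2r // (le_trans (ler_norm L)) // lerDl.
rewrite mulrC -ltr_pdivlMr //; near: y.
have e1: 0<e/(`|L| + 1) by rewrite divr_gt0.
exact: (@cvgr_dist_lt _ _ _ _ _ id x cvg_id _ e1).
Unshelve. all: end_near.
Qed.

Lemma lipr_measurable L A: lipr L A -> mfun R A.
Proof. by move=> AL; apply: continuous_measurable_fun; exact: lipr_continuous AL. Qed.

Lemma slp_le L A x y: lipr L A -> 0<=L -> `|slp A x y| <= L.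
Proof.
move=> AL L0; rewrite /slp normrM normfV.
have [->|ne]:=eqVneq y x; first by rewrite !subrr normr0 mul0r.
by rewrite ler_pdivrMr ?normr_gt0 ?subr_eq0.
Qed.

Lemma m_inv: mfun R (@GRing.inv R).
Proof.
rewrite -(setvU [set 0]); apply/measurable_funU => //; first exact: measurableC.
split; last exact: measurable_fun_set1.
apply: open_continuous_measurable_fun; first by apply: closed_openC; exact: closed_eq.
by move=> x /set_mem /= /eqP x0; exact: inv_continuous.
Qed.

Lemma m_slp L A: lipr L A -> measurable_fun [set: R*R] (fun z => slp A z.1 z.2).
Proof.
move=> AL; have mA:=lipr_measurable AL.
apply: mfunM.
 by apply: mfunB; apply: mcomp.
apply: (mcomp m_inv).
exact: mfunB.
Qed.

Lemma cpoi_le (r t: R) : 0<r -> `|cpoi r t| <= `|t| / r^+2.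
Proof.
move=> r0; rewrite /cpoi normrM normfV ler_wpM2l // ger0_norm ?addr_ge0 ?sqr_ge0 //.
by rewrite lef_pV2 ?posrE ?ltr_pwDl ?exprn_gt0 ?sqr_ge0 // lerDl sqr_ge0.
Qed.

Lemma cpoi_le2 (r t: R) : 0<r -> `|cpoi r t| <= r^-1.
Proof.
move=> r0; rewrite /cpoi normrM normfV [X in X^-1]ger0_norm ?addr_ge0 ?sqr_ge0 //.
have D0: 0<r^+2+t^+2 by rewrite ltr_pwDl ?exprn_gt0 ?sqr_ge0.
rewrite ler_pdivrMr // mulrC ler_pdivlMr //.
rewrite -(real_normK (num_real t)); have:=sqr_ge0 (r - `|t|); have:=sqr_ge0 `|t|; nra.
Qed.

Lemma den_cs (r t u: R) :
 `|r^+2-t*u| <= Num.sqrt ((r^+2+t^+2)*(r^+2+u^+2)).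
Proof.
rewrite -sqrtr_sqr ler_wsqrtr //.
rewrite -subr_ge0 (_: _-_ = (r*(t+u))^+2); [exact: sqr_ge0|ring].
Qed.

Lemma cpoi_lip (r t u: R) : 0<r -> `|cpoi r t-cpoi r u| <= `|t-u| / r^+2.
Proof.
move=> r0; rewrite /cpoi.
have D0 s: 0<r^+2+s^+2 by rewrite ltr_pwDl ?exprn_gt0 ?sqr_ge0.
have r20: 0<r^+2 by rewrite exprn_gt0.
rewrite (_: _-_ = (t-u)*(r^+2-t*u)/((r^+2+t^+2)*(r^+2+u^+2))); last first.
 by field; rewrite !gt_eqF.
have DD: 0<(r^+2+t^+2)*(r^+2+u^+2) by rewrite mulr_gt0.
rewrite normrM normfV (ger0_norm (ltW DD)) normrM -mulrA ler_wpM2l //.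
rewrite ler_pdivrMr // [leRHS]mulrC ler_pdivlMr //.
apply: le_trans (ler_wpM2r (ltW r20) (den_cs r t u)) _.
move: DD; set X:=_*_ => DD.
rewrite -[leRHS](sqr_sqrtr (ltW DD)) [leRHS]expr2 ler_wpM2l ?sqrtr_ge0 //.
rewrite -(ger0_norm (ltW r20)) -sqrtr_sqr ler_wsqrtr // expr2.
by rewrite /X; apply: ler_pM; rewrite ?(ltW r20) ?lerDl ?sqr_ge0.
Qed.

Lemma poi_lip (r t u: R) : 0<r -> `|poi r t-poi r u| <= `|t-u| / r^+2.
Proof.
move=> r0; rewrite /poi.
have D0 s: 0<r^+2+s^+2 by rewrite ltr_pwDl ?exprn_gt0 ?sqr_ge0.
have r20: 0<r^+2 by rewrite exprn_gt0.
rewrite (_: _-_ = (u-t)*(r*(u+t))/((r^+2+t^+2)*(r^+2+u^+2))); last first.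
 by field; rewrite !gt_eqF.
have DD: 0<(r^+2+t^+2)*(r^+2+u^+2) by rewrite mulr_gt0.
rewrite normrM normfV (ger0_norm (ltW DD)) !normrM -mulrA distrC ler_wpM2l //.
rewrite ler_pdivrMr // [leRHS]mulrC ler_pdivlMr // (ger0_norm (ltW r0)).
have h: `|u+t| <= `|u| + `|t| by exact: ler_normD.
rewrite -(real_normK (num_real t)) -(real_normK (num_real u)).
have:=normr_ge0 t; have:=normr_ge0 u; move: `|t| `|u| `|u+t| h => x y z h y0 x0.
apply: (le_via (r*(y+x)*r^+2)).
 by rewrite ler_pM2r // ler_pM2l.
have:=sqr_ge0 (r-x); have:=sqr_ge0 (r-y); have:=sqr_ge0 (x*y).
have: 0<=r^+2*(r-x)^+2 by rewrite mulr_ge0 ?sqr_ge0.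
have: 0<=r^+2*(r-y)^+2 by rewrite mulr_ge0 ?sqr_ge0.
nra.
Qed.

Lemma poi_bound (r t: R) : 0<r -> `|poi r t| <= r^-1.
Proof.
move=> r0; have D0: 0<r^+2+t^+2 by rewrite ltr_pwDl ?exprn_gt0 ?sqr_ge0.
rewrite /poi normrM normfV (ger0_norm (ltW D0)) (ger0_norm (ltW r0)) ler_pdivrMr // mulrC ler_pdivlMr //.
by rewrite -expr2 lerDl sqr_ge0.
Qed.

(** The constant may depend on [x]: only the inner variable is sampled, and the radius of truncation
    varies with [x]. *)
Definition lipk (k: R -> R -> R):=forall x, exists2 L, 0<=L &
 (forall y z, `|k x y-k x z| <= L * `|y-z|) /\ (forall y, `|k x y| <= L).

Lemma lipk_singular L M (P: R -> R) (A: R -> R) (r: R -> R) :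
 0<=L -> (forall s, `|s| <= L -> `|P s| <= M) ->
 (forall s t, `|s| <= L -> `|t| <= L -> `|P s-P t| <= M * `|s-t|) ->
 lipr L A -> (forall x, 0<r x) ->
 lipk (fun x y => P (slp A x y)*cpoi (r x) (x-y)).
Proof.
move=> L0 PM PL AL r0 x.
have M0: 0<=M by apply: le_trans (normr_ge0 _) (PM 0 _); rewrite normr0.
have ri: 0<=(r x)^-1 by rewrite invr_ge0 ltW.
have r2: 0<=(r x^+2)^-1 by rewrite invr_ge0 exprn_ge0 ?ltW.
exists (M*(2*L+1)/r x^+2+M/r x).
 by rewrite addr_ge0 // mulr_ge0 // mulr_ge0 // addr_ge0 // mulr_ge0.
split=> [y z|y]; last first.
 rewrite normrM ler_wpDl ?mulr_ge0 ?addr_ge0 ?mulr_ge0 //.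
 by apply: ler_pM => //; [apply: PM; exact: slp_le|exact: cpoi_le2].
have sy:=slp_le x y AL L0; have sz:=slp_le x z AL L0.
rewrite (_: _-_ = (P (slp A x y)-P (slp A x z))*cpoi (r x) (x-y)
  + P (slp A x z)*(cpoi (r x) (x-y)-cpoi (r x) (x-z))); last by ring.
rewrite [leRHS]mulrDl ler_wpDr ?mulr_ge0 //.
apply: le_trans (ler_normD _ _) _.
rewrite (normrM (_-_) (cpoi _ _)) (normrM (P _)).
have E1 u: slp A x u*(u-x) = A u-A x.
 rewrite /slp; have [->|ne]:=eqVneq u x; first by rewrite !subrr mulr0.
 by rewrite divfK // subr_eq0.
have h1: `|slp A x y-slp A x z| * `|x-y| <= 2*L * `|y-z|.
 rewrite -normrM (_: _*_ = (A z-A y)+(y-z)*slp A x z); last first.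
  have:=E1 y; have:=E1 z; move=> e1 e2.
  rewrite (_: (_-_)*_ = slp A x z*(z-x)+slp A x z*(y-z)-slp A x y*(y-x)); last by ring.
  by rewrite e1 e2; ring.
 apply: le_trans (ler_normD _ _) _.
 have a1:=AL z y.
 have a2: `|(y-z)*slp A x z| <= `|y-z| * L by rewrite normrM ler_wpM2l.
 rewrite distrC in a1; rewrite distrC (distrC z) in a1 *; lra.
have h2:=cpoi_lip (x-y) (x-z) (r0 x).
rewrite (_: x-y-(x-z) = - (y-z)) ?normrN in h2; last by ring.
have h3: `|P (slp A x y)-P (slp A x z)| * `|cpoi (r x) (x-y)| <= M*(2*L)/r x^+2 * `|y-z|.
 apply: le_trans (ler_pM _ _ (PL _ _ sy sz) (cpoi_le _ (r0 x))) _ => //.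
 rewrite [leLHS](_: _ = M/r x^+2*(`|slp A x y-slp A x z| * `|x-y|)); last by ring.
 rewrite [leRHS](_: _ = M/r x^+2*(2*L * `|y-z|)); last by ring.
 by rewrite ler_wpM2l // mulr_ge0.
have h4: `|P (slp A x z)| * `|cpoi (r x) (x-y)-cpoi (r x) (x-z)| <= M*(`|y-z| / r x^+2).
 by apply: ler_pM => //; exact: PM.
apply: le_trans (lerD h3 h4) _.
by le_of_eq; ring.
Qed.

Lemma lipk_poisson (r: R -> R) : (forall x, 0<r x) -> lipk (fun x y => poi (r x) (x-y)).
Proof.
move=> r0 x.
have ri: 0<=(r x)^-1 by rewrite invr_ge0 ltW.
have r2: 0<=(r x^+2)^-1 by rewrite invr_ge0 exprn_ge0 ?ltW.
exists ((r x^+2)^-1+(r x)^-1); first exact: addr_ge0.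
split=> [y z|y]; last by apply: le_trans (poi_bound _ (r0 x)) _; rewrite lerDr.
apply: le_trans (poi_lip _ _ (r0 x)) _.
rewrite (_: x-y-(x-z) = - (y-z)) ?normrN; last by ring.
by rewrite mulrC ler_wpM2r // lerDl.
Qed.

Lemma window_lip (a b p C: R) (k: R -> R -> R) (f: R -> R) (Lf: R) :
 a<b -> 0<p -> 0<=C -> measurable_fun [set: R*R] (fun z => k z.1 z.2) -> lipk k ->
 lipr Lf f -> (forall x, `|f x| <= Lf) ->
 (\forall n \near \oo, forall th, 0<=th<(b-a)/n.+1%:R ->
  \sum_(0<=i<n.+1) `|(b-a)/n.+1%:R * \sum_(0<=j<n.+1)
  k (a+i%:R*((b-a)/n.+1%:R)+th)
  (a+j%:R*((b-a)/n.+1%:R)+th)*f (a+j%:R*((b-a)/n.+1%:R)+th)| `^ p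
  <= C * \sum_(0<=i<n.+1) `|f (a+i%:R*((b-a)/n.+1%:R)+th)%R| `^ p) ->
 (\int[mu]_(x in `[a, b[) (`|\int[mu]_(y in `[a, b[) (k x y*f y)| `^ p)%:E <=
  C%:E * \int[mu]_(x in `[a, b[) (`|f x| `^ p)%:E)%E.
Proof.
move=> ab p0 C0 mk kL fL fM Hd.
have mf:=lipr_measurable fL.
have mfp: mfun R (fun x => (`|f x| `^ p)%:E).
 apply/mEFinP; apply: (mcomp (measurable_powR p)).
 exact: mnorm.
have L0: 0<=Lf by apply: le_trans (fM 0).
apply: (@transfer _ a b p (fun x y => k x y*f y) (fun _ x => (C%:E*(`|f x| `^ p)%:E)%E)) => //.
- apply: mfunM => //; exact: mcomp.
- move=> x; have [M M0 [kL1 kM]]:=kL x.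
 exists (M*Lf+M*Lf); first by rewrite addr_ge0 // mulr_ge0.
 move=> y z _ _.
 rewrite (_: _-_ = (k x y-k x z)*f y+k x z*(f y-f z)); last by ring.
 apply: le_trans (ler_normD _ _) _; rewrite !normrM mulrDl lerD //.
  rewrite mulrAC; apply: ler_pM => //.
 rewrite -mulrA; apply: ler_pM => //.
- move=> n; apply: measurable_funeM => //.
- by move=> n x; rewrite -EFinM lee_fin mulr_ge0 // powR_ge0.
- apply: filterS Hd => n Hn th thI.
 rewrite sumEFin -ge0_sume_distrr; last by move=> i _; rewrite lee_fin powR_ge0.
 by rewrite sumEFin -EFinM lee_fin; exact: Hn.
rewrite ge0_integralZl_EFin //.
- exact: cvg_cst.
- exact: mfunTS.
Qed.
End Kernels.

Lemma ae_sub d (T: measurableType d) (R: realType) (m: {measure set T -> \bar R}) (P Q: T -> Prop) :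
 (forall x, P x -> Q x) -> {ae m, forall x, P x} -> {ae m, forall x, Q x}.
Proof. by move=> PQ; apply: negligibleS => x nQ /PQ. Qed.

(** * Bounds on bounded windows for Lipschitz functions *)

Section Window.
Context {R: realType}.
Local Notation mu:=(@lebesgue_measure R).

Lemma cpoi_scale (h r t: R) : 0<h -> h*cpoi r (h * t) = cpoi (r/h) t.
Proof.
move=> h0; rewrite /cpoi.
have [/eqP D0|D0]:=eqVneq ((r/h)^+2+t^+2) 0.
 move: D0; rewrite paddr_eq0 ?sqr_ge0 // !sqrf_eq0 => /andP[_ /eqP ->].
 by rewrite mulr0 !mul0r mulr0.
have hn: h != 0 by rewrite gt_eqF.
have E: r^+2+(h * t)^+2 = h^+2*((r/h)^+2+t^+2) by field.
rewrite E; move: D0; set D:=(r/h)^+2+t^+2; move: D => D D0.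
by field; rewrite D0 hn.
Qed.

Lemma poi_scale (h r t: R) : 0<h -> h*poi r (h * t) = poi (r/h) t.
Proof.
move=> h0; rewrite /poi.
have [/eqP D0|D0]:=eqVneq ((r/h)^+2+t^+2) 0.
 move: D0; rewrite paddr_eq0 ?sqr_ge0 // !sqrf_eq0 mulf_eq0 => /andP[+ _].
 by rewrite invr_eq0 (gt_eqF h0) orbF => /eqP ->; rewrite !mul0r mulr0.
have hn: h != 0 by rewrite gt_eqF.
have E: r^+2+(h * t)^+2 = h^+2*((r/h)^+2+t^+2) by field.
rewrite E; move: D0; set D:=(r/h)^+2+t^+2; move: D => D D0.
by field; rewrite D0 hn.
Qed.

Definition grid (a h th: R) (i: nat) : R:=a+i%:R*h+th.

Lemma gridB a h th i j: grid a h th i-grid a h th j = h*(i%:R-j%:R).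
Proof. by rewrite /grid; ring. Qed.

Lemma slp_grid (A: R -> R) a h th i j: h != 0 ->
 slp A (grid a h th i) (grid a h th j) = dq (fun i => A (grid a h th i)/h) i j.
Proof.
move=> h0; rewrite /slp /dq gridB -mulrBl invfM -mulrA.
rewrite -(opprB (A _)) mulNr -mulrN; congr (_*_); rewrite -mulrN -invrN opprB.
by [].
Qed.

Lemma lipseq_grid (A: R -> R) L a h th: 0<h -> lipr L A ->
 lipseq L (fun i => A (grid a h th i)/h).
Proof.
move=> h0 AL i j; rewrite -mulrBl normrM normfV (gtr0_norm h0) ler_pdivrMr //.
apply: le_trans (AL _ _) _.
by rewrite gridB normrM (gtr0_norm h0) -mulrA [h*_]mulrC.
Qed.

Lemma near_step (a b r0: R) : a<b -> 0<r0 ->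
 \forall n \near \oo, 0<(b-a)/n.+1%:R<=r0.
Proof.
move=> ab r00; have ab0: 0<b-a by rewrite subr_gt0.
near=> n; rewrite divr_gt0 //= ler_pdivrMr // mulrC -ler_pdivrMr //.
rewrite (le_via n%:R) ?ler_nat //; near: n; exact: nbhs_infty_ger.
Unshelve. all: end_near.
Qed.

(** Dividing [A] and [r] by the step [h] turns the grid into the integers without changing
    difference quotients or Lipschitz constants. A positive lower bound on [r] makes the rescaled
    radii at least 1 for fine meshes; the constant does not depend on it. *)
Lemma singular_window_lip (L K p: R) : 0<=L -> 0<=K -> 1<p ->
 exists2 C, 0<C & forall (P A f r: R -> R) (a b r0 Lf: R),
  smooth L K P -> lipr L A -> mfun R P -> mfun R r ->
  a<b -> 0<r0 -> (forall x, r0<=r x) -> lipr Lf f -> (forall x, `|f x| <= Lf) ->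
 (\int[mu]_(x in `[a, b[)
  (`|\int[mu]_(y in `[a, b[) (P (slp A x y)*cpoi (r x) (x-y)*f y)| `^ p)%:E <=
  C%:E * \int[mu]_(x in `[a, b[) (`|f x| `^ p)%:E)%E.
Proof.
move=> L0 K0 p1; have [C C0 HC]:=discrete_singular L0 K0 p1.
exists C => // P A f r a b r0 Lf sP AL mP mr ab r00 rr fL fM.
have p0: 0<p by exact: lt_trans p1.
have [P1 P2 P3]:=sP.
have rp x: 0<r x by exact: lt_le_trans (rr x).
apply: (window_lip (k:=fun x y => P (slp A x y)*cpoi (r x) (x-y)) (Lf:=Lf)) => //.
- exact: ltW.
- apply: mfunM.
  apply: (mcomp mP); exact: m_slp AL.
 apply: mfunM; first exact: mfunB.
 apply: (mcomp m_inv); apply: mfunD.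
  by apply: mfunX; exact: mcomp.
 by apply: mfunX; exact: mfunB.
- exact: (lipk_singular L0 P1 P2 AL rp).
have:=near_step ab r00; apply: filterS => n.
set h:=(b-a)/n.+1%:R => /andP[h0 hr] th thI.
pose g:=grid a h th.
have:=HC P (fun i => A (g i)/h) n.+1 (fun i => f (g i)) (fun i => r (g i)/h) sP (lipseq_grid _ _ h0 AL).
have r1 i: 1<=r (g i)/h by rewrite ler_pdivlMr // mul1r (le_trans hr).
move=> /(_ r1); apply: le_trans; le_of_eq.
apply: eq_big_nat => i _; congr (`|_| `^ _); rewrite mulr_sumr; apply: eq_big_nat => j _.
rewrite -slp_grid ?gt_eqF // -cpoi_scale // -(gridB a h th) /g /grid; ring.
Qed.

Lemma poisson_window_lip (p: R) : 1<p ->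
 exists2 C, 0<C & forall (f r: R -> R) (a b r0 Lf: R),
  mfun R r ->
  a<b -> 0<r0 -> (forall x, r0<=r x) -> lipr Lf f -> (forall x, `|f x| <= Lf) ->
 (\int[mu]_(x in `[a, b[)
  (`|\int[mu]_(y in `[a, b[) (poi (r x) (x-y)*f y)| `^ p)%:E <=
  C%:E * \int[mu]_(x in `[a, b[) (`|f x| `^ p)%:E)%E.
Proof.
move=> p1; have [C C0 HC]:=discrete_poisson p1.
exists C => // f r a b r0 Lf mr ab r00 rr fL fM.
have p0: 0<p by exact: lt_trans p1.
have rp x: 0<r x by exact: lt_le_trans (rr x).
apply: (window_lip (k:=fun x y => poi (r x) (x-y)) (Lf:=Lf)) => //.
- exact: ltW.
- apply: mfunM; first exact: mcomp.
 apply: (mcomp m_inv); apply: mfunD.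
  by apply: mfunX; exact: mcomp.
 by apply: mfunX; exact: mfunB.
- exact: lipk_poisson.
have:=near_step ab r00; apply: filterS => n.
set h:=(b-a)/n.+1%:R => /andP[h0 hr] th thI.
pose g:=grid a h th.
have:=HC n.+1 (fun i => f (g i)) (fun i => r (g i)/h).
have r1 i: 1<=r (g i)/h by rewrite ler_pdivlMr // mul1r (le_trans hr).
move=> /(_ r1); apply: le_trans; le_of_eq.
apply: eq_big_nat => i _; congr (`|_| `^ _); rewrite mulr_sumr; apply: eq_big_nat => j _.
rewrite -poi_scale // -(gridB a h th) /g /grid; ring.
Qed.

(* the derivative enters only through the difference quotients *)
Lemma flat_window (L K e: R) : 0<=L -> 0<=K -> 0<e ->
 exists2 C, 0<C & forall (P A r dA: R -> R) (a b r0 c: R),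
  smooth L K P -> lipr L A -> mfun R P -> mfun R r ->
  a<b -> 0<r0 -> (forall x, r0<=r x) -> `|c| <= L ->
  mfun R dA -> (forall x, `|dA x| <= L) ->
  {ae mu, forall x, slp A x (x+(b-a)/n.+1%:R) @[n --> \oo] --> dA x} ->
 (\int[mu]_(x in `[a, b[)
  ((\int[mu]_(y in `[a, b[) ((P (slp A x y)-P c)*cpoi (r x) (x-y)))^+2)%:E <=
  (e*(b-a))%:E+C%:E * \int[mu]_(x in `[a, b[) ((dA x-c)^+2)%:E)%E.
Proof.
move=> L0 K0 e0; have [C C0 HC]:=discrete_flat L0 K0 e0.
exists C => // P A r dA a b r0 c sP AL mP mr ab r00 rr cL mdA dAL aed.
have [P1 P2 P3]:=sP.
have rp x: 0<r x by exact: lt_le_trans (rr x).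
have mA:=lipr_measurable AL.
pose h n: R:=(b-a)/n.+1%:R.
have h0 n: 0<h n by rewrite divr_gt0 // subr_gt0.
pose B n x:=(e+C*(slp A x (x+h n)-c)^+2)%:E.
pose k x y:=(P (slp A x y)-P c)*cpoi (r x) (x-y).
have mI: measurable (`[a, b[%classic: set R) by [].
have msl n: mfun R (fun x => slp A x (x+h n)).
 apply: (m_comp2 (m_slp AL)) => //; exact: mfunD.
have mB n: mfun R (B n).
 apply/mEFinP; apply: mfunD => //; apply: mfunM => //.
 by apply: mfunX; exact: mfunB.
have B0 n x: (0<=B n x)%E by rewrite lee_fin addr_ge0 ?(ltW e0) // mulr_ge0 ?sqr_ge0 ?(ltW C0).
have := @transfer R a b 2 k B ((e*(b-a))%:E+C%:E * \int[mu]_(x in `[a, b[) ((dA x-c)^+2)%:E)%E ab.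
have -> : (\int[mu]_(x in `[a, b[) (`|\int[mu]_(y in `[a, b[) k x y| `^ 2)%:E)%E =
  (\int[mu]_(x in `[a, b[) ((\int[mu]_(y in `[a, b[) k x y)^+2)%:E)%E.
 by apply: eq_integral => x _; rewrite powR_mulrn // real_normK // num_real.
apply => //.
- apply: mfunM.
  apply: mfunB => //; apply: (mcomp mP); exact: m_slp AL.
 apply: mfunM; first exact: mfunB.
 apply: (mcomp m_inv); apply: mfunD.
  by apply: mfunX; exact: mcomp.
 by apply: mfunX; exact: mfunB.
- have Pb s: `|s| <= L -> `|P s-P c| <= 2*K.
  move=> sL; apply: le_trans (ler_normB _ _) _; have:=P1 s sL; have:=P1 c cL; lra.
 have Pl s t: `|s| <= L -> `|t| <= L -> `|P s-P c-(P t-P c)| <= 2*K * `|s-t|.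
  move=> sL tL; rewrite (_: _-_ = P s-P t); last by ring.
  apply: le_trans (P2 s t sL tL) _; rewrite -mulrA [leRHS]mulrDl ?mul1r.
  have:=mulr_ge0 K0 (normr_ge0 (s-t)); lra.
 move=> x; have [M M0 [kM _]]:=lipk_singular (P:=fun s => P s-P c) L0 Pb Pl AL rp x.
 by exists M => // y z _ _; exact: kM.
- have:=near_step ab r00; apply: filterS => n.
 rewrite -/(h n) => /andP[_ hr] th thI.
 pose g:=grid a (h n) th.
 have:=HC P (fun i => A (g i)/h n) c n.+1 (fun i => r (g i)/h n) sP (lipseq_grid _ _ (h0 n) AL) cL.
 have r1 i: 1<=r (g i)/h n by rewrite ler_pdivlMr // mul1r (le_trans hr).
 move=> /(_ r1) HC1.
 rewrite !sumEFin lee_fin.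
 apply: le_trans (le_trans HC1 _); le_of_eq.
  apply: eq_big_nat => i _; rewrite powR_mulrn // real_normK ?num_real //; congr (_^+2).
  rewrite mulr_sumr; apply: eq_big_nat => j _.
  rewrite -slp_grid ?gt_eqF // -cpoi_scale // -(gridB a (h n) th) /k /g /grid; ring.
 rewrite big_split /= sumr_const_nat subn0 mulr_natr -mulr_sumr; congr (_+_*_).
 apply: eq_big_nat => i _; congr (_^+2); rewrite -mulrBl /slp.
 rewrite (_: g i.+1 = g i+h n); last by rewrite /g /grid -natr1; ring.
 by congr (_/_-_); rewrite /g /grid; ring.
have iB (D: R -> R) M: mfun R D -> (forall x, `|D x| <= M) ->
  mu.-integrable `[a, b[ (EFin \o D).
 move=> mD DM; apply: (bounded_integrable (M:=M)) => //; last exact: mfunTS.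
 exact: mu_itv_lty.
pose Bl x:=e+C*(dA x-c)^+2.
have mBl: mfun R Bl.
 apply: mfunD => //; apply: mfunM => //.
 by apply: mfunX; exact: mfunB.
have sq s: `|s| <= L -> `|e+C*(s-c)^+2| <= e+C*(2*L)^+2.
 move=> sL; rewrite ger0_norm; last by apply: addr_ge0; [exact: ltW|apply: mulr_ge0; [exact: ltW|exact: sqr_ge0]].
 rewrite lerD2l ler_pM2l //.
 move: sL cL; rewrite !ler_norml => /andP[s1 s2] /andP[c1 c2].
 by rewrite -subr_ge0 subr_sqr mulr_ge0 //; lra.
have E1: (\int[mu]_(x in `[a, b[) (Bl x)%:E)%E =
  ((e*(b-a))%:E+C%:E * \int[mu]_(x in `[a, b[) ((dA x-c)^+2)%:E)%E.
 have -> : (\int[mu]_(x in `[a, b[) (Bl x)%:E = \int[mu]_(x in `[a, b[) (e%:E+C%:E*((dA x-c)^+2)%:E))%E.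
  by apply: eq_integral => x _; rewrite /Bl EFinD EFinM.
 have mq: mfun R (fun x => ((dA x-c)^+2)%:E).
  by apply/mEFinP; apply: mfunX; exact: mfunB.
 rewrite ge0_integralD //.
 - rewrite integral_cst // ge0_integralZl_EFin //.
  + by congr (_+_)%E; rewrite EFinM; congr (_*_)%E; rewrite -mu_itv ?ltW.
  + by move=> x _; rewrite lee_fin sqr_ge0.
  + exact: mfunTS.
  + exact: ltW.
 - by move=> x _; rewrite lee_fin ltW.
 - by move=> x _; rewrite -EFinM lee_fin mulr_ge0 ?sqr_ge0 // ltW.
 - by apply: mfunTS; apply: measurable_funeM.
rewrite -E1.
have := @dominated_convergence _ _ _ mu `[a, b[ mI B (EFin \o Bl) (cst (e+C*(2*L)^+2)%:E).
case=> //.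
- by move=> n; apply: mfunTS; exact: mB.
- by apply: mfunTS; apply/mEFinP.
- apply: ae_sub aed => x xd _; apply: cvg_EFin; first by near=> n.
 rewrite /comp /B /Bl /=; apply: cvgD; first exact: cvg_cst.
 apply: cvgMr; rewrite expr2; under eq_cvg do rewrite expr2.
 by apply: cvgM; apply: cvgB => //; exact: cvg_cst.
- by apply: (iB (fun=> _) `|e+C*(2*L)^+2|).
- apply: aeW => x n _; rewrite /B abse_EFin lee_fin; apply: sq; exact: slp_le.
Unshelve. all: end_near.
Qed.
End Window.

Lemma Rintegral_dominated d (T: measurableType d) (R: realType) (m: {measure set T -> \bar R})
  (D: set T) (fn: nat -> T -> R) (f g: T -> R) : measurable D ->
 (forall n, measurable_fun D (fn n)) -> measurable_fun D f ->
 m.-integrable D (EFin \o g) ->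
 {ae m, forall x, D x -> fn n x @[n --> \oo] --> f x} ->
 (forall n x, D x -> `|fn n x| <= g x) ->
 m.-integrable D (EFin \o f) /\
 \int[m]_(x in D) fn n x @[n --> \oo] --> \int[m]_(x in D) f x.
Proof.
move=> mD mfn mf ig cf dom.
have [] := @dominated_convergence _ _ _ m D mD (fun n => EFin \o fn n) (EFin \o f) (EFin \o g).
- by move=> n; apply/mEFinP.
- by apply/mEFinP.
- by apply: ae_sub cf => x cx Dx; apply: cvg_EFin; [near=> n|exact: cx].
- exact: ig.
- by apply: aeW => x n Dx; rewrite /= lee_fin; exact: dom.
move=> if' _ cI; split=> //; apply: fine_cvg.
rewrite /Rintegral fineK //; exact: integrable_fin_num.
Unshelve. all: end_near.
Qed.

(** * Differentiability almost everywhere on the line *)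

Section Diff.
Context {R: realType}.
Local Notation mu:=(@lebesgue_measure R).

Definition diffat (A: R -> R) (x d: R):=forall e, 0<e ->
 exists2 del, 0<del & forall y, `|y-x| < del -> y != x -> `|slp A x y-d| < e.

Lemma diffat_seq A x d (u: nat -> R) : diffat A x d -> u n @[n --> \oo] --> x ->
 (forall n, u n != x) -> slp A x (u n) @[n --> \oo] --> d.
Proof.
move=> dA ux ne; apply/cvgrPdist_lt => e /dA[del del0 H].
move/cvgrPdist_lt: ux => /(_ _ del0); apply: filterS => n; rewrite distrC => h.
by rewrite distrC; apply: H.
Qed.

Lemma cvg_step (x c: R) : x+c/n.+1%:R @[n --> \oo] --> x.
Proof.
rewrite -[X in _ --> X]addr0; apply: cvgD; first exact: cvg_cst.
by rewrite -(mulr0 c); apply: cvgMr; exact: cvg_harmonic.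
Qed.

Lemma diffat_step A x d c: c != 0 -> diffat A x d -> slp A x (x+c/n.+1%:R) @[n --> \oo] --> d.
Proof.
move=> c0 dA; apply: (diffat_seq dA); first exact: cvg_step.
move=> n; rewrite -subr_eq0 addrC addKr mulf_neq0 // invr_eq0 pnatr_eq0 //.
Qed.

Lemma derivable_diffat (A: R -> R) (x d: R) : derivable A x 1 -> derive1 A x = d -> diffat A x d.
Proof.
move=> dA dE e e0.
have: h^-1 *: ((A \o shift x) (h *: 1)-A x) @[h --> 0^'] --> 'D_1 A x by exact: dA.
move/cvgrPdist_lt => /(_ _ e0); rewrite -derive1E dE.
move=> /nbhs_ballP [del /= del0 H]; exists del => // y yx nyx.
have:=H (y-x); rewrite /ball /= sub0r normrN => /(_ yx).
rewrite subr_eq0 => /(_ nyx).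
by rewrite /slp distrC -[(y-x)%:A]/((y-x)*1) mulr1 subrK -[_ *: _]/(_*_) mulrC.
Qed.

Lemma diffat_near A B x d r c: 0<r -> (forall y, `|y-x| < r -> B y = A y+c) ->
 diffat A x d -> diffat B x d.
Proof.
move=> r0 AB dA e /dA[del del0 H]; exists (Num.min del r); first by rewrite lt_min del0.
move=> y; rewrite lt_min => /andP[y1 y2] yx.
rewrite /slp !AB //; last by rewrite subrr normr0.
rewrite (_: A y+c-_ = A y-A x); last by ring.
exact: H.
Qed.

Lemma lipr_le0 (L: R) (A: R -> R) : lipr L A -> 0<=L.
Proof.
move=> AL; have:=AL 1 0; rewrite subr0 normr1 mulr1; exact: le_trans.
Qed.

Lemma stieltjes_itv (f: cumulative R R) (a b: R) : a<=b ->
 lebesgue_stieltjes_measure f (`]a, b]%classic: set R) = (f b-f a)%:E.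
Proof.
move=> ab; rewrite /lebesgue_stieltjes_measure/= /measure_extension/= measurable_mu_extE //=; last by exists (a, b).
by rewrite wlength_itv_bnd.
Qed.

(** Both [A x + L * x] and [L * x - A x] are nondecreasing, and their Stieltjes measures add up to
    [2 * L] times Lebesgue measure. The first is therefore absolutely continuous, and its
    Radon-Nikodym density is its derivative almost everywhere by the fundamental theorem of
    calculus. *)
Lemma rn_lipschitz L (A: R -> R) (T: R) : lipr L A -> 0<T ->
 exists phi: R -> R, {ae mu, forall x, -T<x<T -> diffat A x (phi x-L)}.
Proof.
move=> AL T0; have L0:=lipr_le0 AL.
pose B1 x:=A x+L*x; pose B2 x:=L*x-A x.
have cA: continuous A by exact: lipr_continuous AL.
have nd1: {homo B1: x y/x<=y}.
 move=> x y xy; rewrite /B1; have:=AL x y; rewrite ler_norml (distrC x) => /andP[_ +].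
 by rewrite ger0_norm ?subr_ge0 //; lra.
have nd2: {homo B2: x y/x<=y}.
 move=> x y xy; rewrite /B2; have:=AL y x; rewrite ler_norml => /andP[_ +].
 by rewrite ger0_norm ?subr_ge0 //; lra.
have cL: continuous (fun x: R => L*x) by move=> x; apply: cvgMr; exact: cvg_id.
have rc1: right_continuous B1 by apply/right_continuousW => x; apply: cvgD; [exact: cA|exact: cL].
have rc2: right_continuous B2 by apply/right_continuousW => x; apply: cvgB; [exact: cL|exact: cA].
pose C1: cumulative R R:=HB.pack B1 (isCumulative.Build R _ R B1 nd1 rc1).
pose C2: cumulative R R:=HB.pack B2 (isCumulative.Build R _ R B2 nd2 rc2).
pose n1:=lebesgue_stieltjes_measure C1; pose n2:=lebesgue_stieltjes_measure C2.
have n1E a b: a<=b -> n1 (`]a, b]%classic: set R) = (B1 b-B1 a)%:E.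
 exact: stieltjes_itv.
have n2E a b: a<=b -> n2 (`]a, b]%classic: set R) = (B2 b-B2 a)%:E.
 exact: stieltjes_itv.
pose k: {nonneg R}:=NngNum (mulr_ge0 (ler0n R 2) L0).
(* Both sides are identified with the Stieltjes measure of [2 * L * x] by their values on half-open
   intervals. *)
have E (X: set R) : measurable X -> mscale k mu X = (n1 X+n2 X)%E.
 move=> mX.
 have nd3: {homo (fun x => 2*L*x) : x y/x<=y}.
  by move=> x y xy; rewrite ler_wpM2l // mulr_ge0.
 have rc3: right_continuous (fun x => 2*L*x).
  by apply/right_continuousW => x; apply: cvgMr; exact: cvg_id.
 pose C3: cumulative R R:=HB.pack (fun x => 2*L*x) (isCumulative.Build R _ R _ nd3 rc3).
 have n3E a b: a<=b -> lebesgue_stieltjes_measure C3 (`]a, b]%classic: set R) = (2*L*b-2*L*a)%:E.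
  exact: stieltjes_itv.
 have n3E' (m: {measure set (measurableTypeR R) -> \bar R}) :
  (forall a b, a<=b -> m (`]a, b]%classic: set R) = (2*L*b-2*L*a)%:E) ->
  lebesgue_stieltjes_measure C3 X = m X.
  move=> mE; apply: lebesgue_stieltjes_measure_unique => // _ [[a b]] _ <- /=.
  have [ab|ab]:=leP a b; first by rewrite n3E // mE.
  by rewrite set_itv_ge ?measure0 // -leNgt bnd_simp ltW.
 rewrite -(n3E' (mscale k mu)).
  rewrite (n3E' (measure_add n1 n2)); first by rewrite /measure_add /= /msum /= !big_ord_recl big_ord0 adde0.
  move=> a b ab; rewrite /measure_add /= /msum /= !big_ord_recl big_ord0 adde0 /=.
  rewrite -/n1 -/n2; have:=n1E _ _ ab; have:=n2E _ _ ab; rewrite /n1 /n2 => -> ->.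
  rewrite -EFinD; congr (_%:E); rewrite /B1 /B2; ring.
 move=> a b ab; change (((2*L)%:E*mu (`]a, b]%classic: set R))%E = (2*L*b-2*L*a)%:E).
 rewrite lebesgue_measure_itv /= lte_fin.
 case: (ltrP a b) => h; first by rewrite -EFinB -EFinM; congr (_%:E); ring.
 by rewrite mule0 (_: a = b) ?subrr //; apply/eqP; rewrite eq_le ab h.
have dom1 (X: set R) : measurable X -> mu X = 0%E -> n1 X = 0%E.
 move=> mX X0; apply/eqP; rewrite eq_le measure_ge0 andbT.
 have:=E X mX; rewrite -[mscale k mu X]/((2*L)%:E*mu X)%E X0 mule0 => H.
 apply: (le_via (n1 X+n2 X)%E); last by rewrite -H.
 by rewrite leeDl.
have mD: @measurable _ (measurableTypeR R) (`]- T, T]%classic) by exact: measurable_itv.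
have Doo: (n1 (`](- T)%R, T]%classic: set R) < +oo)%E by rewrite n1E ?ltry //; lra.
(* Restricting to []-T, T]] makes the measure finite, so that its density is integrable. *)
pose nu: {finite_measure set (measurableTypeR R) -> \bar R}:=mfrestr mD Doo.
have numu: nu `<< mu.
 apply/null_content_dominatesP => X mX X0; rewrite /nu /= /mfrestr /mrestr.
 apply: dom1; first exact: measurableI.
 apply/eqP; rewrite eq_le measure_ge0 andbT -X0.
 apply: (@le_measure _ _ _ mu); [apply/mem_set; exact: measurableI|exact/mem_set|exact: subIsetl].
pose f:=Radon_Nikodym_SigmaFinite.f nu mu.
have ff: mu.-integrable [set: R] f by exact: Radon_Nikodym_SigmaFinite.f_integrable.
have fE x: f x = (fine (f x))%:E.
 by rewrite fineK //; exact: Radon_Nikodym_SigmaFinite.f_fin_num.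
have iphi: mu.-integrable [set: R] (EFin \o (fine \o f)).
 by apply: eq_integrable ff => // x _ /=; rewrite -fE.
exists (fine \o f).
have ifD (D: set R) : measurable D -> mu.-integrable D (EFin \o (fine \o f)).
 by move=> mDD; apply: integrableS iphi.
have loc: locally_integrable [set: R] (fine \o f).
 split; [by move/integrableP: iphi => [/mEFinP]|exact: openT|].
 move=> K _ cK; have mK: measurable K by exact: compact_measurable.
 by have /integrableP[]:=ifD K mK.
have := @FTC1 R (fine \o f) (BRight (- T)) (fun y => ifD _ (measurable_itv _)) loc.
apply: ae_sub => x H /andP[Tx xT].
have [dF FE]:=H Tx.
have dd:=derivable_diffat dF FE.
have r0: 0<Num.min (x+T) (T-x) by rewrite lt_min; apply/andP; split; lra.
have FB y: `|y-x| < Num.min (x+T) (T-x) ->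
  B1 y = \int[mu]_(t in `]-T, y]) (fine \o f) t+B1 (- T).
 rewrite lt_min !ltr_norml => /andP[/andP[h1 h2] /andP[h3 h4]].
 rewrite /Rintegral; under eq_integral do rewrite /= -fE.
 rewrite -Radon_Nikodym_SigmaFinite.f_integral // /nu /= /mfrestr /mrestr.
 rewrite (_: _ `&` _ = `]-T, y]%classic); last first.
  apply/seteqP; split => z /=; rewrite !in_itv /=; first by case.
  by move=> /andP[z1 z2]; rewrite z1 z2 /=; split => //; lra.
 have Ty: -T<=y by lra.
 rewrite (stieltjes_itv C1 Ty) /=; lra.
have dB:=diffat_near r0 FB dd.
move=> e /dB[del del0 Hd]; exists del => // y yx nyx.
have -> : slp A x y-((fine \o f) x-L) = slp B1 x y-(fine \o f) x; last exact: Hd.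
rewrite /slp /B1; field; rewrite subr_eq0 //.
Qed.

Lemma lipr_diff (L: R) (A: R -> R) : lipr L A -> exists dA: R -> R,
 [/\ mfun R dA, (forall x, `|dA x| <= L) & {ae mu, forall x, diffat A x (dA x)}].
Proof.
move=> AL; have L0:=lipr_le0 AL.
pose s n x:=slp A x (x+1/n.+1%:R).
(* The upper limit of difference quotients is measurable even where no derivative exists. Clamping
   it makes the bound hold everywhere and changes nothing at points of differentiability. *)
pose D x:=Num.max (- L) (Num.min L (fine (limn_esup (fun n => (s n x)%:E)))).
have ms n: mfun R (s n).
 by apply: (m_comp2 (m_slp AL)) => //; exact: mfunD.
exists D; split.
- apply: measurable_maxr => //; apply: measurable_minr => //.
 apply: (mcomp (@fine_measurable R setT measurableT)).
 apply: measurable_fun_limn_esup => n; exact/mEFinP.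
- move=> x; rewrite ler_norml /D le_max lexx /= ge_max ge_min lexx andbT; lra.
have aeT: {ae mu, forall x (n: nat), - n.+1%:R<x<n.+1%:R -> exists d, diffat A x d}.
 apply: ae_foralln => n; have [phi]:=rn_lipschitz AL (ltr0Sn R n).
 by apply: ae_sub => x H /H ?; eexists; eassumption.
apply: ae_sub aeT => x H.
have [d dd] : exists d, diffat A x d.
 apply: (H (Num.trunc `|x|)); rewrite -ltr_norml.
 by have /andP[]:=truncn_itv (normr_ge0 x).
suff -> : D x = d by [].
have cs: s n x @[n --> \oo] --> d by apply: diffat_step dd; rewrite oner_eq0.
have dL: `|d| <= L.
 have sL n: `|s n x| <= L by exact: slp_le.
 rewrite ler_norml; apply/andP; split.
  rewrite -(cvg_lim (@Rhausdorff R) cs); apply: limr_ge; [apply/cvg_ex; exists d; exact: cs|near=> n]; by have:=sL n; rewrite ler_norml => /andP[].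
 rewrite -(cvg_lim (@Rhausdorff R) cs); apply: limr_le; [apply/cvg_ex; exists d; exact: cs|near=> n]; by have:=sL n; rewrite ler_norml => /andP[].
have ce: (s n x)%:E @[n --> \oo] --> d%:E by apply: cvg_EFin; [near=> n|].
rewrite /D (cvg_limn_einf_sup ce).2 /=.
move: dL; rewrite ler_norml => /andP[d1 d2].
by rewrite (min_idPr d2) (max_idPr d1).
Unshelve. all: end_near.
Qed.
End Diff.

Lemma m_Rintegral d1 d2 (T1: measurableType d1) (T2: measurableType d2) (R: realType)
  (m: {sigma_finite_measure set T2 -> \bar R}) (F: T1*T2 -> R) :
 measurable_fun [set: T1*T2] F -> mfun T1 (fun x => \int[m]_y F (x, y)).
Proof.
move=> mF; apply: (mcomp (@fine_measurable R setT measurableT)).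
have mE: measurable_fun [set: T1*T2] (EFin \o F) by apply/mEFinP.
rewrite (_: (fun x => _) = fun x => (\int[m]_y ((EFin \o F)^\+ (x, y)) - \int[m]_y ((EFin \o F)^\- (x, y)))%E).
 apply: emeasurable_funB.
 - apply: (measurable_fun_fubini_tonelli_F (EFin \o F)^\+%E) => //; exact: measurable_funepos.
 - apply: (measurable_fun_fubini_tonelli_F (EFin \o F)^\-%E) => //; exact: measurable_funeneg.
by apply/funext => x; rewrite integralE; congr (_-_)%E; apply: eq_integral => y _; rewrite ?funeposE ?funenegE.
Qed.

(** * Steklov averages and bounded functions *)

Section Steklov.
Context {R: realType}.
Local Notation mu:=(@lebesgue_measure R).

Lemma m_powabs d (T: measurableType d) (p: R) (f: T -> R) :
 mfun T f -> mfun T (fun x => (`|f x| `^ p)%:E).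
Proof.
move=> mf; apply/mEFinP; apply: (mcomp (measurable_powR p)).
exact: mnorm.
Qed.

Lemma integrable_supp (f: R -> R) (M a b: R) : a<=b -> mfun R f ->
 (forall x, `|f x| <= M) -> (forall x, x \notin `[a, b[ -> f x = 0) ->
 mu.-integrable [set: R] (EFin \o f).
Proof.
move=> ab mf fM f0.
have -> : EFin \o f = (EFin \o f) \_ `[a, b[.
 apply/funext => x; rewrite patchE; case: ifPn => //.
 by rewrite notin_setE /= => /negP/f0 ->.
rewrite -integrable_mkcond //.
apply: (bounded_integrable (M:=M)) => //; first exact: mu_itv_lty.
exact: mfunTS.
Qed.

(** The averages are difference quotients of the primitive [F] of [f]: Lipschitz and bounded by [M]
    because [F] is Lipschitz of constant [M], and convergent almost everywhere by the fundamental
    theorem. Steps at most 1 enlarge the support by at most 1. *)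
Lemma steklov (f: R -> R) (M a b: R) : a<b -> mfun R f ->
 (forall x, `|f x| <= M) -> (forall x, x \notin `[a, b[ -> f x = 0) ->
 exists fn: nat -> R -> R, [/\ forall n, exists2 Lf, lipr Lf (fn n) & (forall x, `|fn n x| <= Lf),
  forall n x, `|fn n x| <= M, forall n x, x \notin `[a-1, b[ -> fn n x = 0 &
  {ae mu, forall x, fn n x @[n --> \oo] --> f x}].
Proof.
move=> ab mf fM f0.
have M0: 0<=M by apply: le_trans (fM 0).
have intf:=integrable_supp (ltW ab) mf fM f0.
have ifD (D: set R) : measurable D -> mu.-integrable D (EFin \o f).
 by move=> mD; apply: integrableS intf.
pose F y:=\int[mu]_(t in `]-oo, y]) f t.
have FB x y: x<=y -> F y-F x = \int[mu]_(t in `]x, y]) f t.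
 move=> xy; rewrite /F -(@Rintegral_itvB _ _ -oo%O (BRight y) x) //; exact: ifD.
have muI x y: x<=y -> fine (mu (`]x, y]%classic: set R)) = y-x.
 by move=> xy; rewrite lebesgue_measure_itv /= lte_fin; case: (ltrP x y) => //= h; lra.
have Floc x y: x<=y -> `|F y-F x| <= M*(y-x).
 move=> xy; rewrite FB //; apply: le_trans (le_normr_Rintegral _ _) _ => //; first exact: ifD.
 rewrite -(muI _ _ xy) -Rintegral_cst //; apply: le_Rintegral => //.
 - have:=ifD _ (measurable_itv `]x, y]) => /integrable_norm; by [].
 - apply: (bounded_integrable (M:=`|M|)) => //.
  by rewrite lebesgue_measure_itv /=; case: ifP => _; rewrite -?EFinB ltry.
have FL: lipr M F.
 move=> x y; have [xy|/ltW xy]:=leP x y.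
  by rewrite distrC (distrC x) (ger0_norm (_: 0<=y-x)) ?subr_ge0 //; exact: Floc.
 by rewrite (ger0_norm (_: 0<=x-y)) ?subr_ge0 //; exact: Floc.
pose h n: R:=1/n.+1%:R.
have h0 n: 0<h n by rewrite divr_gt0.
pose fn n x:=slp F x (x+h n).
have fnE n x: fn n x = (F (x+h n)-F x)/h n by rewrite /fn /slp addrAC subrr add0r.
exists fn; split.
- move=> n; exists (2*M/h n+M) => [x y|x]; last first.
  apply: le_trans (slp_le _ _ FL M0) _; rewrite lerDr mulr_ge0 ?mulr_ge0 //.
  by rewrite invr_ge0 ltW.
 rewrite !fnE -mulrBl normrM normfV (gtr0_norm (h0 n)) mulrDl ler_wpDr ?mulr_ge0 //.
 rewrite mulrAC ler_wpM2r ?invr_ge0 ?(ltW (h0 n)) //.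
 rewrite (_: _-_ = (F (x+h n)-F (y+h n))-(F x-F y)); last by ring.
 apply: le_trans (ler_normB _ _) _.
 have:=FL (x+h n) (y+h n); rewrite (_: x+h n-(y+h n) = x-y); last by ring.
 have:=FL x y; lra.
- by move=> n x; exact: slp_le.
- move=> n x; rewrite in_itv /= negb_and -ltNge -leNgt => xo.
 have h1: h n<=1 by rewrite /h ler_pdivrMr // mul1r ler1n.
 rewrite fnE FB ?lerDl ?(ltW (h0 n)) //.
 rewrite (_: Rintegral _ _ _ = 0) ?mul0r //.
 rewrite (@eq_Rintegral _ _ _ mu _ (fun=> 0)); last first.
  move=> t /set_mem /=; rewrite in_itv /= => /andP[t1 t2]; apply: f0.
  rewrite in_itv /= negb_and -ltNge -leNgt; case/orP: xo => xo; apply/orP; [left|right]; lra.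
 by rewrite Rintegral_cst // mul0r.
- have loc: locally_integrable [set: R] f.
  by apply: open_integrable_locally => //; exact: openT.
 have := @FTC1Ny R f (fun y => ifD _ (measurable_itv _)) loc.
 apply: ae_sub => x [dF FE]; have dd:=derivable_diffat dF FE.
 by apply: diffat_step dd; rewrite oner_eq0.
Qed.

(** The right side passes to the limit of the Steklov averages by dominated convergence, the left
    side by Fatou's lemma. *)
Lemma window_bounded (a b p C: R) (k: R -> R -> R) :
 a<b -> 0<p -> 0<=C -> measurable_fun [set: R*R] (fun z => k z.1 z.2) -> lipk k ->
 (forall (f: R -> R) (Lf: R), lipr Lf f -> (forall x, `|f x| <= Lf) ->
 (\int[mu]_(x in `[a, b[) (`|\int[mu]_(y in `[a, b[) (k x y*f y)| `^ p)%:E <=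
  C%:E * \int[mu]_(x in `[a, b[) (`|f x| `^ p)%:E)%E) ->
 forall (f: R -> R) (M: R), mfun R f -> (forall x, `|f x| <= M) ->
 (\int[mu]_(x in `[a, b[) (`|\int[mu]_(y in `[a, b[) (k x y*f y)| `^ p)%:E <=
  C%:E * \int[mu]_(x in `[a, b[) (`|f x| `^ p)%:E)%E.
Proof.
move=> ab p0 C0 mk kL H f M mf fM.
pose I: set R:=`[a, b[%classic.
have mI: measurable I by exact: measurable_itv.
pose f1 x:=f x * \1_I x.
have f1E x: I x -> f1 x = f x by move=> Ix; rewrite /f1 indicE mem_set // mulr1.
have mf1: mfun R f1 by apply: mfunM => //; exact: measurable_indic.
have f1M x: `|f1 x| <= M.
 rewrite /f1 indicE normrM; case: (x \in I); rewrite ?normr1 ?mulr1 // normr0 mulr0.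
 by apply: le_trans (fM 0).
have f10 x: x \notin `[a, b[ -> f1 x = 0.
 by move=> xn; rewrite /f1 indicE memNset ?mulr0 //; exact/negP.
have [fn [fnL fnM fn0 fnc]]:=steklov ab mf1 f1M f10.
have mfn n: mfun R (fn n) by have [Lf lf _]:=fnL n; exact: lipr_measurable lf.
have mkx x: mfun R (k x) by apply: (m_comp2 mk).
have cI x: \int[mu]_(y in `[a, b[) (k x y*fn n y) @[n --> \oo] --> \int[mu]_(y in `[a, b[) (k x y*f y).
 have [L L0 [_ kM]]:=kL x.
 have [] := @Rintegral_dominated _ _ _ mu `[a, b[ (fun n y => k x y*fn n y) (fun y => k x y*f y)
  (cst (L*M)) mI => //.
 - by move=> n; apply: mfunTS; apply: mfunM; [exact: mkx|exact: mfn].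
 - by apply: mfunTS; apply: mfunM; [exact: mkx|].
 - apply: (bounded_integrable (M:=`|L*M|)) => //; exact: mu_itv_lty.
 - by apply: ae_sub fnc => y cy Iy; apply: cvgMr; rewrite -(f1E _ Iy).
 - by move=> n y _; rewrite normrM; apply: ler_pM.
have M0: 0<=M by apply: le_trans (fM 0).
have cR: (C%:E * \int[mu]_(x in `[a, b[) (`|fn n x| `^ p)%:E)%E @[n --> \oo] -->
  (C%:E * \int[mu]_(x in `[a, b[) (`|f x| `^ p)%:E)%E.
 apply: cvgeZl => //.
 have [] := @dominated_convergence _ _ _ mu I mI (fun n x => (`|fn n x| `^ p)%:E)
  (fun x => (`|f x| `^ p)%:E) (cst (M`^p)%:E) => //.
 - by move=> n; apply: mfunTS; apply: m_powabs; exact: mfn.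
 - by apply: mfunTS; apply: m_powabs.
 - apply: ae_sub fnc => y cy Iy; apply: cvg_EFin; first by near=> n.
  by rewrite -(f1E _ Iy); apply: cvg_powR_seq => //; exact: cvg_norm.
 - apply: (@bounded_integrable R I (fun=> M`^p) `|M`^p|) => //; exact: mu_itv_lty.
 - apply: aeW => x n _; rewrite abse_EFin lee_fin ger0_norm ?powR_ge0 //.
  by apply: ge0_ler_powR; rewrite ?nnegrE ?(ltW p0).
pose G n x:=(`|\int[mu]_(y in `[a, b[) (k x y*fn n y)| `^ p)%:E.
have GE x: limn_einf (G^~ x) = (`|\int[mu]_(y in `[a, b[) (k x y*f y)| `^ p)%:E.
 have cG: G n x @[n --> \oo] --> (`|\int[mu]_(y in `[a, b[) (k x y*f y)| `^ p)%:E.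
  apply: cvg_EFin; first by near=> n.
  by rewrite /G /=; apply: cvg_powR_seq => //; apply: cvg_norm; exact: cI.
 by have [->]:=cvg_limn_einf_sup cG.
under eq_integral do rewrite -GE.
apply: le_trans (fatou mu mI _ _) _.
- move=> n; rewrite /G; apply: mfunTS; apply: m_powabs.
 rewrite (_: (fun x => _) = fun x => \int[mu]_y (k x y*fn n y * \1_I y)).
  apply: (@m_Rintegral _ _ _ _ R mu (fun z: R*R => k z.1 z.2*fn n z.2 * \1_I z.2)).
  apply: mfunM; first by apply: mfunM => //; exact: mcomp.
  by apply: mcomp => //; exact: measurable_indic.
 apply/funext => x; rewrite Rintegral_mkcond; congr Rintegral; apply/funext => y.
 by rewrite patchE indicE; case: (y \in I); rewrite ?mulr1 ?mulr0.
- by move=> n x _; rewrite /G lee_fin powR_ge0.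
rewrite -(cvg_limn_einf_sup cR).1 !limn_einf_lim; apply: lee_lim; [exact: is_cvg_einfs|exact: is_cvg_einfs|].
near=> n; apply: le_ereal_inf_tmp => _ [m /= nm <-].
apply: (le_via (\int[mu]_(x in `[a, b[) G m x)%E); first by apply: ereal_inf_lbound; exists m.
have [Lm lm bm]:=fnL m; exact: H lm bm.
Unshelve. all: end_near.
Qed.
End Steklov.

(** * The whole line and suprema over radii *)

Section Maximal.
Context {R: realType}.
Local Notation mu:=(@lebesgue_measure R).

(** An enumeration, with repetitions, of the positive rationals. Suprema over radii become
    countable, hence measurable. *)
Definition qpos (n: nat) : R :=
 let ij:=odflt (0%N, 0%N) (unpickle n) in ij.1.+1%:R/ij.2.+1%:R.

Lemma qpos_gt0 n: 0<qpos n. Proof. by rewrite /qpos divr_gt0. Qed.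

Lemma qpos_dense (e d: R) : 0<e -> 0<d -> exists n, e<qpos n<e+d.
Proof.
move=> e0 d0.
pose j:=Num.trunc d^-1; pose i:=Num.trunc (e*j.+1%:R).
have j1: j.+1%:R^-1<d.
 have di: 0<=d^-1 by rewrite invr_ge0 ltW.
 by rewrite invf_plt ?posrE //; have /andP[]:=truncn_itv di.
have i1: 0<=e*j.+1%:R by rewrite mulr_ge0 // ltW.
have /andP[i2 i3]:=truncn_itv i1.
exists (pickle (i, j)); rewrite /qpos pickleK /=.
rewrite ltr_pdivlMr // i3 /= ltr_pdivrMr // mulrDl -natr1.
have: 1<d*j.+1%:R by move: j1; rewrite -[X in X<_]mul1r ltr_pdivrMr.
rewrite -/i in i2 *; lra.
Qed.

Lemma qpos_seq (e: R) : 0<e -> exists u: nat -> nat, qpos (u n) @[n --> \oo] --> e.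
Proof.
move=> e0.
have H n: exists k, e<qpos k<e+n.+1%:R^-1 by apply: qpos_dense.
exists (fun n => sval (cid (H n))).
apply: (@squeeze_cvgr _ _ _ _ (fun=> e) (fun n => e+n.+1%:R^-1)).
- by near=> n; case: cid => k /= /andP[h1 h2]; rewrite !ltW.
- exact: cvg_cst.
- rewrite -[X in _ --> X]addr0; apply: cvgD; first exact: cvg_cst.
 exact: cvg_harmonic.
Unshelve. all: end_near.
Qed.

Lemma cpoiB_le (e r t: R) : 0<e -> 0<r ->
 `|cpoi e t-cpoi r t| <= `|r^+2-e^+2| / (e*r)*poi r t.
Proof.
move=> e0 r0; rewrite /cpoi /poi.
have D1: 0<e^+2+t^+2 by rewrite ltr_pwDl ?exprn_gt0 ?sqr_ge0.
have D2: 0<r^+2+t^+2 by rewrite ltr_pwDl ?exprn_gt0 ?sqr_ge0.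
rewrite (_: _-_ = (r^+2-e^+2)*(t/(e^+2+t^+2))/(r^+2+t^+2)); last first.
 by field; rewrite !gt_eqF.
rewrite normrM normrM [X in _<=X](_: _ = `|r^+2-e^+2| * e^-1/(r^+2+t^+2)); last first.
 by field; rewrite !gt_eqF.
rewrite [`|(r^+2+t^+2)^-1|]gtr0_norm ?invr_gt0 // ler_pM2r ?invr_gt0 // ler_wpM2l //.
exact: cpoi_le2.
Qed.

Lemma poi_ge0 (r t: R) : 0<r -> 0<=poi r t.
Proof. by move=> r0; rewrite /poi divr_ge0 ?(ltW r0) // addr_ge0 ?sqr_ge0. Qed.

Lemma poi_comp (e q t: R) : 0<e -> e<=q<=2*e -> poi e t<=2*poi q t.
Proof.
move=> e0 /andP[eq q2]; have q0: 0<q by lra.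
have D1: 0<e^+2+t^+2 by rewrite ltr_pwDl ?exprn_gt0 ?sqr_ge0.
have D2: 0<q^+2+t^+2 by rewrite ltr_pwDl ?exprn_gt0 ?sqr_ge0.
rewrite /poi ler_pdivrMr // mulrA mulrAC ler_pdivlMr //.
have h1: e*q^+2<=2*q*e^+2.
 rewrite (_: e*q^+2 = (e*q)*q); last by ring.
 rewrite (_: 2*q*e^+2 = (e*q)*(2*e)); last by ring.
 by rewrite ler_pM2l // mulr_gt0.
have h2: e * t^+2<=2*q * t^+2 by rewrite ler_wpM2r ?sqr_ge0 //; lra.
by rewrite !mulrDr; lra.
Qed.

Lemma m_poi d (T: measurableType d) (r t: T -> R) : mfun T r ->
 mfun T t -> mfun T (fun x => poi (r x) (t x)).
Proof.
move=> mr mt; apply: mfunM => //.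
by apply: (mcomp m_inv); apply: mfunD; apply: mfunX.
Qed.

Lemma m_cpoi d (T: measurableType d) (r t: T -> R) : mfun T r ->
 mfun T t -> mfun T (fun x => cpoi (r x) (t x)).
Proof.
move=> mr mt; apply: mfunM => //.
by apply: (mcomp m_inv); apply: mfunD; apply: mfunX.
Qed.

Lemma poi1_lty (x: R) : (\int[mu]_y (poi 1 (x-y))%:E < +oo)%E.
Proof.
have mp: mfun R (fun y => (poi 1 y: R)%:E).
 by apply/mEFinP; apply: m_poi.
have p0 (y: R) : (0<=(poi 1 y)%:E)%E by rewrite lee_fin poi_ge0.
have <- : (\int[mu]_y (poi 1 y)%:E)%E = (\int[mu]_y (poi 1 (x-y))%:E)%E.
 rewrite (@ge0_integral_affine _ (-1) x) ?oppr_eq0 ?oner_eq0 // preimage_setT normrN1 mul1e.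
 by apply: eq_integral => y _; rewrite mulN1r addrC.
have h0: (\int[mu]_(y in `[0%R, +oo[) (poi 1 y)%:E < +oo)%E.
 rewrite (_: (fun y => _) = (fun y => ((oneDsqr y)^-1)%:E)); last first.
  by apply/funext => y; rewrite /poi /oneDsqr expr1n mul1r.
 by rewrite integral0y_oneDsqr ltry.
rewrite -(setUv `[0%R, +oo[) ge0_integral_setU //=; last 3 first.
- exact: measurableC.
- by rewrite setUv.
- exact/disj_setPCl.
rewrite lte_add_pinfty //.
apply: le_lt_trans h0.
rewrite [leRHS](@ge0_integral_affine _ (-1) 0) ?oppr_eq0 ?oner_eq0 //; last exact: mfunTS.
rewrite normrN1 mul1e.
rewrite [leRHS](_: _ = \int[mu]_(x0 in (fun x0 => (-1*x0+0)%R) @^-1` `[0%R, +oo[) (poi 1 x0)%:E)%E; last first.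
 by apply: eq_integral => y _; rewrite addr0 mulN1r /poi sqrrN.
apply: ge0_subset_integral => //.
- exact: measurableC.
- rewrite -[X in measurable X]setTI; exact: (@m_affine R (-1) 0).
- exact: mfunTS.
by move=> y /=; rewrite !in_itv /= !andbT addr0 mulN1r oppr_ge0 => /negP; rewrite -ltNge => /ltW.
Qed.

(* |f| <= 1 + |f|^p, so that the Poisson integral is finite everywhere *)
Lemma integrable_poi1 (p x: R) (f: R -> R) : 1<p -> mfun R f ->
 (Lpi p f < +oo)%E ->
 mu.-integrable [set: R] (fun y => (poi 1 (x-y) * `|f y|)%:E).
Proof.
move=> p1 mf foo.
have mxy: mfun R (fun y => x-y) by exact: mfunB.
have mp: mfun R (fun y => poi 1 (x-y)) by apply: m_poi.
have mn: mfun R (fun y => `|f y|) by exact: mnorm.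
apply/integrableP; split; first by apply/mEFinP; exact: mfunM.
apply: (@le_lt_trans _ _ (\int[mu]_y ((poi 1 (x-y))%:E+(`|f y| `^ p)%:E))%E).
 apply: ge0_le_integral => //.
 - by apply: mcomp => //; apply/mEFinP; exact: mfunM.
 - apply: emeasurable_funD; [exact/mEFinP|exact: m_powabs].
 move=> y _; rewrite abse_EFin -EFinD lee_fin ger0_norm; last first.
  by apply: mulr_ge0 => //; exact: poi_ge0.
 have P0 := @poi_ge0 1 (x-y) ltr01.
 have P1: poi 1 (x-y)<=1 by have:=poi_bound (x-y) (@ltr01 R); rewrite invr1 ger0_norm.
 have [f1|f1]:=leP `|f y| 1.
  by rewrite ler_wpDr ?powR_ge0 // -[leRHS]mulr1 ler_wpM2l.
 rewrite ler_wpDl // (le_via `|f y|) ?ler_piMl //.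
 by rewrite -[leLHS]powRr1 // ler_powR ?ltW.
rewrite ge0_integralD //; [|by move=> y _; rewrite lee_fin poi_ge0|exact/mEFinP|exact: m_powabs].
by rewrite lte_add_pinfty // poi1_lty.
Qed.

(** Windows exhaust the line while [f] is cut at growing heights. The inner integrals converge
    because the kernel is dominated by a Poisson kernel, against which every L^p function is
    integrable. *)
Lemma lp_global (p C: R) (k: R -> R -> R) (kap: R -> R) : 1<p -> 0<=C ->
 measurable_fun [set: R*R] (fun z => k z.1 z.2) ->
 (forall x y, `|k x y| <= kap x*poi 1 (x-y)) ->
 (forall (M: R) (f: R -> R), 0<M -> mfun R f -> (forall x, `|f x| <= M) ->
 (\int[mu]_(x in `[(- M)%R, M[) (`|\int[mu]_(y in `[(- M)%R, M[) (k x y*f y)| `^ p)%:E <=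
  C%:E * \int[mu]_(x in `[(- M)%R, M[) (`|f x| `^ p)%:E)%E) ->
 forall f: R -> R, mfun R f -> (Lpi p f < +oo)%E ->
 (\int[mu]_x (`|\int[mu]_y (k x y*f y)| `^ p)%:E<=C%:E*Lpi p f)%E.
Proof.
move=> p1 C0 mk kk H f mf foo; have p0: 0<p by lra.
pose W n: set R:=`[- n.+1%:R, n.+1%:R[%classic.
have mW n: measurable (W n) by exact: measurable_itv.
pose fn n x:=if `|f x| <= n.+1%:R then f x else 0.
have mfn n: mfun R (fn n).
 apply: measurable_fun_ifT => //.
 apply: measurable_fun_ler => //.
 exact: mnorm.
have fnM n x: `|fn n x| <= n.+1%:R by rewrite /fn; case: ifP; rewrite ?normr0.
have fnf n x: `|fn n x| <= `|f x| by rewrite /fn; case: ifP; rewrite ?normr0.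
have evW x: \forall n \near \oo, W n x.
 near=> n; rewrite /W /= in_itv /=.
 have: `|x| < n.+1%:R.
  near: n; have /andP[_ h]:=truncn_itv (normr_ge0 x).
  by exists (Num.trunc `|x|) => // n /= hn; apply: lt_le_trans h _; rewrite ler_nat ltnS.
 by rewrite ltr_norml => /andP[h1 h2]; rewrite (ltW h1).
have evf x: \forall n \near \oo, fn n x = f x.
 near=> n; rewrite /fn ifT //; near: n; have /andP[_ h]:=truncn_itv (normr_ge0 (f x)).
 by exists (Num.trunc `|f x|) => // n /= hn; apply: le_trans (ltW h) _; rewrite ler_nat ltnS.
pose T n x:=\int[mu]_(y in W n) (k x y*fn n y).
pose G n x:=(`|T n x| `^ p * \1_(W n) x)%:E.
have TE n x: T n x = \int[mu]_y (k x y*fn n y * \1_(W n) y).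
 rewrite /T Rintegral_mkcond; congr Rintegral; apply/funext => y.
 by rewrite patchE indicE; case: (y \in W n); rewrite ?mulr1 ?mulr0.
have mT n: mfun R (T n).
 rewrite (_: T n = fun x => \int[mu]_y (k x y*fn n y * \1_(W n) y)); last by apply/funext.
 apply: (@m_Rintegral _ _ _ _ R mu (fun z: R*R => k z.1 z.2*fn n z.2 * \1_(W n) z.2)).
 apply: mfunM.
  by apply: mfunM => //; apply: mcomp => //; exact: mfn.
 by apply: mcomp => //; apply: measurable_indic; exact: mW.
have mG n: mfun R (G n).
 apply/mEFinP; apply: mfunM; last by apply: measurable_indic; exact: mW.
 by have /mEFinP:=m_powabs p (mT n).
have G0 n x: (0<=G n x)%E by rewrite lee_fin mulr_ge0 ?powR_ge0.
have cT x: T n x @[n --> \oo] --> \int[mu]_y (k x y*f y).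
 rewrite (_: T ^~ x = fun n => \int[mu]_y (k x y*fn n y * \1_(W n) y)); last by apply/funext => n.
 have mkx: mfun R (k x) by apply: (m_comp2 mk).
 have kap0: 0<=kap x.
  have:=le_trans (normr_ge0 _) (kk x x).
  by rewrite subrr /poi expr0n expr1n /= addr0 divr1 mulr1.
 have [] := @Rintegral_dominated _ _ _ mu setT (fun n y => k x y*fn n y * \1_(W n) y)
  (fun y => k x y*f y) (fun y => kap x*(poi 1 (x-y) * `|f y|)) measurableT => //.
 - by move=> n; apply: mfunM; [apply: mfunM; [exact: mkx|exact: mfn]|apply: measurable_indic; exact: mW].
 - by apply: mfunM; [exact: mkx|].
 - have:=integrableZl measurableT (kap x) (integrable_poi1 x p1 mf foo).
  by apply: eq_integrable => // y _ /=; rewrite EFinM.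
 - apply: aeW => y _; apply: cvg_near_cst.
  near=> n; rewrite indicE mem_set ?mulr1; last by near: n; exact: evW.
  by congr (_*_); near: n; exact: evf.
 - move=> n y _; rewrite !normrM indicE.
  apply: (le_via (`|k x y| * `|fn n y|)).
  by rewrite ler_piMr ?mulr_ge0 //; case: (y \in W n); rewrite ?normr1 ?normr0.
  by rewrite mulrA; apply: ler_pM.
have GE x: limn_einf (G^~ x) = (`|\int[mu]_y (k x y*f y)| `^ p)%:E.
 have cG: G n x @[n --> \oo] --> (`|\int[mu]_y (k x y*f y)| `^ p)%:E.
  apply: cvg_EFin; first by near=> n.
  apply: (@cvg_trans _ ((fun n => `|T n x| `^ p) @ \oo)).
  apply: near_eq_cvg; near=> n; rewrite /G /= indicE mem_set ?mulr1 //; near: n; exact: evW.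
  by apply: cvg_powR_seq => //; apply: cvg_norm; exact: cT.
 by have [->]:=cvg_limn_einf_sup cG.
under eq_integral do rewrite -GE.
apply: le_trans (fatou mu measurableT mG _) _; first by move=> n x _; exact: G0.
rewrite limn_einf_lim; apply: lime_le; first exact: is_cvg_einfs.
near=> n; apply: (le_via (\int[mu]_x G n x)%E); first by apply: ereal_inf_lbound; exists n => //=.
have -> : (\int[mu]_x G n x = \int[mu]_(x in W n) (`|T n x| `^ p)%:E)%E.
 rewrite [RHS]integral_mkcond; apply: eq_integral => x _; rewrite /G patchE indicE.
 by case: (x \in W n); rewrite ?mulr1 ?mulr0.
apply: le_trans (H n.+1%:R (fn n) (ltr0Sn R n) (mfn n) (fnM n)) _.
apply: lee_wpmul2l; first by rewrite lee_fin.
apply: le_trans (_: _ <= \int[mu]_(x in W n) (`|f x| `^ p)%:E)%E _.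
 apply: ge0_le_integral => //.
 - by apply: mfunTS; apply: m_powabs; exact: mfn.
 - by apply: mfunTS; apply: m_powabs.
 by move=> x _; rewrite lee_fin; apply: ge0_ler_powR; rewrite ?nnegrE ?(ltW p0).
apply: ge0_subset_integral => //; first exact: mW.
by apply: m_powabs.
Unshelve. all: end_near.
Qed.

(** Linearisation of the supremum: [e n x] selects, measurably in [x], a radius among the first
    [n.+1] rationals that maximises [|T|]. Having finitely many values it is bounded below, so the
    hypothesis applies with the same [B], and monotone convergence finishes. *)
Lemma sup_select (p: R) (T: R -> R -> R) (B: \bar R) : 0<p ->
 (forall e: R -> R, mfun R e -> mfun R (fun x => T (e x) x)) ->
 (forall (e: R -> R) (e0: R), mfun R e -> 0<e0 -> (forall x, e0<=e x) ->
  (\int[mu]_x (`|T (e x) x| `^ p)%:E<=B)%E) ->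
 (\int[mu]_x esups (fun n => (`|T (qpos n) x| `^ p)%:E) 0%N<=B)%E.
Proof.
move=> p0 mT HB.
pose e:=nat_rect (fun=> R -> R) (fun=> qpos 0) (fun n en x =>
  if `|T (en x) x| < `|T (qpos n.+1) x| then qpos n.+1 else en x).
have eS n x: e n.+1 x = if `|T (e n x) x| < `|T (qpos n.+1) x| then qpos n.+1 else e n x by [].
have me n: mfun R (e n).
 elim: n => [|n IH]; first exact: mcst.
 rewrite (_: e n.+1 = fun x => if `|T (e n x) x| < `|T (qpos n.+1) x| then qpos n.+1 else e n x) //.
 apply: measurable_fun_ifT => //.
 apply: measurable_fun_ltr.
  exact: (mcomp (@normr_measurable _ _) (mT _ IH)).
 by have:=mcomp (@normr_measurable _ _) (mT _ (@measurable_cst _ _ _ _ setT (qpos n.+1))).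
have elow n: exists2 e0, 0<e0 & forall x, e0<=e n x.
 elim: n => [|n [e0 e00 IH]]; first by exists (qpos 0); [exact: qpos_gt0|].
 exists (Num.min e0 (qpos n.+1)); first by rewrite lt_min e00 qpos_gt0.
 by move=> x; rewrite eS; case: ifP => _; rewrite ge_min ?lexx ?orbT ?IH.
pose G n x:=(`|T (e n x) x| `^ p)%:E.
have ndT x n: `|T (e n x) x| <= `|T (e n.+1 x) x|.
 by rewrite eS; case: ifP => // /ltW.
have mono (s t: R) : 0<=s -> s<=t -> s`^p<=t`^p.
 by move=> s0 st; apply: ge0_ler_powR; rewrite ?nnegrE ?(ltW p0) // (le_trans s0).
have ndG x: {homo G^~ x: n m/(n<=m)%N >-> (n<=m)%E}.
 by apply/nondecreasing_seqP => n; rewrite lee_fin mono.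
have mG n: mfun R (G n) by apply: m_powabs; apply: mT; exact: me.
have domT x n: `|T (qpos n) x| <= `|T (e n x) x|.
 case: n => [|n] //; rewrite eS; case: ifP => // /negbT; by rewrite -leNgt.
have lims x: limn (G^~ x) = esups (fun n => (`|T (qpos n) x| `^ p)%:E) 0%N.
 have c: G^~ x @ \oo --> ereal_sup (range (G^~ x)) by apply: ereal_nondecreasing_cvgn; exact: ndG.
 rewrite (cvg_lim _ c) //; apply/eqP; rewrite eq_le; apply/andP; split.
  apply: ge_ereal_sup => _ [n _ <-].
  rewrite /G; have [m ->] : exists m, e n x = qpos m.
  elim: n => [|n [m IH]]; first by exists 0%N.
  by rewrite eS; case: ifP => _; [exists n.+1|exists m].
  by apply: ereal_sup_ubound; exists m.
 apply: ge_ereal_sup => _ [n _ <-].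
 apply: (le_via (G n x)); first by rewrite lee_fin mono.
 by apply: ereal_sup_ubound; exists n.
under eq_integral do rewrite -lims.
rewrite monotone_convergence //.
 apply: lime_le.
 apply: ereal_nondecreasing_is_cvgn => n m nm; apply: ge0_le_integral => //.
 - by move=> x _; rewrite lee_fin powR_ge0.
 - exact: mG.
 - exact: mG.
 - by move=> x _; exact: ndG.
 near=> n; have [e0 e00 He]:=elow n; exact: HB (me n) e00 He.
by move=> n x _; rewrite lee_fin powR_ge0.
Unshelve. all: end_near.
Qed.
End Maximal.

(** * Maximal operators on a line *)

Section LineOperators.
Context {R: realType}.
Local Notation mu:=(@lebesgue_measure R).

(** The smooth truncation at radius [e] minus the one at radius 1. The difference of the two kernels
    is dominated by a Poisson kernel ([cpoiB_le]), so the integral converges absolutely for every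
    L^p function, unlike each term separately with its decay [1/t] under estimates of this kind. *)
Definition QQ (P A: R -> R) (e: R) (f: R -> R) (x: R) : R :=
 \int[mu]_y (P (slp A x y)*(cpoi e (x-y)-cpoi 1 (x-y))*f y).

Definition PP (e: R) (f: R -> R) (x: R) : R:=\int[mu]_y (poi e (x-y) * `|f y|).

Lemma m_QQ_fun (L: R) (P A e: R -> R) : lipr L A -> mfun R P -> mfun R e ->
 measurable_fun [set: R*R]
  (fun z => P (slp A z.1 z.2)*(cpoi (e z.1) (z.1-z.2)-cpoi 1 (z.1-z.2))).
Proof.
move=> AL mP me; apply: mfunM.
 apply: (mcomp mP); exact: m_slp AL.
have mB: measurable_fun [set: R*R] (fun z => z.1-z.2) by exact: mfunB.
apply: mfunB; apply: m_cpoi => //.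
exact: mcomp.
Qed.

Lemma powRB_le (p a b: R) : 0<=p -> `|a-b| `^ p<=2`^p*(`|a| `^ p + `|b| `^ p).
Proof.
move=> p0; apply: le_trans (powRD_le (normr_ge0 a) (normr_ge0 b) p0).
by apply: ge0_ler_powR; rewrite ?nnegrE ?addr_ge0 //; exact: ler_normB.
Qed.

Lemma poi_le1 (r t: R) : 0<r -> poi r t<=(r+r^-1)*poi 1 t.
Proof.
move=> r0; rewrite /poi expr1n mul1r.
have D1: 0<r^+2+t^+2 by rewrite ltr_pwDl ?exprn_gt0 ?sqr_ge0.
have D2: 0<1+t^+2 by rewrite ltr_pwDl ?sqr_ge0.
rewrite ler_pdivrMr // mulrAC ler_pdivlMr //.
rewrite (_: (r+r^-1)*(r^+2+t^+2) = r*(1+t^+2)+(r^+2*r+r^-1 * t^+2)).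
 by rewrite lerDl addr_ge0 // mulr_ge0 ?sqr_ge0 ?invr_ge0 // ltW.
by field; rewrite gt_eqF.
Qed.

Lemma QQ_lp_fun (L K p: R) : 0<=L -> 0<=K -> 1<p ->
 exists2 C, 0<C & forall (P A f e: R -> R) (e0: R),
  smooth L K P -> lipr L A -> mfun R P -> mfun R e ->
  0<e0 -> (forall x, e0<=e x) ->
  mfun R f -> (Lpi p f < +oo)%E ->
 (\int[mu]_x (`|QQ P A (e x) f x| `^ p)%:E<=C%:E*Lpi p f)%E.
Proof.
move=> L0 K0 p1; have [C C0 HC]:=singular_window_lip L0 K0 p1.
have p0: 0<p by lra.
exists (2`^p*(C+C)); first by rewrite mulr_gt0 ?powR_gt0 // addr_gt0.
move=> P A f e e0 sP AL mP me e00 ee mf foo.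
have [P1 P2 P3]:=sP.
have ep x: 0<e x by exact: lt_le_trans (ee x).
apply: (lp_global (k:=fun x y => P (slp A x y)*(cpoi (e x) (x-y)-cpoi 1 (x-y)))
  (kap:=fun x => K*(`|1^+2-e x^+2| / (e x*1)))) => //.
- by rewrite mulr_ge0 ?powR_ge0 // addr_ge0 // ltW.
- exact: m_QQ_fun AL mP me.
- move=> x y; rewrite normrM -mulrA; apply: ler_pM => //; first by apply: P1; exact: slp_le.
 exact: cpoiB_le.
move=> M {mf foo}f M0 mf fM.
pose W: set R:=`[- M, M[%classic.
have mW: measurable W by exact: measurable_itv.
have Wlt: (- M<M)%R by lra.
have one (r: R -> R) (r0: R) : mfun R r -> 0<r0 -> (forall x, r0<=r x) ->
 (\int[mu]_(x in W) (`|\int[mu]_(y in W) (P (slp A x y)*cpoi (r x) (x-y)*f y)| `^ p)%:E <=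
  C%:E * \int[mu]_(x in W) (`|f x| `^ p)%:E)%E.
 move=> mr r00 rr.
 have rp x: 0<r x by exact: lt_le_trans (rr x).
 apply: (@window_bounded _ (- M) M p C (fun x y => P (slp A x y)*cpoi (r x) (x-y)) _ _ _ _ _ _ f M) => //.
 - exact: ltW.
 - apply: mfunM; first by apply: (mcomp mP); exact: m_slp AL.
  apply: m_cpoi; [exact: mcomp|exact: mfunB].
 - exact: (lipk_singular L0 P1 P2 AL rp).
 - move=> g Lg gL gM; exact: (HC P A g r (- M) M r0 Lg).
have h1:=one e e0 me e00 ee.
have h2:=one (fun=> 1) 1 (@measurable_cst _ _ _ _ _ _) ltr01 (fun x => lexx _).
pose T (r: R -> R) x:=\int[mu]_(y in W) (P (slp A x y)*cpoi (r x) (x-y)*f y).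
have mT r: mfun R r -> mfun R (T r).
 move=> mr; rewrite (_: T r = fun x => \int[mu]_y (P (slp A x y)*cpoi (r x) (x-y)*f y * \1_W y)); last first.
  apply/funext => x; rewrite /T Rintegral_mkcond; congr Rintegral; apply/funext => y.
  by rewrite patchE indicE; case: (y \in W); rewrite ?mulr1 ?mulr0.
 apply: (@m_Rintegral _ _ _ _ R mu (fun z: R*R => P (slp A z.1 z.2)*cpoi (r z.1) (z.1-z.2)*f z.2 * \1_W z.2)).
 apply: mfunM; last by apply: mcomp => //; exact: measurable_indic.
 apply: mfunM; last exact: mcomp.
 apply: mfunM; first by apply: (mcomp mP); exact: m_slp AL.
 apply: m_cpoi; [exact: mcomp|exact: mfunB].
have ik (r: R -> R) x: 0<r x -> mu.-integrable W (EFin \o (fun y => P (slp A x y)*cpoi (r x) (x-y)*f y)).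
 move=> rx; apply: (bounded_integrable (M:=K*(r x)^-1*M)) => //; first exact: mu_itv_lty.
  apply: mfunTS; apply: mfunM => //; apply: mfunM.
  by apply: (mcomp mP); apply: (m_comp2 (m_slp AL)).
  by apply: m_cpoi => //; exact: mfunB.
 move=> y _; rewrite (normrM _ (f y)) (normrM (P _)); apply: ler_pM => //; apply: ler_pM => //; last exact: cpoi_le2.
 by apply: P1; exact: slp_le.
have E x: \int[mu]_(y in W) (P (slp A x y)*(cpoi (e x) (x-y)-cpoi 1 (x-y))*f y) = T e x-T (fun=> 1) x.
 rewrite /T -RintegralB //; [|exact: ik|exact: (ik (fun=> 1))].
 by apply: eq_Rintegral => y _; ring.
under eq_integral do rewrite E.
have mTp r: mfun R r -> measurable_fun W (fun x => (`|T r x| `^ p)%:E).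
 by move=> mr; apply: mfunTS; apply: m_powabs; exact: mT.
apply: (le_via (\int[mu]_(x in W) ((2`^p)%:E*((`|T e x| `^ p)%:E+(`|T (fun=> 1) x| `^ p)%:E)))%E).
 apply: ge0_le_integral => //.
 - by apply: mfunTS; apply: m_powabs; apply: mfunB; exact: mT.
 - apply: measurable_funeM; apply: emeasurable_funD; exact: mTp.
 by move=> x _; rewrite -EFinD -EFinM lee_fin; apply: powRB_le; exact: ltW.
rewrite ge0_integralZl_EFin //; last 2 first.
- by move=> x _; rewrite -EFinD lee_fin addr_ge0 ?powR_ge0.
- apply: emeasurable_funD; exact: mTp.
rewrite ge0_integralD //; [|exact: mTp|exact: mTp].
rewrite EFinM -muleA; apply: lee_wpmul2l; first by rewrite lee_fin powR_ge0.
rewrite EFinD ge0_muleDl ?lee_fin ?(ltW C0) //.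
exact: (leeD h1 h2).
Qed.

Lemma QQ_lp (L K p: R) : 0<=L -> 0<=K -> 1<p ->
 exists2 C, 0<C & forall (P A f: R -> R),
  smooth L K P -> lipr L A -> mfun R P ->
  mfun R f -> (Lpi p f < +oo)%E ->
 (\int[mu]_x esups (fun n => (`|QQ P A (qpos n) f x| `^ p)%:E) 0%N<=C%:E*Lpi p f)%E.
Proof.
move=> L0 K0 p1; have [C C0 HC]:=QQ_lp_fun L0 K0 p1; have p0: 0<p by lra.
exists C => // P A f sP AL mP mf foo.
apply: (sup_select (T:=fun e x => QQ P A e f x)) => //.
- move=> e me; rewrite /QQ.
 apply: (@m_Rintegral _ _ _ _ R mu
  (fun z: R*R => P (slp A z.1 z.2)*(cpoi (e z.1) (z.1-z.2)-cpoi 1 (z.1-z.2))*f z.2)).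
 apply: mfunM; last exact: mcomp.
 exact: m_QQ_fun AL mP me.
- by move=> e e0 me e00 ee; exact: (HC P A f e e0).
Qed.

Lemma PP_lp (p: R) : 1<p ->
 exists2 C, 0<C & forall (f: R -> R),
  mfun R f -> (Lpi p f < +oo)%E ->
 (\int[mu]_x esups (fun n => (`|PP (qpos n) f x| `^ p)%:E) 0%N<=C%:E*Lpi p f)%E.
Proof.
move=> p1; have [C C0 HC] := @poisson_window_lip R p p1; have p0: 0<p by lra.
have {}HC:=conj I HC.
exists C => // f mf foo.
have mn: mfun R (fun y => `|f y|) by exact: mnorm.
apply: (sup_select (T:=fun e x => PP e f x)) => //.
 move=> e me; rewrite /PP.
 apply: (@m_Rintegral _ _ _ _ R mu (fun z: R*R => poi (e z.1) (z.1-z.2) * `|f z.2|)).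
 apply: mfunM; last by apply: (mcomp mn).
 apply: m_poi; [exact: mcomp|exact: mfunB].
move=> e e0 me e00 ee.
have ep x: 0<e x by exact: lt_le_trans (ee x).
have mk: measurable_fun [set: R*R] (fun z => poi (e z.1) (z.1-z.2)).
 apply: m_poi; [exact: mcomp|exact: mfunB].
have E: (Lpi p f = \int[mu]_x (`|(`|f x|)| `^ p)%:E)%E.
 by apply: eq_integral => x _; rewrite normr_id.
rewrite E in foo *.
apply: (@lp_global _ p C (fun x y => poi (e x) (x-y)) (fun x => e x+(e x)^-1) p1 (ltW C0) mk _ _ (fun y => `|f y|) mn foo).
- by move=> x y; rewrite ger0_norm; [exact: poi_le1|exact: poi_ge0].
move=> M g M0 mg gM.
apply: (@window_bounded _ (- M) M p C (fun x y => poi (e x) (x-y)) _ _ _ _ _ _ g M) => //.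
- lra.
- exact: ltW.
- exact: lipk_poisson.
- move=> h Lh hL hM; by apply: (HC.2 h e (- M) M e0 Lh) => //; lra.
Qed.

Lemma esups_ge (T: R -> R) n: ((T (qpos n))%:E<=esups (fun n => (T (qpos n))%:E) 0%N)%E.
Proof. by apply: ereal_sup_ubound; exists n. Qed.

Section Pointwise.
Variables (L K p: R) (P A f: R -> R).
Hypotheses (p1: 1<p) (sP: smooth L K P) (AL: lipr L A) (mP: mfun R P)
 (mf: mfun R f) (foo: (Lpi p f < +oo)%E).

Lemma integrable_poi (r x: R) : 0<r -> mu.-integrable [set: R] (EFin \o (fun y => poi r (x-y) * `|f y|)).
Proof.
move=> r0.
have mxy: mfun R (fun y => x-y) by exact: mfunB.
have mn: mfun R (fun y => `|f y|) by exact: mnorm.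
have i1:=integrableZl measurableT (r+r^-1) (integrable_poi1 x p1 mf foo).
apply: (le_integrable measurableT _ _ i1).
 by apply/mEFinP; apply: mfunM => //; apply: m_poi.
move=> y _ /=; rewrite lee_fin ger0_norm; last by apply: mulr_ge0 => //; exact: poi_ge0.
by apply: le_trans (ler_norm _); rewrite mulrA ler_wpM2r // poi_le1.
Qed.

Lemma PP_ge0 r x: 0<r -> 0<=PP r f x.
Proof. by move=> r0; apply: Rintegral_ge0 => y _; rewrite mulr_ge0 ?poi_ge0. Qed.

(** Poisson kernels at comparable radii are comparable, so any rational radius between [r] and
    [2 * r] will do. *)
Lemma PP_le_sup r x: 0<r -> exists n, PP r f x<=2*PP (qpos n) f x.
Proof.
move=> r0; have [n /andP[n1 n2]]:=qpos_dense r0 r0; exists n.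
rewrite /PP -RintegralZl //; last by apply: integrable_poi; exact: qpos_gt0.
apply: le_Rintegral => //; first exact: integrable_poi.
 have:=integrableZl measurableT 2 (integrable_poi x (qpos_gt0 n)).
 by apply: eq_integrable => // y _; rewrite /= EFinM.
move=> y _; rewrite mulrA ler_wpM2r //; apply: poi_comp => //.
by rewrite (ltW n1) /=; lra.
Qed.

(** Unlike the Poisson case the kernel changes sign, so a bound at rational radii reaches all radii
    only by continuity in [e], through dominated convergence. *)
Lemma QQ_le_sup e x (B: R) : 0<e -> (forall n, `|QQ P A (qpos n) f x| <= B) -> `|QQ P A e f x| <= B.
Proof.
move=> e0 H; have [u ue]:=qpos_seq e0.
have L0:=lipr_le0 AL.
have [P1 _ _]:=sP.
have K0: 0<=K by apply: le_trans (P1 0 _); rewrite ?normr0.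
have [N _ HN] : \forall n \near \oo, e/2<qpos (u n)<2*e.
 move/cvgrPdist_lt: ue => /(_ (e/2)); rewrite divr_gt0 // => /(_ isT).
 apply: filterS => n; rewrite ltr_distlC => /andP[h1 h2]; apply/andP; split; lra.
have ucv: qpos (u (n+N)%N) @[n --> \oo] --> e by rewrite -(cvg_shiftn N) in ue.
pose B0:=(1+4*e^+2)/(e/2).
have msl: mfun R (slp A x) by apply: (m_comp2 (m_slp AL)).
have mPs: mfun R (fun y => P (slp A x y)) by apply: (mcomp mP).
have mxy: mfun R (fun y => x-y) by exact: mfunB.
have mk r: mfun R (fun y => P (slp A x y)*(cpoi r (x-y)-cpoi 1 (x-y))*f y).
 apply: mfunM => //; apply: mfunM => //.
 by apply: mfunB; apply: m_cpoi.
have [] := @Rintegral_dominated _ _ _ mu setT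
  (fun n y => P (slp A x y)*(cpoi (qpos (u (n+N)%N)) (x-y)-cpoi 1 (x-y))*f y)
  (fun y => P (slp A x y)*(cpoi e (x-y)-cpoi 1 (x-y))*f y)
  (fun y => K*B0*(poi 1 (x-y) * `|f y|)) measurableT.
- by move=> n; exact: mk.
- exact: mk.
- have:=integrableZl measurableT (K*B0) (integrable_poi x ltr01).
 by apply: eq_integrable => // y _; rewrite /= EFinM.
- apply: aeW => y _; apply: cvgMl; apply: cvgMr; apply: cvgB; last exact: cvg_cst.
 rewrite /cpoi; apply: cvgMr; apply: cvgV.
  have [xy|xy]:=eqVneq (x-y) 0; first by rewrite xy expr0n addr0 sqrf_eq0 gt_eqF.
  by rewrite gt_eqF // ltr_wpDl ?sqr_ge0 // exprn_even_gt0.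
 apply: cvgD; last exact: cvg_cst.
 by rewrite expr2; under eq_cvg do rewrite expr2; apply: cvgM.
- move=> n y _; have /andP[q1 q2]:=HN (n+N)%N (leq_addl _ _).
 move: (qpos _) q1 q2 => q q1 q2; have q0: 0<q by lra.
 rewrite !normrM mulrA ler_wpM2r // -mulrA; apply: ler_pM => //; first by apply: P1; exact: slp_le.
 apply: le_trans (cpoiB_le _ q0 ltr01) _; rewrite ler_wpM2r ?poi_ge0 // expr1n mulr1.
 rewrite ler_pdivrMr //.
 apply: (le_via (1+4*e^+2)).
  apply: le_trans (ler_normB _ _) _; rewrite normr1 lerD2l ger0_norm ?sqr_ge0 //.
  rewrite (_: 4*e^+2 = (2*e)^+2); last by ring.
  by rewrite ler_pXn2r // ?nnegrE ?(ltW q0) ?(ltW q2) // mulr_ge0 // ltW.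
 rewrite /B0 mulrAC ler_pdivlMr ?divr_gt0 //.
 rewrite ler_wpM2l ?ltW //. by rewrite ltr_pwDl // mulr_ge0 ?sqr_ge0.
move=> _ /cvg_norm cv.
rewrite -(cvg_lim (@Rhausdorff R) cv); apply: limr_le; first by apply/cvg_ex; eexists; exact: cv.
by near=> n; exact: H.
Unshelve. all: end_near.
Qed.
End Pointwise.
End LineOperators.

(** * Sharp Euclidean truncations on a line *)

Section Sharp.
Context {R: realType}.
Local Notation mu:=(@lebesgue_measure R).

(* Euclidean truncation on the graph of A, [e <= |(x-y, A x-A y)|] *)
Definition trunc (A: R -> R) (e x y: R) : bool:=e <= `|x-y| * Num.sqrt (1+slp A x y^+2).

(** Sharp inner truncation at [e], smooth outer truncation at [r]: the factor [t^-1 - cpoi r t] is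
    close to [1/t] below [r] and of Poisson size above. This is the singular part of the line
    kernels, with [r] the height of the graph. *)
Definition shk (A: R -> R) (e r x y: R) : R :=
 (trunc A e x y)%:R*((x-y)^-1-cpoi r (x-y)).

Definition SH (P A: R -> R) (e r: R) (f: R -> R) (x: R) : R :=
 \int[mu]_y (P (slp A x y)*shk A e r x y*f y).

Lemma sqrt_slope_bounds (q L: R) : `|q| <= L -> 1<=Num.sqrt (1+q^+2)<=1+L.
Proof.
move=> qL; have L0: 0<=L by apply: le_trans qL.
apply/andP; split.
 by rewrite -[leLHS]sqrtr1 ler_wsqrtr // lerDl sqr_ge0.
rewrite -[leRHS]ger0_norm ?addr_ge0 // -sqrtr_sqr ler_wsqrtr //.
rewrite -(real_normK (num_real q)).
have: `|q| ^+ 2<=L^+2 by rewrite ler_pXn2r ?nnegrE.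
by rewrite sqrrD expr1n mul1r; lra.
Qed.

Lemma cpoi_inv (e t: R) : 0<e -> t != 0 -> t^-1-cpoi e t = e/t*poi e t.
Proof.
move=> e0 t0; rewrite /cpoi /poi.
have D1: e^+2+t^+2 != 0 by rewrite gt_eqF // ltr_pwDl ?exprn_gt0 ?sqr_ge0.
by field; rewrite t0 D1.
Qed.

Lemma cpoi_poi (e t r: R) : 0<e -> `|t| <= e -> e<=r -> `|cpoi r t| <= poi e t.
Proof.
move=> e0 te er; rewrite /cpoi /poi normrM normfV.
have D1: 0<e^+2+t^+2 by rewrite ltr_pwDl ?exprn_gt0 ?sqr_ge0.
have D2: 0<r^+2+t^+2 by rewrite ltr_pwDl ?exprn_gt0 ?sqr_ge0 //; lra.
rewrite (gtr0_norm D2); apply: ler_pM => //; first by rewrite invr_ge0 ltW.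
by rewrite lef_pV2 ?posrE // lerD2r ler_pXn2r ?nnegrE //; lra.
Qed.

(** The Euclidean truncation holds when [e <= |t|] and fails when [|t| < e/(1+L)]. In the transition
    region all kernels have size about [1/e], so the exchange of sharp for smooth truncation costs a
    Poisson kernel at radius [e]. *)
Lemma shk_close (A: R -> R) (L e r x y: R) : lipr L A -> 0<e -> e<=r ->
 `|shk A e r x y-(cpoi e (x-y)-cpoi r (x-y))| <= (L+2)*poi e (x-y).
Proof.
move=> AL e0 er; have L0:=lipr_le0 AL.
have:=sqrt_slope_bounds (slp_le x y AL L0).
rewrite /shk /trunc; move: (x-y) (Num.sqrt _) => t s /andP[s1 s2].
have p0 := @poi_ge0 R e t e0.
have [b|b]:=leP e (`|t| * s); last first.
 have te: `|t| <= e by apply: le_trans (ltW b); rewrite ler_peMr.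
 rewrite mul0r sub0r normrN; apply: le_trans (ler_normB _ _) _.
 have:=cpoi_poi e0 te (lexx e); have:=cpoi_poi e0 te er.
 have: 0<=L*poi e t by rewrite mulr_ge0.
 by rewrite mulrDl; lra.
have t0: t != 0 by apply: contraTneq b => ->; rewrite normr0 mul0r -ltNge.
rewrite mul1r (_: _-_ = t^-1-cpoi e t); last by ring.
rewrite cpoi_inv // normrM (ger0_norm p0) ler_wpM2r // normrM normfV (gtr0_norm e0).
rewrite ler_pdivrMr ?normr_gt0 //; apply: le_trans b _.
by rewrite mulrC ler_wpM2r //; lra.
Qed.

Lemma m_trunc (L: R) (A: R -> R) (e: R) : lipr L A ->
 measurable_fun [set: R*R] (fun z => trunc A e z.1 z.2).
Proof.
move=> AL; apply: measurable_fun_ler => //; apply: mfunM.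
 apply: mnorm; exact: mfunB.
apply: msqrt.
apply: mfunD => //; apply: mfunX; exact: m_slp AL.
Qed.

Lemma m_bool_real d (T: measurableType d) (b: T -> bool) : mfun T b ->
 mfun T (fun x => (b x)%:R: R).
Proof.
move=> mb; rewrite (_: (fun x => _) = fun x => if b x then 1 else 0: R); last first.
 by apply/funext => x; case: (b x).
exact: measurable_fun_ifT.
Qed.

Lemma m_shk (L: R) (A: R -> R) (e r: R) : lipr L A ->
 measurable_fun [set: R*R] (fun z => shk A e r z.1 z.2).
Proof.
move=> AL; apply: mfunM.
 by apply: m_bool_real; exact: m_trunc AL.
have mB: measurable_fun [set: R*R] (fun z => z.1-z.2) by exact: mfunB.
apply: mfunB; first exact: (mcomp m_inv).
by apply: m_cpoi.
Qed.

Lemma shk_le (A: R -> R) (L e r x y: R) : lipr L A -> 0<e -> 0<r ->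
 `|shk A e r x y| <= (r*(1+L)/e)*poi r (x-y).
Proof.
move=> AL e0 r0; have L0:=lipr_le0 AL.
have:=sqrt_slope_bounds (slp_le x y AL L0).
rewrite /shk /trunc; move: (x-y) (Num.sqrt _) => t s /andP[s1 s2].
have p0 := @poi_ge0 R r t r0.
have [b|b]:=leP e (`|t| * s); last first.
 by rewrite mul0r normr0 mulr_ge0 // divr_ge0 ?mulr_ge0 ?(ltW r0) ?(ltW e0) ?addr_ge0.
have t0: t != 0 by apply: contraTneq b => ->; rewrite normr0 mul0r -ltNge.
rewrite mul1r cpoi_inv // normrM (ger0_norm p0) ler_wpM2r // normrM normfV (gtr0_norm r0).
rewrite -mulrA ler_pM2l // ler_pdivlMr // mulrC ler_pdivrMr ?normr_gt0 //.
by apply: le_trans b _; rewrite mulrC ler_wpM2r //; lra.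
Qed.

Section Pointwise.
Variables (L K p: R) (P A f: R -> R).
Hypotheses (p1: 1<p) (sP: smooth L K P) (AL: lipr L A) (mP: mfun R P)
 (mf: mfun R f) (foo: (Lpi p f < +oo)%E).

Let mxy x: mfun R (fun y => x-y). Proof. exact: mfunB. Qed.
Let mPs x: mfun R (fun y => P (slp A x y)).
Proof. by apply: (mcomp mP); apply: (m_comp2 (m_slp AL)). Qed.
Let L0: 0<=L. Proof. exact: lipr_le0 AL. Qed.
Let PK x y: `|P (slp A x y)| <= K. Proof. by have [P1 _ _]:=sP; apply: P1; exact: slp_le. Qed.
Let K0: 0<=K. Proof. exact: le_trans (PK 0 0). Qed.

Lemma integrable_dominated (k: R -> R) (c r x: R) : mfun R k -> 0<r ->
 (forall y, `|k y| <= c*poi r (x-y)) -> mu.-integrable [set: R] (EFin \o (fun y => k y*f y)).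
Proof.
move=> mk r0 kc.
have i1:=integrableZl measurableT c (integrable_poi p1 mf foo x r0).
apply: (le_integrable measurableT _ _ i1).
 by apply/mEFinP; exact: mfunM.
move=> y _ /=; rewrite lee_fin normrM; apply: le_trans (ler_norm _).
by rewrite mulrA ler_wpM2r.
Qed.

Lemma le_dominated (k: R -> R) (c r x: R) : mfun R k -> 0<r ->
 (forall y, `|k y| <= c*poi r (x-y)) -> `|\int[mu]_y (k y*f y)| <= c*PP r f x.
Proof.
move=> mk r0 kc; have ik:=integrable_dominated mk r0 kc.
apply: le_trans (le_normr_Rintegral _ ik) _ => //.
have ip:=integrable_poi p1 mf foo x r0.
rewrite /PP -RintegralZl //.
apply: le_Rintegral => //; first exact: (integrable_norm ik).
 have:=integrableZl measurableT c (integrable_poi p1 mf foo x r0).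
 by apply: eq_integrable => // y _; rewrite /= EFinM.
by move=> y _; rewrite normrM mulrA ler_wpM2r.
Qed.

Lemma QQ_integrable e x: 0<e ->
 mu.-integrable [set: R] (EFin \o (fun y => P (slp A x y)*(cpoi e (x-y)-cpoi 1 (x-y))*f y)).
Proof.
move=> e0; apply: (@integrable_dominated _ (K*(`|1^+2-e^+2| / (e*1))) 1 x) => //.
 by apply: mfunM => //; apply: mfunB; apply: m_cpoi.
by move=> y; rewrite normrM -mulrA; apply: ler_pM => //; exact: cpoiB_le.
Qed.

Lemma SH_le e r x: 0<e -> e<=r ->
 `|SH P A e r f x| <= `|QQ P A e f x| + `|QQ P A r f x| + K*(L+2)*PP e f x.
Proof.
move=> e0 er; have r0: 0<r by lra.
have mk1: mfun R (fun y => P (slp A x y)*(shk A e r x y-(cpoi e (x-y)-cpoi r (x-y)))).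
 apply: mfunM => //; apply: mfunB.
  by apply: (m_comp2 (m_shk e r AL)).
 by apply: mfunB; apply: m_cpoi.
have k1 y: `|P (slp A x y)*(shk A e r x y-(cpoi e (x-y)-cpoi r (x-y)))| <= K*(L+2)*poi e (x-y).
 by rewrite normrM -mulrA; apply: ler_pM => //; exact: shk_close.
have -> : SH P A e r f x = \int[mu]_y (P (slp A x y)*(shk A e r x y-(cpoi e (x-y)-cpoi r (x-y)))*f y)
  + (QQ P A e f x-QQ P A r f x).
 rewrite /QQ -RintegralB //; [|exact: QQ_integrable|exact: QQ_integrable].
 rewrite -RintegralD //; [|exact: integrable_dominated mk1 e0 k1|]; last first.
  have:=integrableB measurableT (QQ_integrable x e0) (QQ_integrable x r0).
  by apply: eq_integrable => // y _; rewrite /= EFinB.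
 by apply: eq_Rintegral => y _; ring.
apply: le_trans (ler_normD _ _) _; rewrite addrC lerD //; first exact: ler_normB.
exact: le_dominated.
Qed.

(** A single majorant that bounds every truncation at [x] ([SH_sup]). It is kept as a power [p] in
    the extended reals, ready to be integrated. *)
Definition Mx1 x: \bar R:=(esups (fun n => (`|QQ P A (qpos n) f x| `^ p)%:E) 0%N
  + esups (fun n => (`|PP (qpos n) f x| `^ p)%:E) 0%N)%E.

Lemma Mx1_bound x (B: R) : (Mx1 x<=B%:E)%E -> [/\ 0<=B,
 (forall e, 0<e -> `|QQ P A e f x| <= B`^p^-1) & (forall e, 0<e -> PP e f x<=2*B`^p^-1)].
Proof.
move=> MB; have p0: 0<p by exact: lt_trans p1.
have e0 (T: R -> R) : (0<=esups (fun n => (`|T (qpos n)| `^ p)%:E) 0%N)%E.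
 apply: le_trans (esups_ge (fun e => `|T e| `^ p) 0); by rewrite lee_fin powR_ge0.
have hr (s: R) : `|s| `^ p<=B -> `|s| <= B`^p^-1.
 move=> h; rewrite -(_: (`|s| `^ p)`^p^-1 = `|s|); last by rewrite -powRrM mulfV ?gt_eqF // powRr1.
 by apply: ge0_ler_powR; rewrite ?nnegrE ?powR_ge0 ?invr_ge0 ?(ltW p0) // (le_trans _ h) ?powR_ge0.
have h1 n: `|QQ P A (qpos n) f x| `^ p<=B.
 rewrite -lee_fin; apply: le_trans MB; apply: (le_via (esups (fun n => (`|QQ P A (qpos n) f x| `^ p)%:E) 0%N)).
  exact: (esups_ge (fun e => `|QQ P A e f x| `^ p)).
 by rewrite leeDl // (e0 (fun e => PP e f x)).
have h2 n: `|PP (qpos n) f x| `^ p<=B.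
 rewrite -lee_fin; apply: le_trans MB; apply: (le_via (esups (fun n => (`|PP (qpos n) f x| `^ p)%:E) 0%N)).
  exact: (esups_ge (fun e => `|PP e f x| `^ p)).
 by rewrite leeDr // (e0 (fun e => QQ P A e f x)).
split.
- by apply: le_trans (h1 0%N); exact: powR_ge0.
- by move=> e e00; apply: (QQ_le_sup p1 sP AL mP mf foo e00) => n; exact: hr.
- move=> e e00; have [n hn]:=PP_le_sup p1 mf foo x e00.
 apply: le_trans hn _; rewrite ler_pM2l //; apply: le_trans (ler_norm _) _; exact: hr.
Qed.

Lemma SH_sup e r x (B: R) : 0<e -> e<=r -> (Mx1 x<=B%:E)%E ->
 `|SH P A e r f x| <= (2+2*K*(L+2))*B`^p^-1.
Proof.
move=> e0 er /Mx1_bound[_ h1 h2]; apply: le_trans (SH_le x e0 er) _.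
have r0: 0<r by lra.
have q1:=h1 _ e0; have q2:=h1 _ r0; have q3:=h2 _ e0.
have: K*(L+2)*PP e f x<=K*(L+2)*(2*B`^p^-1).
 by rewrite ler_wpM2l // mulr_ge0 // addr_ge0.
move: q1 q2 => q1 q2 q4; apply: le_trans (lerD (lerD q1 q2) q4) _.
by le_of_eq; ring.
Qed.

End Pointwise.
End Sharp.

(** * Convergence of truncations as the radius tends to 0 *)

Section Conv0.
Context {R: realType}.
Local Notation mu:=(@lebesgue_measure R).

Definition conv0 (u: R -> R):=cvg (u @ 0^'+).

Lemma conv0_approx (u: R -> R) :
 (forall eta, 0<eta -> exists v d, [/\ conv0 v, 0<d & forall e, 0<e -> e<d -> `|u e-v e| <= eta]) ->
 conv0 u.
Proof.
move=> H; apply: (@cauchy_cvg R); apply: cauchy_exP => e e0.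
have e2: 0<e/4 by rewrite divr_gt0.
have [v [d [cv d0 Hd]]]:=H _ e2.
exists (lim (v @ 0^'+)); rewrite /ball /=.
move/cvgrPdist_lt: cv => /(_ _ e2) cv.
near=> s.
have s0: 0<s by near: s; exact: nbhs_right_gt.
have sd: s<d by near: s; exact: nbhs_right_lt.
have h1: `|lim (v x @[x --> 0^'+])-v s| < e/4 by near: s; exact: cv.
have h2:=Hd s s0 sd.
rewrite /= (_: _-u s = (lim (v x @[x --> 0^'+])-v s)-(u s-v s)); last by ring.
apply: le_lt_trans (ler_normB _ _) _; lra.
Unshelve. all: end_near.
Qed.

Lemma conv0_seq (u: R -> R) (l: R) :
 (forall s: nat -> R, (forall n, 0<s n) -> s n @[n --> \oo] --> 0 -> u (s n) @[n --> \oo] --> l) ->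
 conv0 u.
Proof.
move=> H; apply/cvg_ex; exists l; apply/cvg_at_rightP => s [s0 sc]; exact: H.
Qed.

Lemma conv0_seqP (u: R -> R) : conv0 u -> forall s: nat -> R, (forall n, 0<s n) ->
 s n @[n --> \oo] --> 0 -> u (s n) @[n --> \oo] --> lim (u @ 0^'+).
Proof. by move=> /cvg_at_rightP H s s0 sc; apply: H. Qed.

Lemma conv0D (u v: R -> R) : conv0 u -> conv0 v -> conv0 (fun e => u e+v e).
Proof. by move=> cu cv; exact: is_cvgD. Qed.

Lemma conv0M (c: R) (u: R -> R) : conv0 u -> conv0 (fun e => c*u e).
Proof. by move=> cu; apply: is_cvgM => //; exact: is_cvg_cst. Qed.

Lemma conv0_near (u v: R -> R) (d: R) : 0<d -> (forall e, 0<e -> e<d -> u e = v e) -> conv0 v -> conv0 u.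
Proof.
move=> d0 uv cv; apply: conv0_approx => eta eta0; exists v, d; split=> // e e0 ed.
by rewrite uv // subrr normr0 ltW.
Qed.

(** The infimum of the [F n] has integral 0, hence vanishes almost everywhere. *)
Lemma small_ae d (T: measurableType d) (m: {measure set T -> \bar R}) (F: nat -> T -> \bar R) :
 (forall n, mfun T (F n)) -> (forall n x, (0<=F n x)%E) ->
 (forall e: R, 0<e -> exists n, (\int[m]_x F n x<=e%:E)%E) ->
 {ae m, forall x, forall e: R, 0<e -> exists n, (F n x<e%:E)%E}.
Proof.
move=> mF F0 H.
pose G x:=einfs (F^~ x) 0%N.
have G0 x: (0<=G x)%E by apply: le_ereal_inf_tmp => _ [n _ <-].
have mG: mfun T G by apply: measurable_fun_einfs.
have GF n x: (G x<=F n x)%E by apply: ereal_inf_lbound; exists n.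
have iG: (\int[m]_x `|G x| = 0)%E.
 have -> : (\int[m]_x `|G x| = \int[m]_x G x)%E by apply: eq_integral => x _; rewrite gee0_abs.
 apply/eqP; rewrite eq_le integral_ge0 // andbT.
 apply/lee_addgt0Pr => e e0; rewrite add0e.
 have [n Hn]:=H e e0; apply: le_trans Hn; exact: ge0_le_integral.
have /ae_eq_integral_abs:=iG; move=> /(_ measurableT mG).
apply: ae_sub => x /(_ I) Gx e e0.
have: (ereal_inf [set F n x | n in [set k | (0<=k)%N]]<e%:E)%E.
 by move: Gx; rewrite /G /einfs /= => ->; rewrite lte_fin.
by move/ereal_inf_lt => [_ [n _ <-]] h; exists n.
Qed.
End Conv0.

(** * Cancellation and the flat part on a cell *)

Section Flat.
Context {R: realType}.
Local Notation mu:=(@lebesgue_measure R).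

Lemma odd_integral0 (x: R) (h: R -> R) : mfun R h ->
 (forall y, h (-1*y+2*x) = - h y) -> \int[mu]_y h y = 0.
Proof.
move=> mh ho; rewrite /Rintegral integralE.
have E: (\int[mu]_y (EFin \o h)^\+ y = \int[mu]_y (EFin \o h)^\- y)%E.
 rewrite (@ge0_integral_affine _ (-1) (2*x)) ?oppr_eq0 ?oner_eq0 //.
 - rewrite preimage_setT normrN1 mul1e; apply: eq_integral => y _.
  by rewrite funeposE funenegE /= ho.
 - by apply: measurable_funepos; exact/mEFinP.
rewrite (_: (fun x => (EFin \o h)^\+ x)%E = (EFin \o h)^\+%E) in E * => //.
(* If both parts are infinite, [fine] returns 0 and the claim still holds. *)
by rewrite E; case: (\int[mu]_y _)%E => [r| |] //=; rewrite subrr.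
Qed.

Lemma conv0_far (D: set R) (k: R -> R) (x rho M: R) : measurable D -> (mu D < +oo)%E ->
 mfun R k -> 0<rho -> (forall y, `|k y| <= M) ->
 (forall y, `|x-y| < rho -> k y = 0) ->
 conv0 (fun e => \int[mu]_(y in D) (k y*cpoi e (x-y))).
Proof.
move=> mD Doo mk rho0 kM k0.
have M0: 0<=M by apply: le_trans (kM 0).
have mxy: mfun R (fun y => x-y) by exact: mfunB.
apply: (conv0_seq (l:=\int[mu]_(y in D) (k y*(x-y)^-1))) => s s0 sc.
have [] := @Rintegral_dominated _ _ _ mu D (fun n y => k y*cpoi (s n) (x-y))
  (fun y => k y*(x-y)^-1) (cst (M*rho^-1)) mD.
- move=> n; apply: mfunTS; apply: mfunM => //.
 by apply: m_cpoi.
- apply: mfunTS; apply: mfunM => //.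
 exact: (mcomp m_inv).
- by apply: (bounded_integrable (M:=`|M*rho^-1|)).
- apply: aeW => y _; have [h|h]:=ltP `|x-y| rho.
  by rewrite (k0 _ h) mul0r; under eq_cvg do rewrite mul0r; exact: cvg_cst.
 have t0: x-y != 0 by rewrite -normr_gt0 (lt_le_trans rho0).
 apply: cvgMr; rewrite /cpoi -[(x-y)^-1](_: (x-y)/(0^+2+(x-y)^+2) = _); last first.
  by rewrite expr0n /= add0r; field.
 apply: cvgMr; apply: cvgV; first by rewrite expr0n add0r sqrf_eq0.
 apply: cvgD; last exact: cvg_cst.
 by rewrite expr2; under eq_cvg do rewrite expr2; apply: cvgM.
- move=> n y _; rewrite normrM; have [h|h]:=ltP `|x-y| rho.
  by rewrite (k0 _ h) normr0 mul0r mulr_ge0 // invr_ge0 ltW.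
 apply: ler_pM => //; rewrite /cpoi normrM normfV.
 have t0: 0 < `|x-y| by exact: lt_le_trans h.
 have D0: 0<s n^+2+(x-y)^+2 by rewrite ltr_pwDl ?exprn_gt0 ?sqr_ge0.
 rewrite (gtr0_norm D0) ler_pdivrMr // mulrC ler_pdivlMr //.
 apply: (le_via (`|x-y| ^+ 2)); first by rewrite expr2 ler_pM2l.
 by rewrite real_normK ?num_real // lerDr sqr_ge0.
by [].
Qed.

Section Cells.
Variables (L K: R) (P A dA: R -> R).
Hypotheses (sP: smooth L K P) (AL: lipr L A) (mP: mfun R P)
 (mdA: mfun R dA) (dAL: forall x, `|dA x| <= L)
 (aed: {ae mu, forall x, diffat A x (dA x)}).

Let mxy x: mfun R (fun y => x-y). Proof. exact: mfunB. Qed.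
Let mPs x: mfun R (fun y => P (slp A x y)).
Proof. by apply: (mcomp mP); apply: (m_comp2 (m_slp AL)). Qed.
Let L0: 0<=L. Proof. exact: lipr_le0 AL. Qed.
Let PK x y: `|P (slp A x y)| <= K. Proof. by have [P1 _ _]:=sP; apply: P1; exact: slp_le. Qed.
Let K0: 0<=K. Proof. exact: le_trans (PK 0 0). Qed.

Definition flatT (a b c e x: R) : R:=\int[mu]_(y in `[a, b[) ((P (slp A x y)-P c)*cpoi e (x-y)).

Lemma flatT_bound (a b c e x B: R) : `|c| <= L -> 0<e ->
 (forall n, `|flatT a b c (qpos n) x| <= B) -> `|flatT a b c e x| <= B.
Proof.
move=> cL e0 H; have [u ue] := @qpos_seq R e e0.
have [N _ HN] : \forall n \near \oo, e/2<qpos (u n)<2*e.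
 move/cvgrPdist_lt: ue => /(_ (e/2)); rewrite divr_gt0 // => /(_ isT).
 apply: filterS => n; rewrite ltr_distlC => /andP[h1 h2]; apply/andP; split; lra.
have ucv: qpos (u (n+N)%N) @[n --> \oo] --> e by rewrite -(cvg_shiftn N) in ue.
have mk r: mfun R (fun y => (P (slp A x y)-P c)*cpoi r (x-y)).
 by apply: mfunM; [exact: mfunB|apply: m_cpoi].
have [] := @Rintegral_dominated _ _ _ mu `[a, b[
  (fun n y => (P (slp A x y)-P c)*cpoi (qpos (u (n+N)%N)) (x-y))
  (fun y => (P (slp A x y)-P c)*cpoi e (x-y)) (cst ((K+K)*(e/2)^-1)) (measurable_itv _).
- by move=> n; apply: mfunTS; exact: mk.
- by apply: mfunTS; exact: mk.
- by apply: (bounded_integrable (M:=`|(K+K)*(e/2)^-1|)) => //; exact: mu_itv_lty.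
- apply: aeW => y _; apply: cvgMr.
 rewrite /cpoi; apply: cvgMr; apply: cvgV.
  have [xy|xy]:=eqVneq (x-y) 0; first by rewrite xy expr0n addr0 sqrf_eq0 gt_eqF.
  by rewrite gt_eqF // ltr_wpDl ?sqr_ge0 // exprn_even_gt0.
 apply: cvgD; last exact: cvg_cst.
 by rewrite expr2; under eq_cvg do rewrite expr2; apply: cvgM.
- move=> n y _; have /andP[q1 q2]:=HN (n+N)%N (leq_addl _ _).
 rewrite normrM; apply: ler_pM => //.
  by apply: le_trans (ler_normB _ _) _; apply: lerD => //; have [P1 _ _]:=sP; exact: P1.
 apply: le_trans (cpoi_le2 _ (qpos_gt0 _)) _.
 by rewrite lef_pV2 ?posrE ?qpos_gt0 ?divr_gt0 // ltW.
move=> _ /cvg_norm cv.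
rewrite -(cvg_lim (@Rhausdorff R) cv); apply: limr_le; first by apply/cvg_ex; eexists; exact: cv.
by near=> n; exact: H.
Unshelve. all: end_near.
Qed.

Lemma m_flatT (a b c: R) (e: R -> R) : mfun R e ->
 mfun R (fun x => flatT a b c (e x) x).
Proof.
move=> me; pose W: set R:=`[a, b[%classic.
rewrite (_: (fun x => _) = fun x => \int[mu]_y ((P (slp A x y)-P c)*cpoi (e x) (x-y) * \1_W y)); last first.
 apply/funext => x; rewrite /flatT Rintegral_mkcond; congr Rintegral; apply/funext => y.
 by rewrite patchE indicE; case: (y \in W); rewrite ?mulr1 ?mulr0.
apply: (@m_Rintegral _ _ _ _ R mu (fun z: R*R => (P (slp A z.1 z.2)-P c)*cpoi (e z.1) (z.1-z.2) * \1_W z.2)).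
apply: mfunM; last by apply: mcomp => //; apply: measurable_indic; exact: measurable_itv.
apply: mfunM.
 by apply: mfunB => //; apply: (mcomp mP); exact: m_slp AL.
apply: m_cpoi; [exact: mcomp|exact: mfunB].
Qed.

Definition flatG (a b c x: R) : \bar R :=
 esups (fun n => (`|flatT a b c (qpos n) x * \1_(`[a, b[%classic) x| `^ 2)%:E) 0%N.

Lemma flatG_ge0 a b c x: (0<=flatG a b c x)%E.
Proof.
apply: le_trans (esups_ge (fun e => `|flatT a b c e x * \1_(`[a, b[%classic) x| `^ 2) 0).
by rewrite lee_fin powR_ge0.
Qed.

Lemma m_flatG a b c: mfun R (flatG a b c).
Proof.
apply: measurable_fun_esups => n; apply: m_powabs; apply: mfunM.
 exact: (m_flatT a b c (@measurable_cst _ _ _ _ _ _)).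
by apply: measurable_indic; exact: measurable_itv.
Qed.

Lemma flatG_bound a b c e x (B: R) : `|c| <= L -> 0<e -> x \in `[a, b[ -> (flatG a b c x<=(B^+2)%:E)%E ->
 0<=B -> `|flatT a b c e x| <= B.
Proof.
move=> cL e0 xI GB B0; apply: flatT_bound => // n.
have:=le_trans (esups_ge (fun e => `|flatT a b c e x * \1_(`[a, b[%classic) x| `^ 2) n) GB.
rewrite lee_fin indicE mem_set // mulr1 powR_mulrn // => h.
by rewrite -(ler_pXn2r (ltn0Sn 1)) ?nnegrE.
Qed.

End Cells.

(** [flat_window] holds for every variable radius, so [sup_select] upgrades it to the supremum over
    rational radii. *)
Lemma flatG_int (L K e: R) : 0<=L -> 0<=K -> 0<e ->
 exists2 C, 0<C & forall (P A dA: R -> R) (a b c: R),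
  smooth L K P -> lipr L A -> mfun R P -> a<b -> `|c| <= L ->
  mfun R dA -> (forall x, `|dA x| <= L) ->
  {ae mu, forall x, diffat A x (dA x)} ->
 (\int[mu]_x flatG P A a b c x <=
  (e*(b-a))%:E+C%:E * \int[mu]_(x in `[a, b[) ((dA x-c)^+2)%:E)%E.
Proof.
move=> L0 K0 e0; have [C C0 HC]:=flat_window L0 K0 e0.
have {}HC:=conj I HC.
exists C => // P A dA a b c sP AL mP ab cL mdA dAL aed.
apply: (sup_select (T:=fun r x => flatT P A a b c r x * \1_(`[a, b[%classic) x)) => //.
 move=> r mr; apply: mfunM; first exact: (m_flatT AL mP).
 by apply: measurable_indic; exact: measurable_itv.
move=> r r0 mr r00 rr.
have ba: b-a != 0 by rewrite subr_eq0 gt_eqF.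
have aed' : {ae mu, forall x, slp A x (x+(b-a)/n.+1%:R) @[n --> \oo] --> dA x}.
 by apply: ae_sub aed => x; exact: diffat_step.
apply: le_trans (HC.2 P A r dA a b r0 c sP AL mP mr ab r00 rr cL mdA dAL aed').
le_of_eq; rewrite [RHS]integral_mkcond.
apply: eq_integral => x _; rewrite patchE indicE /flatT.
case: (x \in `[a, b[%classic); last by rewrite mulr0 normr0 powR0.
by rewrite mulr1 powR_mulrn // real_normK // num_real.
Qed.
End Flat.

(** * Partition of a window into cells *)

Section Cells2.
Context {R: realType}.
Local Notation mu:=(@lebesgue_measure R).

Definition cell (a h: R) (i: nat) : set R:=`[a+i%:R*h, a+i%:R*h+h[%classic.

Lemma cell_disj (a h x: R) i j: 0<h -> cell a h i x -> cell a h j x -> i = j.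
Proof.
move=> h0; rewrite /cell /= !in_itv /= => /andP[i1 i2] /andP[j1 j2].
have H k l: a+k%:R*h<=x -> x<a+l%:R*h+h -> (k<=l)%N.
 move=> k1 l2; rewrite -ltnS -(ltr_nat R) -(ltr_pM2r h0) -natr1 mulrDl mul1r; lra.
by apply/eqP; rewrite eqn_leq (H i j) // (H j i).
Qed.

Lemma cell_sum (V: nmodType) (a h x: R) (n i: nat) (g: nat -> R) : 0<h -> (i<n)%N -> cell a h i x ->
 \sum_(0<=j<n) g j * \1_(cell a h j) x = g i.
Proof.
move=> h0 il ci; rewrite (bigD1_seq i) ?mem_index_iota ?iota_uniq //=.
rewrite indicE mem_set // mulr1 big1 ?addr0 // => j ji.
rewrite indicE memNset ?mulr0 // => cj; move: ji.
by rewrite (cell_disj h0 ci cj) eqxx.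
Qed.

Lemma integral_cells (a h: R) (n: nat) (f: R -> \bar R) : 0<=h ->
 mfun R f -> (forall x, (0<=f x)%E) ->
 (\int[mu]_(x in `[a, (a+n%:R*h)%R[) f x = \sum_(0<=i<n) \int[mu]_(x in cell a h i) f x)%E.
Proof.
move=> h0 mf f0; rewrite integral_tile // ge0_integral_sum //; last first.
 by move=> i; apply: mfunTS; apply: mcomp => //; exact: mfunD.
apply: eq_big_nat => i _; rewrite /cell.
have := @integral_tile R (a+i%:R*h) h 1 f h0 mf f0.
by rewrite mul1r => ->; under [RHS]eq_integral do rewrite big_nat1 mul0r addr0.
Qed.
End Cells2.

Lemma integrable_addr d (T: measurableType d) (R: realType) (m: {measure set T -> \bar R})
  (D: set T) (f g: T -> R) : measurable D -> m.-integrable D (EFin \o f) ->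
 m.-integrable D (EFin \o g) -> m.-integrable D (EFin \o (fun x => f x+g x)).
Proof.
move=> mD fi gi; have:=integrableD mD fi gi.
by apply: eq_integrable => // x _; rewrite /= EFinD.
Qed.

Lemma ae_and d (T: measurableType d) (R: realType) (m: {measure set T -> \bar R}) (P Q: T -> Prop) :
 {ae m, forall x, P x} -> {ae m, forall x, Q x} -> {ae m, forall x, P x /\ Q x}.
Proof. by move=> aP aQ; exact: (@filterI _ _ (ae_filter_ringOfSetsType m) _ _ aP aQ). Qed.

(** * Principal values of the kernel on a window *)

Section VConv.
Context {R: realType}.
Local Notation mu:=(@lebesgue_measure R).
Variables (L K: R) (P A dA: R -> R).
Hypotheses (sP: smooth L K P) (AL: lipr L A) (mP: mfun R P)
 (mdA: mfun R dA) (dAL: forall x, `|dA x| <= L)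
 (aed: {ae mu, forall x, diffat A x (dA x)}).

Let mxy x: mfun R (fun y => x-y). Proof. exact: mfunB. Qed.
Let mPs x: mfun R (fun y => P (slp A x y)).
Proof. by apply: (mcomp mP); apply: (m_comp2 (m_slp AL)). Qed.
Let L0: 0<=L. Proof. exact: lipr_le0 AL. Qed.
Let PK x y: `|P (slp A x y)| <= K. Proof. by have [P1 _ _]:=sP; apply: P1; exact: slp_le. Qed.
Let K0: 0<=K. Proof. exact: le_trans (PK 0 0). Qed.

(** The straddle lemma: a quotient over an interval containing [x] is a convex combination of
    quotients with one end at [x]. The ends of a cell may thus approach [x] unevenly. *)
Lemma diffat_straddle x d e: 0<e -> diffat A x d -> exists2 del, 0<del &
 forall u v, u<=x -> x<=v -> u<v -> v-u<del -> `|slp A u v-d| <= e.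
Proof.
move=> e0 /(_ _ e0)[del del0 H]; exists del => // u v ux xv uv uvd.
have E: (A v-A u)-d*(v-u) = ((A v-A x)-d*(v-x))+((A x-A u)-d*(x-u)) by ring.
have h1: `|(A v-A x)-d*(v-x)| <= e*(v-x).
 move: xv; rewrite le_eqVlt => /predU1P[<-|xv]; first by rewrite !subrr !mulr0 subrr normr0.
 have:=H v; rewrite (gtr0_norm (_: 0<v-x)) ?subr_gt0 // => /(_ _ _)/ltW.
 rewrite gt_eqF // => /(_ _ isT) h.
 have vx: 0<v-x by rewrite subr_gt0.
 have -> : A v-A x-d*(v-x) = (slp A x v-d)*(v-x) by rewrite /slp; field; rewrite gt_eqF.
 rewrite normrM (gtr0_norm vx) ler_pM2r //; apply: h; lra.
have h2: `|(A x-A u)-d*(x-u)| <= e*(x-u).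
 move: ux; rewrite le_eqVlt => /predU1P[->|ux]; first by rewrite !subrr !mulr0 subrr normr0.
 have:=H u; rewrite (ltr0_norm (_: u-x<0)) ?subr_lt0 // => /(_ _ _)/ltW.
 rewrite lt_eqF // => /(_ _ isT) h.
 have vx: 0<x-u by rewrite subr_gt0.
 have -> : A x-A u-d*(x-u) = (slp A x u-d)*(x-u).
  by rewrite /slp; field; rewrite subr_eq0 lt_eqF.
 rewrite normrM (gtr0_norm vx) ler_pM2r //; apply: h; lra.
have vu: 0<v-u by rewrite subr_gt0.
have -> : slp A u v-d = ((A v-A u)-d*(v-u))/(v-u) by rewrite /slp; field; rewrite gt_eqF.
rewrite normrM normfV (gtr0_norm vu) ler_pdivrMr // E.
apply: le_trans (ler_normD _ _) _; apply: le_trans (lerD h1 h2) _.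
by rewrite -mulrDr (_: v-x+(x-u) = v-u) //; ring.
Qed.

(** The window is cut into cells, and on each of them the slope is compared with that of the chord.
    The chord slopes converge to the derivative, so by [flatG_int] the maximal truncations of the
    differences have arbitrarily small integral; at almost every [x] some mesh therefore leaves an
    error below [eta]. What remains is a constant times an odd kernel on a ball, which integrates to
    0, plus kernels vanishing near [x]. *)
Lemma V_conv (a b: R) : a<b ->
 {ae mu, forall x, a<x<b -> conv0 (fun e => \int[mu]_(y in `[a, b[) (P (slp A x y)*cpoi e (x-y)))}.
Proof.
move=> ab.
pose h n: R:=(b-a)/n.+1%:R.
have h0 n: 0<h n by rewrite divr_gt0 // subr_gt0.
have bE n: a+n.+1%:R*h n = b by rewrite /h mulrC divfK ?gt_eqF //; ring.
pose al n i: R:=a+i%:R*h n.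
pose c n i:=slp A (al n i) (al n i+h n).
have cL n i: `|c n i| <= L by exact: slp_le.
pose G n x:=(\sum_(0<=i<n.+1) flatG P A (al n i) (al n i+h n)%R (c n i) x)%E.
have mG n: mfun R (G n).
 by apply: emeasurable_sum => i; exact: (m_flatG AL mP).
have G0 n x: (0<=G n x)%E by apply: sume_ge0 => i _; exact: flatG_ge0.
pose D n x:=\sum_(0<=i<n.+1) (dA x-c n i)^+2 * \1_(cell a (h n) i) x.
have mcell n i: measurable (cell a (h n) i) by exact: measurable_itv.
have mD n: mfun R (D n).
 apply: measurable_sum => i; apply: mfunM; last by apply: measurable_indic.
 by apply: mfunX; exact: mfunB.
pose W: set R:=`[a, b[%classic.
have mW: measurable W by exact: measurable_itv.
have Wcell n x: W x -> exists2 i, (i<n.+1)%N & cell a (h n) i x.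
 move=> Wx; have [i [th [il /andP[th0 th1] ->]]] := @grid_point R a b x n.+1 ab isT Wx.
 rewrite -/(h n) in th1 *.
 by exists i => //; rewrite /cell /= in_itv /=; apply/andP; split; lra.
have Dx n x i: (i<n.+1)%N -> cell a (h n) i x -> D n x = (dA x-c n i)^+2.
 by move=> il ci; rewrite /D (cell_sum nat (fun i => (dA x-c n i)^+2) (h0 n) il ci).
have sq (u: R) B: `|u| <= B -> u^+2<=B^+2.
 by move=> uB; rewrite -(real_normK (num_real u)) ler_pXn2r ?nnegrE // (le_trans _ uB).
have DB n x: W x -> `|D n x| <= (2*L)^+2.
 move=> /(Wcell n)[i il ci]; rewrite (Dx _ _ _ il ci) ger0_norm ?sqr_ge0 //; apply: sq.
 by apply: le_trans (ler_normB _ _) _; have:=dAL x; have:=cL n i; lra.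
have hc: h n @[n --> \oo] --> 0.
 by rewrite -(mulr0 (b-a)); apply: cvgMr; exact: cvg_harmonic.
have Dc: {ae mu, forall x, W x -> D n x @[n --> \oo] --> 0}.
 apply: ae_sub aed => x dx Wx; apply/cvgrPdist_le => e e0.
 have se: 0<Num.sqrt e by rewrite sqrtr_gt0.
 have [del del0 Hd]:=diffat_straddle se dx.
 move/cvgrPdist_lt: hc => /(_ _ del0); apply: filterS => n.
 rewrite sub0r normrN (gtr0_norm (h0 n)) => hd.
 have [i il ci]:=Wcell n x Wx.
 rewrite sub0r normrN (Dx _ _ _ il ci) ger0_norm ?sqr_ge0 //.
 rewrite -(sqr_sqrtr (ltW e0)); apply: sq; rewrite distrC; apply: Hd.
 - by move: ci; rewrite /cell /= in_itv /= => /andP[].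
 - by move: ci; rewrite /cell /= in_itv /= => /andP[_ /ltW].
 - by rewrite ltrDl.
 - by rewrite addrAC subrr add0r.
have DI: (\int[mu]_(x in W) (D n x)%:E)%E @[n --> \oo] --> 0%E.
 have [] := @dominated_convergence _ _ _ mu W mW (fun n x => (D n x)%:E) (cst 0%E) (cst ((2*L)^+2)%:E).
 - by move=> n; apply: mfunTS; apply/mEFinP; exact: mD.
 - exact: mcst.
 - by apply: ae_sub Dc => x cx Wx; apply: cvg_EFin; [near=> n|exact: cx].
 - by apply: (@bounded_integrable R W (fun=> (2*L)^+2) `|(2*L)^+2|) => //; exact: mu_itv_lty.
 - by apply: aeW => x n Wx; rewrite abse_EFin lee_fin; exact: DB.
 by move=> _ _; rewrite integral0.
have GI (e: R) : 0<e -> exists n, (\int[mu]_x G n x<=e%:E)%E.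
 move=> e0; have ba: 0<b-a by rewrite subr_gt0.
 have e1: 0<e/2/(b-a) by rewrite !divr_gt0.
 have [C C0 HC]:=flatG_int L0 K0 e1.
 have e2: 0<e/2/C by rewrite !divr_gt0.
 have [n Hn] : exists n, (\int[mu]_(x in W) (D n x)%:E<=(e/2/C)%:E)%E.
  have /fine_cvgP[_ /cvgrPdist_lt /(_ _ e2)]:=DI.
  case=> N _ HN; exists N; have:=HN N (leqnn N); rewrite /= sub0r normrN => hN.
  have fn: (\int[mu]_(x in W) (D N x)%:E)%E \is a fin_num.
  apply: integrable_fin_num => //.
  apply: (bounded_integrable (M:=(2*L)^+2)) => //; first exact: mu_itv_lty.
  by apply: mfunTS; exact: mD.
  by move=> x; exact: DB.
  by rewrite -(fineK fn) lee_fin; apply: le_trans (ler_norm _) (ltW hN).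
 exists n; rewrite ge0_integral_sum //; last 2 first.
 - by move=> i; exact: (m_flatG AL mP).
 - by move=> i x _; exact: flatG_ge0.
 apply: (le_via (\sum_(0<=i<n.+1) ((e/2/(b-a)*h n)%:E+C%:E * \int[mu]_(x in cell a (h n) i) (D n x)%:E))%E).
  rewrite !big_nat; apply: lee_sum => i /andP[_ il].
  have lt1: al n i<al n i+h n by rewrite ltrDl.
  apply: le_trans (HC P A dA _ _ (c n i) sP AL mP lt1 (cL n i) mdA dAL aed) _.
  rewrite (_: al n i+h n-al n i = h n); last by ring.
  le_of_eq; congr (_+_*_)%E.
  by apply: eq_integral => x /set_mem cx; rewrite (Dx _ _ _ il cx).
 rewrite big_split /= -ge0_sume_distrr; last first.
  move=> i _; apply: integral_ge0 => x cx; rewrite lee_fin.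
  by apply: sumr_ge0 => j _; rewrite mulr_ge0 ?sqr_ge0.
 rewrite -integral_cells ?(ltW (h0 n)) //; last 2 first.
 - by apply/mEFinP; exact: mD.
 - by move=> x; rewrite lee_fin; apply: sumr_ge0 => j _; rewrite mulr_ge0 ?sqr_ge0.
 rewrite bE sumEFin sumr_const_nat subn0.
 apply: (le_via ((e/2)%:E+C%:E*(e/2/C)%:E)%E).
  apply: leeD; last by apply: lee_wpmul2l => //; rewrite lee_fin ltW.
  rewrite lee_fin -[leLHS]mulr_natl.
  rewrite (_: n.+1%:R*_ = e/2/(b-a)*(a+n.+1%:R*h n-a)); last by ring.
  by rewrite bE divfK // gt_eqF.
 rewrite -EFinM -EFinD lee_fin (_: C*(e/2/C) = e/2); [lra|by field; rewrite gt_eqF].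
have sm: {ae mu, forall x, forall e: R, 0<e -> exists n, (G n x<e%:E)%E} by apply: small_ae.
(* Off the countable set of cell ends, [x] is the centre of a ball inside its cell, on which oddness
   can be used. *)
have nogrid: {ae mu, forall x, forall n i: nat, x != al n i}.
 apply: ae_foralln => n; apply: ae_foralln => i.
 exists [set al n i]; split; [exact: measurable_set1|exact: lebesgue_measure_set1|].
 by move=> x /= /negP; rewrite negbK => /eqP.
apply: (ae_sub _ (ae_and sm nogrid)) => x [Gx ng] /andP[ax xb].
have Wx: W x by rewrite /W /= in_itv /= (ltW ax).
apply: conv0_approx => eta eta0.
have [n Gn]:=Gx (eta^+2) (exprn_gt0 2 eta0).
have [i il ci]:=Wcell n x Wx.
set I: set R:=cell a (h n) i; have mI: measurable I by exact: mcell.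
have lo: al n i<x.
 by have:=ng n i; move: ci; rewrite /cell /= in_itv /= -/(al n i) => /andP[+ _]; rewrite le_eqVlt eq_sym => /orP[/eqP->|//]; rewrite eqxx.
have hi: x<al n i+h n by move: ci; rewrite /cell /= in_itv /= => /andP[].
pose rho:=Num.min (x-al n i) (al n i+h n-x).
have rho0: 0<rho by rewrite lt_min !subr_gt0 lo hi.
have ballI y: `|x-y| < rho -> I y.
 rewrite lt_min !ltr_norml => /andP[/andP[h1 h2] /andP[h3 h4]].
 by rewrite /I /cell /= in_itv /= -/(al n i); apply/andP; split; lra.
have IW y: I y -> W y.
 rewrite /I /cell /W /= !in_itv /= => /andP[y1 y2].
 have il' : i.+1%:R*h n<=n.+1%:R*h n by rewrite ler_wpM2r ?(ltW (h0 n)) // ler_nat.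
 have:=bE n; have i0: 0<=i%:R*h n by rewrite mulr_ge0 // ltW.
 by move: il'; rewrite -(natr1 i) mulrDl mul1r => *; apply/andP; split; lra.
pose b1 y: R:=(`|x-y| < rho)%R%:R.
have mb1: mfun R b1.
 apply: m_bool_real; apply: measurable_fun_ltr => //.
 exact: mnorm.
(* The kernel is the sum of [k1] outside the cell, [k2] in the cell off the ball, [k3] the
   difference from the chord in the cell, and [k4] the chord value on the ball. *)
pose k1 y:=P (slp A x y) * \1_(W `\` I) y.
pose k2 y:=P (c n i)*(\1_I y-b1 y).
have mk1: mfun R k1.
 by apply: mfunM => //; apply: measurable_indic; exact: measurableD.
have mk2: mfun R k2.
 by apply: mfunM => //; apply: mfunB => //; exact: measurable_indic.
have i01 (S: set R) y: `|\1_S y: R| <= 1 by rewrite indicE; case: (y \in S); rewrite ?normr1 ?normr0.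
have Wlt: (mu W < +oo)%E by exact: mu_itv_lty.
have PcK: `|P (c n i)| <= K by have [P1 _ _]:=sP; exact: P1.
have far1: conv0 (fun e => \int[mu]_(y in W) (k1 y*cpoi e (x-y))).
 apply: (conv0_far (rho:=rho) (M:=K)) => //.
  by move=> y; rewrite normrM -[K]mulr1; apply: ler_pM.
 by move=> y /ballI Iy; rewrite /k1 indicE memNset ?mulr0 // => -[].
have far2: conv0 (fun e => \int[mu]_(y in W) (k2 y*cpoi e (x-y))).
 apply: (conv0_far (rho:=rho) (M:=K*2)) => //.
  move=> y; rewrite normrM; apply: ler_pM => //; apply: le_trans (ler_normB _ _) _.
  rewrite (_: 2 = 1+1)//; apply: lerD => //; rewrite /b1; case: (_<_); by rewrite ?normr1 ?normr0.
 move=> y yr; rewrite /k2 /b1 yr indicE mem_set; last exact: ballI.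
 by rewrite subrr mulr0.
exists (fun e => \int[mu]_(y in W) (k1 y*cpoi e (x-y)) + \int[mu]_(y in W) (k2 y*cpoi e (x-y))), 1.
split; [exact: conv0D far1 far2|exact: ltr01|].
move=> e e0 _.
have mc: mfun R (fun y => cpoi e (x-y)) by apply: m_cpoi.
have ik (k: R -> R) M: mfun R k -> (forall y, `|k y| <= M) ->
  mu.-integrable W (EFin \o (fun y => k y*cpoi e (x-y))).
 move=> mk kM; apply: (bounded_integrable (M:=M*e^-1)) => //.
  by apply: mfunTS; exact: mfunM.
 move=> y _; rewrite (normrM (k y)); apply: ler_pM => //; exact: cpoi_le2.
have k1M y: `|k1 y| <= K by rewrite normrM -[K]mulr1; apply: ler_pM.
have b1M y: `|b1 y| <= 1 by rewrite /b1; case: (_<_); rewrite ?normr1 ?normr0.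
have k2M y: `|k2 y| <= K*2.
 rewrite normrM; apply: ler_pM => //; apply: le_trans (ler_normB _ _) _.
 by rewrite (_: 2 = 1+1)//; apply: lerD.
pose k3 y:=(P (slp A x y)-P (c n i)) * \1_I y.
have mk3: mfun R k3.
 by apply: mfunM; [exact: mfunB|exact: measurable_indic].
have k3M y: `|k3 y| <= (K+K)*1.
 by rewrite normrM; apply: ler_pM => //; apply: le_trans (ler_normB _ _) _; apply: lerD.
pose k4 y:=P (c n i)*b1 y.
have mk4: mfun R k4 by exact: mfunM.
have k4M y: `|k4 y| <= K*1 by rewrite normrM; apply: ler_pM.
have k5M y: `|P (slp A x y)| <= K by exact: PK.
have odd0: \int[mu]_(y in W) (k4 y*cpoi e (x-y)) = 0.
 rewrite Rintegral_mkcond.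
 rewrite (_: _ \_ W = fun y => k4 y*cpoi e (x-y)); last first.
  apply/funext => y; rewrite patchE; case: ifPn => // /negP yW.
  rewrite /k4 /b1 ltNge; case: leP => [_|yr]; first by rewrite mulr0 mul0r.
  by exfalso; apply: yW; apply/mem_set; apply: IW; exact: ballI.
 apply: (odd_integral0 (x:=x)); first exact: mfunM.
 move=> y; rewrite /k4 /b1 (_: x-(-1*y+2*x) = - (x-y)); last by ring.
 by rewrite normrN /cpoi sqrrN; ring.
have E: \int[mu]_(y in W) (P (slp A x y)*cpoi e (x-y)) -
  (\int[mu]_(y in W) (k1 y*cpoi e (x-y)) + \int[mu]_(y in W) (k2 y*cpoi e (x-y))) =
  flatT P A (al n i) (al n i+h n) (c n i) e x.
 have -> : flatT P A (al n i) (al n i+h n) (c n i) e x = \int[mu]_(y in W) (k3 y*cpoi e (x-y)).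
  rewrite /flatT -/(cell a (h n) i) -/I Rintegral_mkcond [RHS]Rintegral_mkcond; congr Rintegral.
  apply/funext => y; rewrite !patchE /k3 indicE.
  case: ifPn => yI; first by rewrite mem_set ?mulr1 //; apply: IW; exact/set_mem.
  by rewrite mulr0 mul0r if_same.
 have i1:=ik _ _ mk1 k1M; have i2:=ik _ _ mk2 k2M; have i3:=ik _ _ mk3 k3M; have i4:=ik _ _ mk4 k4M.
 have i34 := @integrable_addr _ _ _ mu W (fun y => k3 y*cpoi e (x-y)) (fun y => k4 y*cpoi e (x-y)) mW i3 i4.
 have i234 := @integrable_addr _ _ _ mu W (fun y => k2 y*cpoi e (x-y))
  (fun y => k3 y*cpoi e (x-y)+k4 y*cpoi e (x-y)) mW i2 i34.
 have -> : \int[mu]_(y in W) (P (slp A x y)*cpoi e (x-y)) = \int[mu]_(y in W)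
  (k1 y*cpoi e (x-y)+(k2 y*cpoi e (x-y)+(k3 y*cpoi e (x-y)+k4 y*cpoi e (x-y)))).
  apply: eq_Rintegral => y /[dup] yW /set_mem Wy; rewrite /k1 /k2 /k3 /k4 !indicE in_setD yW /=.
  by case: (y \in I) => /=; ring.
 rewrite RintegralD // RintegralD // RintegralD // odd0; ring.
rewrite E; apply: (flatG_bound sP AL mP) => //.
- apply: le_trans (ltW Gn); rewrite /G (bigD1_seq i) ?mem_index_iota ?iota_uniq //=.
 by rewrite leeDl // sume_ge0 // => j _; exact: flatG_ge0.
- exact: ltW.
Unshelve. all: end_near.
Qed.
End VConv.

(** * Blow-up at a point of differentiability *)

Section PV.
Context {R: realType}.
Local Notation mu:=(@lebesgue_measure R).

Lemma Rintegral_affine (c b: R) (f: R -> R) : c != 0 -> mfun R f ->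
 mu.-integrable [set: R] (EFin \o f) ->
 \int[mu]_x f x = `|c| * \int[mu]_x f (c*x+b).
Proof.
move=> c0 mf fi.
have maff: mfun R (fun x => c*x+b) by exact: m_affine.
have mfa: mfun R (fun x => f (c*x+b)) by exact: (mcomp mf).
have n0: 0 < `|c| by rewrite normr_gt0.
have fia: mu.-integrable [set: R] (EFin \o (fun x => f (c*x+b))).
 apply/integrableP; split; first exact/mEFinP.
 have /integrableP[_]:=fi; rewrite (@ge0_integral_affine _ c b) //; last first.
  by apply: mcomp => //; exact/mEFinP.
 rewrite preimage_setT; move=> h; rewrite ltNge; apply/negP => h2; move: h; rewrite ltNge => /negP; apply.
 have -> : (\int[mu]_x `|(EFin \o f) (c*x+b)%R| = +oo)%E by apply/eqP; rewrite -leye_eq.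
 by rewrite gt0_muley ?lte_fin.
have Eq: (\int[mu]_x (f x)%:E = `|c|%:E * \int[mu]_x (f (c*x+b)%R)%:E)%E; last first.
 by rewrite /Rintegral Eq fineM // (integrable_fin_num measurableT fia).
rewrite integralE [X in (_*X)%E]integralE.
have fp: (\int[mu]_x (EFin \o f)^\+ x = `|c|%:E * \int[mu]_x (EFin \o (fun x => f (c*x+b)%R))^\+ x)%E.
 rewrite (@ge0_integral_affine _ c b) // ?preimage_setT //.
  by congr (_*_)%E; apply: eq_integral => t _; rewrite !funeposE.
 by apply: measurable_funepos; exact/mEFinP.
have fn: (\int[mu]_x (EFin \o f)^\- x = `|c|%:E * \int[mu]_x (EFin \o (fun x => f (c*x+b)%R))^\- x)%E.
 rewrite (@ge0_integral_affine _ c b) // ?preimage_setT //.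
  by congr (_*_)%E; apply: eq_integral => t _; rewrite !funenegE.
 by apply: measurable_funeneg; exact/mEFinP.
rewrite [LHS](_: _ = \int[mu]_x (EFin \o f)^\+ x - \int[mu]_x (EFin \o f)^\- x)%E // fp fn.
have pf: (\int[mu]_x (EFin \o (fun x => f (c*x+b)%R))^\+ x)%E \is a fin_num.
 exact: (integrable_pos_fin_num measurableT fia).
by apply/esym; apply: muleBr => //; exact: fin_num_adde_defr.
Qed.

Section Sharp0.
Variables (L K: R) (P A: R -> R).
Hypotheses (sP: smooth L K P) (AL: lipr L A) (mP: mfun R P).

Let mxy x: mfun R (fun y => x-y). Proof. exact: mfunB. Qed.
Let mPs x: mfun R (fun y => P (slp A x y)).
Proof. by apply: (mcomp mP); apply: (m_comp2 (m_slp AL)). Qed.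
Let mpoi r x: mfun R (fun y => poi r (x-y)).
Proof. by apply: m_poi; [exact: mcst|exact: mxy]. Qed.
Let L0: 0<=L. Proof. exact: lipr_le0 AL. Qed.
Let PK x y: `|P (slp A x y)| <= K. Proof. by have [P1 _ _]:=sP; apply: P1; exact: slp_le. Qed.
Let K0: 0<=K. Proof. exact: le_trans (PK 0 0). Qed.

Lemma sharp0_close (e t q: R) : 0<e -> `|q| <= L ->
 `|(e <= `|t| * Num.sqrt (1+q^+2))%R%:R/t-cpoi e t| <= (L+1)*poi e t.
Proof.
move=> e0 qL; have:=sqrt_slope_bounds qL; move: (Num.sqrt _) => s /andP[s1 s2].
have p0 := @poi_ge0 R e t e0.
have [b|b]:=leP e (`|t| * s); last first.
 have te: `|t| <= e by apply: le_trans (ltW b); rewrite ler_peMr.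
 rewrite mul0r sub0r normrN; have:=cpoi_poi e0 te (lexx e).
 have: 0<=L*poi e t by rewrite mulr_ge0.
 by rewrite mulrDl; lra.
have t0: t != 0 by apply: contraTneq b => ->; rewrite normr0 mul0r -ltNge.
rewrite mul1r cpoi_inv // normrM (ger0_norm p0) ler_wpM2r // normrM normfV (gtr0_norm e0).
rewrite ler_pdivrMr ?normr_gt0 //; apply: le_trans b _.
by rewrite mulrC ler_wpM2r //; lra.
Qed.

Definition trk e x y: R:=(trunc A e x y)%:R.

Lemma m_trk e x: mfun R (trk e x).
Proof.
apply: m_bool_real; exact: (m_comp2 (m_trunc e AL)).
Qed.

Lemma trk_le e x y: `|trk e x y| <= 1.
Proof. by rewrite /trk; case: trunc; rewrite ?normr1 ?normr0. Qed.

Lemma trk_cvg x y (s: nat -> R) : y != x -> s n @[n --> \oo] --> 0 -> trk (s n) x y @[n --> \oo] --> (1: R).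
Proof.
move=> yx sc; apply: cvg_near_cst.
have t0: 0 < `|x-y| by rewrite normr_gt0 subr_eq0 eq_sym.
move/cvgrPdist_lt: sc => /(_ _ t0); apply: filterS => n; rewrite sub0r normrN => h.
rewrite /trk /trunc (_: _<=_ = true) //.
apply: le_trans (ler_norm _) _; apply: le_trans (ltW h) _.
by rewrite ler_peMr //; have /andP[]:=sqrt_slope_bounds (slp_le x y AL L0).
Qed.

(** The substitution [y = x - e * u] turns the difference between sharp and smooth truncation into
    an integral over a fixed scale, which converges to the same integral for the tangent line of
    slope [d]. The Poisson bound of [sharp0_close] rescales to a fixed dominating function. *)
Lemma blowup (g: R -> R) (M x d: R) : mfun R g -> (forall y, `|g y| <= M) ->
 {for x, continuous g} -> diffat A x d -> `|d| <= L ->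
 conv0 (fun e => \int[mu]_y (P (slp A x y)*(trk e x y/(x-y)-cpoi e (x-y))*g y)).
Proof.
move=> mg gM gc dx dL.
have M0: 0<=M by apply: le_trans (gM 0).
have KM: 0<=K*(L+1)*M by rewrite !mulr_ge0 ?addr_ge0.
pose q (e u: R):=slp A x ((- e)*u+x).
pose bb (q u: R) : R:=(1 <= `|u| * Num.sqrt (1+q^+2))%R%:R.
pose Phi e u:=P (q e u)*(bb (q e u) u/u-cpoi 1 u)*g ((- e)*u+x).
pose Phi0 u:=P d*(bb d u/u-cpoi 1 u)*g x.
have mk e: mfun R (fun y => P (slp A x y)*(trk e x y/(x-y)-cpoi e (x-y))*g y).
 apply: mfunM => //; apply: mfunM => //; apply: mfunB.
  by apply: mfunM; [exact: m_trk|exact: (mcomp m_inv)].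
 by apply: m_cpoi.
have maff e: mfun R (fun u: R => - e*u+x) by exact: m_affine.
pose F e y:=P (slp A x y)*(trk e x y/(x-y)-cpoi e (x-y))*g y.
have FPhi e u: 0<e -> e*F e (- e*u+x) = Phi e u.
 move=> e0; rewrite /F /Phi /trk /trunc -/(q e u) /bb.
 rewrite (_: x-(- e*u+x) = e*u); last by ring.
 have -> : (e <= `|e*u| * Num.sqrt (1+q e u^+2)) = (1 <= `|u| * Num.sqrt (1+q e u^+2)).
  by rewrite normrM (gtr0_norm e0) -mulrA -[X in X<=_]mulr1 ler_pM2l.
 rewrite (_: cpoi e (e*u) = e^-1*cpoi 1 u); last first.
  by rewrite -[1](mulfV (lt0r_neq0 e0)) -cpoi_scale // mulrA mulVf ?mul1r ?gt_eqF.
 rewrite invfM; move: (g _) (P _) (cpoi 1 u) (_%:R) => G Q W B.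
 rewrite (_: e*(Q*(B*(e^-1*u^-1)-e^-1*W)*G) = (e*e^-1)*(Q*(B*u^-1-W)*G)); last by ring.
 by rewrite mulfV ?gt_eqF // mul1r.
have ip e: 0<e -> mu.-integrable [set: R] (EFin \o (fun y => (K*(L+1)*M)*poi e (x-y))).
 move=> e0; have i1: mu.-integrable [set: R] (EFin \o (fun y => poi 1 (x-y))).
  apply/integrableP; split.
  by apply/mEFinP; exact: mpoi.
  apply: le_lt_trans (poi1_lty x); le_of_eq.
  by apply: eq_integral => y _; rewrite /= ger0_norm // poi_ge0.
 have i2:=integrableZl measurableT (K*(L+1)*M*(e+e^-1)) i1.
 apply: (le_integrable measurableT _ _ i2).
  by apply/mEFinP; apply: mfunM; [exact: mcst|exact: mpoi].
 move=> y _ /=; rewrite lee_fin ger0_norm; last by apply: mulr_ge0 => //; exact: poi_ge0.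
 apply: le_trans (ler_norm _); rewrite -[leRHS]mulrA; apply: ler_wpM2l => //; exact: poi_le1.
have FM e y: 0<e -> `|F e y| <= K*(L+1)*M*poi e (x-y).
 move=> e0; rewrite /F (normrM _ (g y)) (normrM (P _)).
 rewrite (_: K*(L+1)*M*poi e (x-y) = K*((L+1)*poi e (x-y))*M); last by move: (poi _ _) => z; ring.
 apply: ler_pM => //; apply: ler_pM => //; apply: sharp0_close => //; exact: slp_le.
have iF e: 0<e -> mu.-integrable [set: R] (EFin \o F e).
 move=> e0; apply: (le_integrable measurableT _ _ (ip e e0)); first by apply/mEFinP; exact: mk.
 by move=> y _ /=; rewrite lee_fin; apply: le_trans (FM e y e0) (ler_norm _).
have mPhi e: 0<e -> mfun R (Phi e).
 move=> e0; rewrite (_: Phi e = fun u => e*F e (- e*u+x)); last by apply/funext => u; rewrite FPhi.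
 by apply: mfunM => //; apply: (mcomp (mk e)).
have PhiM e u: 0<e -> `|Phi e u| <= K*(L+1)*M*poi 1 (0-u).
 move=> e0; rewrite -FPhi // normrM (gtr0_norm e0).
 apply: le_trans (ler_wpM2l (ltW e0) (FM e (- e*u+x) e0)) _.
 rewrite mulrCA ler_wpM2l // (_: x-(- e*u+x) = e*u); last by ring.
 by rewrite poi_scale // divff ?gt_eqF // sub0r /poi sqrrN.
have ip0: mu.-integrable [set: R] (EFin \o (fun u => K*(L+1)*M*poi 1 (0-u))).
 apply/integrableP; split.
  by apply/mEFinP; apply: mfunM; [exact: mcst|exact: mpoi].
 rewrite [ltLHS](_: _ = (\int[mu]_u ((K*(L+1)*M)%:E*(poi 1 (0-u)%R)%:E)))%E; last first.
  by apply: eq_integral => y _; rewrite /= ger0_norm ?EFinM //; apply: mulr_ge0 => //; exact: poi_ge0.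
 rewrite ge0_integralZl_EFin //.
 - by rewrite lte_mul_pinfty ?lee_fin // poi1_lty.
 - by move=> y _; rewrite lee_fin poi_ge0.
 - by apply/mEFinP; exact: mpoi.
have E e: 0<e -> \int[mu]_y F e y = \int[mu]_u Phi e u.
 move=> e0; rewrite (@Rintegral_affine (- e) x) ?oppr_eq0 ?gt_eqF //; [|exact: mk|exact: iF].
 rewrite normrN (gtr0_norm e0) -RintegralZl //.
  by apply: eq_Rintegral => u _; rewrite FPhi.
 have i0: mu.-integrable [set: R] (EFin \o Phi e).
  apply: (le_integrable measurableT _ _ ip0); first by apply/mEFinP; exact: mPhi.
  by move=> y _ /=; rewrite lee_fin; apply: le_trans (PhiM e y e0) (ler_norm _).
 have:=integrableZl measurableT e^-1 i0; apply: eq_integrable => // u _ /=.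
 by rewrite -EFinM -FPhi // mulrA mulVf ?mul1r ?gt_eqF.
apply: (conv0_seq (l:=\int[mu]_u Phi0 u)) => s s0 sc.
rewrite (_: (fun n => _) = (fun n => \int[mu]_u Phi (s n) u)); last by apply/funext => n; exact: E.
have ac u: - s n*u+x @[n --> \oo] --> x.
 rewrite -[X in _ --> X]add0r; apply: cvgD; last exact: cvg_cst.
 by rewrite -(mul0r u) -oppr0; apply: cvgMl; exact: cvgN.
have qc u: u != 0 -> q (s n) u @[n --> \oo] --> d.
 move=> u0; apply: (diffat_seq dx); first exact: ac.
 by move=> n; rewrite -subr_eq0 addrK mulf_neq0 // oppr_eq0 gt_eqF.
(* The limiting truncation jumps at [u1] and [- u1]; with the origin these are the only points
   excluded from pointwise convergence. *)
pose u1:=(Num.sqrt (1+d^+2))^-1.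
have s1: 1<=Num.sqrt (1+d^+2) by have /andP[]:=sqrt_slope_bounds dL.
have pc u: u != 0 -> u != u1 -> u != - u1 -> Phi (s n) u @[n --> \oo] --> Phi0 u.
 move=> u0 ua ub; rewrite /Phi /Phi0; have qn:=qc u u0.
 have sqc: `|u| * Num.sqrt (1+q (s n) u^+2) @[n --> \oo] --> `|u| * Num.sqrt (1+d^+2).
  apply: cvgMr; apply: (cvg_comp (fun n => 1+q (s n) u^+2) Num.sqrt _ (@sqrt_continuous R _)).
  apply: cvgD; first exact: cvg_cst.
  by rewrite expr2; under eq_cvg do rewrite expr2; apply: cvgM.
 have nd: `|u| * Num.sqrt (1+d^+2) != 1.
  apply/negP => /eqP h; have un: `|u| = u1.
  apply: (mulIf (lt0r_neq0 (lt_le_trans ltr01 s1))); rewrite h /u1 mulVf //; exact: lt0r_neq0 (lt_le_trans ltr01 s1).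
  by move: ua ub; rewrite -un; case: (ler0P u) => _; rewrite ?opprK eqxx.
 have bc: bb (q (s n) u) u @[n --> \oo] --> bb d u.
  apply: cvg_near_cst; rewrite /bb.
  move: nd; rewrite neq_lt => /orP[lt1|gt1].
  have cl: \forall n \near \oo, `|u| * Num.sqrt (1+q (s n) u^+2)<1 by apply: (cvgr_lt _ sqc).
  have -> : (1 <= `|u| * Num.sqrt (1+d^+2)) = false by apply/negbTE; rewrite -ltNge.
  by apply: filterS cl => n h; rewrite leNgt h.
  have cl: \forall n \near \oo, 1 < `|u| * Num.sqrt (1+q (s n) u^+2) by apply: (cvgr_gt _ sqc).
  rewrite (ltW gt1).
  by apply: filterS cl => n h; rewrite (ltW h).
 apply: cvgM.
  apply: cvgM.
  apply/subr_cvg0/norm_cvg0P.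
  apply: (@squeeze_cvgr _ _ _ _ (fun=> 0) (fun n => K * `|q (s n) u-d|)).
  - near=> n; rewrite normr_ge0 /=; have [_ P2 _]:=sP; apply: P2 => //; exact: slp_le.
  - exact: cvg_cst.
  - by rewrite -(mulr0 K); apply: cvgMr; apply/norm_cvg0P; apply/subr_cvg0.
  by apply: cvgB; [apply: cvgMl|exact: cvg_cst].
 exact: (cvg_comp (fun n => - s n*u+x) g (ac u) gc).
have mbb: mfun R (bb d).
 apply: m_bool_real; apply: measurable_fun_ler => //; exact: mfunM.
have [] := @Rintegral_dominated _ _ _ mu setT (fun n u => Phi (s n) u) Phi0
 (fun u => K*(L+1)*M*poi 1 (0-u)) measurableT.
- by move=> n; exact: mPhi.
- rewrite /Phi0; apply: mfunM => //; apply: mfunM => //; apply: mfunB.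
  by apply: mfunM => //; exact: m_inv.
 by apply: m_cpoi.
- exact: ip0.
- have ne (z: R) : {ae mu, forall u, u != z}.
  exists [set z]; split; [exact: measurable_set1|exact: lebesgue_measure_set1|].
  by move=> y /= /negP; rewrite negbK => /eqP.
 apply: (ae_sub _ (ae_and (ne 0) (ae_and (ne u1) (ne (- u1))))) => u [u0 [ua ub]] _.
 exact: pc.
- by move=> n u _; exact: PhiM.
by [].
Unshelve. all: end_near.
Qed.
End Sharp0.
End PV.

(** * Joint measurability of the line operators *)

Section Measurability.
Context {R: realType} d (T: measurableType d).
Local Notation mu:=(@lebesgue_measure R).
Variables (P: R -> R) (A f: T -> R -> R) (x: T -> R).
Hypotheses (mP: mfun R P) (mA: measurable_fun [set: T*R] (fun z => A z.1 z.2))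
 (mf: measurable_fun [set: T*R] (fun z => f z.1 z.2)) (mx: mfun T x).

Let mx1: measurable_fun [set: T*R] (fun z => x z.1).
Proof. exact: (mcomp mx). Qed.

Let mxy: measurable_fun [set: T*R] (fun z => x z.1-z.2).
Proof. exact: mfunB. Qed.

Let mslp : measurable_fun [set: T*R] (fun z => slp (A z.1) (x z.1) z.2).
Proof.
apply: mfunM; first by apply: mfunB => //; exact: (m_comp2 mA).
by apply: (mcomp m_inv); exact: mfunB.
Qed.

Let mPs: measurable_fun [set: T*R] (fun z => P (slp (A z.1) (x z.1) z.2)).
Proof. exact: (mcomp mP). Qed.

Lemma m_QQ e: mfun T (fun t => QQ P (A t) e (f t) (x t)).
Proof.
apply: (@m_Rintegral _ _ _ _ R mu (fun z: T*R => P (slp (A z.1) (x z.1) z.2) *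
 (cpoi e (x z.1-z.2)-cpoi 1 (x z.1-z.2))*f z.1 z.2)).
apply: mfunM => //; apply: mfunM => //.
by apply: mfunB; apply: m_cpoi.
Qed.

Lemma m_PP e: mfun T (fun t => PP e (f t) (x t)).
Proof.
apply: (@m_Rintegral _ _ _ _ R mu (fun z: T*R => poi e (x z.1-z.2) * `|f z.1 z.2|)).
apply: mfunM; first exact: m_poi.
exact: mnorm.
Qed.

Lemma m_Mx1 p: mfun T (fun t => Mx1 p P (A t) (f t) (x t)).
Proof.
apply: emeasurable_funD; apply: measurable_fun_esups => n; apply: m_powabs.
 exact: m_QQ.
exact: m_PP.
Qed.
End Measurability.

(** * Density of compactly supported Lipschitz functions *)

Section Density.
Context {R: realType}.
Local Notation mu:=(@lebesgue_measure R).

Lemma Rintegral_EFin (h: R -> R) : mu.-integrable [set: R] (EFin \o h) ->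
 (\int[mu]_x (h x)%:E = (\int[mu]_x h x)%:E)%E.
Proof. by move=> ih; rewrite /Rintegral fineK //; exact: integrable_fin_num ih. Qed.

(** [f] is first cut in height and support, then replaced by a Steklov average. Each error tends to
    0 by dominated convergence, and the factor [2^p * 2] in the choice of [dl] pays for adding the
    two. *)
Lemma lp_lip_dense (p: R) (f: R -> R) : 1<p -> mfun R f ->
 (Lpi p f < +oo)%E -> forall dlt: R, 0<dlt ->
 exists (g: R -> R) (N: nat) (Lg: R), [/\ lipr Lg g, (forall x, `|g x| <= Lg),
  (forall x, x \notin `[- N%:R, N%:R[ -> g x = 0) & (\int[mu]_x (`|f x-g x| `^ p)%:E<=dlt%:E)%E].
Proof.
move=> p1 mf foo dlt d0; have p0: 0<p by exact: lt_trans p1.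
have D0: 0<2`^p*2 :> R by rewrite mulr_gt0 ?powR_gt0.
pose dl: R:=dlt/(2`^p*2); have dl0: 0<dl by rewrite divr_gt0.
pose ft n x:=if (`|f x| <= n%:R) && (x \in `[- n%:R, n%:R[) then f x else 0.
have mft n: mfun R (ft n).
 apply: measurable_fun_ifT => //; apply: measurable_and.
  by apply: measurable_fun_ler => //; exact: mnorm.
 rewrite (_: (fun x => _) = (fun x => (- n%:R<=x) && (x<n%:R))); last by apply/funext => x; rewrite in_itv.
 by apply: measurable_and; [exact: measurable_fun_ler|exact: measurable_fun_ltr].
have mfp: mfun R (fun x => `|f x| `^ p) by apply/mEFinP; exact: m_powabs.
have if0: mu.-integrable [set: R] (EFin \o (fun x => `|f x| `^ p)).
 apply/integrableP; split; first exact/mEFinP.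
 rewrite [ltLHS](_: _ = Lpi p f)%E //; apply: eq_integral => x _.
 by rewrite /= ger0_norm // powR_ge0.
have ne0: - dl<dl by lra.
have small (h: nat -> R -> R) (G: R -> R) : (forall n, mfun R (h n)) ->
  mu.-integrable [set: R] (EFin \o G) -> {ae mu, forall x, h n x @[n --> \oo] --> (0: R)} ->
  (forall n x, `|h n x| `^ p<=G x) -> exists n: nat, (0<n)%N /\ (Lpi p (h n)<=dl%:E)%E.
 move=> mh iG hc hG.
 have mhp n: mfun R (fun x => `|h n x| `^ p) by apply/mEFinP; exact: m_powabs.
 have ih n: mu.-integrable [set: R] (EFin \o (fun x => `|h n x| `^ p)).
  apply: (le_integrable measurableT _ _ iG); first by apply/mEFinP; exact: mhp.
  by move=> x _ /=; rewrite lee_fin ger0_norm ?powR_ge0 // (le_trans (hG n x)) // ler_norm.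
 have [] := @Rintegral_dominated _ _ _ mu setT (fun n x => `|h n x| `^ p) (fun=> 0) G measurableT.
 - by [].
 - exact: mcst.
 - by [].
 - apply: (ae_sub _ hc) => x hx _.
  rewrite -(powR0 (lt0r_neq0 p0)); apply: cvg_powR_seq => //; rewrite -(normr0 R); exact: cvg_norm.
 - by move=> n x _; rewrite ger0_norm ?powR_ge0.
 move=> _; rewrite Rintegral_cst // mul0r => /cvgrPdist_le /(_ _ dl0)[n _ Hn].
 exists n.+1; split=> //; rewrite Rintegral_EFin // lee_fin.
 by have:=Hn n.+1 (leqnSn n); rewrite sub0r normrN; apply: le_trans (ler_norm _).
have [n [n0 Hn]] : exists n: nat, (0<n)%N /\ (\int[mu]_x (`|f x-ft n x| `^ p)%:E<=dl%:E)%E.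
 apply: (small (fun n x => f x-ft n x) (fun x => `|f x| `^ p)) => //.
 - by move=> n; exact: mfunB.
 - apply: aeW => x; apply: cvg_near_cst; exists (Num.trunc `|f x| + Num.trunc `|x|).+2 => //.
  move=> n /= hn; have:=truncn_itv (normr_ge0 (f x)); have:=truncn_itv (normr_ge0 x).
  move: hn; rewrite -(ler_nat R) => hn /andP[_ h1] /andP[_ h2].
  have h1' : `|x| < (Num.trunc `|x|)%:R+1 by move: h1; rewrite -natr1.
  have h2' : `|f x| < (Num.trunc `|f x|)%:R+1 by move: h2; rewrite -natr1.
  have t1: 0<=(Num.trunc `|x|)%:R :> R by rewrite ler0n.
  have t2: 0<=(Num.trunc `|f x|)%:R :> R by rewrite ler0n.
  have hn' : (Num.trunc `|f x|)%:R+(Num.trunc `|x|)%:R+2<=n%:R :> R by move: hn; rewrite -addn2 !natrD.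
  rewrite /ft ifT ?subrr // in_itv /=; apply/andP; split; first by lra.
  by have:=ler_norm x; have:=ler_norm (- x); rewrite normrN; lra.
 - move=> n x; rewrite /ft; case: ifP => _; last by rewrite subr0.
  by rewrite subrr normr0 powR0 ?powR_ge0 // gt_eqF.
have nr0: 0<n%:R :> R by rewrite ltr0n.
have n1: - n%:R<n%:R :> R by lra.
have ftM x: `|ft n x| <= n%:R by rewrite /ft; case: ifP => [/andP[]//|_]; rewrite normr0 ler0n.
have ft0 x: x \notin `[- n%:R, n%:R[ -> ft n x = 0 by rewrite /ft => /negbTE ->; rewrite andbF.
have [fn [fnL fnM fn0 fnc]] := @steklov R (ft n) n%:R _ _ n1 (mft n) ftM ft0.
have mfn j: mfun R (fn j) by have [Lf h _]:=fnL j; exact: lipr_measurable h.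
have lt2: - n.+1%:R<n.+1%:R :> R by rewrite -natr1; lra.
have off (x: R) : x \notin `[- n.+1%:R, n.+1%:R[ -> (x \notin `[- n%:R-1, n%:R[) /\ (x \notin `[- n%:R, n%:R[).
 clear; rewrite -natr1 !in_itv /= => h; split; apply: contra h => /andP[h1 h2]; apply/andP; split; lra.
have [j [_ Hj]] : exists j: nat, (0<j)%N /\ (\int[mu]_x (`|ft n x-fn j x| `^ p)%:E<=dl%:E)%E.
 apply: (small (fun j x => ft n x-fn j x)
  (fun x => (2*n%:R)`^p*(\1_(`[(- n.+1%:R: R), n.+1%:R[%classic) x))) => //.
 - by move=> j; exact: mfunB.
 - apply: (@integrable_supp R _ ((2*n%:R)`^p) (- n.+1%:R) n.+1%:R (ltW lt2)).
  + by apply: mfunM => //; apply: measurable_indic; exact: measurable_itv.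
  + move=> x; rewrite normrM ger0_norm ?powR_ge0 // ler_piMr ?powR_ge0 //.
  by rewrite indicE; case: (_ \in _); rewrite ?normr1 ?normr0.
  + by move=> x h; rewrite indicE memNset ?mulr0 //= => h2; move: h; rewrite h2.
 - apply: (ae_sub _ fnc) => x hx; rewrite -(subrr (ft n x)); apply: cvgB => //; exact: cvg_cst.
 - move=> j x; have [xin|xout]:=boolP (x \in `[- n.+1%:R, n.+1%:R[).
  rewrite indicE mem_set // mulr1; apply: ge0_ler_powR; rewrite ?nnegrE ?(ltW p0) ?mulr_ge0 //.
  apply: le_trans (ler_normB _ _) _; have:=ftM x; have:=fnM j x; lra.
  have [q1 q2]:=off x xout.
  by rewrite ft0 // fn0 // subrr normr0 powR0 ?mulr_ge0 ?powR_ge0 // gt_eqF.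
have [Lf fl fb]:=fnL j; exists (fn j), n.+1, Lf; split => //.
 by move=> x h; apply: fn0; have []:=off x h.
have mf1: mfun R (fun x => (`|f x-ft n x| `^ p)%:E).
 by apply: m_powabs; exact: mfunB.
have mf2: mfun R (fun x => (`|ft n x-fn j x| `^ p)%:E).
 by apply: m_powabs; exact: mfunB.
have mf3: mfun R (fun x => (`|f x-fn j x| `^ p)%:E).
 by apply: m_powabs; exact: mfunB.
apply: (le_via (\int[mu]_x ((2`^p)%:E*((`|f x-ft n x| `^ p)%:E+(`|ft n x-fn j x| `^ p)%:E)))%E).
 apply: ge0_le_integral => //.
 - by apply: measurable_funeM; exact: emeasurable_funD.
 - move=> x _; rewrite -EFinD -EFinM lee_fin.
  rewrite (_: f x-fn j x = (f x-ft n x)-(fn j x-ft n x)); last by ring.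
  by rewrite (distrC (ft n x)); exact: powRB_le (ltW p0).
rewrite ge0_integralZl_EFin ?powR_ge0 //; last exact: emeasurable_funD.
 rewrite ge0_integralD //; try by move=> x _; rewrite lee_fin powR_ge0.
 apply: (le_via ((2`^p)%:E*(dl%:E+dl%:E))%E).
  by apply: lee_wpmul2l; [rewrite lee_fin powR_ge0|exact: (leeD Hn Hj)].
 rewrite -EFinD -EFinM lee_fin (_: 2`^p*(dl+dl) = dl*(2`^p*2)); last by ring.
 by rewrite /dl divfK ?gt_eqF.
by move=> x _; rewrite -EFinD lee_fin addr_ge0 ?powR_ge0.
Qed.
End Density.

(** * Almost everywhere convergence of sharp truncations in L^p *)

Section PV.
Context {R: realType}.
Local Notation mu:=(@lebesgue_measure R).

Lemma Rintegral_off (W: set R) (h: R -> R) : measurable W -> (forall y, ~ W y -> h y = 0) ->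
 \int[mu]_y h y = \int[mu]_(y in W) h y.
Proof.
move=> mW h0; rewrite [RHS]Rintegral_mkcond; apply: eq_Rintegral => y _.
by rewrite patchE; case: ifPn => // /negP; rewrite in_setE => /h0.
Qed.

Lemma integrableDR (W: set R) (f g: R -> R) : measurable W -> mu.-integrable W (EFin \o f) ->
 mu.-integrable W (EFin \o g) -> mu.-integrable W (EFin \o (fun y => f y+g y)).
Proof.
move=> mW i1 i2; suff: mu.-integrable W ((EFin \o f) \+ (EFin \o g))%E by [].
by apply: integrableD.
Qed.

Lemma RintegralDR (W: set R) (f g: R -> R) : measurable W -> mu.-integrable W (EFin \o f) ->
 mu.-integrable W (EFin \o g) ->
 \int[mu]_(y in W) (f y+g y) = \int[mu]_(y in W) f y + \int[mu]_(y in W) g y.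
Proof. by move=> mW i1 i2; rewrite RintegralD. Qed.

Lemma RintegralZR (W: set R) (c: R) (f: R -> R) : measurable W -> mu.-integrable W (EFin \o f) ->
 \int[mu]_(y in W) (c*f y) = c * \int[mu]_(y in W) f y.
Proof. by move=> mW i1; rewrite RintegralZl. Qed.

Lemma Mx1_ge0 (P A: R -> R) p f x: (0<=Mx1 p P A f x)%E.
Proof.
have h (T: R -> R) : (0<=esups (fun n => (`|T (qpos n)| `^ p)%:E) 0%N)%E.
 by apply: le_trans (esups_ge (fun e => `|T e| `^ p) 0); rewrite lee_fin powR_ge0.
by apply: adde_ge0; [exact: (h (fun e => QQ P A e f x))|exact: (h (fun e => PP e f x))].
Qed.

Lemma le_integralD (F1 F2: R -> \bar R) (a b: \bar R) : mfun R F1 -> mfun R F2 ->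
 (forall x, 0<=F1 x)%E -> (forall x, 0<=F2 x)%E -> (\int[mu]_x F1 x<=a)%E -> (\int[mu]_x F2 x<=b)%E ->
 (\int[mu]_x (F1 x+F2 x)<=a+b)%E.
Proof. by move=> m1 m2 f1 f2 h1 h2; rewrite ge0_integralD //; exact: leeD. Qed.

Lemma Mx1_lp (L K p: R) : 0<=L -> 0<=K -> 1<p ->
 exists2 C, 0<C & forall (P A f: R -> R),
  smooth L K P -> lipr L A -> mfun R P ->
  mfun R f -> (Lpi p f < +oo)%E ->
 (\int[mu]_x Mx1 p P A f x<=C%:E*Lpi p f)%E.
Proof.
move=> L0 K0 p1; have [C1 C10 H1]:=QQ_lp L0 K0 p1; have [C2 C20 H2]:=PP_lp p1.
exists (C1+C2); first by rewrite addr_gt0.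
move=> P A f sP AL mP mf foo.
have b1:=H1 P A _ sP AL mP mf foo; have b2:=H2 _ mf foo; clear H1 H2.
have mA2: measurable_fun [set: R*R] (fun z: R*R => A z.2).
 by apply: (mcomp (lipr_measurable AL)).
have mf2: measurable_fun [set: R*R] (fun z: R*R => f z.2) by exact: (mcomp mf).
have m1: mfun R (fun x => esups (fun n => (`|QQ P A (qpos n) f x| `^ p)%:E) 0%N).
 apply: measurable_fun_esups => n; apply: m_powabs.
 exact: (@m_QQ R _ R P (fun=> A) (fun=> f) id mP mA2 mf2).
have m2: mfun R (fun x => esups (fun n => (`|PP (qpos n) f x| `^ p)%:E) 0%N).
 apply: measurable_fun_esups => n; apply: m_powabs.
 exact: (@m_PP R _ R (fun=> f) id mf2).
have g1 x: (0<=esups (fun n => (`|QQ P A (qpos n) f x| `^ p)%:E) 0%N)%E.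
 by apply: le_trans (esups_ge (fun e => `|QQ P A e f x| `^ p) 0); rewrite lee_fin powR_ge0.
have g2 x: (0<=esups (fun n => (`|PP (qpos n) f x| `^ p)%:E) 0%N)%E.
 by apply: le_trans (esups_ge (fun e => `|PP e f x| `^ p) 0); rewrite lee_fin powR_ge0.
apply: le_trans (le_integralD m1 m2 g1 g2 b1 b2) _.
by rewrite EFinD ge0_muleDl ?lee_fin ?(ltW C10) ?(ltW C20).
Qed.

Section Lip.
Variables (L K: R) (P A: R -> R).
Hypotheses (sP: smooth L K P) (AL: lipr L A) (mP: mfun R P).

Let mxy x: mfun R (fun y => x-y). Proof. exact: mfunB. Qed.
Let mPs x: mfun R (fun y => P (slp A x y)).
Proof. by apply: (mcomp mP); apply: (m_comp2 (m_slp AL)). Qed.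
Let mcp r x: mfun R (fun y => cpoi r (x-y)).
Proof. by apply: m_cpoi; [exact: mcst|exact: mxy]. Qed.
Let mtr e x: mfun R (trk A e x). Proof. exact: m_trk AL e x. Qed.
Let minv x: mfun R (fun y => (x-y)^-1).
Proof. exact: (mcomp m_inv). Qed.
Let L0: 0<=L. Proof. exact: lipr_le0 AL. Qed.
Let PK x y: `|P (slp A x y)| <= K. Proof. by have [P1 _ _]:=sP; apply: P1; exact: slp_le. Qed.
Let K0: 0<=K. Proof. exact: le_trans (PK 0 0). Qed.

Lemma cpoi_cvg (t: R) (s: nat -> R) : t != 0 -> s n @[n --> \oo] --> 0 -> cpoi (s n) t @[n --> \oo] --> t^-1.
Proof.
move=> t0 sc; rewrite /cpoi [X in _ --> X](_: _ = t/(0*0+t^+2)); last by field.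
apply: cvgMr; apply: cvgV; first by rewrite mul0r add0r sqrf_eq0.
apply: cvgD; last exact: cvg_cst.
by under eq_cvg do rewrite expr2; apply: cvgM.
Qed.

Lemma cpoi_le_inv (e t: R) : 0<e -> `|cpoi e t| <= `|t|^-1.
Proof.
move=> e0; rewrite /cpoi; have [->|t0]:=eqVneq t 0; first by rewrite mul0r normr0 invr0.
have n0: 0 < `|t| by rewrite normr_gt0.
rewrite -(real_normK (num_real t)); move: n0; rewrite -[X in X/_](mulr1) normrM normfV normrM normr1 mulr1.
move: `|t| => s s0; have D0: 0<e^+2+s^+2 by rewrite ltr_wpDr ?sqr_ge0 ?exprn_gt0.
rewrite (ger0_norm (ltW D0)) ler_pdivrMr // mulrC ler_pdivlMr // -expr2 lerDr sqr_ge0 //.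
Qed.

(** Four pieces: [J1] exchanges sharp for smooth truncation ([blowup]); [J2] contains [g y - g x]
    and converges absolutely; [J3] is the principal value of the kernel itself ([V_conv]); [J4] is
    the smooth outer truncation, whose kernel is bounded. *)
Lemma SH_conv_lip (g: R -> R) (N: nat) (Lg: R) : lipr Lg g -> (forall x, `|g x| <= Lg) ->
 (forall x, x \notin `[- N%:R, N%:R[ -> g x = 0) ->
 {ae mu, forall x, conv0 (fun e => SH P A e 1 g x)}.
Proof.
move=> gL gM g0.
have [dA [mdA dAL aed]]:=lipr_diff AL.
have mg:=lipr_measurable gL.
have Lg0: 0<=Lg:=le_trans (normr_ge0 _) (gM 0).
have Wn (n: nat) : - n.+1%:R<n.+1%:R :> R by have:=ltr0Sn R n; lra.
have Vc: {ae mu, forall x, forall n: nat, - n.+1%:R<x<n.+1%:R ->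
  conv0 (fun e => \int[mu]_(y in `[- n.+1%:R, n.+1%:R[) (P (slp A x y)*cpoi e (x-y)))}.
 by apply: ae_foralln => n; exact: V_conv sP AL mP mdA dAL aed _ _ (Wn n).
apply: (ae_sub _ (ae_and aed Vc)) => x [dx Vx].
pose n:=(N+(Num.trunc `|x|).+1)%N.
have xn: - n.+1%:R<x<n.+1%:R.
 have:=truncn_itv (normr_ge0 x); rewrite -natr1 => /andP[_ h].
 have hN: 0<=N%:R :> R by rewrite ler0n.
 have hn: n.+1%:R = N%:R+((Num.trunc `|x|)%:R+1)+1 :> R by rewrite -natr1 /n natrD -natr1.
 rewrite hn; have:=ler_norm x; have:=ler_norm (- x); rewrite normrN => u1 u2.
 by apply/andP; split; lra.
have {}Vx:=Vx n xn.
set W: set R:=`[- n.+1%:R, n.+1%:R[%classic in Vx *.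
have mW: measurable W by exact: measurable_itv.
have Woo: (mu W < +oo)%E by exact: mu_itv_lty.
have gW y: ~ W y -> g y = 0.
 move=> Wy; apply: g0; apply/negP => yN; apply: Wy; move: yN; rewrite /W /= !in_itv /= => /andP[h1 h2].
 have nN: N%:R<=n.+1%:R :> R by rewrite ler_nat /n; lia.
 by apply/andP; split; lra.
have ib e y: 0<e -> `|cpoi e (x-y)| <= e^-1 by move=> e0; exact: cpoi_le2.
have bi (h: R -> R) (M: R) : mfun R h -> (forall y, `|h y| <= M) -> mu.-integrable W (EFin \o h).
 by move=> mh hM; apply: (bounded_integrable mW Woo (mfunTS mh)) => y _; exact: hM.
pose J1 e y:=P (slp A x y)*(trk A e x y/(x-y)-cpoi e (x-y))*g y.
pose J2 e y:=P (slp A x y)*cpoi e (x-y)*(g y-g x).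
pose J3 e y:=P (slp A x y)*cpoi e (x-y).
pose J4 e y:=P (slp A x y)*trk A e x y*cpoi 1 (x-y)*g y.
have mJ1 e: mfun R (J1 e).
 apply: mfunM => //; apply: mfunM; first exact: mPs.
 by apply: mfunB; [apply: mfunM; [exact: mtr|exact: minv]|exact: mcp].
have mJ3 e: mfun R (J3 e) by apply: mfunM; [exact: mPs|exact: mcp].
have mJ2 e: mfun R (J2 e).
 by apply: mfunM; [exact: mJ3|exact: mfunB].
have mJ4 e: mfun R (J4 e).
 apply: mfunM => //; apply: mfunM; last exact: mcp.
 by apply: mfunM; [exact: mPs|exact: mtr].
have J1M e y: 0<e -> `|J1 e y| <= K*((L+1)*e^-1)*Lg.
 move=> e0; rewrite /J1 (normrM _ (g y)) (normrM (P _)); apply: ler_pM => //; apply: ler_pM => //.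
 apply: le_trans (sharp0_close AL (x-y) e0 (slp_le x y AL L0)) _.
 by apply: ler_wpM2l; [rewrite addr_ge0|apply: le_trans (ler_norm _) (poi_bound _ e0)].
have J3M e y: 0<e -> `|J3 e y| <= K*e^-1.
 by move=> e0; rewrite /J3 (normrM (P _)); apply: ler_pM => //; exact: ib.
have J2M e y: 0<e -> `|J2 e y| <= K*Lg.
 move=> e0; rewrite /J2 -mulrA (normrM (P _)); apply: ler_pM => //.
 have [->|ne]:=eqVneq y x; first by rewrite !subrr mulr0 normr0.
 rewrite normrM; apply: (le_via (`|x-y|^-1*(Lg * `|y-x|))).
  apply: ler_pM => //.
  exact: cpoi_le_inv.
 have n0: `|y-x| != 0 by rewrite normr_eq0 subr_eq0.
 by rewrite (distrC x) mulrCA mulVf // mulr1.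
have J4M e y: `|J4 e y| <= K*1*1*Lg.
 rewrite /J4 (normrM _ (g y)) (normrM _ (cpoi _ _)) (normrM (P _)); apply: ler_pM => //; apply: ler_pM => //.
  by apply: ler_pM => //; exact: trk_le.
 by have:=cpoi_le2 (x-y) (@ltr01 R); rewrite invr1.
have i1 e: 0<e -> mu.-integrable W (EFin \o J1 e) by move=> e0; exact: (bi _ _ (mJ1 e) (fun y => J1M e y e0)).
have i2 e: 0<e -> mu.-integrable W (EFin \o J2 e) by move=> e0; exact: (bi _ _ (mJ2 e) (fun y => J2M e y e0)).
have i3 e: 0<e -> mu.-integrable W (EFin \o J3 e) by move=> e0; exact: (bi _ _ (mJ3 e) (fun y => J3M e y e0)).
have i4 e: mu.-integrable W (EFin \o J4 e) by exact: (bi _ _ (mJ4 e) (J4M e)).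
have E e: 0<e -> SH P A e 1 g x = \int[mu]_y J1 e y+(\int[mu]_(y in W) J2 e y +
  (g x * \int[mu]_(y in W) J3 e y+(-1) * \int[mu]_(y in W) J4 e y)).
 move=> e0; rewrite (@Rintegral_off W (J1 e)) //; last by move=> y /gW gy; rewrite /J1 gy mulr0.
 rewrite /SH (@Rintegral_off W) //; last by move=> y /gW ->; rewrite mulr0.
 have i3' : mu.-integrable W (EFin \o (fun y => g x*J3 e y)).
  apply: (bi _ (Lg*(K*e^-1))); first by apply: mfunM; [exact: mcst|exact: mJ3].
  by move=> y; rewrite (normrM (g x)); apply: ler_pM => //; exact: J3M.
 have i4' : mu.-integrable W (EFin \o (fun y => (-1)*J4 e y)).
  apply: (bi _ (K*1*1*Lg)); first by apply: mfunM; [exact: mcst|exact: mJ4].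
  by move=> y; rewrite mulN1r normrN; exact: J4M.
 have i34:=integrableDR mW i3' i4'.
 have i234:=integrableDR mW (i2 e e0) i34.
 rewrite -(RintegralZR (g x) mW (i3 e e0)) -(RintegralZR (-1) mW (i4 e)).
 rewrite -(RintegralDR mW i3' i4') -(RintegralDR mW (i2 e e0) i34) -(RintegralDR mW (i1 e e0) i234).
 apply: eq_Rintegral => y _; rewrite /J1 /J2 /J3 /J4 /shk -/(trk A e x y).
 by move: (trk _ _ _ _) (cpoi e _) (cpoi 1 _) (g y) (P _) => a b c d h; ring.
apply: (conv0_near ltr01 (fun e e0 _ => E e e0)).
apply: conv0D.
 have gcx: {for x, continuous g} by first [exact: (lipr_continuous gL)|have h:=lipr_continuous gL; exact: (h x)|move: (lipr_continuous gL x); rewrite /continuous_at; exact].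
 exact: (blowup sP AL mP mg gM gcx dx (dAL x)).
have aene: {ae mu, forall u, u != x}.
 exists [set x]; split; [exact: measurable_set1|exact: lebesgue_measure_set1|].
 by move=> y /= /negP; rewrite negbK => /eqP.
apply: conv0D.
 pose J20 y:=P (slp A x y)*(x-y)^-1*(g y-g x).
 apply: (conv0_seq (l:=\int[mu]_(y in W) J20 y)) => s s0 sc.
 have [] := @Rintegral_dominated _ _ _ mu W (fun n => J2 (s n)) J20 (fun=> K*Lg) mW.
 - by move=> k; apply: mfunTS; exact: mJ2.
 - apply: mfunTS; apply: mfunM; last exact: mfunB.
  by apply: mfunM; [exact: mPs|exact: minv].
 - by apply: (bi _ `|K*Lg|) => //; exact: mcst.
 - apply: (ae_sub _ aene) => y ne _; apply: cvgMl; apply: cvgMr; apply: cpoi_cvg => //; by rewrite subr_eq0 eq_sym.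
 - by move=> k y _; exact: J2M.
 by [].
apply: conv0D; first exact: conv0M.
apply: conv0M.
pose J40 y:=P (slp A x y)*1*cpoi 1 (x-y)*g y.
apply: (conv0_seq (l:=\int[mu]_(y in W) J40 y)) => s s0 sc.
have [] := @Rintegral_dominated _ _ _ mu W (fun n => J4 (s n)) J40 (fun=> K*1*1*Lg) mW.
- by move=> k; apply: mfunTS; exact: mJ4.
- apply: mfunTS; apply: mfunM => //; apply: mfunM; last exact: mcp.
 by apply: mfunM; [exact: mPs|exact: mcst].
- by apply: (bi _ `|K*1*1*Lg|) => //; exact: mcst.
- apply: (ae_sub _ aene) => y yx _; apply: cvgMl; apply: cvgMl; apply: cvgMr.
 exact: (trk_cvg AL).
- by move=> k y _; exact: J4M.
by [].
Qed.

Section General.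
Variables (p: R) (f: R -> R).
Hypotheses (p1: 1<p) (mf: mfun R f) (foo: (Lpi p f < +oo)%E).

Let msh e r x: mfun R (fun y => P (slp A x y)*shk A e r x y).
Proof. by apply: mfunM => //; apply: (m_comp2 (m_shk e r AL)). Qed.

Lemma SH_integrable e r x: 0<e -> 0<r ->
 mu.-integrable [set: R] (EFin \o (fun y => P (slp A x y)*shk A e r x y*f y)).
Proof.
move=> e0 r0; apply: (@integrable_dominated _ p f p1 mf foo _ (K*(r*(1+L)/e)) r x) => //.
by move=> y; rewrite (normrM (P _)) -mulrA; apply: ler_pM => //; exact: shk_le.
Qed.

(** Changing the outer radius changes the integrand by a term dominated by a Poisson kernel
    uniformly in [e]. *)
Lemma SH_change r x: 0<r -> conv0 (fun e => SH P A e 1 f x) -> conv0 (fun e => SH P A e r f x).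
Proof.
move=> r0 c1.
pose D e y:=P (slp A x y)*(trk A e x y*(cpoi 1 (x-y)-cpoi r (x-y))).
pose c:=K*(`|r^+2-1^+2| / (1*r)).
have mD e: mfun R (D e).
 apply: mfunM; first exact: mPs.
 by apply: mfunM; [exact: mtr|apply: mfunB; exact: mcp].
have DM e y: `|D e y| <= c*poi r (x-y).
 rewrite /D /c (normrM (P _)) -mulrA; apply: ler_pM => //.
 rewrite (normrM (trk _ _ _ _)) -[leRHS]mul1r; apply: ler_pM => //; first exact: trk_le.
 exact: (cpoiB_le _ ltr01 r0).
have iD e: mu.-integrable [set: R] (EFin \o (fun y => D e y*f y)).
 exact: (@integrable_dominated _ p f p1 mf foo _ c r x (mD e) r0 (DM e)).
have E e: 0<e -> SH P A e r f x = SH P A e 1 f x + \int[mu]_y (D e y*f y).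
 move=> e0; rewrite /SH -(RintegralDR measurableT (SH_integrable x e0 ltr01) (iD e)).
 apply: eq_Rintegral => y _; rewrite /shk /D -/(trk A e x y).
 by move: (trk _ _ _ _) (cpoi r _) (cpoi 1 _) (f y) (P _) => a b d g h; ring.
suff cD: conv0 (fun e => \int[mu]_y (D e y*f y)).
 exact: (conv0_near ltr01 (fun e e0 _ => E e e0) (conv0D c1 cD)).
pose D0 y:=P (slp A x y)*(1*(cpoi 1 (x-y)-cpoi r (x-y))).
apply: (conv0_seq (l:=\int[mu]_y (D0 y*f y))) => s s0 sc.
have [] := @Rintegral_dominated _ _ _ mu setT (fun n y => D (s n) y*f y) (fun y => D0 y*f y)
 (fun y => c*(poi r (x-y) * `|f y|)) measurableT.
- by move=> n; apply: mfunM => //; exact: mD.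
- apply: mfunM => //; apply: mfunM; first exact: mPs.
 by apply: mfunM; [exact: mcst|apply: mfunB; exact: mcp].
- have:=integrableZl measurableT c (integrable_poi p1 mf foo x r0).
 by apply: eq_integrable => // y _; rewrite /= EFinM.
- have ne: {ae mu, forall u, u != x}.
  exists [set x]; split; [exact: measurable_set1|exact: lebesgue_measure_set1|].
  by move=> y /= /negP; rewrite negbK => /eqP.
 apply: (ae_sub _ ne) => y yx _; apply: cvgMl; apply: cvgMr; apply: cvgMl.
 exact: (trk_cvg AL).
- by move=> n y _; rewrite (normrM (D _ _)) mulrA; apply: ler_pM => //; exact: DM.
by [].
Qed.

(** At almost every [x] the majorant [Mx1] of [f - gg j] is small for some [j] ([small_ae]), so the
    truncations of [f] are uniformly close to those of a Lipschitz function, which converge. *)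
Lemma SH_conv: {ae mu, forall x, forall r, 0<r -> conv0 (fun e => SH P A e r f x)}.
Proof.
have p0: 0<p by exact: lt_trans p1.
have [CC CC0 H1]:=Mx1_lp L0 K0 p1.
have H1':=conj I H1; clear H1.
have dj (j: nat) : 0<(j.+1%:R)^-1 :> R by rewrite invr_gt0.
pose sel (j: nat):=cid (lp_lip_dense p1 mf foo (dj j)).
pose gg j:=sval (sel j).
have gP j: exists (N: nat) (Lg: R), [/\ lipr Lg (gg j), (forall x, `|gg j x| <= Lg),
  (forall x, x \notin `[- N%:R, N%:R[ -> gg j x = 0) & (\int[mu]_x (`|f x-gg j x| `^ p)%:E<=(j.+1%:R^-1)%:E)%E].
 exact: (svalP (sel j)).
have mg j: mfun R (gg j) by have [N [Lg [h _ _ _]]]:=gP j; exact: lipr_measurable h.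
have mh j: mfun R (fun y => f y-gg j y) by exact: mfunB.
have hoo j: (\int[mu]_x (`|f x-gg j x| `^ p)%:E < +oo)%E.
 by have [N [Lg [_ _ _ h]]]:=gP j; apply: le_lt_trans h _; rewrite ltry.
pose F j x:=Mx1 p P A (fun y => f y-gg j y) x.
have mA2: measurable_fun [set: R*R] (fun z: R*R => A z.2).
 by apply: (mcomp (lipr_measurable AL)).
have mF j: mfun R (F j).
 apply: (@m_Mx1 R _ R P (fun=> A) (fun=> (fun y => f y-gg j y)) id mP mA2) => //.
 exact: (mcomp (mh j)).
have IF j: (\int[mu]_x F j x<=(CC*j.+1%:R^-1)%:E)%E.
 have [N [Lg [_ _ _ h]]]:=gP j.
 apply: le_trans (H1'.2 P A _ sP AL mP (mh j) (hoo j)) _; rewrite EFinM.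
 by apply: lee_wpmul2l => //; rewrite lee_fin ltW.
have sm: {ae mu, forall x, forall e: R, 0<e -> exists n, (F n x<e%:E)%E}.
 apply: small_ae => //; first by move=> n x; exact: Mx1_ge0.
 move=> e e0; have ce: 0<CC/e by rewrite divr_gt0.
 exists (Num.trunc (CC/e)); apply: le_trans (IF _) _; rewrite lee_fin.
 have:=truncn_itv (ltW ce) => /andP[_ h].
 by rewrite ler_pdivrMr // mulrC -ler_pdivrMr // ltW.
have cg: {ae mu, forall x, forall j, conv0 (fun e => SH P A e 1 (gg j) x)}.
 by apply: ae_foralln => j; have [N [Lg [h1 h2 h3 _]]]:=gP j; exact: SH_conv_lip h1 h2 h3.
apply: (ae_sub _ (ae_and sm cg)) => x [sx cx] r r0; apply: SH_change => //.
apply: conv0_approx => eta eta0.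
pose C0:=2+2*K*(L+2).
have C00: 0<C0 by rewrite ltr_pwDl // !mulr_ge0 ?addr_ge0.
have ec: 0<(eta/C0)`^p by rewrite powR_gt0 // divr_gt0.
have [j Fj]:=sx _ ec; exists (fun e => SH P A e 1 (gg j) x), 1; split => // e e0 e1.
have goo: (Lpi p (gg j) < +oo)%E.
 have m1: mfun R (fun x => (`|f x| `^ p)%:E):=m_powabs p mf.
 have m2: mfun R (fun x => (`|f x-gg j x| `^ p)%:E):=m_powabs p (mh j).
 have m3: mfun R (fun x => (`|gg j x| `^ p)%:E):=m_powabs p (mg j).
 have b0 (h: R -> R) y: (0<=(`|h y| `^ p)%:E)%E by rewrite lee_fin powR_ge0.
 apply: (@le_lt_trans _ _ (\int[mu]_x ((2`^p)%:E*((`|f x| `^ p)%:E+(`|f x-gg j x| `^ p)%:E)))%E).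
  apply: ge0_le_integral => //.
  - by apply: measurable_funeM; exact: emeasurable_funD.
  - move=> y _; rewrite -EFinD -EFinM lee_fin.
  have:=powRB_le (f y) (f y-gg j y) (ltW p0).
  by rewrite (_: f y-(f y-gg j y) = gg j y); last by ring.
 rewrite ge0_integralZl_EFin ?powR_ge0 //; last exact: emeasurable_funD.
  have h:=le_integralD m1 m2 (b0 f) (b0 (fun y => f y-gg j y)) (lexx _) (lexx _).
  apply: (@le_lt_trans _ _ ((2`^p)%:E*(Lpi p f + \int[mu]_x (`|f x-gg j x| `^ p)%:E))%E).
  by apply: lee_wpmul2l => //; rewrite lee_fin powR_ge0.
  by rewrite lte_mul_pinfty ?lee_fin ?powR_ge0 //; apply: lte_add_pinfty.
 by move=> y _; rewrite -EFinD lee_fin addr_ge0 ?powR_ge0.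
have ig: mu.-integrable [set: R] (EFin \o (fun y => P (slp A x y)*shk A e 1 x y*gg j y)).
 apply: (@integrable_dominated _ p (gg j) p1 (mg j) goo _ (K*(1*(1+L)/e)) 1 x) => //.
 by move=> y; rewrite (normrM (P _)) -mulrA; apply: ler_pM => //; exact: (shk_le _ _ AL e0 ltr01).
have ih: mu.-integrable [set: R] (EFin \o (fun y => P (slp A x y)*shk A e 1 x y*(f y-gg j y))).
 apply: (@integrable_dominated _ p _ p1 (mh j) (hoo j) _ (K*(1*(1+L)/e)) 1 x) => //.
 by move=> y; rewrite (normrM (P _)) -mulrA; apply: ler_pM => //; exact: (shk_le _ _ AL e0 ltr01).
have -> : SH P A e 1 f x-SH P A e 1 (gg j) x = SH P A e 1 (fun y => f y-gg j y) x.
 apply/eqP; rewrite subr_eq; apply/eqP; rewrite /SH -(RintegralDR measurableT ih ig).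
 by apply: eq_Rintegral => y _; ring.
apply: le_trans (SH_sup p1 sP AL mP (mh j) (hoo j) e0 (ltW e1) (ltW Fj)) _.
have q0: 0<=eta/C0 by rewrite divr_ge0 // ltW.
by rewrite -powRrM mulfV ?gt_eqF // powRr1 // mulrC divfK ?gt_eqF.
Qed.
End General.
End Lip.
End PV.

(** * Line kernels with variable height *)

Section Line.
Context {R: realType}.
Local Notation mu:=(@lebesgue_measure R).

Definition rho (alpha: R) (P: R -> R) (kap: R -> R -> R -> R) (t a b: R) : R :=
 kap t a b-alpha*(P ((b-a)/(- t))*(t^-1-cpoi a t)).

(** Here [t] is the difference of positions and [a], [b] are the heights at the two ends. Such a
    kernel is [alpha] times a smooth singular kernel cut off at the height [a], up to a Poisson
    kernel at height [a]. [lk_meas] quantifies over all measurable spaces because base point and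
    direction will be variables too. *)
Record lkernel (L K C alpha: R) (P: R -> R) (kap: R -> R -> R -> R) : Prop:=LKernel {
 lk_smooth: smooth L K P;
 lk_measP: mfun R P;
 lk_meas: forall d (T: measurableType d) (t a b: T -> R), mfun T t ->
  mfun T a -> mfun T b ->
  mfun T (fun x => kap (t x) (a x) (b x));
 lk_rho: forall t a b, 0<a -> 0<b -> `|b-a| <= L * `|t| -> `|rho alpha P kap t a b| <= C*poi a t }.

Definition IN (kap: R -> R -> R -> R) (A: R -> R) (e: R) (f: R -> R) (x: R) : R :=
 \int[mu]_y (trk A e x y*kap (x-y) (A x) (A y)*f y).

Lemma m_IN (kap: R -> R -> R -> R) d (T: measurableType d) (A f: T -> R -> R) (e x: T -> R) :
 (forall d (T: measurableType d) (t a b: T -> R), mfun T t ->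
  mfun T a -> mfun T b ->
  mfun T (fun x => kap (t x) (a x) (b x))) ->
 measurable_fun [set: T*R] (fun z => A z.1 z.2) ->
 measurable_fun [set: T*R] (fun z => f z.1 z.2) -> mfun T e -> mfun T x ->
 mfun T (fun t => IN kap (A t) (e t) (f t) (x t)).
Proof.
move=> mk mA mf me mx.
have mx1: measurable_fun [set: T*R] (fun z => x z.1) by exact: (mcomp mx).
have me1: measurable_fun [set: T*R] (fun z => e z.1) by exact: (mcomp me).
have mxy: measurable_fun [set: T*R] (fun z => x z.1-z.2) by exact: mfunB.
have mAx: measurable_fun [set: T*R] (fun z => A z.1 (x z.1)) by exact: (m_comp2 mA).
apply: (@m_Rintegral _ _ _ _ R mu (fun z: T*R =>
 trk (A z.1) (e z.1) (x z.1) z.2*kap (x z.1-z.2) (A z.1 (x z.1)) (A z.1 z.2)*f z.1 z.2)).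
apply: mfunM => //; apply: mfunM; last exact: mk.
apply: m_bool_real; apply: measurable_fun_ler => //; apply: mfunM.
 exact: mnorm.
apply: msqrt.
apply: mfunD => //; apply: mfunX; apply: mfunM.
 exact: mfunB.
by apply: (mcomp m_inv); exact: mfunB.
Qed.

(** The Cauchy criterion at 0 along rational radii, written with countable quantifiers so that the
    set of points where it holds is measurable ([m_ratc]). *)
Definition ratc (u: R -> R) : Prop:=forall k: nat, exists n: nat, forall i j: nat,
 (qpos i: R)<=n.+1%:R^-1 -> (qpos j: R)<=n.+1%:R^-1 -> `|u (qpos i)-u (qpos j)| <= (k.+1%:R)^-1.

Lemma conv0_ratc (u: R -> R) : conv0 u -> ratc u.
Proof.
move=> cu k; have k0: 0<(k.+1%:R)^-1/2 :> R by rewrite divr_gt0 // invr_gt0.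
have:=cu; move/cvg_ex => [l /cvgrPdist_lt /(_ _ k0)].
move=> [d /= d0 Hd]; have dV: 0<=d^-1 by rewrite invr_ge0 ltW.
have [/andP[_ h]]:=(truncn_itv dV, I); exists (Num.trunc d^-1).
have nd: (Num.trunc d^-1).+1%:R^-1<d by rewrite invf_plt ?posrE.
move=> i j hi hj.
have H n: (qpos n: R)<=(Num.trunc d^-1).+1%:R^-1 -> `|l-u (qpos n)| < (k.+1%:R)^-1/2.
 move=> hn; apply: Hd; last exact: qpos_gt0.
 by rewrite /ball_ /= sub0r normrN gtr0_norm ?qpos_gt0 // (le_lt_trans hn).
have h1:=H i hi; have h2:=H j hj.
rewrite (_: u (qpos i)-u (qpos j) = (l-u (qpos j))-(l-u (qpos i))); last by ring.
by apply: le_trans (ler_normB _ _) _; rewrite [leRHS]splitr; apply: lerD; exact: ltW.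
Qed.

(* left-continuity in the truncation radius upgrades [ratc] to convergence *)
Lemma ratc_conv0 (u: R -> R) : (forall e (s: nat -> R), 0<e -> (forall n, 0<s n<e) ->
  s n @[n --> \oo] --> e -> u (s n) @[n --> \oo] --> u e) ->
 ratc u -> conv0 u.
Proof.
move=> lu ru; apply: (@cauchy_cvg R); apply: cauchy_exP => eta eta0.
have eV: 0<=(eta/2)^-1 by rewrite invr_ge0 divr_ge0 // ltW.
have /andP[_ hk]:=truncn_itv eV.
have kd: (Num.trunc (eta/2)^-1).+1%:R^-1<eta/2 by rewrite invf_plt ?posrE ?divr_gt0.
have [n Hn]:=ru (Num.trunc (eta/2)^-1).
have n0: 0<(n.+1%:R)^-1 :> R by rewrite invr_gt0.
have nh: 0<(n.+1%:R)^-1/2 :> R by rewrite divr_gt0.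
have [i0 /andP[i1 i2]]:=qpos_dense nh nh.
have i3: (qpos i0: R)<=n.+1%:R^-1 by move: i2; rewrite -splitr => /ltW.
exists (u (qpos i0)); exists n.+1%:R^-1 => //= e; rewrite /ball /= sub0r normrN => ed e0.
rewrite gtr0_norm // in ed.
have [s sP] : exists s: nat -> nat, forall j, e-e/j.+2%:R<qpos (s j)<e.
 have H j: exists k, e-e/j.+2%:R<qpos k<e.
  have j0: 0<e/j.+2%:R by rewrite divr_gt0.
  have j1: 0<e-e/j.+2%:R.
  by rewrite subr_gt0 ltr_pdivrMr // ltr_pMr // ltr1n.
  have [k]:=qpos_dense j1 j0; rewrite subrK => hk'; by exists k.
 by exists (fun j => sval (cid (H j))) => j; exact: (svalP (cid (H j))).
have sc: qpos (s j) @[j --> \oo] --> e.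
 apply: (@squeeze_cvgr _ _ _ _ (fun j => e-e/j.+2%:R) (fun=> e)).
 - by apply: nearW => j; have /andP[a b]:=sP j; rewrite !ltW.
 - rewrite -[X in _ --> X]subr0; apply: cvgB; first exact: cvg_cst.
  rewrite -(mulr0 e); apply: cvgMr; have := @cvg_harmonic R; rewrite -(cvg_shiftS _) /=; exact.
 - exact: cvg_cst.
have sb j: 0<(qpos (s j) : R)<e by rewrite qpos_gt0 /=; have /andP[]:=sP j.
have ue:=lu e (fun j => qpos (s j)) e0 sb sc.
apply: (@le_lt_trans _ _ (eta/2)); last by lra.
have cd: `|u (qpos i0)-u (qpos (s j))| @[j --> \oo] --> `|u (qpos i0)-u e|.
 by apply: cvg_norm; apply: cvgB => //; exact: cvg_cst.
rewrite -(cvg_lim (@Rhausdorff R) cd); apply: limr_le; first by apply: cvgP cd.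
apply: nearW => j; apply: le_trans (ltW kd); apply: Hn => //.
by have /andP[_ h]:=sP j; rewrite ltW // (lt_trans h).
Qed.

Section Fixed.
Variables (L K C alpha p: R) (P: R -> R) (kap: R -> R -> R -> R) (A f: R -> R).
Hypotheses (HK: lkernel L K C alpha P kap) (AL: lipr L A) (A0: forall x, 0<A x)
 (p1: 1<p) (mf: mfun R f) (foo: (Lpi p f < +oo)%E).

Let sP:=lk_smooth HK.
Let mP:=lk_measP HK.
Let mA:=lipr_measurable AL.
Let mxy x: mfun R (fun y => x-y). Proof. exact: mfunB. Qed.
Let mPs x: mfun R (fun y => P (slp A x y)).
Proof. by apply: (mcomp mP); apply: (m_comp2 (m_slp AL)). Qed.
Let mcp r x: mfun R (fun y => cpoi r (x-y)).
Proof. by apply: m_cpoi; [exact: mcst|exact: mxy]. Qed.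
Let mtr e x: mfun R (trk A e x). Proof. exact: m_trk AL e x. Qed.
Let mkap x: mfun R (fun y => kap (x-y) (A x) (A y)).
Proof. by apply: (lk_meas HK) => //; exact: mxy. Qed.
Let minv x: mfun R (fun y => (x-y)^-1).
Proof. exact: (mcomp m_inv). Qed.
Let L0: 0<=L. Proof. exact: lipr_le0 AL. Qed.
Let PK x y: `|P (slp A x y)| <= K. Proof. by have [P1 _ _]:=sP; apply: P1; exact: slp_le. Qed.
Let K0: 0<=K. Proof. exact: le_trans (PK 0 0). Qed.

Let rh x y:=rho alpha P kap (x-y) (A x) (A y).

Let slpE x y: (A y-A x) / - (x-y) = slp A x y.
Proof. by rewrite opprB. Qed.

Let mrh x: mfun R (rh x).
Proof.
rewrite /rh /rho; apply: mfunB; first exact: mkap.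
apply: mfunM => //; apply: mfunM.
 by rewrite (_: (fun _ => _) = (fun y => P (slp A x y))) //; apply/funext => y; rewrite slpE.
by apply: mfunB; [exact: minv|exact: mcp].
Qed.

Lemma lkernel_rho_le x y: `|rh x y| <= C*poi (A x) (x-y).
Proof. by apply: (lk_rho HK) => //; rewrite (distrC x). Qed.

Let mtrh e x: mfun R (fun y => trk A e x y*rh x y).
Proof. by apply: mfunM; [exact: mtr|exact: mrh]. Qed.

Let trh_le e x y: `|trk A e x y*rh x y| <= C*poi (A x) (x-y).
Proof.
rewrite (normrM (trk _ _ _ _)) -[leRHS]mul1r; apply: ler_pM => //; [exact: trk_le|exact: lkernel_rho_le].
Qed.

Let irh e x: mu.-integrable [set: R] (EFin \o (fun y => trk A e x y*rh x y*f y)).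
Proof. exact: (integrable_dominated p1 mf foo (mtrh e x) (A0 x) (trh_le e x)). Qed.

Lemma trk_kap_split e x y: trk A e x y*kap (x-y) (A x) (A y) =
 alpha*(P (slp A x y)*shk A e (A x) x y)+trk A e x y*rh x y.
Proof. by rewrite /rh /rho slpE /shk -/(trk A e x y); move: (trk _ _ _ _) (cpoi _ _) (kap _ _ _) => a b c; ring. Qed.

Lemma IN_split e x: 0<e -> IN kap A e f x =
 alpha*SH P A e (A x) f x + \int[mu]_y (trk A e x y*rh x y*f y).
Proof.
move=> e0; have iS:=SH_integrable sP AL mP p1 mf foo x e0 (A0 x).
have iaS: mu.-integrable [set: R] (EFin \o (fun y => alpha*(P (slp A x y)*shk A e (A x) x y*f y))).
 have:=integrableZl measurableT alpha iS; by apply: eq_integrable => // y _; rewrite /= EFinM.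
rewrite /IN /SH -(RintegralZR alpha measurableT iS) -(RintegralDR measurableT iaS (irh e x)).
apply: eq_Rintegral => y _; rewrite trk_kap_split.
by move: (P _) (shk _ _ _ _ _) (trk _ _ _ _) (rh x y) (f y) => a b c d h; ring.
Qed.

Lemma trk_kap_le e x y: 0<e -> `|trk A e x y*kap (x-y) (A x) (A y)| <=
 (`|alpha| * (K*(A x*(1+L)/e))+C)*poi (A x) (x-y).
Proof.
move=> e0; rewrite trk_kap_split mulrDl; apply: le_trans (ler_normD _ _) _; apply: lerD; last exact: trh_le.
rewrite (normrM alpha) (normrM (P _)) -[leRHS]mulrA; apply: ler_wpM2l => //.
by rewrite -[leRHS]mulrA; apply: ler_pM => //; exact: (shk_le _ _ AL e0 (A0 x)).
Qed.

Lemma IN_abs_integrable e x: 0<e ->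
 mu.-integrable [set: R] (EFin \o (fun y => trk A e x y*kap (x-y) (A x) (A y)*f y)).
Proof.
move=> e0; apply: (integrable_dominated p1 mf foo _ (A0 x) (fun y => trk_kap_le x y e0)).
by apply: mfunM; [exact: mtr|exact: mkap].
Qed.

Let rcv (s: nat -> R) (k0: R -> R) x: mfun R k0 ->
 {ae mu, forall y, trk A (s n) x y @[n --> \oo] --> k0 y} ->
 \int[mu]_y (trk A (s n) x y*rh x y*f y) @[n --> \oo] --> \int[mu]_y (k0 y*rh x y*f y).
Proof.
move=> mk0 ck.
have [] := @Rintegral_dominated _ _ _ mu setT (fun n y => trk A (s n) x y*rh x y*f y)
 (fun y => k0 y*rh x y*f y) (fun y => C*(poi (A x) (x-y) * `|f y|)) measurableT.
- by move=> n; apply: mfunM => //; exact: mtrh.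
- by apply: mfunM => //; apply: mfunM => //; exact: mrh.
- have:=integrableZl measurableT C (integrable_poi p1 mf foo x (A0 x)).
 by apply: eq_integrable => // y _; rewrite /= EFinM.
- by apply: (ae_sub _ ck) => y cy _; apply: cvgMl; apply: cvgMl.
- by move=> n y _; rewrite (normrM _ (f y)) mulrA; apply: ler_pM => //; exact: trh_le.
by [].
Qed.

Let IN_conv_at (x: R) : conv0 (fun e => SH P A e (A x) f x) -> conv0 (fun e => IN kap A e f x).
Proof.
move=> cx.
suff cr: conv0 (fun e => \int[mu]_y (trk A e x y*rh x y*f y)).
 apply: (@conv0_near _ _ (fun e => alpha*SH P A e (A x) f x + \int[mu]_y (trk A e x y*rh x y*f y)) 1 ltr01).
  by move=> e e0 _; exact: IN_split.
 by apply: conv0D => //; exact: conv0M.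
apply: (conv0_seq (l:=\int[mu]_y ((cst 1: R -> R) y*rh x y*f y))) => s s0 sc.
apply: rcv; first exact: mcst.
have ne: {ae mu, forall u, u != x}.
 exists [set x]; split; [exact: measurable_set1|exact: lebesgue_measure_set1|].
 by move=> y /= /negP; rewrite negbK => /eqP.
by apply: (ae_sub _ ne) => y yx; exact: (trk_cvg AL).
Qed.

Lemma IN_conv: {ae mu, forall x, conv0 (fun e => IN kap A e f x)}.
Proof.
by apply: (ae_sub _ (SH_conv sP AL mP p1 mf foo)) => x cx; apply: IN_conv_at; apply: cx.
Qed.

(** The inner radius must stay below the outer one, which is the height [A x]; this is the origin of
    the restriction to small radii in everything that follows. *)
Lemma IN_sup e x (B: R) : 0<e -> e<=A x -> (Mx1 p P A f x<=B%:E)%E ->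
 `|IN kap A e f x| <= (`|alpha| * (2+2*K*(L+2))+2 * `|C|)*B`^p^-1.
Proof.
move=> e0 eA MB; rewrite IN_split //; apply: le_trans (ler_normD _ _) _; rewrite mulrDl; apply: lerD.
 by rewrite normrM -mulrA; apply: ler_wpM2l => //; exact: (SH_sup p1 sP AL mP mf foo e0 eA MB).
apply: le_trans (le_dominated p1 mf foo (mtrh e x) (A0 x) (trh_le e x)) _.
have [_ _ h']:=Mx1_bound p1 sP AL mP mf foo MB; have h:=h' _ (A0 x).
have P0 := @PP_ge0 R f (A x) x (A0 x).
apply: (le_via (`|C| * PP (A x) f x)); first by rewrite ler_wpM2r // ler_norm.
by rewrite [leRHS](_: _ = `|C| * (2*B`^p^-1)); [exact: ler_wpM2l|ring].
Qed.

Lemma trk_left e x y (s: nat -> R) : (forall n, 0<s n<e) -> s n @[n --> \oo] --> e ->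
 trk A (s n) x y @[n --> \oo] --> trk A e x y.
Proof.
move=> sb sc; apply: cvg_near_cst; rewrite /trk /trunc.
have [h|h]:=leP e (`|x-y| * Num.sqrt (1+slp A x y^+2)).
 apply: nearW => n; have /andP[_ sn]:=sb n.
 by rewrite (le_trans (ltW sn) h).
have cl: \forall n \near \oo, `|x-y| * Num.sqrt (1+slp A x y^+2)<s n by apply: (cvgr_gt _ sc).
by apply: filterS cl => n hn; rewrite leNgt hn.
Qed.

(** The inequality in [trunc] is not strict, so the truncated kernel is continuous from the left in
    the radius at every pair of points. *)
Lemma IN_left e x (s: nat -> R) : 0<e -> (forall n, 0<s n<e) -> s n @[n --> \oo] --> e ->
 IN kap A (s n) f x @[n --> \oo] --> IN kap A e f x.
Proof.
move=> e0 sb sc.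
have cl: \forall n \near \oo, e/2<s n by apply: (cvgr_gt _ sc); lra.
have [N _ HN]:=cl; rewrite -(cvg_shiftn N) /=.
pose c:=`|alpha| * (K*(A x*(1+L)/(e/2)))+C.
have e2: 0<e/2 by lra.
have [] := @Rintegral_dominated _ _ _ mu setT (fun n y => trk A (s (n+N)%N) x y*kap (x-y) (A x) (A y)*f y)
 (fun y => trk A e x y*kap (x-y) (A x) (A y)*f y) (fun y => c*(poi (A x) (x-y) * `|f y|)) measurableT.
- by move=> n; apply: mfunM => //; apply: mfunM; [exact: mtr|exact: mkap].
- by apply: mfunM => //; apply: mfunM; [exact: mtr|exact: mkap].
- have:=integrableZl measurableT c (integrable_poi p1 mf foo x (A0 x)).
 by apply: eq_integrable => // y _; rewrite /= EFinM.
- apply: aeW => y _; apply: cvgMl; apply: cvgMl.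
 by have := @trk_left e x y s sb sc; rewrite -(cvg_shiftn N).
- move=> n y _; rewrite (normrM _ (f y)) mulrA; apply: ler_pM => //.
 have sN: e/2<s (n+N)%N by apply: HN; rewrite /= leq_addl.
 apply: (le_via `|trk A (e/2) x y*kap (x-y) (A x) (A y)|); last exact: trk_kap_le.
 rewrite (normrM (trk _ _ _ _)) (normrM (trk A (e/2) x y)); apply: ler_pM => //.
 rewrite /trk /trunc; have [h|h]:=leP (s (n+N)%N) (`|x-y| * Num.sqrt (1+slp A x y^+2)).
  by rewrite (le_trans (ltW sN) h).
 by rewrite [leLHS](_: _ = 0) //; exact: normr0.
by [].
Qed.

Lemma IN_ratc x: ratc (fun e => IN kap A e f x) -> conv0 (fun e => IN kap A e f x).
Proof. by apply: ratc_conv0 => e s e0 sb sc; exact: IN_left. Qed.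

End Fixed.
End Line.

(** * Lebesgue measure and its products as sigma-finite measures *)

Section LebD.
Variable R: realType.
Local Notation mu:=(@lebesgue_measure R).

(* Lebesgue measure on the canonical measurable structure of [R], which differs
  (by its display) from the structure that carries [lebesgue_measure] *)
Definition lebD: set R -> \bar R:=mu.

Let lebD0: lebD set0 = 0%E. Proof. exact: measure0. Qed.
Let lebD_ge0 A: (0<=lebD A)%E. Proof. exact: measure_ge0. Qed.
Let lebD_add: semi_sigma_additive lebD.
Proof. exact: (@measure_semi_sigma_additive _ _ _ mu). Qed.
HB.instance Definition _:=isMeasure.Build _ R R lebD lebD0 lebD_ge0 lebD_add.
Let lebD_sf: sigma_finite [set: R] lebD.
Proof. by have [F FT HF]:=sigma_finiteT mu; exists F. Qed.
HB.instance Definition _ := @Measure_isSigmaFinite.Build _ R R lebD lebD_sf.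

Let idR: measurableTypeR R -> R:=id.
Let midR: mfun (measurableTypeR R) idR.
Proof. by move=> _ Y mY; rewrite setTI preimage_id. Qed.

Lemma ge0_integral_lebD (f: R -> \bar R) : mfun R f -> (forall x, 0<=f x)%E ->
 (\int[lebD]_x f x = \int[mu]_x f x)%E.
Proof.
move=> mf f0.
have := @ge0_integral_pushforward _ _ _ _ R idR midR mu setT f measurableT mf (fun x _ => f0 x).
rewrite preimage_setT => <-.
by apply: eq_measure_integral => A mA _.
Qed.

Lemma integral_lebD (f: R -> \bar R) : mfun R f -> (\int[lebD]_x f x = \int[mu]_x f x)%E.
Proof.
move=> mf; rewrite integralE [RHS]integralE; congr (_-_)%E; apply: ge0_integral_lebD => //.
 exact: measurable_funepos.
exact: measurable_funeneg.
Qed.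

Definition lebDm: {sigma_finite_measure set R -> \bar R}:=lebD.

Section Prod.
Variables (d: measure_display) (T: measurableType d) (m: {sigma_finite_measure set T -> \bar R}).

(** The product receives its own measure and sigma-finiteness instances so that [lebm] can iterate
    it by recursion on the dimension. *)
Definition pmeas: set (R*T)%type -> \bar R:=(lebDm \x m)%E.

Let pm0: pmeas set0 = 0%E. Proof. exact: measure0. Qed.
Let pm_ge0 A: (0<=pmeas A)%E. Proof. exact: measure_ge0. Qed.
Let pm_add: semi_sigma_additive pmeas. Proof. exact: measure_semi_sigma_additive. Qed.
HB.instance Definition _:=isMeasure.Build _ _ R pmeas pm0 pm_ge0 pm_add.

Let pm_sf: sigma_finite [set: R*T] pmeas.
Proof.
have /sigma_finiteP[F [TF ndF Foo]]:=sigma_finiteT lebDm.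
have /sigma_finiteP[G [TG ndG Goo]]:=sigma_finiteT m.
exists (fun n => F n `*` G n).
 rewrite -setXTT TF TG predeqE => -[x y]; split.
  move=> [/= [n _ Fnx] [k _ Gky]]; exists (maxn n k) => //; split.
  - by move: x Fnx; exact/subsetPset/ndF/leq_maxl.
  - by move: y Gky; exact/subsetPset/ndG/leq_maxr.
 by move=> [n _ []/= ? ?]; split; exists n.
move=> k; have [? ?]:=Foo k; have [? ?]:=Goo k.
split; first exact: measurableX.
by rewrite /pmeas product_measure1E// lte_mul_pinfty// ge0_fin_numE.
Qed.
HB.instance Definition _ := @Measure_isSigmaFinite.Build _ _ R pmeas pm_sf.

Definition prodm: {sigma_finite_measure set (R*T)%type -> \bar R}:=pmeas.
End Prod.
End LebD.

(** * Iterated product spaces and the weight on directions *)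

Section Rsp.
Context {R: realType}.
Local Notation mu:=(@lebesgue_measure R).
Local Notation Rsp:=(Rsp R).

Fixpoint lebm (k: nat) : {sigma_finite_measure set (Rsp k) -> \bar R} :=
 match k return {sigma_finite_measure set (Rsp k) -> \bar R} with
 | 0 => @lebD R
 | k'.+1 => prodm (lebm k')
 end.

Lemma lebmE k: (lebm k: set (Rsp k) -> \bar R) = @lebn R k.
Proof. by elim: k => [//|k IH] /=; rewrite -IH. Qed.

Lemma lebmS k (F: Rsp k.+1 -> \bar R) : mfun (Rsp k.+1) F -> (forall x, 0<=F x)%E ->
 (\int[lebm k.+1]_x F x = \int[mu]_s \int[lebm k]_v F (s, v))%E.
Proof.
move=> mF F0; rewrite [LHS](@fubini_tonelli1 _ _ R (Rsp k) R (@lebDm R) (lebm k) F) //.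
apply: ge0_integral_lebD.
 exact: (@measurable_fun_fubini_tonelli_F _ _ R (Rsp k) R (lebm k) F).
by move=> x; apply: integral_ge0.
Qed.

Lemma lebmS2 k (F: Rsp k.+1 -> \bar R) : mfun (Rsp k.+1) F -> (forall x, 0<=F x)%E ->
 (\int[lebm k.+1]_x F x = \int[lebm k]_v \int[mu]_s F (s, v))%E.
Proof.
move=> mF F0; rewrite [LHS](@fubini_tonelli2 _ _ R (Rsp k) R (@lebDm R) (lebm k) F) //.
apply: eq_integral => v _; rewrite /fubini_G; apply: ge0_integral_lebD => //.
by apply: (mcomp mF); exact: mpair.
Qed.

Fixpoint vlin (k: nat) (c d: R) : Rsp k -> Rsp k -> Rsp k :=
 match k return Rsp k -> Rsp k -> Rsp k with
 | 0 => fun u w => c*u+d*w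
 | k'.+1 => fun u w => (c*u.1+d*w.1, @vlin k' c d u.2 w.2)
 end.

Lemma m_vlin k d0 (T: measurableType d0) (c d: T -> R) (u w: T -> Rsp k) :
 mfun T c -> mfun T d -> mfun T u -> mfun T w ->
 mfun T (fun x => vlin (c x) (d x) (u x) (w x)).
Proof.
move=> mc md; elim: k u w => [|k IH] u w mu0 mw /=.
 by apply: mfunD; apply: mfunM.
apply: mpair.
 by apply: mfunD; apply: mfunM => //; exact: (mcomp measurable_fst).
by apply: IH; exact: (mcomp measurable_snd).
Qed.

Lemma ge0_integral_affine_scale (c b: R) n (H: R -> \bar R) : c != 0 -> mfun R H ->
 (forall s, 0<=H s)%E ->
 (\int[mu]_s ((`|c| ^+ n)%:E*H s) = (`|c| ^+ n.+1)%:E * \int[mu]_s H (c*s+b)%R)%E.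
Proof.
move=> c0 mH H0; rewrite ge0_integralZl_EFin ?exprn_ge0 //.
by rewrite (@ge0_integral_affine R c b setT H) // preimage_setT muleA -EFinM -exprSr.
Qed.

Lemma integral_vlin k (c d: R) (w: Rsp k) (F: Rsp k -> \bar R) : c != 0 -> mfun (Rsp k) F ->
 (forall x, 0<=F x)%E ->
 (\int[lebm k]_u F u = (`|c| ^+ k.+1)%:E * \int[lebm k]_u F (vlin c d u w))%E.
Proof.
move=> c0; elim: k w F => [|k IH] w F mF F0.
 rewrite /= ge0_integral_lebD // (@ge0_integral_affine R c (d*w)) // preimage_setT expr1.
 rewrite ge0_integral_lebD //.
 by apply: (mcomp mF); exact: m_affine.
have mG: mfun (Rsp k.+1) (fun u => F (vlin c d u w)).
 by apply: (mcomp mF); apply: (@m_vlin k.+1).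
rewrite lebmS // [in RHS]lebmS //.
have mH (F' : Rsp k.+1 -> \bar R) : mfun (Rsp k.+1) F' -> (forall x, 0<=F' x)%E ->
  mfun R (fun s => \int[lebm k]_v F' (s, v))%E.
 by move=> m' ?; exact: (@measurable_fun_fubini_tonelli_F _ _ R (Rsp k) R (lebm k) F').
have mFs s: mfun (Rsp k) (fun v => F (s, v)).
 by apply: (mcomp mF); exact: mpair.
have E s: (\int[lebm k]_v F (s, v) = (`|c| ^+ k.+1)%:E * \int[lebm k]_v F (s, vlin c d v w.2))%E.
 exact: (IH w.2 (fun v => F (s, v))).
have mF2: mfun (Rsp k.+1) (fun z: Rsp k.+1 => F (z.1, vlin c d z.2 w.2)).
 apply: (mcomp mF); apply: mpair => //.
 by apply: m_vlin.
have m2:=mH _ mF2 (fun z => F0 _).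
rewrite [LHS](_: _ = (\int[mu]_s ((`|c| ^+ k.+1)%:E * \int[lebm k]_v F (s, vlin c d v w.2)))%E); last first.
 by apply: eq_integral => s _; exact: E.
apply: (@ge0_integral_affine_scale c (d*w.1) k.+1 (fun s => \int[lebm k]_v F (s, vlin c d v w.2))%E c0 m2).
by move=> s; apply: integral_ge0.
Qed.

Fixpoint l1 k: Rsp k -> Rsp k -> R:=match k return Rsp k -> Rsp k -> R with
 | 0 => fun u w => `|u-w|
 | k'.+1 => fun u w => `|u.1-w.1| + @l1 k' u.2 w.2
 end.

Lemma l1_refl k (u: Rsp k) : l1 u u = 0.
Proof. by elim: k u => [u|k IH u] /=; rewrite subrr normr0 // IH addr0. Qed.

(** Rounding the first coordinate to a grid gives functions whose preimages are countable unions of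
    products of an interval with a section; the sections are measurable by induction, and the
    rounded functions converge to [G]. *)
Lemma l1_measurable k (L: R) (G: Rsp k -> R) : (forall u w, `|G u-G w| <= L * l1 u w) ->
 mfun (Rsp k) G.
Proof.
elim: k G => [G GL|k IH G GL]; first exact: (lipr_measurable GL).
have mv s: mfun (Rsp k) (fun v => G (s, v)).
 by apply: IH => u w; apply: le_trans (GL _ _) _; rewrite /= subrr normr0 add0r.
pose z (n: nat) (s: R) : int:=Num.floor (s*n.+1%:R).
pose F n (x: Rsp k.+1):=G ((z n x.1)%:~R/n.+1%:R, x.2).
apply: (@measurable_fun_cvg _ _ _ setT F).
 move=> n _ Y mY; rewrite setTI.
 rewrite (_: _ @^-1` _ = \bigcup_(i: int) ([set s: R | z n s = i] `*` ((fun v => G (i%:~R/n.+1%:R, v)) @^-1` Y))).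
  apply: countable_bigcupT_measurable => // i; apply: measurableX.
  rewrite (_: [set s | _] = `[i%:~R/n.+1%:R, (i+1)%:~R/n.+1%:R[%classic); first exact: measurable_itv.
  apply/seteqP; split=> s /=; rewrite in_itv /= ler_pdivrMr // ltr_pdivlMr //.
  by move=> <-; exact: floor_itv.
  by move=> h; apply/eqP; rewrite /z floor_eq.
  by have:=mv (i%:~R/n.+1%:R) measurableT Y mY; rewrite setTI.
 apply/seteqP; split=> x /=; first by move=> h; exists (z n x.1).
 by move=> [i _ [/= zi h]]; rewrite /F zi.
move=> x _; apply/cvgrPdist_le => e e0.
have L0: 0 <= `|L| / e by rewrite divr_ge0 // ltW.
have /andP[_ hN]:=truncn_itv L0.
exists (Num.trunc (`|L| / e)) => // n /= Nn.
apply: le_trans (GL _ _) _; rewrite /= l1_refl addr0.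
apply: (le_via (`|L| * n.+1%:R^-1)).
 apply: le_trans (ler_wpM2r (normr_ge0 _) (ler_norm L)) _; apply: ler_wpM2l => //.
 have /andP[h1 h2]:=floor_itv (x.1*n.+1%:R); rewrite -/(z n x.1) in h1 h2.
 have n0: 0<n.+1%:R :> R by [].
 rewrite -[X in X-_](mulfK (lt0r_neq0 n0)) -mulrBl normrM [X in _*X]ger0_norm ?invr_ge0 ?(ltW n0) //.
 rewrite -[leRHS]mul1r ler_wpM2r ?invr_ge0 ?(ltW n0) //.
 by rewrite intrD in h2; rewrite ger0_norm; lra.
rewrite ler_pdivrMr // mulrC -ler_pdivrMr //; apply: le_trans (ltW hN) _.
by rewrite ler_nat ltnS.
Qed.

Fixpoint vsq k: Rsp k -> R:=match k return Rsp k -> R with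
 | 0 => fun u => u^+2
 | k'.+1 => fun u => u.1^+2 + @vsq k' u.2
 end.

Lemma vsq_ge0 k (u: Rsp k) : 0<=vsq u.
Proof. by elim: k u => [u|k IH u] /=; rewrite ?addr_ge0 ?sqr_ge0. Qed.

Lemma m_vsq k: mfun (Rsp k) (@vsq k).
Proof.
elim: k => [|k IH] /=; first exact: mfunX.
apply: mfunD; first by apply: mfunX.
exact: (mcomp IH).
Qed.

Lemma m_nth k i: mfun (Rsp k) (fun u => nth 0 (rspcoords u) i).
Proof.
elim: k i => [[|i]|k IH [|i]] //=; first exact: measurable_fst.
exact: (mcomp (IH i) measurable_snd).
Qed.

Lemma nth_vlin k c d (u w: Rsp k) i :
 nth 0 (rspcoords (vlin c d u w)) i = c*nth 0 (rspcoords u) i+d*nth 0 (rspcoords w) i.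
Proof.
elim: k i u w => [|k IH] [|i] u w //=.
by rewrite ?nth_nil !mulr0 addr0.
Qed.

Lemma vsq_sum k (u: Rsp k) : vsq u = \sum_(i<k.+1) nth 0 (rspcoords u) i^+2.
Proof.
elim: k u => [u|k IH u] /=; first by rewrite big_ord_recl big_ord0 addr0.
by rewrite big_ord_recl /= IH.
Qed.

Lemma l1_sum k (u w: Rsp k) : l1 u w = \sum_(i<k.+1) `|nth 0 (rspcoords u) i-nth 0 (rspcoords w) i|.
Proof.
elim: k u w => [u w|k IH u w] /=; first by rewrite big_ord_recl big_ord0 addr0.
by rewrite big_ord_recl /= IH.
Qed.

Lemma poi_integral: exists2 W: R, 0<=W & forall r, 0<r -> (\int[mu]_y (poi r y)%:E<=W%:E)%E.
Proof.
have h0: (0 <= \int[mu]_y (poi 1 y)%:E)%E by apply: integral_ge0 => y _; rewrite lee_fin poi_ge0.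
have E0: (\int[mu]_y (poi 1 (0-y))%:E = \int[mu]_y (poi 1 y)%:E)%E.
 by apply: eq_integral => y _; rewrite /poi sub0r sqrrN.
have:=poi1_lty (0: R); rewrite E0 => hy.
exists (fine (\int[mu]_y (poi 1 y)%:E)%E); first exact: fine_ge0.
move=> r r0; rewrite fineK ?ge0_fin_numE //.
rewrite (@ge0_integral_affine R r 0) ?gt_eqF //; last 2 first.
- by apply/mEFinP; apply: m_poi; [exact: mcst|exact: measurable_id].
- by move=> y _; rewrite lee_fin poi_ge0.
rewrite preimage_setT (gtr0_norm r0) -ge0_integralZl_EFin ?(ltW r0) //.
- rewrite [leLHS](_: _ = (\int[mu]_y (poi 1 y)%:E)%E) //; apply: eq_integral => y _.
 by rewrite addr0 -EFinM poi_scale // divff ?gt_eqF.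
- by move=> y _; rewrite lee_fin poi_ge0.
- apply/mEFinP; apply: m_poi; first exact: mcst.
 exact: m_affine.
Qed.

(** [Rsp k] has [k.+1] coordinates, so the exponent [k.+2] is the first integer for which the
    integral converges. *)
Definition wden k (a: R) (v: Rsp k) : R:=((Num.sqrt (a+vsq v))^+k.+2)^-1.

Lemma m_wden k a: mfun (Rsp k) (wden a: Rsp k -> R).
Proof.
apply: (mcomp m_inv); apply: mfunX.
apply: msqrt.
by apply: mfunD => //; exact: m_vsq.
Qed.

(** One coordinate is integrated at a time: with [b^2 = a + |v|^2], the integrand is at most
    [wden a v] times the Poisson kernel of height [b], whose mass is bounded independently of
    [b]. *)
Lemma wden_integral k: exists2 W: R, 0<=W &
 forall a, 0<a -> (\int[lebm k]_v (wden a v)%:E<=(W/Num.sqrt a)%:E)%E.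
Proof.
have [W0 W00 H0]:=poi_integral.
elim: k => [|k [W WW H]].
 exists W0 => // a a0; have s0: 0<Num.sqrt a by rewrite sqrtr_gt0.
 rewrite /= ge0_integral_lebD; last 2 first.
 - by apply/mEFinP; have := @m_wden 0 a; apply.
 - by move=> v; rewrite lee_fin /wden invr_ge0 exprn_ge0 ?sqrtr_ge0.
 rewrite [leLHS](_: _ = (\int[mu]_v (((Num.sqrt a)^-1)%:E*(poi (Num.sqrt a) v)%:E))%E); last first.
  apply: eq_integral => v _; rewrite -EFinM; congr EFin; rewrite /wden /poi /= !sqr_sqrtr ?addr_ge0 ?sqr_ge0 ?(ltW a0) //.
  by rewrite mulrA mulVf ?gt_eqF // mul1r.
 rewrite ge0_integralZl_EFin ?invr_ge0 ?(ltW s0) //.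
 - rewrite mulrC EFinM; apply: lee_wpmul2l; [by rewrite lee_fin invr_ge0 ltW|exact: H0].
 - by move=> v _; rewrite lee_fin poi_ge0.
 - by apply/mEFinP; apply: m_poi; [exact: mcst|exact: measurable_id].
exists (W0*W); first exact: mulr_ge0.
move=> a a0; have s0: 0<Num.sqrt a by rewrite sqrtr_gt0.
rewrite lebmS2; last 2 first.
- by apply/mEFinP; exact: (@m_wden k.+1 a).
- by move=> v; rewrite lee_fin /wden invr_ge0 exprn_ge0 ?sqrtr_ge0.
have w0 v: 0<=wden a (v: Rsp k) by rewrite /wden invr_ge0 exprn_ge0 ?sqrtr_ge0.
have key (v: Rsp k) : (\int[mu]_s (wden a ((s, v) : Rsp k.+1))%:E<=W0%:E*(wden a v)%:E)%E.
 have av: 0<a+vsq v by rewrite ltr_pwDl ?vsq_ge0.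
 have b0: 0<Num.sqrt (a+vsq v) by rewrite sqrtr_gt0.
 set b:=Num.sqrt (a+vsq v) in b0.
 have mp: mfun R (fun s => (poi b s)%:E).
  by apply/mEFinP; apply: m_poi; [exact: mcst|exact: measurable_id].
 apply: (le_via (\int[mu]_s ((wden a v)%:E*(poi b s)%:E))%E); last first.
  rewrite ge0_integralZl_EFin //; first by rewrite [leRHS]muleC; apply: lee_wpmul2l; [rewrite lee_fin|exact: H0].
  by move=> s _; rewrite lee_fin poi_ge0.
 have mws: mfun R (fun s => (wden a ((s, v) : Rsp k.+1))%:E).
  apply/mEFinP; apply: (mcomp (@m_wden k.+1 a)).
  exact: mpair.
 have mwp: mfun R (fun s => (wden a v)%:E*(poi b s)%:E)%E by exact: measurable_funeM.
 have ws0 s: (0<=(wden a ((s, v) : Rsp k.+1))%:E)%E by rewrite lee_fin /wden invr_ge0 exprn_ge0 ?sqrtr_ge0.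
 apply: ge0_le_integral => //; try by [move=> s _; exact: ws0|exact: mws|exact: mwp].
 - move=> s _; rewrite -EFinM lee_fin /wden /poi -/b /=.
  have bE: b^+2 = a+vsq v by rewrite sqr_sqrtr // ltW.
  have cE: a+(s^+2+vsq v) = b^+2+s^+2 by rewrite bE; ring.
  rewrite cE; have D0: 0<b^+2+s^+2 by rewrite ltr_pwDl ?exprn_gt0 ?sqr_ge0.
  have c0: 0<Num.sqrt (b^+2+s^+2) by rewrite sqrtr_gt0.
  have bc: b<=Num.sqrt (b^+2+s^+2).
  by rewrite -[leLHS]ger0_norm ?(ltW b0) // -sqrtr_sqr ler_wsqrtr // lerDl sqr_ge0.
  have c2: Num.sqrt (b^+2+s^+2)^+2 = b^+2+s^+2 by rewrite sqr_sqrtr // ltW.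
  move: (Num.sqrt (b^+2+s^+2)) c0 bc c2 => c c0 bc c2; rewrite -c2.
  rewrite (_: (b^+k.+2)^-1*(b/c^+2) = (b^+k.+1*c^+2)^-1); last first.
  rewrite (exprS b k.+1); field; rewrite !expf_neq0 ?gt_eqF //.
  have -> : c^+k.+3 = c^+k.+1*c^+2 by rewrite -exprD addn2.
  rewrite lef_pV2 ?posrE ?mulr_gt0 ?exprn_gt0 //.
  by rewrite ler_wpM2r ?exprn_ge0 ?(ltW c0) // lerXn2r ?nnegrE ?(ltW b0) ?(ltW c0).
have mI: mfun (Rsp k) (fun v => \int[mu]_s (wden a ((s, v) : Rsp k.+1))%:E)%E.
 rewrite (_: (fun v => _) = (fun v: Rsp k => \int[@lebD R]_s (wden a ((s, v) : Rsp k.+1))%:E)%E).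
  apply: (@measurable_fun_fubini_tonelli_G _ _ R (Rsp k) R (@lebDm R) (fun z: Rsp k.+1 => (wden a z)%:E)).
  - by apply/mEFinP; exact: (@m_wden k.+1 a).
  - by move=> x; rewrite lee_fin /wden invr_ge0 exprn_ge0 ?sqrtr_ge0.
 apply/funext => v; rewrite ge0_integral_lebD //.
  apply/mEFinP; apply: (mcomp (@m_wden k.+1 a)).
  exact: mpair.
 by move=> x; rewrite lee_fin /wden invr_ge0 exprn_ge0 ?sqrtr_ge0.
have mw: mfun (Rsp k) (fun v: Rsp k => (wden a v)%:E).
 by apply/mEFinP; exact: m_wden.
apply: (le_via (\int[lebm k]_v (W0%:E*(wden a v)%:E))%E).
 apply: ge0_le_integral => //.
 - move=> v _; apply: integral_ge0 => s _; by rewrite lee_fin /wden invr_ge0 exprn_ge0 ?sqrtr_ge0.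
 - exact: measurable_funeM.
apply: (le_via (W0%:E * \int[lebm k]_v (wden a v)%:E)%E).
 by rewrite ge0_integralZl_EFin // => x _; rewrite lee_fin.
by rewrite -mulrA EFinM; apply: lee_wpmul2l; [rewrite lee_fin|exact: H].
Qed.
End Rsp.

(** * Averaging line operators over directions *)

Section ND.
Context {R: realType}.
Local Notation mu:=(@lebesgue_measure R).
Local Notation Rsp:=(Rsp R).

Lemma m_ratc d (T: measurableType d) (u: T -> R -> R) :
 (forall i, mfun T (fun t => u t (qpos i))) -> measurable [set t | ratc (u t)].
Proof.
move=> mu0.
rewrite (_: [set t | _] = \bigcap_(k in [set: nat]) \bigcup_(n in [set: nat])
  \bigcap_(i in [set: nat]) \bigcap_(j in [set: nat])
  (if ((qpos i: R)<=n.+1%:R^-1) && ((qpos j: R)<=n.+1%:R^-1)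
  then [set t | `|u t (qpos i)-u t (qpos j)| <= (k.+1%:R)^-1] else setT)).
 apply: bigcap_measurable => [|k _]; first by exists 0%N.
 apply: bigcup_measurable => n _.
 apply: bigcap_measurable => [|i _]; first by exists 0%N.
 apply: bigcap_measurable => [|j _]; first by exists 0%N.
 case: ifP => // _.
 have mf: mfun T (fun t => `|u t (qpos i)-u t (qpos j)|).
  apply: mnorm; exact: mfunB.
 have:=mf measurableT `]-oo, (k.+1%:R)^-1]%classic (measurable_itv _); rewrite setTI.
 by congr measurable; apply/seteqP; split=> t /=; rewrite in_itv.
apply/seteqP; split=> t /=.
 move=> H k _; have [n Hn]:=H k; exists n => // i _ j _.
 by case: ifP => // /andP[h1 h2]; exact: Hn.
move=> H k; have [n _ Hn]:=H k I; exists n => i j hi hj.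
by have:=Hn i I j I; rewrite hi hj.
Qed.

Lemma div_cancel (a b c d: R) : b != 0 -> d != 0 -> a/d*c/(b/d) = a*c/b.
Proof. by move=> b0 d0; field; rewrite b0 d0. Qed.

(** With [young_pow] this is Holder's inequality for the weighted mean over directions: the root is
    linearised with a free parameter [la], the linear bound is integrated, and [la = I^(1/p)] is
    inserted at the end. *)
Lemma pow_opt (p X I W CK: R) : 1<p -> 0<=X -> 0<=I -> 0<=W -> 0<=CK ->
 (forall la, 0<la -> X<=CK*(la`^(1-p)*I+la*W)) ->
 X`^p<=(CK*(1+W))`^p*I.
Proof.
move=> p1 X0 I0 W0 C00 H; have p0: 0<p by lra.
have [Iz|In]:=eqVneq I 0.
 suff -> : X = 0 by rewrite powR0 ?gt_eqF // Iz mulr0.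
 apply/eqP; rewrite eq_le X0 andbT; apply/ler_addgt0Pr => e e0; rewrite add0r.
 have CW: 0<CK*W+1 by rewrite ltr_wpDl // mulr_ge0.
 have d0: 0<e/(CK*W+1) by rewrite divr_gt0.
 apply: le_trans (H _ d0) _; rewrite Iz mulr0 add0r mulrCA mulrC mulrA ler_pdivrMr // mulrC.
 by rewrite ler_wpM2l ?(ltW e0) // lerDl.
have Ip: 0<I by rewrite lt_neqAle eq_sym In.
have la0: 0<I`^p^-1 by rewrite powR_gt0.
have E: (I`^p^-1)`^(1-p)*I = I`^p^-1.
 rewrite -powRrM -[X in _*X](powRr1 I0) -powRD ?In ?implybT //.
 by congr (_`^_); field; rewrite gt_eqF.
have h: X<=CK*(1+W)*I`^p^-1.
 by apply: le_trans (H _ la0) _; rewrite E le_eqVlt; apply/orP; left; apply/eqP; ring.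
have C1: 0<=CK*(1+W) by rewrite mulr_ge0 // addr_ge0.
apply: (le_via ((CK*(1+W)*I`^p^-1)`^p)).
 by apply: ge0_ler_powR; rewrite ?nnegrE ?(ltW p0) ?mulr_ge0 ?powR_ge0 ?addr_ge0.
by rewrite powRM ?powR_ge0 // -powRrM mulVf ?gt_eqF // powRr1.
Qed.

Lemma young_pow (p B la: R) : 1<p -> 0<=B -> 0<la -> B`^p^-1<=la`^(1-p)*B+la.
Proof.
move=> p1 B0 l0; have p0: 0<p by lra.
have l1: 0<=la`^(1-p)*B by rewrite mulr_ge0 // powR_ge0.
have [h|h]:=leP (B`^p^-1) la; first by apply: le_trans h _; rewrite lerDr.
apply: (le_via (la`^(1-p)*B)); last by rewrite lerDl ltW.
set b:=B`^p^-1 in h *; have b0: 0<b by exact: lt_trans h.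
have -> : B = b`^p by rewrite /b -powRrM mulVf ?gt_eqF // powRr1.
rewrite -[leLHS](powRr1 (ltW b0)) [X in b`^X](_: 1 = (1-p)+p); last by ring.
rewrite powRD; last by rewrite (gt_eqF b0) implybT.
apply: ler_wpM2r; first exact: powR_ge0.
have q0: 0<=p-1 by lra.
rewrite (_: 1-p = - (p-1)); last by ring.
rewrite !powRN lef_pV2 ?posrE ?(powR_gt0 _ l0) ?(powR_gt0 _ b0) //.
by apply: ge0_ler_powR; rewrite ?nnegrE ?(ltW l0) ?(ltW b0) ?(ltW h).
Qed.

Variable k: nat.
Definition om (v: Rsp k) : R:=Num.sqrt (1+vsq v).

Lemma om_ge1 v: 1<=om v.
Proof. by rewrite -[leLHS]sqrtr1 ler_wsqrtr // lerDl vsq_ge0. Qed.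

Lemma om_gt0 v: 0<om v. Proof. exact: lt_le_trans (om_ge1 v). Qed.

Lemma m_om: mfun (Rsp k) om.
Proof.
apply: msqrt.
by apply: mfunD => //; exact: m_vsq.
Qed.

Lemma vlin_add (c d: R) (u w: Rsp k) : vlin 1 c (vlin 1 d u w) w = vlin 1 (d+c) u w.
Proof.
elim: k u w => [|n IH] u w /=; first by ring.
by rewrite IH; congr pair; ring.
Qed.

(* base point on s = 0 of the line through z with direction (1, v) *)
Definition shr (t: Rsp k.+1*Rsp k) : Rsp k.+1*Rsp k:=((t.1.1, vlin 1 (- t.1.1) t.1.2 t.2), t.2).

Lemma m_shr: measurable_fun [set: Rsp k.+1*Rsp k] shr.
Proof.
have m11: measurable_fun [set: Rsp k.+1*Rsp k] (fun t => t.1.1) by exact: (mcomp measurable_fst).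
have m12: measurable_fun [set: Rsp k.+1*Rsp k] (fun t => t.1.2) by exact: (mcomp measurable_snd).
apply: mpair => //; apply: mpair => //.
by apply: m_vlin => //; exact: mfunN.
Qed.

Lemma integral_shear (sg: R) (v: Rsp k) (F: Rsp k.+1 -> \bar R) : mfun (Rsp k.+1) F ->
 (forall x, 0<=F x)%E ->
 (\int[lebm k.+1]_z F (z.1, vlin 1 (sg*z.1)%R z.2 v) = \int[lebm k.+1]_z F z)%E.
Proof.
move=> mF F0.
have mS: mfun (Rsp k.+1) (fun z: Rsp k.+1 => F (z.1, vlin 1 (sg*z.1) z.2 v)).
 apply: (mcomp mF); apply: mpair => //.
 by apply: m_vlin => //; exact: mfunM.
rewrite lebmS // [in RHS]lebmS //; apply: eq_integral => s _.
rewrite [RHS](@integral_vlin _ k 1 (sg*s) v (fun y => F (s, y))) //.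
 by rewrite normr1 expr1n mul1e.
by apply: (mcomp mF); exact: mpair.
Qed.

Lemma integral_shr (om0: Rsp k -> \bar R) (Q: Rsp k.+1*Rsp k -> \bar R) : mfun (Rsp k) om0 ->
 (forall v, 0<=om0 v)%E -> measurable_fun [set: Rsp k.+1*Rsp k] Q -> (forall t, 0<=Q t)%E ->
 (\int[lebm k.+1]_z \int[lebm k]_v (om0 v*Q (shr (z, v))) = \int[lebm k]_v (om0 v * \int[lebm k.+1]_z Q (z, v)))%E.
Proof.
move=> mo o0 mQ Q0.
have mQv v: mfun (Rsp k.+1) (fun z => Q (z, v)).
 by apply: (mcomp mQ); exact: mpair.
have mQs v: mfun (Rsp k.+1) (fun z => Q (shr (z, v))).
 by apply: (mcomp mQ); apply: (mcomp m_shr); exact: mpair.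
rewrite (@fubini_tonelli _ _ (Rsp k.+1) (Rsp k) R (lebm k.+1) (lebm k) (fun t => om0 t.2*Q (shr t))%E); last 2 first.
- apply: emeasurable_funM; first exact: (mcomp mo).
 exact: (mcomp mQ m_shr).
- by move=> t; rewrite mule_ge0.
apply: eq_integral => v _ /=.
rewrite ge0_integralZl //.
congr (_*_)%E; have := @integral_shear (-1) v (fun z => Q (z, v)) (mQv v) (fun z => Q0 _) => <-.
by apply: eq_integral => z _; rewrite /shr /= mulN1r.
Qed.

Section Fixed.
Variables (L K C alpha p: R) (P: R -> R) (kap: R -> R -> R -> R) (G h: Rsp k.+1 -> R) (w: Rsp k -> R).
Hypotheses (HK: lkernel L K C alpha P kap) (L0: 0<=L) (p1: 1<p)
 (mG: mfun (Rsp k.+1) G) (G0: forall z, 0<G z)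
 (mh: mfun (Rsp k.+1) h) (mw: mfun (Rsp k) w)
 (wle: forall v, `|w v| <= wden 1 v).

(** Division by [om v], the length of [(1, v)], measures heights in the unit of the parameter [s]
    and keeps the Lipschitz constant independent of the direction. *)
Definition Av (e v: Rsp k) (s: R) : R:=G (s, vlin 1 s e v)/om v.
Definition fv (e v: Rsp k) (s: R) : R:=h (s, vlin 1 s e v).

Hypothesis AL: forall e v, lipr L (Av e v).

Let T:=(Rsp k.+1*Rsp k)%type.

Let A0 e v s: 0<Av e v s. Proof. by rewrite divr_gt0 // om_gt0. Qed.

Let mpt: measurable_fun [set: T*R] (fun z: T*R => (z.2, vlin 1 z.2 z.1.1.2 z.1.2) : Rsp k.+1).
Proof.
apply: mpair => //; apply: m_vlin => //.
 by apply: (mcomp measurable_snd); exact: (mcomp measurable_fst).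
exact: (mcomp measurable_snd).
Qed.

Let mA: measurable_fun [set: T*R] (fun z: T*R => Av z.1.1.2 z.1.2 z.2).
Proof.
apply: mfunM; first exact: (mcomp mG mpt).
apply: (mcomp m_inv); apply: (mcomp m_om).
exact: (mcomp measurable_snd).
Qed.

Let mf: measurable_fun [set: T*R] (fun z: T*R => fv z.1.1.2 z.1.2 z.2).
Proof. exact: (mcomp mh mpt). Qed.

Let mx: mfun T (fun t: T => t.1.1). Proof. exact: (mcomp measurable_fst). Qed.

Definition INf (e: R) (t: T) : R:=IN kap (Av t.1.2 t.2) e (fv t.1.2 t.2) t.1.1.
Definition Mxf (t: T) : \bar R:=Mx1 p P (Av t.1.2 t.2) (fv t.1.2 t.2) t.1.1.

Lemma m_INf (e: T -> R) : mfun T e -> mfun T (fun t => INf (e t) t).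
Proof.
by move=> me; apply: (@m_IN R kap _ T (fun t => Av t.1.2 t.2) (fun t => fv t.1.2 t.2) e (fun t => t.1.1) (lk_meas HK)).
Qed.

Lemma m_Mxf: mfun T Mxf.
Proof. by apply: (@m_Mx1 R _ T P (fun t => Av t.1.2 t.2) (fun t => fv t.1.2 t.2) (fun t => t.1.1) (lk_measP HK)). Qed.

Let mfl (e v: Rsp k) : mfun R (fv e v).
Proof.
apply: (mcomp mh); apply: mpair => //.
by apply: m_vlin.
Qed.

Definition LL (e v: Rsp k) : \bar R:=(Lpi p (fv e v))%E.

Let mLLt: mfun T (fun t => LL t.1.2 t.2).
Proof.
rewrite (_: (fun t => _) = fun t: T => (\int[@lebD R]_s (`|fv t.1.2 t.2 s| `^ p)%:E)%E).
 apply: (@measurable_fun_fubini_tonelli_F _ _ (Rsp k.+1*Rsp k)%type R R (@lebDm R)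
  (fun z: (Rsp k.+1*Rsp k)*R => (`|fv z.1.1.2 z.1.2 z.2| `^ p)%:E)).
  exact: (m_powabs p mf).
 by move=> z; rewrite lee_fin powR_ge0.
apply/funext => t; by rewrite ge0_integral_lebD //; apply: m_powabs; exact: mfl.
Qed.

Let mLL v: mfun (Rsp k) (fun e => LL e v).
Proof.
have mp: mfun (Rsp k) (fun e => (((0: R), e) : Rsp k.+1, v)).
 by apply: mpair => //; exact: mpair.
exact: (mcomp mLLt mp).
Qed.

Definition goodk (t: T) : Prop:=(LL t.1.2 t.2 < +oo)%E /\ ratc (fun e => INf e t).

Let mgood: measurable [set t | goodk t].
Proof.
rewrite (_: [set t | _] = [set t: T | (LL t.1.2 t.2 < +oo)%E] `&` [set t | ratc (fun e => INf e t)]); last by apply/seteqP; split.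
apply: measurableI; last by apply: m_ratc => i; apply: m_INf.
have:=mLLt measurableT (emeasurable_itv `[0%E, +oo%E[); rewrite setTI.
congr measurable; apply/seteqP; split=> t /=; rewrite in_itv /=; first by move=> /andP[].
by move=> ->; rewrite andbT; apply: integral_ge0 => s _; rewrite lee_fin powR_ge0.
Qed.

Hypothesis hoo: (\int[lebm k.+1]_z (`|h z| `^ p)%:E < +oo)%E.

Let mhp: mfun (Rsp k.+1) (fun z => (`|h z| `^ p)%:E). Proof. exact: m_powabs. Qed.
Let hp0 z: (0<=(`|h z| `^ p)%:E)%E. Proof. by rewrite lee_fin powR_ge0. Qed.

Let integral_line (v: Rsp k) : (\int[lebm k]_e LL e v = \int[lebm k.+1]_z (`|h z| `^ p)%:E)%E.
Proof.
rewrite -(@integral_shear 1 v) // lebmS2.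
- by apply: eq_integral => e _; apply: eq_integral => s _; rewrite /fv /= mul1r.
- apply: (mcomp mhp); apply: mpair => //.
 by apply: m_vlin => //; exact: mfunM.
- by move=> z; exact: hp0.
Qed.

Let bad (t: T) : \bar R:=(\1_[set t | ~ goodk t] t)%:E.
Let mbad: mfun T bad.
Proof. by apply/mEFinP; apply: measurable_indic; exact: measurableC mgood. Qed.
Let bad0 t: (0<=bad t)%E. Proof. by rewrite lee_fin. Qed.

Let ae_zero d (S: measurableType d) (m: {measure set S -> \bar R}) (F: S -> \bar R) :
 mfun S F -> (forall x, 0<=F x)%E -> (\int[m]_x F x = 0)%E -> {ae m, forall x, F x = 0%E}.
Proof.
move=> mF F0 IF; have: (\int[m]_x `|F x| = 0)%E.
 by rewrite -[RHS]IF; apply: eq_integral => x _; rewrite gee0_abs.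
move/(@ae_eq_integral_abs _ _ _ m setT measurableT F mF).1.
by apply: ae_sub => x h1; exact: h1.
Qed.

Let ae_int0 d (S: measurableType d) (m: {measure set S -> \bar R}) (F: S -> \bar R) :
 mfun S F -> {ae m, forall x, F x = 0%E} -> (\int[m]_x F x = 0)%E.
Proof.
move=> mF h1; rewrite (@ae_eq_integral _ _ _ m setT (cst 0%E) F) ?integral0 //.
by apply: (ae_sub _ h1) => x /=.
Qed.

(** In a fixed direction almost every line carries an L^p function, and on such a line [IN_conv]
    holds almost everywhere. The measurability of [goodk] lets Fubini's theorem combine the two
    statements. *)
Let bad_null (v: Rsp k) : (\int[lebm k.+1]_z bad (z, v) = 0)%E.
Proof.
have mb1: mfun (Rsp k.+1) (fun z => bad (z, v)).
 by apply: (mcomp mbad); exact: mpair.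
rewrite lebmS2 //; apply: ae_int0.
 rewrite (_: (fun e => _) = (fun e: Rsp k => \int[@lebD R]_s bad ((s, e) : Rsp k.+1, v))%E).
  exact: (@measurable_fun_fubini_tonelli_G _ _ R (Rsp k) R (@lebDm R) (fun z: Rsp k.+1 => bad (z, v))).
 apply/funext => e; rewrite ge0_integral_lebD //.
 by apply: (mcomp mb1); exact: mpair.
have mL: mfun (Rsp k) (fun e => LL e v) by exact: mLL.
have iL: (lebm k).-integrable [set: Rsp k] (fun e => LL e v).
 apply/integrableP; split=> //; rewrite (eq_integral (fun e => LL e v)) ?integral_line //.
 by move=> e _; rewrite gee0_abs //; apply: integral_ge0.
have:=integrable_ae measurableT iL; apply: ae_sub => e /(_ I) fe.
have lf: (LL e v < +oo)%E.
 by rewrite -ge0_fin_numE //; apply: integral_ge0.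
have mbs: mfun R (fun s => bad ((s, e) : Rsp k.+1, v)).
 by apply: (mcomp mb1); exact: mpair.
apply: ae_int0 => //.
apply: (ae_sub _ (IN_conv HK (@AL e v) (A0 e v) p1 (mfl e v) lf)) => s cs.
rewrite /bad indicE memNset //= => ng; apply: ng; split => //.
exact: conv0_ratc.
Qed.

Definition MM (z: Rsp k.+1) : \bar R:=(\int[lebm k]_v ((wden 1 v)%:E*Mxf (shr (z, v))))%E.

Let wd0 v: 0<wden 1 (v: Rsp k). Proof. by rewrite invr_gt0 exprn_gt0 // om_gt0. Qed.
Let mwd: mfun (Rsp k) (fun v: Rsp k => (wden 1 v)%:E).
Proof. by apply/mEFinP; exact: m_wden. Qed.
Let Mx0 t: (0<=Mxf t)%E. Proof. exact: Mx1_ge0. Qed.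
Let mwM: mfun T (fun t: T => ((wden 1 t.2)%:E*Mxf (shr t))%E).
Proof.
apply: emeasurable_funM; first exact: (mcomp mwd).
exact: (mcomp m_Mxf m_shr).
Qed.

Lemma m_MM: mfun (Rsp k.+1) MM.
Proof.
apply: (@measurable_fun_fubini_tonelli_F _ _ (Rsp k.+1) (Rsp k) R (lebm k) (fun t => (wden 1 t.2)%:E*Mxf (shr t))%E) => //.
by move=> t; rewrite mule_ge0 // lee_fin ltW.
Qed.

Lemma MM_ge0 z: (0<=MM z)%E.
Proof. by apply: integral_ge0 => v _; rewrite mule_ge0 // lee_fin ltW. Qed.

(** For a fixed direction the shear [shr] preserves the measure, so the integral over points becomes
    an integral over parallel lines, where [HC] applies; lines on which [h] has infinite norm
    satisfy the bound trivially. *)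
Lemma MM_lp (CM W: R) : 0<CM ->
 (forall e v, (LL e v < +oo)%E ->
  (\int[mu]_s Mx1 p P (Av e v) (fv e v) s<=CM%:E*LL e v)%E) ->
 (\int[lebm k]_v (wden 1 v)%:E<=W%:E)%E ->
 (\int[lebm k.+1]_z MM z<=(CM*W)%:E * \int[lebm k.+1]_z (`|h z| `^ p)%:E)%E.
Proof.
move=> CK HC HW; set I:=(\int[lebm k.+1]_z (`|h z| `^ p)%:E)%E.
have I0: (0<=I)%E by apply: integral_ge0.
rewrite (@integral_shr (fun v => (wden 1 v)%:E) Mxf) //; last 2 first.
- by move=> v; rewrite lee_fin ltW.
- exact: m_Mxf.
have key v: (\int[lebm k.+1]_z Mxf (z, v)<=CM%:E*I)%E.
 rewrite lebmS2; last 2 first.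
 - by apply: (mcomp m_Mxf); exact: mpair.
 - by move=> z; exact: Mx0.
 have mL: mfun (Rsp k) (fun e => LL e v) by exact: mLL.
 have l0 e: (0<=LL e v)%E by apply: integral_ge0.
 rewrite /I -(integral_line v) -ge0_integralZl_EFin ?(ltW CK) //.
 have mM1: mfun (Rsp k.+1) (fun z => Mxf (z, v)).
  by apply: (mcomp m_Mxf); exact: mpair.
 have mI1: mfun (Rsp k) (fun e => \int[mu]_s Mxf ((s, e) : Rsp k.+1, v))%E.
  rewrite (_: (fun e => _) = (fun e: Rsp k => \int[@lebD R]_s Mxf ((s, e) : Rsp k.+1, v))%E).
  exact: (@measurable_fun_fubini_tonelli_G _ _ R (Rsp k) R (@lebDm R) (fun z: Rsp k.+1 => Mxf (z, v))).
  apply/funext => e; rewrite ge0_integral_lebD //.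
  by apply: (mcomp mM1); exact: mpair.
 apply: ge0_le_integral => //.
 - by move=> e _; apply: integral_ge0.
 - exact: measurable_funeM.
 - move=> e _; have [lf|lf]:=ltP (LL e v) +oo%E; first exact: HC.
  have -> : LL e v = +oo%E by apply/eqP; rewrite -leye_eq.
  by rewrite gt0_muley ?lte_fin // leey.
have mK: mfun (Rsp k) (fun v => \int[lebm k.+1]_z Mxf (z, v))%E.
 exact: (@measurable_fun_fubini_tonelli_G _ _ (Rsp k.+1) (Rsp k) R (lebm k.+1) Mxf m_Mxf).
apply: (le_via (\int[lebm k]_v ((CM%:E*I)*(wden 1 v)%:E))%E).
 apply: ge0_le_integral => //.
 - by move=> v _; apply: mule_ge0; [rewrite lee_fin ltW|apply: integral_ge0].
 - exact: emeasurable_funM.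
 - exact: emeasurable_funM.
 - by move=> v _; rewrite muleC; apply: lee_wpmul2r; [rewrite lee_fin ltW|exact: key].
have CI: (0<=CM%:E*I)%E by rewrite mule_ge0 // lee_fin ltW.
rewrite ge0_integralZl //; last by move=> v _; rewrite lee_fin ltW.
apply: (le_via ((CM%:E*I)*W%:E)%E); first exact: lee_wpmul2l.
by rewrite EFinM muleAC.
Qed.

(** A Euclidean radius [eps] on the graph corresponds to [eps/om v] in the rescaled picture on a
    line of direction [(1, v)]. *)
Definition TTk (eps: R) (z: Rsp k.+1) : R:=\int[lebm k]_v (w v*INf (eps/om v) (shr (z, v))).

Definition nice (z: Rsp k.+1) : Prop:=(MM z < +oo)%E /\ {ae lebm k, forall v, goodk (shr (z, v))}.

Lemma ae_nice (hM: (\int[lebm k.+1]_z MM z < +oo)%E) : {ae lebm k.+1, forall z, nice z}.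
Proof.
apply: ae_and.
 have iM: (lebm k.+1).-integrable [set: Rsp k.+1] MM.
  apply/integrableP; split; first exact: m_MM.
  by rewrite (eq_integral MM) // => z _; rewrite gee0_abs // MM_ge0.
 have:=integrable_ae measurableT iM; apply: ae_sub => z /(_ I).
 by rewrite ge0_fin_numE // MM_ge0.
have mb: mfun T (fun t => bad (shr t)) by exact: (mcomp mbad m_shr).
have E: (\int[lebm k.+1]_z \int[lebm k]_v bad (shr (z, v)) = 0)%E.
 have := @integral_shr (fun=> 1%E) bad (mcst _) (fun=> lee01) mbad bad0.
 under eq_integral do under eq_integral do rewrite mul1e.
 move=> ->; under eq_integral do rewrite bad_null mule0.
 by rewrite integral0.
have mI: mfun (Rsp k.+1) (fun z => \int[lebm k]_v bad (shr (z, v)))%E.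
 exact: (@measurable_fun_fubini_tonelli_F _ _ (Rsp k.+1) (Rsp k) R (lebm k) (fun t => bad (shr t))).
have I0 z: (0 <= \int[lebm k]_v bad (shr (z, v)))%E by apply: integral_ge0.
apply: (ae_sub _ (ae_zero mI I0 E)) => z Ez.
have mz: mfun (Rsp k) (fun v => bad (shr (z, v))).
 by apply: (mcomp mb); exact: mpair.
apply: (ae_sub _ (ae_zero mz (fun v => bad0 _) Ez)) => v.
rewrite /bad indicE => h1; apply/not_notP => ng; move: h1; rewrite mem_set //= => /eqP.
by rewrite eqe oner_eq0.
Qed.

Let ae_dom (f: Rsp k -> R) (D: Rsp k -> \bar R) : mfun (Rsp k) f ->
 mfun (Rsp k) D -> (forall x, 0<=D x)%E ->
 {ae lebm k, forall x, (`|f x|%:E<=D x)%E} -> (\int[lebm k]_x D x < +oo)%E ->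
 (lebm k).-integrable [set: Rsp k] (EFin \o f) /\ (`|\int[lebm k]_x f x|%:E <= \int[lebm k]_x D x)%E.
Proof.
move=> mf0 mD D0 fD iD.
have mE: mfun (Rsp k) (EFin \o f) by apply/mEFinP.
have mn: mfun (Rsp k) (fun x => (`|f x|%:E)) by apply/mEFinP; exact: mnorm.
have le1: (\int[lebm k]_x (`|f x|%:E) <= \int[lebm k]_x D x)%E.
 apply: ae_ge0_le_integral => //; apply: (ae_sub _ fD) => x h1 _; exact: h1.
have iF: (lebm k).-integrable [set: Rsp k] (EFin \o f).
 by apply/integrableP; split=> //; apply: le_lt_trans iD.
split=> //; apply: le_trans le1.
apply: (le_via (\int[lebm k]_x `|f x|)%:E); first by rewrite lee_fin; exact: le_normr_Rintegral.
rewrite /Rintegral fineK //; exact: (integrable_fin_num measurableT (integrable_norm iF)).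
Qed.

Let vlin0 (u v: Rsp k) : vlin 1 0 u v = u.
Proof.
have H n (a b: Rsp n) : vlin 1 0 a b = a.
 elim: n a b => [|n IH] a b /=; first by rewrite mul1r mul0r addr0.
 by rewrite IH mul1r mul0r addr0; case: a.
exact: H.
Qed.

Let Av_shr z v: Av (shr (z, v)).1.2 (shr (z, v)).2 (shr (z, v)).1.1 = G z/om v.
Proof. by rewrite /Av /shr /= vlin_add addNr vlin0; case: z. Qed.

Let K0: 0<=K.
Proof. by have [h1 _ _]:=lk_smooth HK; apply: le_trans (normr_ge0 _) (h1 0 _); rewrite normr0. Qed.

Definition CK: R:=`|alpha| * (2+2*K*(L+2))+2 * `|C|.

Let C00: 0<=CK.
Proof. by rewrite /CK addr_ge0 ?mulr_ge0 ?addr_ge0 ?mulr_ge0 ?addr_ge0. Qed.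

Let INf_bound t eps: goodk t -> (Mxf t < +oo)%E -> 0<eps -> eps<=Av t.1.2 t.2 t.1.1 ->
 `|INf eps t| <= CK*(fine (Mxf t))`^p^-1.
Proof.
move=> [lf _] Mf e0 eA.
apply: (@IN_sup _ _ _ _ _ _ _ _ _ _ HK (@AL t.1.2 t.2) (A0 t.1.2 t.2) p1 (mfl t.1.2 t.2) lf) => //.
by rewrite fineK // ge0_fin_numE.
Qed.

Definition nicev (z: Rsp k.+1) (v: Rsp k) : Prop:=goodk (shr (z, v)) /\ (Mxf (shr (z, v)) < +oo)%E.

Let mzv z: mfun (Rsp k) (fun v => shr (z, v)).
Proof. by apply: (mcomp m_shr); exact: mpair. Qed.

Let mMz z: mfun (Rsp k) (fun v => Mxf (shr (z, v))).
Proof. exact: (mcomp m_Mxf (mzv z)). Qed.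

Let mwMz z: mfun (Rsp k) (fun v => ((wden 1 v)%:E*Mxf (shr (z, v)))%E).
Proof. exact: emeasurable_funM. Qed.

Let wM0 z v: (0<=(wden 1 v)%:E*Mxf (shr (z, v)))%E.
Proof. by rewrite mule_ge0 // lee_fin ltW. Qed.

Lemma nicev_ae z: nice z -> {ae lebm k, forall v, nicev z v}.
Proof.
move=> [Mz gz].
have iM: (lebm k).-integrable [set: Rsp k] (fun v => (wden 1 v)%:E*Mxf (shr (z, v)))%E.
 apply/integrableP; split => //.
 by rewrite (eq_integral (fun v => (wden 1 v)%:E*Mxf (shr (z, v)))%E) // => v _; rewrite gee0_abs.
have h1:=integrable_ae measurableT iM.
apply: (ae_sub _ (ae_and gz h1)) => v [gv /(_ I) fv0]; split=> //.
rewrite ltNge; apply/negP => h2; have Mi: Mxf (shr (z, v)) = +oo%E by apply/eqP; rewrite -leye_eq.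
by move: fv0; rewrite Mi gt0_muley ?lte_fin.
Qed.

Let mnicev z: measurable [set v | nicev z v].
Proof.
rewrite (_: [set v | _] = [set v | goodk (shr (z, v))] `&` [set v | (Mxf (shr (z, v)) < +oo)%E]); last by apply/seteqP; split.
apply: measurableI.
 by have:=mzv z measurableT mgood; rewrite setTI.
have:=mMz z measurableT (emeasurable_itv `[0%E, +oo%E[); rewrite setTI.
congr measurable; apply/seteqP; split=> v /=; rewrite in_itv /=; first by move=> /andP[].
by move=> ->; rewrite andbT; exact: Mx0.
Qed.

Let Si z v: R:=\1_[set v | nicev z v] v.
Let mSi z: mfun (Rsp k) (Si z).
Proof. by apply: measurable_indic; exact: mnicev. Qed.

Let mINz z (e: Rsp k -> R) : mfun (Rsp k) e -> mfun (Rsp k) (fun v => INf (e v) (shr (z, v))).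
Proof.
move=> me; have m2: mfun T (fun t: T => e t.2) by exact: (mcomp me).
by have:=mcomp (m_INf m2) (mzv z).
Qed.

Let mdiv (eps: R) : mfun (Rsp k) (fun v => eps/om v).
Proof.
by apply: mfunM => //; apply: (mcomp m_inv); exact: m_om.
Qed.

Let mTT z eps: mfun (Rsp k) (fun v => w v*INf (eps/om v) (shr (z, v))).
Proof. by apply: mfunM => //; apply: mINz. Qed.

Let TT_S z eps: nice z -> TTk eps z = \int[lebm k]_v (Si z v*(w v*INf (eps/om v) (shr (z, v)))).
Proof.
move=> nz; rewrite /TTk /Rintegral; congr fine; apply: ae_eq_integral => //.
- by apply/mEFinP; exact: mTT.
- by apply/mEFinP; apply: mfunM; [exact: mSi|exact: mTT].
- by apply: (ae_sub _ (nicev_ae nz)) => v nv _; rewrite /Si indicE mem_set // mul1r.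
Qed.

Section Wint.
Variable W: R.
Hypothesis HW: (\int[lebm k]_v (wden 1 v)%:E<=W%:E)%E.

Let W0: 0<=W.
Proof. by rewrite -lee_fin; apply: le_trans HW; apply: integral_ge0 => v _; rewrite lee_fin ltW. Qed.

Let Dom (a b: R) z v: \bar R:=(a%:E*(wden 1 v)%:E+b%:E*((wden 1 v)%:E*Mxf (shr (z, v))))%E.

Let mDom a b z: mfun (Rsp k) (Dom a b z).
Proof. by apply: emeasurable_funD; apply: measurable_funeM. Qed.

Let Dom0 a b z v: 0<=a -> 0<=b -> (0<=Dom a b z v)%E.
Proof. by move=> a0 b0; rewrite adde_ge0 // mule_ge0 ?lee_fin // ltW. Qed.

Let iDom a b z: 0<=a -> 0<=b -> (\int[lebm k]_v Dom a b z v<=(a*W)%:E+b%:E*MM z)%E.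
Proof.
move=> a0 b0; rewrite /Dom ge0_integralD //; last 4 first.
- by move=> v _; rewrite mule_ge0 ?lee_fin // ltW.
- exact: measurable_funeM.
- by move=> v _; rewrite mule_ge0 ?lee_fin.
- exact: measurable_funeM.
apply: leeD.
 rewrite ge0_integralZl_EFin //; first by rewrite EFinM; apply: lee_wpmul2l; rewrite ?lee_fin.
 by move=> v _; rewrite lee_fin ltW.
by rewrite ge0_integralZl_EFin.
Qed.

Let fineM_ z v: nicev z v -> ((fine (Mxf (shr (z, v))))%:E = Mxf (shr (z, v)))%E.
Proof. by move=> [_ h1]; rewrite fineK // ge0_fin_numE. Qed.

Let TT_young z eps la: nice z -> 0<eps -> eps<=G z -> 0<la ->
 `|TTk eps z| <= CK*(la`^(1-p)*fine (MM z)+la*W).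
Proof.
move=> nz e0 eG l0.
have fM: MM z \is a fin_num by rewrite ge0_fin_numE ?MM_ge0 //; have []:=nz.
have la0:=powR_ge0 la (1-p).
have c1: 0<=CK*la by rewrite mulr_ge0 // ltW.
have c2: 0<=CK*la`^(1-p) by rewrite mulr_ge0.
have [|||||_ h1] := @ae_dom (fun v => w v*INf (eps/om v) (shr (z, v))) (Dom (CK*la) (CK*la`^(1-p)) z).
- exact: mTT.
- exact: mDom.
- by move=> v; exact: Dom0.
- apply: (ae_sub _ (nicev_ae nz)) => v nv; have [gv Mv]:=nv.
 rewrite /Dom -(fineM_ nv) -!EFinM -EFinD lee_fin normrM.
 have b0: 0<=fine (Mxf (shr (z, v))) by rewrite fine_ge0.
 have eA: eps/om v<=Av (shr (z, v)).1.2 (shr (z, v)).2 (shr (z, v)).1.1.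
  by rewrite Av_shr ler_wpM2r // invr_ge0 ltW // om_gt0.
 have h2:=INf_bound gv Mv (divr_gt0 e0 (om_gt0 v)) eA.
 have h3:=young_pow p1 b0 l0.
 apply: (le_via (wden 1 v*(CK*(la`^(1-p)*fine (Mxf (shr (z, v)))+la)))).
  apply: ler_pM => //.
  by apply: le_trans h2 _; exact: ler_wpM2l.
 by le_of_eq; ring.
- apply: le_lt_trans (iDom z c1 c2) _; rewrite -(fineK fM) -EFinM -EFinD ltry //.
have:=le_trans h1 (iDom z c1 c2); rewrite -(fineK fM) -EFinM -EFinD lee_fin => h4.
by apply: le_trans h4 _; le_of_eq; ring.
Qed.

Lemma TT_bound z eps: nice z -> 0<eps -> eps<=G z ->
 ((`|TTk eps z| `^ p)%:E<=((CK*(1+W))`^p)%:E*MM z)%E.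
Proof.
move=> nz e0 eG; have fM: MM z \is a fin_num by rewrite ge0_fin_numE ?MM_ge0 //; have []:=nz.
rewrite -(fineK fM) -EFinM lee_fin; apply: pow_opt => //; first by rewrite fine_ge0 // MM_ge0.
by move=> la l0; exact: TT_young.
Qed.

Lemma TT_conv z: nice z -> conv0 (fun eps => TTk eps z).
Proof.
move=> nz; have fM: MM z \is a fin_num by rewrite ge0_fin_numE ?MM_ge0 //; have []:=nz.
pose F e v:=Si z v*(w v*INf (e/om v) (shr (z, v))).
have mF e: mfun (Rsp k) (F e) by apply: mfunM; [exact: mSi|exact: mTT].
have cF v (s: nat -> R) : nicev z v -> (forall n, 0<s n) -> s n @[n --> \oo] --> 0 ->
  INf (s n/om v) (shr (z, v)) @[n --> \oo] --> lim (INf e (shr (z, v)) @[e --> 0^'+]).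
 move=> [[lf gv] _] s0 sc.
 have cv: conv0 (fun e => INf e (shr (z, v))).
  exact: (@IN_ratc _ _ _ _ _ _ _ _ _ _ HK (@AL _ _) (A0 _ _) p1 (mfl _ _) lf).
 apply: (conv0_seqP cv); first by move=> n; rewrite divr_gt0 // om_gt0.
 by rewrite -(mul0r (om v)^-1); apply: cvgMl.
pose F0 v:=Si z v*(w v*lim (INf e (shr (z, v)) @[e --> 0^'+])).
have cFF v (s: nat -> R) : (forall n, 0<s n) -> s n @[n --> \oo] --> 0 -> F (s n) v @[n --> \oo] --> F0 v.
 move=> s0 sc; rewrite /F /F0 /Si indicE; have [nv|nv]:=pselect (nicev z v).
  by rewrite mem_set //; apply: cvgMr; apply: cvgMr; exact: cF.
 by rewrite memNset //; under eq_cvg do rewrite mul0r; rewrite mul0r; exact: cvg_cst.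
have mF0: mfun (Rsp k) F0.
 apply: (@measurable_fun_cvg _ _ _ setT (fun n => F (n.+1%:R^-1))) => // v _.
 apply: cFF; [by move=> n; rewrite invr_gt0|exact: cvg_harmonic].
pose g v:=CK*(wden 1 v*(1+fine (Mxf (shr (z, v))))).
have mg: mfun (Rsp k) g.
 apply: mfunM => //; apply: mfunM; first exact: m_wden.
 by apply: mfunD => //; apply: (mcomp (@fine_measurable R setT measurableT)); exact: mMz.
have ig: (lebm k).-integrable [set: Rsp k] (EFin \o g).
 have [|||//] := @ae_dom g (Dom CK CK z) mg (mDom _ _ _).
 - by move=> v; exact: Dom0.
 - apply: aeW => v; have b0: 0<=fine (Mxf (shr (z, v))) by rewrite fine_ge0.
  rewrite ger0_norm; last by rewrite mulr_ge0 // mulr_ge0 ?addr_ge0 // ltW.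
  have -> : ((g v)%:E = CK%:E*(wden 1 v)%:E+CK%:E*((wden 1 v)%:E*(fine (Mxf (shr (z, v))))%:E))%E.
  by rewrite -!EFinM -EFinD /g; congr EFin; ring.
  rewrite /Dom; apply: leeD => //; apply: lee_wpmul2l; first by rewrite lee_fin.
  apply: lee_wpmul2l; first by rewrite lee_fin ltW.
  by move: (Mx0 (shr (z, v))); case: (Mxf _) => [r| |] //= _; rewrite ?leey.
 - by apply: le_lt_trans (iDom z C00 C00) _; rewrite -(fineK fM) -EFinM -EFinD ltry.
have FM e v: 0<e -> e<=G z -> `|F e v| <= g v.
 move=> e0 eG; have b0: 0<=fine (Mxf (shr (z, v))) by rewrite fine_ge0.
 have g0: 0<=g v by rewrite mulr_ge0 // mulr_ge0 ?addr_ge0 // ltW.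
 rewrite /F /Si indicE; have [nv|nv]:=pselect (nicev z v); last by rewrite memNset // mul0r normr0.
 rewrite mem_set // mul1r normrM; have [gv Mv]:=nv.
 have eA: e/om v<=Av (shr (z, v)).1.2 (shr (z, v)).2 (shr (z, v)).1.1.
  by rewrite Av_shr ler_wpM2r // invr_ge0 ltW // om_gt0.
 have h2:=INf_bound gv Mv (divr_gt0 e0 (om_gt0 v)) eA.
 have h3:=young_pow p1 b0 ltr01; rewrite powR1 mul1r addrC in h3.
 rewrite /g mulrCA; apply: ler_pM => //.
 by apply: le_trans h2 _; exact: ler_wpM2l.
(* Radii are capped at the height [G z], below which [g] dominates; the limit at 0 is unaffected. *)
apply: (@conv0_near _ _ (fun e => \int[lebm k]_v F (Num.min e (G z)) v) (G z)) => //.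
 by move=> e e0 eG; rewrite (TT_S _ nz) (min_l (ltW eG)).
apply: (conv0_seq (l:=\int[lebm k]_v F0 v)) => s s0 sc.
have m0 n: 0<Num.min (s n) (G z) by rewrite lt_min s0 G0.
have mc: Num.min (s n) (G z) @[n --> \oo] --> 0.
 apply: (@squeeze_cvgr _ _ _ _ (fun=> 0) s) => //; last exact: cvg_cst.
 by apply: nearW => n; rewrite (ltW (m0 n)) ge_min lexx.
have [] := @Rintegral_dominated _ _ _ (lebm k) setT (fun n => F (Num.min (s n) (G z))) F0 g measurableT.
- by move=> n; exact: mF.
- exact: mF0.
- exact: ig.
- by apply: aeW => v _; exact: cFF.
- by move=> n v _; apply: FM => //; rewrite ge_min lexx orbT.
by [].
Qed.

Definition HH z (eps: R) (v: Rsp k) (s: R) : R:=w v*(trk (Av (shr (z, v)).1.2 v) (eps/om v) z.1 s *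
  kap (z.1-s) (Av (shr (z, v)).1.2 v z.1) (Av (shr (z, v)).1.2 v s)*fv (shr (z, v)).1.2 v s).

Let mHH z eps: measurable_fun [set: Rsp k*R] (fun y: Rsp k*R => HH z eps y.1 y.2).
Proof.
have mq: measurable_fun [set: Rsp k*R] (fun y: Rsp k*R => (shr (z, y.1), y.2)).
 by apply: mpair => //; apply: (mcomp (mzv z)).
have mA1: measurable_fun [set: Rsp k*R] (fun y: Rsp k*R => Av (shr (z, y.1)).1.2 y.1 y.2).
 exact: (mcomp mA mq).
have mq2: measurable_fun [set: Rsp k*R] (fun y: Rsp k*R => (shr (z, y.1), z.1)).
 by apply: mpair => //; apply: (mcomp (mzv z)).
have mA2: measurable_fun [set: Rsp k*R] (fun y: Rsp k*R => Av (shr (z, y.1)).1.2 y.1 z.1).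
 exact: (mcomp mA mq2).
have mf1: measurable_fun [set: Rsp k*R] (fun y: Rsp k*R => fv (shr (z, y.1)).1.2 y.1 y.2).
 exact: (mcomp mf mq).
have mzs: measurable_fun [set: Rsp k*R] (fun y: Rsp k*R => z.1-y.2) by exact: mfunB.
apply: mfunM; first exact: (mcomp mw).
apply: mfunM => //; apply: mfunM; last exact: (lk_meas HK).
apply: m_bool_real; apply: measurable_fun_ler; first exact: (mcomp (mdiv eps)).
apply: mfunM; first exact: mnorm.
apply: msqrt.
apply: mfunD => //; apply: mfunX; apply: mfunM; first exact: mfunB.
by apply: (mcomp m_inv); exact: mfunB.
Qed.

Lemma TT_nested z eps: nice z -> 0<eps -> TTk eps z = \int[lebm k]_v \int[mu]_s HH z eps v s.
Proof.
move=> nz e0; rewrite /TTk {1}/Rintegral [RHS]/Rintegral; congr fine; apply: ae_eq_integral => //.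
- by apply/mEFinP; exact: mTT.
- apply/mEFinP.
 exact: (@m_Rintegral _ _ _ _ R mu (fun y: Rsp k*R => HH z eps y.1 y.2) (mHH z eps)).
- apply: (ae_sub _ (nicev_ae nz)) => v [[lf gv] Mv] _; congr EFin.
 have ei: 0<eps/om v by rewrite divr_gt0 // om_gt0.
 have ii:=IN_abs_integrable HK (@AL (shr (z, v)).1.2 v) (A0 _ _) p1 (mfl _ _) lf z.1 ei.
 by rewrite /HH (RintegralZR (w v) measurableT ii).
Qed.

(** Absolute convergence at a fixed radius. It is the condition under which [polarR] unfolds a
    signed integral over lines. *)
Lemma line_abs z eps: nice z -> 0<eps ->
 (\int[lebm k]_v \int[mu]_s `|HH z eps v s|%:E < +oo)%E.
Proof.
move=> nz e0; have fM: MM z \is a fin_num by rewrite ge0_fin_numE ?MM_ge0 //; have []:=nz.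
pose c:=`|alpha| * (K*(G z*(1+L)/eps)) + `|C|.
have c0: 0<=c by rewrite addr_ge0 // !mulr_ge0 ?addr_ge0 ?invr_ge0 ?(ltW e0) ?(ltW (G0 z)).
have c2: 0<=c*2 by rewrite mulr_ge0.
apply: (@le_lt_trans _ _ (\int[lebm k]_v Dom (c*2) (c*2) z v)%E); last first.
 by apply: le_lt_trans (iDom z c2 c2) _; rewrite -(fineK fM) -EFinM -EFinD ltry.
pose H (y: Rsp k*R):=HH z eps y.1 y.2.
have mH: measurable_fun [set: Rsp k*R] H by exact: mHH.
have mI: mfun (Rsp k) (fun v => \int[mu]_s `|H (v, s)|%:E)%E.
 have mHn: measurable_fun [set: Rsp k*R] (fun y => `|H y|%:E).
  by apply/mEFinP; exact: mnorm.
 rewrite (_: (fun v => _) = fun v => (\int[@lebD R]_s `|H (v, s)|%:E)%E).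
  by apply: (@measurable_fun_fubini_tonelli_F _ _ (Rsp k) R R (@lebDm R) (fun y => `|H y|%:E)).
 apply/funext => v; rewrite ge0_integral_lebD //.
 by apply: (mcomp mHn); exact: mpair.
apply: ae_ge0_le_integral => //.
- by move=> v _; apply: integral_ge0.
- by move=> v _; exact: Dom0.
apply: (ae_sub _ (nicev_ae nz)) => v nv _; have [[lf gv] Mv]:=nv.
have b0: 0<=fine (Mxf (shr (z, v))) by rewrite fine_ge0.
have MB: (Mx1 p P (Av (shr (z, v)).1.2 v) (fv (shr (z, v)).1.2 v) z.1<=(fine (Mxf (shr (z, v))))%:E)%E.
 by rewrite (fineM_ nv).
have AE:=Av_shr z v; rewrite /= in AE.
have [_ _ PPb]:=Mx1_bound p1 (lk_smooth HK) (@AL (shr (z, v)).1.2 v) (lk_measP HK) (mfl _ _) lf MB.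
have a0:=A0 (shr (z, v)).1.2 v z.1.
have ip:=integrable_poi p1 (mfl (shr (z, v)).1.2 v) lf z.1 a0.
have hp:=PPb _ a0.
have h3:=young_pow p1 b0 ltr01; rewrite powR1 mul1r addrC in h3.
have ce: `|alpha| * (K*(Av (shr (z, v)).1.2 v z.1*(1+L)/(eps/om v)))+C<=c.
 rewrite AE /c; apply: lerD; last exact: ler_norm.
 apply: ler_wpM2l => //; apply: ler_wpM2l => //.
 by rewrite div_cancel ?gt_eqF ?om_gt0.
apply: (le_via (\int[mu]_s ((wden 1 v*c)%:E*(poi (Av (shr (z, v)).1.2 v z.1) (z.1-s) * `|fv (shr (z, v)).1.2 v s|)%:E))%E).
 have mHv: mfun R (fun s => `|H (v, s)|%:E).
  apply/mEFinP; apply: mnorm.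
  by apply: (mcomp mH); exact: mpair.
 have mpo:=measurable_int _ ip.
 apply: ge0_le_integral; try by [].
 - by apply: measurable_funeM; exact: mpo.
 - move=> s _; rewrite -EFinM lee_fin /H /HH (normrM (w v)) -[leRHS]mulrA; apply: ler_pM => //.
  rewrite (normrM _ (fv _ _ _)) mulrA; apply: ler_wpM2r => //.
  apply: le_trans (trk_kap_le HK (@AL _ _) (A0 _ _) z.1 s (divr_gt0 e0 (om_gt0 v))) _.
  by apply: ler_wpM2r; [exact: poi_ge0|exact: ce].
rewrite ge0_integralZl_EFin //; last 3 first.
- by move=> s _; rewrite lee_fin; apply: mulr_ge0 => //; exact: poi_ge0.
- exact: (measurable_int _ ip).
- by rewrite mulr_ge0 // ltW.
rewrite (Rintegral_EFin ip) -[X in (_*X)%E]/((PP (Av (shr (z, v)).1.2 v z.1) (fv (shr (z, v)).1.2 v) z.1)%:E).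
rewrite /Dom -(fineM_ nv) -!EFinM -EFinD lee_fin.
have h5: PP (Av (shr (z, v)).1.2 v z.1) (fv (shr (z, v)).1.2 v) z.1<=2*(1+fine (Mxf (shr (z, v)))).
 by apply: le_trans hp _; rewrite ler_wpM2l.
have wc: 0<=wden 1 v*c by rewrite mulr_ge0 // ltW.
apply: le_trans (ler_wpM2l wc h5) _.
by le_of_eq; ring.
Qed.
End Wint.
End Fixed.
End ND.

(** * Smoothness of powers of the inverse square root *)

Section Smooth.
Context {R: realType}.
Implicit Types P: R -> R.

Lemma smooth_mul (L K1 K2: R) P1 P2: 0<=L -> smooth L K1 P1 -> smooth L K2 P2 ->
 smooth L (4*(K1*K2)) (fun s => P1 s*P2 s).
Proof.
move=> L0 [a1 b1 c1] [a2 b2 c2].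
have z0: `|0: R| <= L by rewrite normr0.
have k1: 0<=K1:=le_trans (normr_ge0 _) (a1 0 z0).
have k2: 0<=K2:=le_trans (normr_ge0 _) (a2 0 z0).
have kk:=mulr_ge0 k1 k2.
split.
- move=> s sL; rewrite normrM; apply: (le_via (K1*K2)); last by lra.
 by apply: ler_pM; [| |exact: a1|exact: a2].
- move=> s t sL tL.
 rewrite (_: P1 s*P2 s-P1 t*P2 t = P1 s*(P2 s-P2 t)+(P1 s-P1 t)*P2 t); last by ring.
 apply: le_trans (ler_normD _ _) _; rewrite !normrM.
 have h1: `|P1 s| * `|P2 s-P2 t| <= K1*(K2 * `|s-t|) by apply: ler_pM; [| |exact: a1|exact: b2].
 have h2: `|P1 s-P1 t| * `|P2 t| <= K1 * `|s-t| * K2 by apply: ler_pM; [| |exact: b1|exact: a2].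
 have h3: 0<=K1*K2 * `|s-t| by rewrite mulr_ge0.
 by nra.
- move=> s t h sL tL h01; have /andP[h0 h1]:=h01.
 have uL: `|h*s+(1-h) * t| <= L.
  apply: le_trans (ler_normD _ _) _; rewrite !normrM (ger0_norm h0) (@ger0_norm _ (1-h)) ?subr_ge0 //.
  have e1:=ler_wpM2l h0 sL; have e2: (1-h) * `|t| <= (1-h)*L by rewrite ler_wpM2l // subr_ge0.
  by lra.
 set u:=h*s+(1-h) * t in uL *.
 (* the product of the interpolants differs from the interpolant of the product by a second difference *)
 have E: P1 u*P2 u-(h*(P1 s*P2 s)+(1-h)*(P1 t*P2 t)) =
  (P1 u-(h*P1 s+(1-h)*P1 t))*P2 u+(h*P1 s+(1-h)*P1 t)*(P2 u-(h*P2 s+(1-h)*P2 t))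
  - h*(1-h)*((P1 s-P1 t)*(P2 s-P2 t)) by ring.
 rewrite E.
 have hh: 0<=h*(1-h) by rewrite mulr_ge0 // subr_ge0.
 have t1: `|P1 u-(h*P1 s+(1-h)*P1 t)| * `|P2 u| <= K1*(h*(1-h))*(s-t)^+2*K2.
  by apply: ler_pM => //; [exact: c1|exact: a2].
 have mid: `|h*P1 s+(1-h)*P1 t| <= K1.
  apply: le_trans (ler_normD _ _) _; rewrite !normrM (ger0_norm h0) (@ger0_norm _ (1-h)) ?subr_ge0 //.
  have e1:=ler_wpM2l h0 (a1 s sL).
  have e2: (1-h) * `|P1 t| <= (1-h)*K1 by rewrite ler_wpM2l ?subr_ge0 // a1.
  by lra.
 have t2: `|h*P1 s+(1-h)*P1 t| * `|P2 u-(h*P2 s+(1-h)*P2 t)| <= K1*(K2*(h*(1-h))*(s-t)^+2).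
  by apply: ler_pM => //; exact: c2.
 have t3: `|P1 s-P1 t| * `|P2 s-P2 t| <= K1 * `|s-t| * (K2 * `|s-t|).
  by apply: ler_pM => //; [exact: b1|exact: b2].
 have t3':=ler_wpM2l hh t3.
 apply: le_trans (ler_normB _ _) _; apply: le_trans (lerD (ler_normD _ _) (lexx _)) _.
 rewrite (normrM (h*(1-h))) (ger0_norm hh) (normrM (P1 s-P1 t)) (normrM _ (P2 u)) (normrM (h*P1 s+_)).
 have sq: `|s-t| * `|s-t| = (s-t)^+2 by rewrite -normrM -expr2 ger0_norm ?sqr_ge0.
 have E3: h*(1-h)*(K1 * `|s-t| * (K2 * `|s-t|)) = K1*K2*(h*(1-h))*(s-t)^+2.
  by rewrite -sq; ring.
 rewrite E3 in t3'; have g0: 0<=K1*K2*(h*(1-h))*(s-t)^+2.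
  by rewrite mulr_ge0 ?sqr_ge0 // mulr_ge0.
 have F1: K1*(h*(1-h))*(s-t)^+2*K2 = K1*K2*(h*(1-h))*(s-t)^+2 by ring.
 have F2: K1*(K2*(h*(1-h))*(s-t)^+2) = K1*K2*(h*(1-h))*(s-t)^+2 by ring.
 have F4: 4*(K1*K2)*(h*(1-h))*(s-t)^+2 = 4*(K1*K2*(h*(1-h))*(s-t)^+2) by ring.
 rewrite F1 in t1; rewrite F2 in t2; rewrite F4.
 move: t1 t2 t3' g0; move: (K1*K2*(h*(1-h))*(s-t)^+2) => Z; lra.
Qed.

Lemma smooth_cst (L c: R) : smooth L `|c| (fun=> c).
Proof.
split=> [s _|s t _ _|s t h _ _ /andP[h0 h1]] //; first by rewrite subrr normr0 mulr_ge0.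
rewrite (_: c-_ = 0); last by ring.
rewrite normr0; apply: mulr_ge0; last exact: sqr_ge0.
by rewrite !mulr_ge0 // subr_ge0.
Qed.

Lemma smooth_id (L: R) : 0<=L -> smooth L (L+1) id.
Proof.
move=> L0; split=> [s sL|s t _ _|s t h _ _ /andP[h0 h1]] /=; first lra.
 by have:=normr_ge0 (s-t); nra.
rewrite subrr normr0; apply: mulr_ge0; last exact: sqr_ge0.
by rewrite !mulr_ge0 ?subr_ge0 //; lra.
Qed.

Definition isq (s: R) : R:=(Num.sqrt (1+s^+2))^-1.

(** The square roots [x], [y], [z] at the two ends and at the intermediate point are treated as
    variables. With [w] the interpolant of [x] and [y], the identity [wz] is exact, and the defect
    is a difference of two nonnegative terms, each at most [H * (s-t)^2]. *)
Lemma smooth_isq (L: R) : 0<=L -> smooth L 1 isq.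
Proof.
move=> L0.
have D (s: R) : 1<=Num.sqrt (1+s^+2) by rewrite -[leLHS]sqrtr1 ler_wsqrtr // lerDl sqr_ge0.
have Q (s: R) : Num.sqrt (1+s^+2)^+2 = 1+s^+2 by rewrite sqr_sqrtr // addr_ge0 ?sqr_ge0.
have sd (s: R) : `|s| <= Num.sqrt (1+s^+2) by rewrite -sqrtr_sqr ler_wsqrtr // lerDr.
have lipS (s t: R) : `|Num.sqrt (1+s^+2)-Num.sqrt (1+t^+2)| <= `|s-t|.
 have a:=D s; have b:=D t; have c:=sd s; have d:=sd t; have e:=Q s; have f:=Q t.
 move: (Num.sqrt (1+s^+2)) (Num.sqrt (1+t^+2)) a b c d e f => x y a b c d e f.
 have xy: 0<x+y by lra.
 rewrite -(ler_pM2r xy) -[X in _*X](ger0_norm (ltW xy)) -normrM.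
 rewrite (_: (x-y)*(x+y) = (s-t)*(s+t)); last by nra.
 rewrite normrM ler_wpM2l //; apply: le_trans (ler_normD _ _) _; lra.
have [P1 P2] : (forall s, `|isq s| <= 1) /\ (forall s t, `|isq s-isq t| <= `|s-t|).
 split=> [s|s t]; rewrite /isq.
  by rewrite ger0_norm ?invr_ge0 ?sqrtr_ge0 // invf_le1 ?D // (lt_le_trans ltr01) ?D.
 have l:=lipS s t; have a:=D s; have b:=D t.
 move: (Num.sqrt (1+s^+2)) (Num.sqrt (1+t^+2)) a b l => x y a b l.
 have x0: 0<x by lra. have y0: 0<y by lra.
 rewrite (_: x^-1-y^-1 = (y-x)/(x*y)); last by field; rewrite !gt_eqF.
 rewrite normrM normfV (ger0_norm (mulr_ge0 (ltW x0) (ltW y0))) ler_pdivrMr ?mulr_gt0 //.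
 rewrite distrC; apply: le_trans l _; rewrite ler_peMr //; nra.
split=> [s _|s t _ _|s t h _ _ /andP[h0 h1]]; [exact: P1|by rewrite mul1r; exact: P2|].
set u:=h*s+(1-h) * t; rewrite /isq.
have e:=Q s; have f:=Q t; have g:=Q u; have l:=lipS s t; have dx:=D s; have dy:=D t; have dz:=D u.
move: (Num.sqrt (1+s^+2)) (Num.sqrt (1+t^+2)) (Num.sqrt (1+u^+2)) e f g l dx dy dz => x y z e f g l dx dy dz.
pose w:=h*x+(1-h)*y; pose H:=h*(1-h).
have H0: 0<=H by rewrite mulr_ge0 // subr_ge0.
have w1: 1<=w by rewrite /w; nra.
have X: (x-y)^+2<=(s-t)^+2.
 by rewrite -(real_normK (num_real (x-y))) -(real_normK (num_real (s-t))) lerXn2r ?nnegrE.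
have wz: w^+2-z^+2 = H*((s-t)^+2-(x-y)^+2).
 have -> : w^+2 = h*x^+2+(1-h)*y^+2-H*(x-y)^+2 by rewrite /w /H; ring.
 by rewrite e f g /u /H; ring.
have [x0 y0 z0 w0] : [/\ 0<x, 0<y, 0<z & 0<w] by split; lra.
have E: z^-1-(h*x^-1+(1-h)*y^-1) = (w-z)/(w*z)-H*(x-y)^+2/(x*y*w).
 by rewrite /H /w; field; rewrite !gt_eqF.
rewrite E; set T:=(s-t)^+2 in wz X *; set X2:=(x-y)^+2 in wz X *.
have X20: 0<=X2 by rewrite sqr_ge0.
have HT: 0<=H*(T-X2) by rewrite mulr_ge0 // subr_ge0.
have wz0: 0<=w-z.
 have hwz: (w-z)*(w+z) = w^+2-z^+2 by ring.
 have: 0<=(w-z)*(w+z) by rewrite hwz wz.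
 by rewrite pmulr_lge0 //; lra.
have b1: (w-z)/(w*z)<=H*T.
 have m1: 1<=w*z by nra.
 rewrite ler_pdivrMr ?mulr_gt0 //.
 have: w-z<=H*(T-X2) by rewrite -wz; nra.
 have: 0<=H*X2 by rewrite mulr_ge0.
 have: H*T<=H*T*(w*z) by rewrite ler_peMr // mulr_ge0 // (le_trans X20).
 rewrite mulrBr; lra.
have b2: H*X2/(x*y*w)<=H*T.
 have m1: 1<=x*y by nra. have m2: 1<=x*y*w by nra.
 rewrite ler_pdivrMr ?mulr_gt0 //; apply: (le_via (H*T)); first exact: ler_wpM2l.
 by rewrite ler_peMr // mulr_ge0 // (le_trans X20).
have p1: 0<=(w-z)/(w*z) by rewrite divr_ge0 // mulr_ge0 // ltW.
have xyw: 0<x*y*w by rewrite !mulr_gt0.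
have p2: 0<=H*X2/(x*y*w) by apply: divr_ge0; [exact: mulr_ge0|exact: ltW].
by rewrite mul1r -/H ler_norml; apply/andP; split; lra.
Qed.

Lemma smooth_isqX (L: R) n: 0<=L -> exists K, smooth L K (fun s => isq s^+n).
Proof.
move=> L0; elim: n => [|n [K HK]]; first by exists `|1|; exact: smooth_cst.
exists (4*(1*K)); rewrite (_: (fun s => _) = fun s => isq s*isq s^+n); last by apply/funext => s; rewrite exprS.
exact: smooth_mul L0 (smooth_isq L0) HK.
Qed.

Lemma m_isq: mfun R isq.
Proof.
apply: (mcomp m_inv); apply: msqrt.
by apply: mfunD => //; exact: mfunX.
Qed.

Lemma isq_itv (s: R) : 0<isq s<=1.
Proof.
have D: 1<=Num.sqrt (1+s^+2) by rewrite -[leLHS]sqrtr1 ler_wsqrtr // lerDl sqr_ge0.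
have D0: 0<Num.sqrt (1+s^+2) by lra.
by rewrite /isq invr_gt0 D0 /= invf_le1.
Qed.
End Smooth.

(** * The two Clifford kernels restricted to a line *)

Section Kernels.
Context {R: realType}.
Variable k: nat.

(* distance from x to the mirror image of y, in the coordinates of a line *)
Definition mdist (t a b: R) : R:=Num.sqrt (t^+2+(a+b)^+2).

(** The factor [a/mdist t a b] is the height of the base point over its distance to the mirror
    image, raised to the power [n-2 = k.+1]; the rest is a singular kernel in slope form. *)
Definition kapE (P: R -> R) (t a b: R) : R:=P ((b-a)/(- t))*(a/mdist t a b)^+k.+1 * t^-1.

Definition kapF (c: R -> R -> R -> R) (t a b: R) : R :=
 c t a b*a^+k.+1*isq ((b-a)/(- t))^+k.+1/mdist t a b^+k.+3.

Lemma mdist_bounds (t a b: R) : 0<a -> 0<b -> [/\ 0<mdist t a b, a+b<=mdist t a b,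
 `|t| <= mdist t a b & mdist t a b^+2 = t^+2+(a+b)^+2].
Proof.
move=> a0 b0; have ab: 0<a+b by lra.
have D: 0<t^+2+(a+b)^+2 by rewrite ltr_wpDl ?sqr_ge0 ?exprn_gt0.
split; first by rewrite sqrtr_gt0.
- by rewrite -[leLHS]ger0_norm ?(ltW ab) // -sqrtr_sqr ler_wsqrtr // lerDr sqr_ge0.
- by rewrite -sqrtr_sqr ler_wsqrtr // lerDl sqr_ge0.
- by rewrite sqr_sqrtr // ltW.
Qed.

Lemma normXB_le (x y: R) n: 0<=x<=1 -> 0<=y<=1 -> `|x^+n-y^+n| <= n%:R * `|x-y|.
Proof.
move=> /andP[x0 x1] /andP[y0 y1]; elim: n => [|n IH]; first by rewrite !expr0 subrr normr0 mul0r.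
rewrite !exprS (_: x*x^+n-y*y^+n = x*(x^+n-y^+n)+(x-y)*y^+n); last by ring.
apply: le_trans (ler_normD _ _) _; rewrite !normrM -natr1 mulrDl mul1r; apply: lerD.
 by rewrite (ger0_norm x0); apply: le_trans (ler_piMl _ x1) IH.
by rewrite ler_piMr // ger0_norm ?exprn_ge0 // exprn_ile1.
Qed.

(** On the diagonal [mdist] equals [2 * a], so the multiplier has the value [2^-(k+1)] there, the
    inverse of the power of 2 in the definition of the operator. For [|t| <= a] the deviation from
    it is [O(|t|/a)]; for larger [t] both terms are [O(a/t^2)]. Either is of Poisson size at height
    [a]. *)
Lemma mult_rem (L: R) : 0<=L -> exists2 C, 0<=C & forall t a b: R, 0<a -> 0<b -> `|b-a| <= L * `|t| ->
 `|(a/mdist t a b)^+k.+1 * t^-1-(2^+k.+1)^-1*(t^-1-cpoi a t)| <= C*poi a t.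
Proof.
move=> L0; pose c:=1+4*L+L^+2; have c0: 0<=c by rewrite /c; nra.
pose C:=2*(k.+1%:R*c+1)+3.
have CK: 0<=k.+1%:R*c by rewrite mulr_ge0.
exists C; first by rewrite /C; lra.
move=> t a b a0 b0 bt; have [D0 Dab Dt D2]:=mdist_bounds t a0 b0.
move: (mdist t a b) D0 Dab Dt D2 => D D0 Dab Dt D2.
have p0 := @poi_ge0 R a t a0.
have M0: 0<=a/D by rewrite divr_ge0 ?ltW.
have M1: a/D<=1 by rewrite ler_pdivrMr // mul1r; lra.
have N0: 0<=(2^+k.+1)^-1 :> R by rewrite invr_ge0 exprn_ge0.
have N1: (2^+k.+1)^-1<=1 :> R by rewrite invf_le1 ?exprn_gt0 // exprn_ege1 // ler1n.
have q0: 0<a^+2+t^+2 by rewrite ltr_pwDl ?exprn_gt0 ?sqr_ge0.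
have [t0|t0]:=eqVneq t 0.
 have Cp: 0<=C*poi a t by apply: mulr_ge0 => //; rewrite /C; lra.
 rewrite [X in `|X|](_: _ = 0) ?normr0 //.
 by rewrite t0 /cpoi invr0 mulr0 mul0r subrr mulr0 subrr.
have n0: 0 < `|t| by rewrite normr_gt0.
have [ta|ta]:=leP `|t| a.
 have h: `|a/D-2^-1| <= c * `|t| / a.
  rewrite (_: a/D-2^-1 = (4*a^+2-D^+2)/(2*D*(2*a+D))); last by field; rewrite !gt_eqF //; lra.
  have den: 0<2*D*(2*a+D) by rewrite mulr_gt0 //; lra.
  rewrite normrM normfV (gtr0_norm den) ler_pdivrMr // mulrAC ler_pdivlMr //.
  have num: `|4*a^+2-D^+2| <= c * `|t| * a.
  rewrite D2 (_: _-_ = - (t^+2+(b-a)*(3*a+b))); last by ring.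
  rewrite normrN; apply: le_trans (ler_normD _ _) _.
  have h0: 0<=3*a+b by lra.
  rewrite (ger0_norm (sqr_ge0 t)) (normrM (b-a)) -(real_normK (num_real t)) (ger0_norm h0).
  have h1: 3*a+b<=4*a+L * `|t| by have:=ler_norm (b-a); lra.
  have h2: `|b-a| * (3*a+b)<=L * `|t| * (4*a+L * `|t|).
  by apply: ler_pM => //; lra.
  have h3: `|t| ^+ 2 <= `|t| * a by rewrite expr2 ler_wpM2l.
  have h4: L^+2 * `|t| ^+ 2<=L^+2*(`|t| * a) by rewrite ler_wpM2l ?sqr_ge0.
  by rewrite /c; nra.
  apply: le_trans (ler_wpM2r (ltW a0) num) _; rewrite -[leLHS]mulrA.
  apply: ler_wpM2l; first by rewrite mulr_ge0.
  have h5: a*a<=D*D by apply: ler_pM; lra.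
  have h6:=mulr_ge0 (ltW a0) (ltW D0); have h7:=mulr_ge0 (ltW D0) (ltW D0).
  rewrite mulrDr; nra.
 have ex: (2^+k.+1)^-1 = 2^-1^+k.+1 :> R by rewrite exprVn.
 have h2: `|(a/D)^+k.+1-(2^+k.+1)^-1| <= k.+1%:R*(c * `|t| / a).
  rewrite ex; apply: le_trans (normXB_le k.+1 _ _) _; first by rewrite M0.
  by apply/andP; split; lra.
  by apply: ler_wpM2l.
 rewrite (_: _-_ = ((a/D)^+k.+1-(2^+k.+1)^-1) * t^-1+(2^+k.+1)^-1*cpoi a t); last by ring.
 apply: le_trans (ler_normD _ _) _; rewrite (normrM _ t^-1) (normrM _ (cpoi a t)) normfV (ger0_norm N0).
 have h3: `|(a/D)^+k.+1-(2^+k.+1)^-1| / `|t| <= k.+1%:R*c/a.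
  rewrite ler_pdivrMr //; apply: le_trans h2 _; le_of_eq; ring.
 have h4: (2^+k.+1)^-1 * `|cpoi a t| <= 1*a^-1 by apply: ler_pM => //; exact: cpoi_le2.
 have h5: a^-1<=2*poi a t.
  rewrite /poi mulrA ler_pdivlMr // mulrC ler_pdivrMr //.
  have th: t^+2<=a^+2 by rewrite -(real_normK (num_real t)) lerXn2r ?nnegrE ?(ltW a0).
  by rewrite -mulrA -(expr2 a); lra.
 have h6: (k.+1%:R*c+1)*a^-1<=(k.+1%:R*c+1)*(2*poi a t) by apply: ler_wpM2l => //; lra.
 rewrite /C mulrDl; have:=mulr_ge0 (ler0n R 3) p0.
 move: h3 h4 h6; rewrite mul1r; move: (k.+1%:R*c) (poi a t) a^-1 => u v w; nra.
apply: le_trans (ler_normB _ _) _.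
rewrite (normrM _ t^-1) (normrM _ (t^-1-cpoi a t)) normfV (ger0_norm N0) (ger0_norm (exprn_ge0 _ M0)).
have tt: `|t| ^+ 2 = t^+2 by rewrite real_normK ?num_real.
have q0' : 0<a^+2 + `|t| ^+ 2 by rewrite tt.
have h1: (a/D)^+k.+1 / `|t| <= 2*poi a t.
 apply: (le_via (a/D / `|t|)).
  by rewrite ler_wpM2r ?invr_ge0 // exprS ler_piMr // exprn_ile1.
 apply: (le_via (a / `|t| / `|t|)).
  by rewrite ler_wpM2r ?invr_ge0 // ler_wpM2l ?(ltW a0) // lef_pV2 ?posrE.
 rewrite -mulrA -invfM -expr2 tt /poi mulrCA ler_wpM2l ?(ltW a0) //.
 rewrite -[X in _<=X]invf_div lef_pV2 ?posrE ?divr_gt0 -?tt ?exprn_gt0 //.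
 rewrite ler_pdivrMr //; have: a^+2 <= `|t| ^+ 2 by rewrite lerXn2r ?nnegrE // ltW.
 lra.
have h2: `|t^-1-cpoi a t| <= poi a t.
 rewrite cpoi_inv // normrM (ger0_norm p0) ler_piMl // normrM normfV (gtr0_norm a0) ler_pdivrMr // mul1r ltW //.
have h3: (2^+k.+1)^-1 * `|t^-1-cpoi a t| <= 1*poi a t by apply: ler_pM.
have h4: 0<=(k.+1%:R*c+1)*poi a t by apply: mulr_ge0 => //; lra.
rewrite /C mulrDl; move: h1 h3 h4; rewrite mul1r; move: (k.+1%:R*c) (poi a t) => u v; nra.
Qed.

Lemma m_mdist d (T: measurableType d) (t a b: T -> R) : mfun T t ->
 mfun T a -> mfun T b ->
 mfun T (fun x => mdist (t x) (a x) (b x)).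
Proof.
move=> mt ma mb; apply: msqrt.
by apply: mfunD; apply: mfunX => //; exact: mfunD.
Qed.

Lemma m_quot d (T: measurableType d) (t a b: T -> R) : mfun T t ->
 mfun T a -> mfun T b ->
 mfun T (fun x => (b x-a x)/(- t x)).
Proof.
move=> mt ma mb; apply: mfunM; first exact: mfunB.
by apply: (mcomp m_inv); exact: mfunN.
Qed.

Lemma quot_le (L t a b: R) : 0<=L -> `|b-a| <= L * `|t| -> `|(b-a)/(- t)| <= L.
Proof.
move=> L0 h; have [->|t0]:=eqVneq t 0; first by rewrite oppr0 invr0 mulr0 normr0.
by rewrite normrM normfV normrN ler_pdivrMr // normr_gt0.
Qed.

Lemma kapE_lkernel (L K: R) (P: R -> R) : 0<=L -> smooth L K P -> mfun R P ->
 exists C, lkernel L K C (2^+k.+1)^-1 P (kapE P).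
Proof.
move=> L0 sP mP; have [C CK HC]:=mult_rem L0; exists (K*C); split=> //.
 move=> d T t a b mt ma mb; apply: mfunM; last exact: (mcomp m_inv).
 apply: mfunM; first by apply: (mcomp mP); exact: m_quot.
 apply: mfunX; apply: mfunM => //.
 by apply: (mcomp m_inv); exact: m_mdist.
move=> t a b a0 b0 h; have [P1 _ _]:=sP; have PK:=P1 _ (quot_le L0 h).
rewrite /rho /kapE [X in `|X|](_: _ = P ((b-a)/(- t)) *
 ((a/mdist t a b)^+k.+1 * t^-1-(2^+k.+1)^-1*(t^-1-cpoi a t))); last by move: (cpoi _ _) => z; ring.
by rewrite (normrM (P _)) -mulrA; apply: ler_pM => //; exact: HC.
Qed.

(** The pole of [F] is at the mirror image, at distance at least [a + b], so there is no singular
    part and [alpha] and [P] are zero. The numerator [c] stands for one coordinate of the reflected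
    difference. *)
Lemma kapF_lkernel (L: R) (c: R -> R -> R -> R) : 0<=L ->
 (forall t a b, 0<a -> 0<b -> `|c t a b| <= mdist t a b) ->
 (forall d (T: measurableType d) (t a b: T -> R), mfun T t ->
  mfun T a -> mfun T b ->
  mfun T (fun x => c (t x) (a x) (b x))) ->
 lkernel L `|0: R| 1 0 (fun=> 0) (kapF c).
Proof.
move=> L0 cD mc; split=> //; first exact: smooth_cst.
 move=> d T t a b mt ma mb; apply: mfunM.
  apply: mfunM; first by apply: mfunM; [exact: mc|exact: mfunX].
  by apply: mfunX; apply: (mcomp m_isq); exact: m_quot.
 by apply: (mcomp m_inv); apply: mfunX; exact: m_mdist.
move=> t a b a0 b0 h; have cc:=cD t a b a0 b0; have [D0 Dab Dt D2]:=mdist_bounds t a0 b0.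
rewrite /rho /kapF mul0r subr0 mul1r; have /andP[i0 i1]:=isq_itv ((b-a)/(- t)).
move: (isq _) i0 i1 => i i0 i1; move: (mdist t a b) cc D0 Dab Dt D2 => D cc D0 Dab Dt D2.
have ii: `|i^+k.+1| <= 1 by rewrite ger0_norm ?exprn_ge0 ?(ltW i0) // exprn_ile1 ?(ltW i0).
have q0: 0<a^+2+t^+2 by rewrite ltr_pwDl ?exprn_gt0 ?sqr_ge0.
rewrite normrM normfV [X in _/X]ger0_norm ?exprn_ge0 ?(ltW D0) // ler_pdivrMr ?exprn_gt0 //.
apply: (le_via (D*a^+k.+1*1)).
 rewrite (normrM _ (i^+_)); apply: ler_pM => //; rewrite normrM; apply: ler_pM => //.
 by rewrite ger0_norm ?exprn_ge0 ?(ltW a0).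
have D2' : a^+2+t^+2<=D^+2 by rewrite D2; nra.
have ak: a^+k<=D^+k by rewrite lerXn2r ?nnegrE ?(ltW a0) ?(ltW D0) //; lra.
have -> : D^+k.+3 = D^+2*D^+k.+1 by rewrite -exprD.
rewrite /poi mulr1 -mulrA; apply: (le_via (a*(D^+k.+1))).
 rewrite (exprS a) (exprS D) mulrCA; apply: ler_wpM2l; first exact: ltW.
 by apply: ler_wpM2l => //; exact: ltW.
apply: ler_wpM2l; first exact: ltW.
by rewrite mulrA ler_peMl ?exprn_ge0 ?(ltW D0) // ler_pdivlMl // mulr1.
Qed.

End Kernels.

(** * Coordinates on the lines through a point *)

Section Polar.
Context {R: realType}.
Local Notation mu:=(@lebesgue_measure R).
Local Notation Rsp:=(Rsp R).
Variable k: nat.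

Lemma vlin_comm (c: R) (u w: Rsp k) : vlin c 1 u w = vlin 1 c w u.
Proof.
have H n (a b: Rsp n) : vlin c 1 a b = vlin 1 c b a.
 by elim: n a b => [|n IH] a b /=; [rewrite addrC|rewrite IH addrC].
exact: H.
Qed.

(** For each first coordinate other than [z.1] this is an affine change of the remaining [k.+1]
    coordinates, whose determinant gives the power; the excluded value is a null set. *)
Lemma polar (z: Rsp k.+1) (F: Rsp k.+1 -> \bar R) : mfun (Rsp k.+1) F -> (forall x, 0<=F x)%E ->
 (\int[lebm k.+1]_x F x =
  \int[lebm k.+1]_x ((`|x.1-z.1| ^+ k.+1)%:E*F (x.1, vlin 1 (x.1-z.1)%R z.2 x.2)))%E.
Proof.
move=> mF F0.
have mFp: mfun (Rsp k.+1) (fun x: Rsp k.+1 => F (x.1, vlin 1 (x.1-z.1) z.2 x.2)).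
 apply: (mcomp mF); apply: mpair => //.
 by apply: m_vlin => //; exact: mfunB.
have mc: mfun (Rsp k.+1) (fun x: Rsp k.+1 => (`|x.1-z.1| ^+ k.+1)%:E).
 apply/mEFinP; apply: mfunX; apply: mnorm.
 exact: mfunB.
have mG: mfun (Rsp k.+1) (fun x: Rsp k.+1 => (`|x.1-z.1| ^+ k.+1)%:E*F (x.1, vlin 1 (x.1-z.1) z.2 x.2))%E.
 exact: emeasurable_funM.
have G0 x: (0<=(`|x.1-z.1| ^+ k.+1)%:E*F (x.1, vlin 1 (x.1-z.1) z.2 x.2))%E.
 by rewrite mule_ge0 // lee_fin exprn_ge0.
rewrite lebmS // [RHS]lebmS //.
have mI (F' : Rsp k.+1 -> \bar R) : mfun (Rsp k.+1) F' -> (forall x, 0<=F' x)%E ->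
  mfun R (fun s => \int[lebm k]_v F' (s, v))%E.
 by move=> m' ?; exact: (@measurable_fun_fubini_tonelli_F _ _ R (Rsp k) R (lebm k) F').
have m1:=mI _ mF F0; have m2:=mI _ mG G0.
have ne: {ae mu, forall s, s != z.1}.
 exists [set z.1]; split; [exact: measurable_set1|exact: lebesgue_measure_set1|].
 by move=> y /= /negP; rewrite negbK => /eqP.
apply: ae_eq_integral => //; apply: (ae_sub _ ne) => s sz _ /=.
have c0: s-z.1 != 0 by rewrite subr_eq0.
have mFs: mfun (Rsp k) (fun v => F (s, v)).
 by apply: (mcomp mF); exact: mpair.
rewrite (@integral_vlin _ k (s-z.1) 1 z.2 (fun v => F (s, v))) //.
rewrite ge0_integralZl_EFin ?exprn_ge0 //.
 by congr (_*_)%E; apply: eq_integral => v _; rewrite vlin_comm.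
by apply: (mcomp mFs); apply: m_vlin.
Qed.

Definition plr (z: Rsp k.+1) (F: Rsp k.+1 -> R) (s: R) (v: Rsp k) : R :=
 `|s-z.1| ^+ k.+1*F (s, vlin 1 (s-z.1) z.2 v).

(* polar coordinates on each line through z, for integrands of either sign *)
Lemma polarR (z: Rsp k.+1) (F: Rsp k.+1 -> R) : mfun (Rsp k.+1) F ->
 (\int[lebm k]_v \int[mu]_s `|plr z F s v|%:E < +oo)%E ->
 (lebm k.+1).-integrable [set: Rsp k.+1] (EFin \o F) /\
 \int[lebm k.+1]_x F x = \int[lebm k]_v \int[mu]_s plr z F s v.
Proof.
move=> mF Foo.
pose Q (x: Rsp k.+1):=plr z F x.1 x.2.
have mc: mfun (Rsp k.+1) (fun x: Rsp k.+1 => `|x.1-z.1| ^+ k.+1).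
 apply: mfunX; apply: mnorm.
 exact: mfunB.
have mQ: mfun (Rsp k.+1) Q.
 apply: mfunM => //; apply: (mcomp mF); apply: mpair => //.
 by apply: m_vlin => //; exact: mfunB.
have mFE: mfun (Rsp k.+1) (EFin \o F) by apply/mEFinP.
have mQE: mfun (Rsp k.+1) (EFin \o Q) by apply/mEFinP.
have mQs v: mfun R (fun s => Q (s, v)).
 by apply: (mcomp mQ); exact: mpair.
have c0 (x: Rsp k.+1) : 0 <= `|x.1-z.1| ^+ k.+1 by rewrite exprn_ge0.
have Ep (x: Rsp k.+1) : ((EFin \o Q)^\+ x = (`|x.1-z.1| ^+ k.+1)%:E*(EFin \o F)^\+ (x.1, vlin 1 (x.1-z.1)%R z.2 x.2))%E.
 by rewrite !funeposE /= -!EFin_max -EFinM maxr_pMr // mulr0.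
have En (x: Rsp k.+1) : ((EFin \o Q)^\- x = (`|x.1-z.1| ^+ k.+1)%:E*(EFin \o F)^\- (x.1, vlin 1 (x.1-z.1)%R z.2 x.2))%E.
 by rewrite !funenegE /= -?EFinN -!EFin_max -EFinM maxr_pMr // mulr0 mulrN.
have Ip: (\int[lebm k.+1]_x (EFin \o F)^\+ x = \int[lebm k.+1]_x (EFin \o Q)^\+ x)%E.
 rewrite (@polar z) //; last exact: measurable_funepos.
 by apply: eq_integral => x _; rewrite Ep.
have In: (\int[lebm k.+1]_x (EFin \o F)^\- x = \int[lebm k.+1]_x (EFin \o Q)^\- x)%E.
 rewrite (@polar z) //; last exact: measurable_funeneg.
 by apply: eq_integral => x _; rewrite En.
have mnorm (H: Rsp k.+1 -> R) : mfun (Rsp k.+1) H -> mfun (Rsp k.+1) (fun x => `|H x|%:E).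
 by move=> mH; apply/mEFinP; exact: mnorm.
have iQ: (lebm k.+1).-integrable [set: Rsp k.+1] (EFin \o Q).
 apply/integrableP; split=> //; rewrite [ltLHS](_: _ = (\int[lebm k.+1]_x `|Q x|%:E)%E) // lebmS2 //.
 exact: mnorm.
have iF: (lebm k.+1).-integrable [set: Rsp k.+1] (EFin \o F).
 apply/integrableP; split=> //; have /integrableP[_]:=iQ.
 rewrite [X in (X<_)%E -> _](_: _ = (\int[lebm k.+1]_x `|F x|%:E)%E) //.
 rewrite [RHS](@polar z) //; last exact: mnorm.
 by apply: eq_integral => x _; rewrite /= -EFinM /Q /plr (normrM (`|_| ^+ _)) (ger0_norm (c0 x)).
split=> //.
have -> : \int[lebm k.+1]_x F x = \int[lebm k.+1]_x Q x.
 by rewrite /Rintegral integralE Ip In -integralE.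
have iQ' : ((@lebDm R) \x (lebm k))%E.-integrable [set: R*Rsp k] (EFin \o Q) by exact: iQ.
rewrite /Rintegral -[X in fine X](@integral21_prod_meas1 _ _ R (Rsp k) R (@lebDm R) (lebm k) (EFin \o Q) iQ').
have aeI := @ae_integrable2 _ _ R (Rsp k) R (@lebDm R) (lebm k) (EFin \o Q) iQ'.
congr fine.
have mG: mfun (Rsp k) (fubini_G (@lebDm R) (EFin \o Q)).
 exact: (@measurable_fubini_G _ _ R (Rsp k) R (@lebDm R) (lebm k) (EFin \o Q) iQ').
have EG v: (\int[mu]_s (Q (s, v))%:E = fubini_G (@lebDm R) (EFin \o Q) v)%E.
 by rewrite /fubini_G integral_lebD //; apply/mEFinP; exact: mQs.
apply: ae_eq_integral => //.
 rewrite (_: (fun v => _) = (fun v => (fine (fubini_G (@lebDm R) (EFin \o Q) v))%:E)).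
  by apply/mEFinP; apply: (mcomp (@fine_measurable R setT measurableT)).
 by apply/funext => v; rewrite -EG.
apply: (ae_sub _ aeI) => v iv _.
rewrite -[X in (fine X)%:E]/(\int[mu]_s (Q (s, v))%:E)%E EG fineK //.
exact: (integrable_fin_num measurableT iv).
Qed.
End Polar.

(** * Geometry of the graph along a line *)

Section Geo.
Context {R: realType}.
Local Notation mu:=(@lebesgue_measure R).
Local Notation Rsp:=(Rsp R).

Lemma lipschitz_bound m (g: 'rV[R]_m -> R) : lipschitz g ->
 exists2 L, 0<=L & forall x y, `|g x-g y| <= L * `|x-y|.
Proof.
move=> [M [_ HM]]; exists (`|M| + 1); first by rewrite addr_ge0.
have M1: M < `|M| + 1 by rewrite ltr_pwDr // ler_norm.
by move=> x y; exact: (HM _ M1 (x, y)).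
Qed.

Lemma mx_norm_le m (x: 'rV[R]_m) (c: R) : 0<=c -> (forall i, `|x 0 i| <= c) -> `|x| <= c.
Proof.
move=> c0 H; rewrite /Num.Def.normr /= mx_normrE; apply: bigmax_le => // -[i j] _ /=.
by rewrite (ord1 i).
Qed.

Lemma sum_last n (F: 'I_n.+1 -> R) : \sum_i F i = \sum_(j<n) F (lift ord_max j)+F ord_max.
Proof.
rewrite big_ord_recr /=; congr (_+_); apply: eq_bigr => j _; congr F.
by apply: val_inj; exact/esym/lift_max.
Qed.

Lemma subE m (x y: 'rV[R]_m) i: (x-y) 0 i = x 0 i-y 0 i.
Proof. by rewrite !mxE. Qed.

Lemma vhat_lift m (y: 'rV[R]_m.+1) (j: 'I_m) : vhat y 0 (lift ord_max j) = y 0 (lift ord_max j).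
Proof. by rewrite mxE eq_sym (negbTE (neq_lift _ _)). Qed.

Lemma vhat_max m (y: 'rV[R]_m.+1) : vhat y 0 ord_max = - y 0 ord_max.
Proof. by rewrite mxE eqxx. Qed.

Lemma vinvE m (x: 'rV[R]_m) i: vinv x 0 i = - (enorm x^+2)^-1*x 0 i.
Proof. by rewrite mxE. Qed.

Lemma sqM3 (a b c: R) : (a*(b*c))^+2 = a^+2*(b^+2*c^+2).
Proof. by ring. Qed.

Lemma enormE n (v: 'rV[R]_n) (c: R) : 0<=c -> \sum_i v 0 i^+2 = c^+2 -> enorm v = c.
Proof. by move=> c0 E; rewrite /enorm E sqrtr_sqr ger0_norm. Qed.

Variables (k: nat) (g: 'rV[R]_k.+2 -> R).

Definition rs (z: Rsp k.+1) : 'rV[R]_k.+2 := @rsprow R k.+2 z.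
Definition gz (z: Rsp k.+1) : R:=g (rs z).
Definition pt (z: Rsp k.+1) : 'rV[R]_k.+3:=graphpt g (rs z).

Lemma pt_lift z (j: 'I_k.+2) : pt z 0 (lift ord_max j) = nth 0 (rspcoords z) j.
Proof. by rewrite mxE liftK mxE. Qed.

Lemma pt_max z: pt z 0 ord_max = gz z.
Proof. by rewrite mxE unlift_none. Qed.

Definition ln (z: Rsp k.+1) (s: R) (v: Rsp k) : Rsp k.+1:=(s, vlin 1 (s-z.1) z.2 v).

Definition dir (v: Rsp k) (j: nat) : R:=nth 0 (1 :: rspcoords v) j.

Lemma vlin10 (u v: Rsp k) : vlin 1 0 u v = u.
Proof.
have H n (a b: Rsp n) : vlin 1 0 a b = a.
 elim: n a b => [|n IH] a b /=; first by rewrite mul1r mul0r addr0.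
 by rewrite IH mul1r mul0r addr0; case: a.
exact: H.
Qed.

Lemma ln_base z v: ln z z.1 v = z.
Proof. by rewrite /ln subrr vlin10; case: z. Qed.

Lemma ln_coord z s v (j: 'I_k.+2) :
 nth 0 (rspcoords (ln z s v)) j-nth 0 (rspcoords z) j = (s-z.1)*dir v j.
Proof.
case: j => -[|j] jk /=; first by rewrite mulr1.
by rewrite nth_vlin mul1r addrAC subrr add0r.
Qed.

Lemma dir_sum v: \sum_(j<k.+2) dir v j^+2 = om v^+2.
Proof.
rewrite big_ord_recl /= expr1n /om sqr_sqrtr ?addr_ge0 ?vsq_ge0 //; congr (_+_).
by rewrite vsq_sum.
Qed.

Lemma dir_le v (j: 'I_k.+2) : `|dir v j| <= om v.
Proof.
have o0:=ltW (om_gt0 v).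
rewrite -(ger0_norm o0) -sqrtr_sqr -[leRHS]sqrtr_sqr ler_wsqrtr // -dir_sum (bigD1 j) //=.
by rewrite lerDl sumr_ge0 // => i _; exact: sqr_ge0.
Qed.

Definition e0 (z: Rsp k.+1) (v: Rsp k) : Rsp k:=vlin 1 (- z.1) z.2 v.

Lemma Av_ln z s v: Av gz (e0 z v) v s = gz (ln z s v)/om v.
Proof. by rewrite /Av /e0 vlin_add addrC. Qed.

Lemma fv_ln (h: Rsp k.+1 -> R) z s v: fv h (e0 z v) v s = h (ln z s v).
Proof. by rewrite /fv /e0 vlin_add addrC. Qed.

Lemma enorm_ln z s v: enorm (pt (ln z s v)-pt z) =
 om v*(`|z.1-s| * Num.sqrt (1+slp (Av gz (e0 z v) v) z.1 s^+2)).
Proof.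
have o0:=om_gt0 v.
apply: enormE; first by rewrite !mulr_ge0 ?sqrtr_ge0 // ltW.
have Sq (q: R) : Num.sqrt (1+q^+2)^+2 = 1+q^+2 by rewrite sqr_sqrtr ?addr_ge0 ?sqr_ge0.
rewrite sum_last; under eq_bigr => j _ do rewrite subE !pt_lift ln_coord exprMn.
rewrite -mulr_sumr dir_sum subE !pt_max sqM3 (real_normK (num_real _)) Sq.
rewrite /slp !Av_ln ln_base; move: (om v) o0 => O o0.
have [->|sz]:=eqVneq s z.1; first by rewrite ln_base !subrr expr0n /=; ring.
have t0: s-z.1 != 0 by rewrite subr_eq0.
by field; rewrite t0 gt_eqF.
Qed.

Lemma mdist_sq t a b: mdist t a b^+2 = t^+2+(a+b)^+2 :> R.
Proof. by rewrite sqr_sqrtr // addr_ge0 ?sqr_ge0. Qed.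

Lemma enorm_hat z s v: enorm (pt (ln z s v)-vhat (pt z)) =
 om v*mdist (z.1-s) (Av gz (e0 z v) v z.1) (Av gz (e0 z v) v s).
Proof.
have o0:=om_gt0 v.
apply: enormE; first by rewrite !mulr_ge0 ?sqrtr_ge0 // ltW.
rewrite sum_last; under eq_bigr => j _ do rewrite subE vhat_lift !pt_lift ln_coord exprMn.
rewrite -mulr_sumr dir_sum subE vhat_max !pt_max exprMn mdist_sq !Av_ln ln_base.
by move: (om v) o0 => O o0; field; rewrite gt_eqF.
Qed.

Lemma enorm_hat' z s v: enorm (vhat (pt (ln z s v))-pt z) =
 om v*mdist (z.1-s) (Av gz (e0 z v) v z.1) (Av gz (e0 z v) v s).
Proof.
rewrite -enorm_hat /enorm; congr Num.sqrt; apply: eq_bigr => i _; rewrite !mxE.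
by case: ifP => // _; ring.
Qed.

(** Clifford products have constant structure coefficients, so boundedness reduces to the scalar
    components of the two vector kernels, here already multiplied by the power of the height. *)
Definition kE (i: 'I_k.+3) (x y: 'rV[R]_k.+3) : R:=y 0 ord_max^+k.+1 *
 ((enorm (x-y)^+k.+1*enorm (x-vhat y)^+k.+1)^-1*vinv (x-y) 0 i).
Definition kF (i: 'I_k.+3) (x y: 'rV[R]_k.+3) : R:=y 0 ord_max^+k.+1 *
 ((enorm (x-y)^+k.+1*enorm (vhat x-y)^+k.+1)^-1*vinv (vhat x-y) 0 i).

(** Along a line the [ord_max] component of [x - y] is a slope times the displacement, the others
    are the displacement times a coordinate of the direction. Each component is accordingly shared
    out between the weight [wi] on directions and the line kernel, through [PE] for [E] and [cF] for
    [F]. *)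
Definition wi (i: 'I_k.+3) (v: Rsp k) : R :=
 if unlift ord_max i is Some j then dir v j/om v^+k.+3 else wden 1 v.
Definition PE (i: 'I_k.+3) (q: R) : R:=(if i == ord_max then q else 1)*isq q^+k.+3.
Definition cF (i: 'I_k.+3) (t a b: R) : R:=if i == ord_max then a+b else t.

Hypothesis g0: forall x, 0<g x.

Lemma ln_facts z s v: s != z.1 ->
 let A:=Av gz (e0 z v) v in
 [/\ 0<A z.1, 0<A s, gz z = om v*A z.1, gz (ln z s v) = om v*A s &
  isq ((A s-A z.1) / - (z.1-s)) = (Num.sqrt (1+slp A z.1 s^+2))^-1].
Proof.
move=> sz A; have o0:=om_gt0 v.
rewrite /A !Av_ln ln_base !divr_gt0 ?g0 //; split => //.
- by rewrite mulrC divfK // gt_eqF.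
- by rewrite mulrC divfK // gt_eqF.
- by rewrite /isq /slp opprB !Av_ln ln_base.
Qed.

Lemma algE n (O T Q D a t X: R) : 0<O -> 0<T -> 0<Q -> 0<D -> t^+2 = T^+2 ->
 T^+n*((O*a)^+n*(((O*(T*Q))^+n*(O*D)^+n)^-1*(- ((O*(T*Q))^+2)^-1*X))) =
 - X/O^+n.+2*(Q^-1^+n.+2*(a/D)^+n)/t^+2.
Proof.
move=> O0 T0 Q0 D0 ->; rewrite !exprMn !exprVn -!(addn2 n) !exprD.
have [tN ON QN DN] : [/\ T^+n != 0, O^+n != 0, Q^+n != 0 & D^+n != 0] by rewrite !expf_neq0 // gt_eqF.
move: (T^+n) (O^+n) (Q^+n) (D^+n) (a^+n) tN ON QN DN => tn on qn dn an tN ON QN DN.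
by field; rewrite tN ON QN DN !gt_eqF.
Qed.

Lemma algF n (O T Q D a X: R) : 0<O -> 0<T -> 0<Q -> 0<D ->
 T^+n*((O*a)^+n*(((O*(T*Q))^+n*(O*D)^+n)^-1*(- ((O*D)^+2)^-1*X))) =
 - X/O^+n.+2*(a^+n*Q^-1^+n/D^+n.+2).
Proof.
move=> O0 T0 Q0 D0; rewrite !exprMn !exprVn -!(addn2 n) !exprD.
have [tN ON QN DN] : [/\ T^+n != 0, O^+n != 0, Q^+n != 0 & D^+n != 0] by rewrite !expf_neq0 // gt_eqF.
move: (T^+n) (O^+n) (Q^+n) (D^+n) (a^+n) tN ON QN DN => tn on qn dn an tN ON QN DN.
by field; rewrite tN ON QN DN !gt_eqF.
Qed.

(** Here the Jacobian in [plr] meets the kernel: of the powers of the distance one factor [1/t] is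
    left, powers of [om v] go to the weight, and powers of the slope factor to [PE]. *)
Lemma kE_ln i z s v (eps: R) (h: Rsp k.+1 -> R) : 0<eps ->
 plr z (fun x => (eps<=enorm (pt x-pt z))%R%:R*kE i (pt x) (pt z)*h x) s v =
 HH (kapE k (PE i)) gz h (wi i) z eps v s.
Proof.
move=> ep; have o0:=om_gt0 v; rewrite /plr /HH -[shr (z, v)]/((z.1, e0 z v), v) /= -/(ln z s v) fv_ln.
have trE: (eps/om v <= `|z.1-s| * Num.sqrt (1+slp (Av gz (e0 z v) v) z.1 s^+2)) =
  (eps<=enorm (pt (ln z s v)-pt z)) by rewrite ler_pdivrMr // [X in _<=X]mulrC -enorm_ln.
rewrite /trk /trunc trE.
(* At the base point the distance is 0, which [0 < eps] truncates on both sides. *)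
have [->|sz]:=eqVneq s z.1.
 rewrite ln_base subrr normr0 expr0n mul0r subrr.
 have -> : enorm (0: 'rV[R]_k.+3) = 0 by apply: enormE => //; rewrite expr0n big1 // => j _; rewrite mxE expr0n.
 by rewrite leNgt ep /= !mul0r mulr0.
have [a0 b0 ga gb iq]:=ln_facts v sz.
case: (eps<=_); last by rewrite !mul0r !mulr0.
rewrite !mul1r [LHS]mulrA [RHS]mulrA; congr (_*_).
have [D0 _ _ _]:=mdist_bounds (z.1-s) a0 b0.
rewrite /kE /kapE /PE iq vinvE enorm_ln enorm_hat pt_max ga.
have n0: 0 < `|z.1-s| by rewrite normr_gt0 subr_eq0 eq_sym.
have t0: z.1-s != 0 by rewrite subr_eq0 eq_sym.
have Q0: 0<Num.sqrt (1+slp (Av gz (e0 z v) v) z.1 s^+2) by rewrite sqrtr_gt0 ltr_pwDl ?sqr_ge0.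
have tt: (z.1-s)^+2 = `|z.1-s| ^+ 2 by rewrite real_normK ?num_real.
rewrite (distrC s) (@algE k.+1 _ _ _ _ _ _ _ o0 n0 Q0 D0 tt).
have ON: om v^+k.+2 != 0 by rewrite expf_neq0 // gt_eqF.
have O0: om v != 0 by rewrite gt_eqF.
move: ((Num.sqrt _)^-1^+_) ((_/mdist _ _ _)^+_) => S M.
rewrite /wi; case: unliftP => [j ->|->].
 rewrite eq_sym (negbTE (neq_lift _ _)) subE !pt_lift ln_coord (exprS _ k.+2).
 move: (om v) (om v^+k.+2) (dir v j) O0 ON => O OK dj O0 ON.
 by field; rewrite O0 ON t0.
rewrite eqxx subE !pt_max ga gb /wden -/(om v) (exprS _ k.+2).
move: (om v) (om v^+k.+2) (Av _ _ _ _) (Av _ _ _ s) O0 ON => O OK a b O0 ON.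
by field; rewrite O0 ON t0.
Qed.

Lemma kF_ln i z s v (eps: R) (h: Rsp k.+1 -> R) : 0<eps ->
 plr z (fun x => (eps<=enorm (pt x-pt z))%R%:R*kF i (pt x) (pt z)*h x) s v =
 HH (kapF k (cF i)) gz h (wi i) z eps v s.
Proof.
move=> ep; have o0:=om_gt0 v; rewrite /plr /HH -[shr (z, v)]/((z.1, e0 z v), v) /= -/(ln z s v) fv_ln.
have trE: (eps/om v <= `|z.1-s| * Num.sqrt (1+slp (Av gz (e0 z v) v) z.1 s^+2)) =
  (eps<=enorm (pt (ln z s v)-pt z)) by rewrite ler_pdivrMr // [X in _<=X]mulrC -enorm_ln.
rewrite /trk /trunc trE.
have [->|sz]:=eqVneq s z.1.
 rewrite ln_base subrr normr0 expr0n mul0r subrr.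
 have -> : enorm (0: 'rV[R]_k.+3) = 0 by apply: enormE => //; rewrite expr0n big1 // => j _; rewrite mxE expr0n.
 by rewrite leNgt ep /= !mul0r mulr0.
have [a0 b0 ga gb iq]:=ln_facts v sz.
case: (eps<=_); last by rewrite !mul0r !mulr0.
rewrite !mul1r [LHS]mulrA [RHS]mulrA; congr (_*_).
have [D0 _ _ _]:=mdist_bounds (z.1-s) a0 b0.
rewrite /kF /kapF /cF iq vinvE enorm_ln enorm_hat' pt_max ga.
have n0: 0 < `|z.1-s| by rewrite normr_gt0 subr_eq0 eq_sym.
have t0: z.1-s != 0 by rewrite subr_eq0 eq_sym.
have Q0: 0<Num.sqrt (1+slp (Av gz (e0 z v) v) z.1 s^+2) by rewrite sqrtr_gt0 ltr_pwDl ?sqr_ge0.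
have tt: (z.1-s)^+2 = `|z.1-s| ^+ 2 by rewrite real_normK ?num_real.
rewrite (distrC s) (@algF k.+1 _ _ _ _ _ _ o0 n0 Q0 D0).
have ON: om v^+k.+2 != 0 by rewrite expf_neq0 // gt_eqF.
have O0: om v != 0 by rewrite gt_eqF.
have DN: mdist (z.1-s) (Av gz (e0 z v) v z.1) (Av gz (e0 z v) v s)^+k.+3 != 0 by rewrite expf_neq0 // gt_eqF.
move: (mdist _ _ _^+_) ((Num.sqrt _)^-1^+_) (Av _ _ _ _^+k.+1) DN => DD S M DN.
rewrite /wi; case: unliftP => [j ->|->].
 rewrite eq_sym (negbTE (neq_lift _ _)) subE vhat_lift !pt_lift ln_coord (exprS _ k.+2).
 move: (om v) (om v^+k.+2) (dir v j) O0 ON => O OK dj O0 ON.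
 by field; rewrite O0 ON DN.
rewrite eqxx subE vhat_max !pt_max ga gb /wden -/(om v) (exprS _ k.+2).
move: (om v) (om v^+k.+2) (Av _ _ _ _) (Av _ _ _ s) O0 ON => O OK a b O0 ON.
by field; rewrite O0 ON DN.
Qed.
End Geo.

(** * Bounded scalar operators over the parameter space *)

Section Op.
Context {R: realType}.
Local Notation mu:=(@lebesgue_measure R).
Local Notation Rsp:=(Rsp R).
Variables (k: nat) (g: 'rV[R]_k.+2 -> R) (L: R).
Hypotheses (L0: 0<=L) (gL: forall x y, `|g x-g y| <= L * `|x-y|) (g0: forall x, 0<g x).

Lemma Av_lip e v: lipr L (Av (gz g) e v).
Proof.
move=> s t; rewrite /Av -mulrBl normrM normfV (gtr0_norm (om_gt0 v)) ler_pdivrMr ?om_gt0 //.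
apply: le_trans (gL _ _) _; rewrite -mulrA; apply: ler_wpM2l => //.
apply: mx_norm_le; first by rewrite mulr_ge0 // ltW // om_gt0.
move=> j; rewrite !mxE [X in `|X|](_: _ = (s-t)*dir v j).
 by rewrite normrM; apply: ler_wpM2l => //; exact: dir_le.
case: j => -[|j] jk /=; first by rewrite mulr1.
by rewrite !nth_vlin /dir /=; ring.
Qed.

Lemma m_gz: mfun (Rsp k.+1) (gz g).
Proof.
apply: (@l1_measurable _ k.+1 L) => u w; apply: le_trans (gL _ _) _; apply: ler_wpM2l => //.
apply: mx_norm_le; first by rewrite l1_sum sumr_ge0.
move=> i; rewrite !mxE l1_sum (bigD1 i) //= lerDl; exact: sumr_ge0.
Qed.

Lemma m_pt i: mfun (Rsp k.+1) (fun x => pt g x 0 i).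
Proof.
case: (unliftP ord_max i) => [j ->|->].
 by under eq_fun do rewrite pt_lift; exact: m_nth.
by under eq_fun do rewrite pt_max; exact: m_gz.
Qed.

Lemma m_vhat d (T: measurableType d) (f: T -> 'rV[R]_k.+3) :
 (forall i, mfun T (fun x => f x 0 i)) ->
 forall i, mfun T (fun x => vhat (f x) 0 i).
Proof.
move=> mf i; case: (unliftP ord_max i) => [j ->|->].
 by under eq_fun do rewrite vhat_lift; exact: mf.
by under eq_fun do rewrite vhat_max; exact: mfunN.
Qed.

Lemma m_enormB d (T: measurableType d) n (f: T -> 'rV[R]_n) (y: 'rV[R]_n) :
 (forall i, mfun T (fun x => f x 0 i)) ->
 mfun T (fun x => enorm (f x-y)).
Proof.
move=> mf; apply: msqrt.
apply: measurable_sum => i; apply: mfunX; under eq_fun do rewrite subE.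
exact: mfunB.
Qed.

Lemma m_vinvB d (T: measurableType d) n (f: T -> 'rV[R]_n) (y: 'rV[R]_n) i :
 (forall i, mfun T (fun x => f x 0 i)) ->
 mfun T (fun x => vinv (f x-y) 0 i).
Proof.
move=> mf; under eq_fun do rewrite vinvE subE; apply: mfunM; last exact: mfunB.
apply: mfunN; apply: (mcomp m_inv); apply: mfunX.
exact: m_enormB.
Qed.

Lemma m_kE i y: mfun (Rsp k.+1) (fun x => kE i (pt g x) y).
Proof.
have mp:=m_pt.
apply: mfunM => //; apply: mfunM; last exact: m_vinvB.
apply: (mcomp m_inv).
by apply: mfunM; apply: mfunX; exact: m_enormB.
Qed.

Lemma m_kF i y: mfun (Rsp k.+1) (fun x => kF i (pt g x) y).
Proof.
have mp:=m_pt; have mv:=m_vhat mp.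
apply: mfunM => //; apply: mfunM; last exact: m_vinvB.
apply: (mcomp m_inv).
by apply: mfunM; apply: mfunX; exact: m_enormB.
Qed.

Lemma m_wi i: mfun (Rsp k) (wi i: Rsp k -> R).
Proof.
rewrite /wi; case: (unlift _ _) => [j|]; last exact: m_wden.
apply: mfunM.
 case: j => -[|j] jk; first exact: mcst.
 exact: (@m_nth _ k j).
by apply: (mcomp m_inv); apply: mfunX; exact: m_om.
Qed.

Lemma wi_le i v: `|wi i (v: Rsp k)| <= wden 1 v.
Proof.
have o0:=om_gt0 v; rewrite /wi; case: (unlift _ _) => [j|]; last first.
 by rewrite ger0_norm // invr_ge0 exprn_ge0 // ltW.
rewrite normrM normfV (gtr0_norm (exprn_gt0 _ o0)) ler_pdivrMr ?exprn_gt0 // /wden -/(om v).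
by rewrite (exprS _ k.+2) mulrCA mulVf ?mulr1 ?dir_le // expf_neq0 // gt_eqF.
Qed.

Lemma PE_lkernel i: exists K C, lkernel L K C (2^+k.+1)^-1 (PE (k:=k) i) (kapE k (PE i)).
Proof.
have [K1 s1] := @smooth_isqX R L k.+3 L0.
have mi: mfun R (fun q: R => isq q^+k.+3) by apply: mfunX; exact: m_isq.
have [K sK] : exists K, smooth L K (PE (k:=k) i).
 rewrite /PE; case: (i == ord_max); eexists.
  exact: (smooth_mul L0 (smooth_id L0) s1).
 exact: (smooth_mul L0 (smooth_cst L 1) s1).
have mP: mfun R (PE (k:=k) i).
 by rewrite /PE; case: (i == ord_max); apply: mfunM.
by have [C HC]:=kapE_lkernel k L0 sK mP; exists K, C.
Qed.

Lemma cF_lkernel i: lkernel L `|0: R| 1 0 (fun=> 0) (kapF k (cF (k:=k) i)).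
Proof.
apply: kapF_lkernel => //.
 move=> t a b a0 b0; have [_ h1 h2 _]:=mdist_bounds t a0 b0.
 by rewrite /cF; case: (i == ord_max) => //; rewrite ger0_norm // addr_ge0 // ltW.
by move=> d T t a b mt ma mb; rewrite /cF; case: (i == ord_max) => //; exact: mfunD.
Qed.

Definition OPf (kk: 'rV[R]_k.+3 -> 'rV[R]_k.+3 -> R) (h: Rsp k.+1 -> R) (z: Rsp k.+1) (eps: R) (x: Rsp k.+1) : R :=
 (eps<=enorm (pt g x-pt g z))%R%:R*kk (pt g x) (pt g z)*h x.

(** A majorant for all truncations below the height is carried along with their convergence and
    integrability. In this form bounds can be added and multiplied by constants before any limit is
    taken. *)
Definition bounded_op (p: R) (kk: 'rV[R]_k.+3 -> 'rV[R]_k.+3 -> R):=exists2 B: R, 0<=B &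
 forall h: Rsp k.+1 -> R, mfun (Rsp k.+1) h -> (\int[lebm k.+1]_z (`|h z| `^ p)%:E < +oo)%E ->
 exists Mb: Rsp k.+1 -> \bar R, [/\ mfun (Rsp k.+1) Mb, (forall z, 0<=Mb z)%E,
  (\int[lebm k.+1]_z Mb z<=B%:E * \int[lebm k.+1]_z (`|h z| `^ p)%:E)%E &
  {ae lebm k.+1, forall z, [/\ conv0 (fun eps => \int[lebm k.+1]_x OPf kk h z eps x),
  forall eps, 0<eps -> eps<=gz g z -> ((`|\int[lebm k.+1]_x OPf kk h z eps x| `^ p)%:E<=Mb z)%E &
  forall eps, 0<eps -> (lebm k.+1).-integrable [set: Rsp k.+1] (EFin \o OPf kk h z eps)]}].

Lemma line_bounded_op (p K C alpha: R) P kap (w: Rsp k -> R) kk: 1<p ->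
 lkernel L K C alpha P kap -> mfun (Rsp k) w -> (forall v, `|w v| <= wden 1 v) ->
 (forall y, mfun (Rsp k.+1) (fun x => kk (pt g x) y)) ->
 (forall z s v eps h, 0<eps -> plr z (OPf kk h z eps) s v = HH kap (gz g) h w z eps v s) ->
 bounded_op p kk.
Proof.
move=> p1 HK mw wle mk Hid; have p0: 0<p by lra.
have G0 z: 0<gz g z by exact: g0.
have mG:=m_gz.
have K0: 0<=K by have [h1 _ _]:=lk_smooth HK; apply: le_trans (normr_ge0 _) (h1 0 _); rewrite normr0.
have [W W0 HW'] := @wden_integral R k.
have HW: (\int[lebm k]_v (wden 1 v)%:E<=W%:E)%E by have:=HW' 1 ltr01; rewrite sqrtr1 divr1.
have [CM CM0 HM]:=Mx1_lp L0 K0 p1; have HM':=conj I HM; clear HM.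
pose D:=(CK L K C alpha*(1+W))`^p.
have D0: 0<=D by exact: powR_ge0.
exists (D*(CM*W)); first by rewrite mulr_ge0 // mulr_ge0 // ltW.
move=> h mh hoo.
have HML e v: (LL p h e v < +oo)%E ->
  (\int[mu]_s Mx1 p P (Av (gz g) e v) (fv h e v) s<=CM%:E*LL p h e v)%E.
 move=> lf; apply: (HM'.2 P _ _ (lk_smooth HK) (Av_lip e v) (lk_measP HK)) => //.
 apply: (mcomp mh); apply: mpair => //.
 by apply: m_vlin.
have IM:=MM_lp HK mG mh CM0 HML HW.
have MMoo: (\int[lebm k.+1]_z MM p P (gz g) h z < +oo)%E.
 apply: le_lt_trans IM _; rewrite lte_mul_pinfty ?lee_fin //.
 by rewrite mulr_ge0 // ltW.
have mMM:=m_MM p HK mG mh.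
exists (fun z => D%:E*MM p P (gz g) h z)%E; split.
- exact: measurable_funeM.
- by move=> z; rewrite mule_ge0 ?lee_fin // MM_ge0.
- rewrite ge0_integralZl_EFin //; last by move=> z _; exact: MM_ge0.
 by rewrite EFinM -muleA; apply: lee_wpmul2l.
- have an:=ae_nice HK p1 mG G0 mh Av_lip hoo MMoo.
 apply: (ae_sub _ an) => z nz.
 have mO eps: mfun (Rsp k.+1) (OPf kk h z eps).
  apply: mfunM => //; apply: mfunM => //; apply: m_bool_real.
  apply: measurable_fun_ler => //; exact: (m_enormB _ m_pt).
 have fin eps: 0<eps -> (\int[lebm k]_v \int[mu]_s `|plr z (OPf kk h z eps) s v|%:E < +oo)%E.
  move=> e0; have E v: (\int[mu]_s `|plr z (OPf kk h z eps) s v|%:E =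
  \int[mu]_s `|HH kap (gz g) h w z eps v s|%:E)%E.
  by apply: eq_integral => s _; rewrite Hid.
  by rewrite (eq_integral _ _ (fun v _ => E v)); exact: (line_abs HK L0 p1 mG G0 mh mw wle Av_lip HW nz e0).
 have OT eps: 0<eps -> \int[lebm k.+1]_x OPf kk h z eps x = TTk kap (gz g) h w eps z.
  move=> e0; have [_ ->]:=polarR (mO eps) (fin eps e0).
  rewrite (TT_nested HK p1 mG G0 mh mw Av_lip nz e0).
  by apply: eq_Rintegral => v _; apply: eq_Rintegral => s _; rewrite Hid.
 split.
 + apply: (conv0_near ltr01 (fun e e0 _ => OT e e0)).
  exact: (TT_conv HK L0 p1 mG G0 mh mw wle Av_lip HW nz).
 + move=> eps e0 eG; rewrite OT //.
  exact: (TT_bound HK L0 p1 mG G0 mh mw wle Av_lip HW nz e0 eG).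
 + by move=> eps e0; have []:=polarR (mO eps) (fin eps e0).
Qed.

Lemma kE_bounded_op p i: 1<p -> bounded_op p (kE i).
Proof.
move=> p1; have [K [C HK]]:=PE_lkernel i.
apply: (line_bounded_op p1 HK (m_wi i) (wi_le i)); first exact: m_kE.
by move=> z s v eps h e0; exact: kE_ln.
Qed.

Lemma kF_bounded_op p i: 1<p -> bounded_op p (kF i).
Proof.
move=> p1.
apply: (line_bounded_op p1 (cF_lkernel i) (m_wi i) (wi_le i)); first exact: m_kF.
by move=> z s v eps h e0; exact: kF_ln.
Qed.
End Op.

(** * Differentiability tested on rational increments *)

Section LinForm.
Context {R: realType}.
Variable m: nat.
Implicit Types (d: 'I_m -> R) (h: 'rV[R]_m).

Definition linform d h: R:=\sum_i h 0 i*d i.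

Lemma linform_is_linear d: linear (linform d).
Proof.
move=> a u v; rewrite /linform scaler_sumr -big_split /=; apply: eq_bigr => i _.
by rewrite !mxE mulrDl -mulrA.
Qed.

HB.instance Definition _ d:=GRing.isLinear.Build R 'rV[R]_m R *:%R (linform d) (linform_is_linear d).

Lemma linform_le d h: `|linform d h| <= (\sum_i `|d i|) * `|h|.
Proof.
apply: le_trans (ler_norm_sum _ _ _) _; rewrite mulr_suml; apply: ler_sum => i _.
rewrite normrM mulrC ler_wpM2l // {2}/Num.Def.normr /= mx_normrE.
exact: (le_bigmax _ (fun ij: 'I_1 * 'I_m => `|h ij.1 ij.2|) (0, i)).
Qed.

Lemma linform_continuous d: continuous (linform d).
Proof.
move=> x; apply: (proj2 (@cvgrPdist_le R R _ (nbhs x) (nbhs_filter x) _ _)) => e e0.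
apply/(@nbhs_normP _ 'rV[R]_m).
have S0: 0 <= \sum_i `|d i| by exact: sumr_ge0.
exists (e/(\sum_i `|d i| + 1)) => /=; first by rewrite divr_gt0 // ltr_wpDl.
move=> y /=; rewrite ltr_pdivlMr ?ltr_wpDl // => H.
rewrite -linearB; apply: le_trans (linform_le _ _) _; apply: le_trans (ltW H).
by rewrite mulrC ler_wpM2l // lerDl.
Qed.

Lemma rat_row_approx h (e: R) : 0<e -> exists q: 'rV[rat]_m, `|map_mx ratr q-h| <= e.
Proof.
move=> e0; have /choice[q qP] : forall i, exists q: rat, `|ratr q-h 0 i| <= e.
 move=> i; have /rat_in_itvoo[q] : h 0 i-e<h 0 i+e by lra.
 by rewrite in_itv /= => /andP[q1 q2]; exists q; rewrite ler_distl; apply/andP; split; lra.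
exists (\row_i q i); apply: mx_norm_le; first exact: ltW.
by move=> i; rewrite !mxE.
Qed.

Lemma linform_diff (f: 'rV[R]_m -> R) (x: 'rV[R]_m) : differentiable f x ->
 'd f x = linform (fun i => 'D_(delta_mx 0 i) f x) :> ('rV[R]_m -> R).
Proof.
move=> df; apply/funext => h; rewrite {1}(row_sum_delta h) linear_sum /linform /=.
by apply: eq_bigr => i _; rewrite linearZ /= deriveE.
Qed.

Lemma differentiable_near (f: 'rV[R]_m -> R) (x: 'rV[R]_m) d :
 (forall e, 0<e -> exists2 r, 0<r & forall h, `|h| < r -> `|f (x+h)-f x-linform d h| <= e * `|h|) <->
 differentiable f x /\ forall i, 'D_(delta_mx 0 i) f x = d i.
Proof.
split=> [H|[df dE] e e0].
 have lo: f \o shift x = cst (f x)+linform d +o_ (0: 'rV[R]_m) id.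
  apply/eqaddoP => e e0; have [r r0 rP]:=H _ e0.
  apply/(@nbhs_normP _ 'rV[R]_m); exists r => // h /=; rewrite sub0r normrN => hr.
  by rewrite /= opprD !fctE addrA (addrC h) /=; apply: rP.
 have dE: 'd f x = linform d :> ('rV[R]_m -> R) :=
  @diff_unique R 'rV[R]_m R f (linform d) x (@linform_continuous d) lo.
 have df: differentiable f x.
  by apply/diff_locallyP; rewrite dE; split => //; exact: linform_continuous.
 split=> // i; rewrite deriveE // dE /linform (bigD1 i) //= big1 ?addr0 ?mxE ?eqxx ?mul1r //.
 by move=> j ji; rewrite mxE eqxx /= (negbTE ji) mul0r.
have /diff_locallyP[_ /eqaddoP /(_ _ e0)]:=df.
rewrite linform_diff // (_: (fun i => _) = d); last exact/funext.
rewrite -nbhs_nearE => /nbhs_normP[r /= r0 rP]; exists r => // h hr.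
have:=rP h; rewrite /= sub0r normrN => /(_ hr).
by rewrite /= opprD !fctE addrA (addrC h).
Qed.

Lemma norm_add3_le (A B C e h M S s t: R) : 0<=h -> `|A| <= e/2*(h+s) -> `|B| <= M*s ->
 `|C| <= S*s -> s*(M+S+e/2+1)<=t -> 0<e -> 0<s -> `|A+(B+C)| <= e*h+t.
Proof.
move=> h0 a b c st e0 s0; apply: le_trans (ler_normD _ _) _; have bc:=ler_normD B C.
have eh: 0<=e*h by rewrite mulr_ge0 // ltW.
have -> : e*h+t = e/2*(h+s)+(M*s+S*s) +
 (e*h/2+s+(t-s*(M+S+e/2+1))) by field.
rewrite -[leLHS]addr0; apply: lerD; first by apply: lerD => //; apply: le_trans bc _; exact: lerD.
by rewrite addr_ge0 ?subr_ge0 // addr_ge0 ?(ltW s0) // divr_ge0.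
Qed.

(** A rational increment within a small [s] of [h] changes both [f] and the linear form by a
    multiple of [s], which tends to 0. The condition is thereby reduced to countable quantifiers. *)
Lemma differentiable_rat (f: 'rV[R]_m -> R) (L: R) (x: 'rV[R]_m) d :
 0<=L -> (forall x y, `|f x-f y| <= L * `|x-y|) ->
 (forall e, 0<e -> exists2 r, 0<r & forall h, `|h| < r -> `|f (x+h)-f x-linform d h| <= e * `|h|) <->
 (forall k: nat, exists n: nat, forall q: 'rV[rat]_m, let h:=map_mx ratr q in
  `|h| < n.+1%:R^-1 -> `|f (x+h)-f x-linform d h| <= k.+1%:R^-1 * `|h|).
Proof.
move=> L0 fL; split=> [H k|H e e0].
 have [r r0 rP]:=H k.+1%:R^-1 (ltac:(by rewrite invr_gt0)).
 have [n nr] : exists n: nat, n.+1%:R^-1<=r.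
  exists (Num.truncn r^-1); rewrite invf_ple ?posrE // ltW //.
  by have /andP[] : (Num.truncn r^-1)%:R<=r^-1<(Num.truncn r^-1).+1%:R by apply: truncn_itv; rewrite invr_ge0 ltW.
 by exists n => q h hn; apply: rP; exact: lt_le_trans hn nr.
have e20: 0<e/2 by lra.
have [k ke] : exists k: nat, k.+1%:R^-1<=e/2.
 exists (Num.truncn (e/2)^-1); rewrite invf_ple ?posrE // ltW //.
 by have /andP[] : (Num.truncn (e/2)^-1)%:R<=(e/2)^-1<(Num.truncn (e/2)^-1).+1%:R by apply: truncn_itv; rewrite invr_ge0 ltW.
have [n nP]:=H k; exists n.+1%:R^-1; first by rewrite invr_gt0.
move=> h hn; apply/ler_addgt0Pr => t t0.
pose S:=\sum_i `|d i|.
have S0: 0<=S by exact: sumr_ge0.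
pose c:=L+S+e/2+1.
have c0: 0<c by rewrite /c; lra.
pose s:=Num.min (t/c) ((n.+1%:R^-1 - `|h|)/2).
have s0: 0<s by rewrite lt_min !divr_gt0 // subr_gt0.
have st: s*c<=t by rewrite -ler_pdivlMr // ge_min lexx.
have sn: s<=(n.+1%:R^-1 - `|h|)/2 by rewrite ge_min lexx orbT.
have [q qh]:=rat_row_approx h s0; set w:=map_mx ratr q in qh.
have wh: `|w| <= `|h| + s.
 by rewrite -[w](subrK h) addrC; apply: le_trans (ler_normD _ _) _; rewrite lerD2l.
have wn: `|w| < n.+1%:R^-1 by
 apply: le_lt_trans wh _; rewrite -ltrBrDl; apply: le_lt_trans sn _;
 rewrite ltr_pdivrMr // ltr_pMr ?subr_gt0 // ltr1n.
have F1:=nP q wn.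
have F2:=fL (x+h) (x+w).
have F3:=linform_le d (w-h).
rewrite linearB /= in F3.
have F4: `|x+h-(x+w)| <= s by rewrite opprD addrACA subrr add0r distrC.
have F5: k.+1%:R^-1 * `|w| <= e/2*(`|h| + s) by apply: ler_pM.
have F2' : `|f (x+h)-f (x+w)| <= L*s by apply: le_trans F2 _; apply: ler_wpM2l.
have F3' : `|linform d w-linform d h| <= S*s by apply: le_trans F3 _; apply: ler_wpM2l.
have F1':=le_trans F1 F5.
rewrite (_: f (x+h)-f x-linform d h = (f (x+w)-f x-linform d w) +
 ((f (x+h)-f (x+w))+(linform d w-linform d h))); last by ring.
exact: norm_add3_le (normr_ge0 h) F1' F2' F3' st e0 s0.
Qed.

End LinForm.

(** * Measurability of the partial derivatives *)

Section MeasDeriv.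
Context {R: realType}.
Local Notation Rsp:=(Rsp R).
Variables (k: nat) (g: 'rV[R]_k.+2 -> R) (L: R).
Hypotheses (L0: 0<=L) (gL: forall x y, `|g x-g y| <= L * `|x-y|).

Lemma m_shift (h: 'rV[R]_k.+2) : mfun (Rsp k.+1) (fun z => g (rs z+h)).
Proof.
apply: (@l1_measurable _ k.+1 L) => u w; apply: le_trans (gL _ _) _; apply: ler_wpM2l => //.
apply: mx_norm_le; first by rewrite l1_sum sumr_ge0.
move=> i; rewrite opprD addrACA subrr addr0 !mxE l1_sum (bigD1 i) //= lerDl; exact: sumr_ge0.
Qed.

Definition dquot i (n: nat) (z: Rsp k.+1) : R :=
 n.+1%:R*(g (rs z+n.+1%:R^-1 *: delta_mx 0 i)-g (rs z)).

(** A measurable candidate for the partial derivative, defined at every point. Inserting it into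
    [differentiable_rat] makes the set of differentiability measurable. *)
Definition dcand i (z: Rsp k.+1) : R:=fine (limn_esup (fun n => (dquot i n z)%:E)).

Lemma m_dcand i: mfun (Rsp k.+1) (dcand i).
Proof.
have H: mfun (Rsp k.+1) (fun z => limn_esup (fun n => (dquot i n z)%:E)).
 apply: (@measurable_fun_limn_esup _ _ R [set: Rsp k.+1] (fun n z => (dquot i n z)%:E)) => n.
 have gm:=m_gz L0 gL.
 have sm:=m_shift (n.+1%:R^-1 *: delta_mx 0 i).
 apply/mEFinP; apply: mfunM; first exact: mcst.
 exact: mfunB.
exact: (mcomp (fine_measurable (measurableT))) H.
Qed.

Lemma dquot_cvg i z: differentiable g (rs z) ->
 dquot i n z @[n --> \oo] --> 'D_(delta_mx 0 i) g (rs z).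
Proof.
move=> df; have:=diff_derivable (v:=delta_mx 0 i) df.
move/cvgr_dnbhsP => /(_ (fun n => n.+1%:R^-1)) H.
rewrite (_: (fun n => dquot i n z) = (fun n => (n.+1%:R^-1)^-1 *:
 ((g \o shift (rs z)) (n.+1%:R^-1 *: delta_mx 0 i)-g (rs z)))).
 apply: H; split; last exact: cvg_harmonic.
 by move=> n; rewrite invr_eq0 pnatr_eq0.
by apply/funext => n; rewrite /dquot invrK /= (addrC (rs z)).
Qed.

Lemma dcandE i z: differentiable g (rs z) -> dcand i z = 'D_(delta_mx 0 i) g (rs z).
Proof.
move=> df; rewrite /dcand.
have H: (dquot i n z)%:E @[n --> \oo] --> ('D_(delta_mx 0 i) g (rs z))%:E.
 by apply: cvg_EFin (dquot_cvg df); apply: nearW.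
by rewrite is_cvg_limn_esupE ?(cvg_lim _ H) //; apply/cvg_ex; eexists; exact: H.
Qed.

Lemma pderiv_bound i z: `|pderiv g (rs z) i| <= L.
Proof.
rewrite /pderiv; case: asboolP => df; last by rewrite normr0.
have H:=dquot_cvg (i:=i) df.
have B n: `|dquot i n z| <= L.
 rewrite /dquot normrM ger0_norm // mulrC -ler_pdivlMr //.
 apply: le_trans (gL _ _) _; apply: ler_wpM2l => //; rewrite addrAC subrr add0r.
 apply: mx_norm_le; first by rewrite invr_ge0.
 move=> j; rewrite !mxE eqxx /=; case: (j == i); rewrite ?mulr1 ?mulr0 ?normr0 ?invr_ge0 //.
 by rewrite ger0_norm // invr_ge0.
rewrite -(cvg_lim _ H) // ler_norml; apply/andP; split.
 apply: limr_ge; first by apply/cvg_ex; eexists; exact: H.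
 by apply: nearW => n; have:=B n; rewrite ler_norml => /andP[].
apply: limr_le; first by apply/cvg_ex; eexists; exact: H.
by apply: nearW => n; have:=B n; rewrite ler_norml => /andP[].
Qed.

Lemma m_differentiable: measurable [set z: Rsp k.+1 | differentiable g (rs z)].
Proof.
pose P (a n: nat) (q: 'rV[rat]_k.+2) : set (Rsp k.+1) := [set z | let h:=map_mx ratr q in
  `|h| < n.+1%:R^-1 -> `|g (rs z+h)-g (rs z)-linform (dcand ^~ z) h| <= a.+1%:R^-1 * `|h| ].
rewrite (_: [set z | _] = \bigcap_a \bigcup_n ~` \bigcup_q ~` P a n q).
 apply: bigcap_measurable => [|a _]; first by exists 0%N.
 apply: bigcup_measurable => n _; apply: measurableC.
 apply: countable_bigcupT_measurable => [|q]; first exact: countableP.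
 apply: measurableC; rewrite /P /=.
 have [hn|hn]:=boolP (`|map_mx (ratr: rat -> R) q| < n.+1%:R^-1); last first.
  by rewrite (_: [set _ | _] = setT) //; apply/seteqP; split.
 have m1:=m_shift (map_mx ratr q).
 have m2:=m_gz L0 gL.
 have m3: mfun (Rsp k.+1) (fun z => linform (dcand ^~ z) (map_mx ratr q)).
  apply: measurable_sum => i; apply: mfunM; first exact: mcst.
  exact: m_dcand.
 have m4: mfun (Rsp k.+1) (fun z => `|g (rs z+map_mx ratr q)-g (rs z) -
  linform (dcand ^~ z) (map_mx ratr q)|).
  apply: mnorm.
  by apply: mfunB => //; apply: mfunB.
 have:=measurable_fun_le measurableT m4 (mcst (a.+1%:R^-1 * `|map_mx (ratr: rat -> R) q|)).
 by rewrite setTI; congr measurable; apply/seteqP; split => z /=; [move=> H _|apply].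
apply/seteqP; split => z /=.
 move=> df a _.
 have /differentiable_near: differentiable g (rs z) /\ forall i, 'D_(delta_mx 0 i) g (rs z) = dcand i z.
  by split => // i; rewrite dcandE.
 move/(differentiable_rat _ _ L0 gL) => /(_ a)[n nP]; exists n => //= -[q _]; apply; exact: nP.
move=> H; have /(differentiable_rat _ _ L0 gL)/differentiable_near[] : forall a: nat, exists n: nat,
  forall q: 'rV[rat]_k.+2, let h:=map_mx ratr q in
  `|h| < n.+1%:R^-1 -> `|g (rs z+h)-g (rs z)-linform (dcand ^~ z) h| <= a.+1%:R^-1 * `|h|.
 move=> a; have [n _ nP]:=H a I; exists n => q.
 by apply: contrapT => nq; apply: nP; exists q.
by [].
Qed.

Lemma m_pderiv i: mfun (Rsp k.+1) (fun z => pderiv g (rs z) i).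
Proof.
rewrite (_: (fun z => _) = (fun z => \1_[set z | differentiable g (rs z)] z*dcand i z)).
 have m1:=m_dcand i.
 apply: mfunM => //; exact: measurable_indic m_differentiable.
apply/funext => z; rewrite /pderiv indicE; case: asboolP => df.
 by rewrite mem_set // mul1r dcandE.
by rewrite memNset // mul0r.
Qed.

End MeasDeriv.

(** Serves for the norm of [TSigma], a function given by limits. The majorant is raised to infinity
    on a null set, which does not change its integral, and the two integrals are then compared as
    suprema over simple functions. *)
Lemma ae_le_integral d (T: measurableType d) (R: realType) (m: {measure set T -> \bar R})
  (f M: T -> \bar R) : (forall x, 0<=f x)%E -> mfun T M -> (forall x, 0<=M x)%E ->
 {ae m, forall x, (f x<=M x)%E} -> (\int[m]_x f x <= \int[m]_x M x)%E.
Proof.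
move=> f0 mM M0 [N [mN N0 HN]].
pose M' x: \bar R:=if x \in N then +oo%E else M x.
have mM' : mfun T M'.
 apply: measurable_fun_if => //.
  apply: (measurable_fun_bool true); rewrite setTI (_: _ @^-1` _ = N) //.
  by apply/seteqP; split => x /=; [move/set_mem|move/mem_set].
 exact: measurable_funS mM.
have M'0 x: (0<=M' x)%E by rewrite /M'; case: ifP.
have fM x: (f x<=M' x)%E.
 rewrite /M'; case: ifPn => xN; first exact: leey.
 by apply: contrapT => H; move/negP: xN; apply; apply/mem_set; exact: HN.
have -> : (\int[m]_x M x = \int[m]_x M' x)%E.
 apply: ge0_ae_eq_integral => //; exists N; split => // x /= H; apply: contrapT => xN; apply: H => _.
 by rewrite /M' memNset.
rewrite !ge0_integralTE //; apply: le_ereal_sup => _ [h hf <-]; exists h => // x.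
exact: le_trans (hf x) (fM x).
Qed.

Lemma ae_forall_fin d (T: measurableType d) (R: realType) (m: {measure set T -> \bar R})
  (I: finType) (P: I -> T -> Prop) : (forall i, {ae m, forall x, P i x}) -> {ae m, forall x, forall i, P i x}.
Proof.
move=> H; have K n: {ae m, forall x, forall i, unpickle n = Some i -> P i x}.
 case: (unpickle n) => [i|]; last exact: aeW.
 by apply: (ae_sub _ (H i)) => x Px j [<-].
by apply: (ae_sub _ (ae_foralln K)) => x Px i; apply: (Px (pickle i)); rewrite pickleK.
Qed.

(** * Coefficients of Clifford products *)

Section CliffordAlgebra.
Context {R: realType}.

Lemma clnorm_ge n (u: Cl R n) A: `|u A| <= clnorm u.
Proof.
rewrite -sqrtr_sqr ler_wsqrtr // (bigD1 A) //= lerDl; apply: sumr_ge0 => i _; exact: sqr_ge0.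
Qed.

Lemma clnorm_le_sum n (u: Cl R n) : clnorm u <= \sum_A `|u A|.
Proof.
have S0 (r: seq {set 'I_n}) : 0 <= \sum_(A <- r) `|u A| by exact: sumr_ge0.
rewrite -[leRHS]ger0_norm // -sqrtr_sqr ler_wsqrtr //.
elim: (index_enum _) => [|A r IH]; first by rewrite !big_nil expr0n.
rewrite !big_cons sqrrD -[u A^+2]real_normK ?num_real // -addrA lerD2l.
by apply: le_trans IH _; rewrite lerDr mulrn_wge0 // mulr_ge0.
Qed.

Lemma powR_sum_le (I: finType) (a: I -> R) (p: R) : 0<p -> (forall i, 0<=a i) ->
 (\sum_i a i)`^p <= #|I|%:R`^p * \sum_i a i`^p.
Proof.
move=> p0 a0; set s:=\sum_i a i`^p.
have s0: 0<=s by apply: sumr_ge0 => i _; exact: powR_ge0.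
have aE x: 0<=x -> (x`^p)`^p^-1 = x by move=> x0; rewrite -powRrM mulfV ?gt_eqF // powRr1.
have H i: a i<=s`^p^-1.
 rewrite -[a i]aE //; apply: ge0_ler_powR; rewrite ?nnegrE ?invr_ge0 ?powR_ge0 ?(ltW p0) //.
 by rewrite /s (bigD1 i) //= lerDl; apply: sumr_ge0 => j _; exact: powR_ge0.
have sE: (s`^p^-1)`^p = s by rewrite -powRrM mulVf ?gt_eqF // powRr1.
rewrite -[in leRHS]sE -powRM ?powR_ge0 //; apply: ge0_ler_powR; rewrite ?nnegrE ?(ltW p0) //.
- exact: sumr_ge0.
- by rewrite mulr_ge0 // powR_ge0.
- by apply: le_trans (ler_sum _ (fun i _ => H i)) _; rewrite sumr_const mulr_natl.
Qed.

(** Moves the height factor [c], the kernel scalar [s] and the surface density [j] inside the sums,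
    next to the component of the vector, so that each summand is a constant times one scalar
    operator. *)
Lemma clmul_vec_expand n (c s j: R) (w: 'rV[R]_n) (N u: Cl R n) C :
 c*clmul (clmul (clscale s (clvec w)) N) u C*j =
 \sum_A \sum_B (if (A :\: B) :|: (B :\: A) == C then clsign R A B *
  \sum_D \sum_F (if (D :\: F) :|: (F :\: D) == A then clsign R D F *
  \sum_i (if D == [set i]%SET then c*(s*w 0 i)*(N F*j*u B) else 0) else 0) else 0)%SET.
Proof.
rewrite {1}/clmul mulr_sumr mulr_suml; apply: eq_bigr => A _.
rewrite mulr_sumr mulr_suml; apply: eq_bigr => B _.
case: ifP => _; last by rewrite mulr0 mul0r.
rewrite [LHS](_: _ = clsign R A B*(clmul (clscale s (clvec w)) N A*(c*u B*j))); last by ring.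
congr (_*_); rewrite /clmul mulr_suml; apply: eq_bigr => D _.
rewrite mulr_suml; apply: eq_bigr => F _.
case: ifP => _; last by rewrite mul0r.
rewrite /clscale /clvec.
rewrite [LHS](_: _ = clsign R D F*((\sum_(i<n) (if D == [set i]%SET then w 0 i else 0))*(s*N F*(c*u B*j))));
 last by ring.
congr (_*_); rewrite mulr_suml; apply: eq_bigr => i _.
by case: ifP => _; [ring|rewrite mul0r].
Qed.

Lemma clhat_norm m (u: Cl R m.+1) A: `|clhat u A| = `|u A|.
Proof. by rewrite /clhat; case: ifP; rewrite ?normrN. Qed.

End CliffordAlgebra.

(** * The operator on Clifford-valued functions on the graph *)

Section Surface.
Context {R: realType}.
Local Notation Rsp:=(Rsp R).
Variables (k: nat) (g: 'rV[R]_k.+2 -> R) (L p: R).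
Hypotheses (L0: 0<=L) (gL: forall x y, `|g x-g y| <= L * `|x-y|) (g0: forall x, 0<g x) (p1: 1<p).
Local Notation mm:=(lebm k.+1).
Local Notation field:=('rV[R]_k.+3 -> Cl R k.+3).
Implicit Types (phi: field) (z x: Rsp k.+1) (eps: R).

Definition jz z:=jac g (rs z).

Lemma m_jz: mfun (Rsp k.+1) jz.
Proof.
apply: msqrt.
apply: mfunD => //; apply: measurable_sum => i; apply: mfunX.
exact: (m_pderiv L0 gL).
Qed.

Lemma jz_ge1 z: 1<=jz z.
Proof.
rewrite -[leLHS]sqrtr1 ler_wsqrtr // lerDl; apply: sumr_ge0 => i _; exact: sqr_ge0.
Qed.

Lemma jz_le: exists2 J, 0<=J & forall z, jz z<=J.
Proof.
exists (1 + \sum_(i<k.+2) L^+2); first by rewrite addr_ge0 // sumr_ge0 // => i _; exact: sqr_ge0.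
move=> z; have j1:=jz_ge1 z; apply: (le_via (jz z^+2)).
 by rewrite expr2 ler_peMl // (le_trans ler01 j1).
rewrite /jz /jac sqr_sqrtr; last by rewrite addr_ge0 // sumr_ge0 // => i _; exact: sqr_ge0.
rewrite lerD2l; apply: ler_sum => i _; rewrite -[leLHS]real_normK ?num_real //.
by rewrite lerXn2r ?nnegrE //; exact: (pderiv_bound L0 gL).
Qed.

(** The normal times the density of surface measure: the normalising factors cancel, so the
    components are 1 and minus the partial derivatives of [g] ([nuzE]), measurable and bounded. *)
Definition nuz z (F: {set 'I_k.+3}) : R:=clvec (unormal g (rs z)) F*jz z.

Lemma nuzE z F: nuz z F = \sum_(i<k.+3) (if F == [set i]%SET then
  (if unlift ord_max i is Some j then-pderiv g (rs z) j else 1) else 0).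
Proof.
rewrite /nuz /clvec mulr_suml; apply: eq_bigr => i _; case: ifP => _; last by rewrite mul0r.
have j0: jz z != 0 by rewrite gt_eqF // (lt_le_trans ltr01 (jz_ge1 z)).
by rewrite /unormal !mxE mulrC mulrA -/(jz z) mulfV // mul1r.
Qed.

Lemma m_nuz F: mfun (Rsp k.+1) (fun z => nuz z F).
Proof.
under eq_fun do rewrite nuzE; apply: measurable_sum => i; case: (F == _) => //.
case: (unlift _ _) => [j|] //; apply: mfunN; exact: (m_pderiv L0 gL).
Qed.

Lemma nuz_le z F: `|nuz z F| <= \sum_(i<k.+3) (L+1).
Proof.
rewrite nuzE; apply: le_trans (ler_norm_sum _ _ _) _; apply: ler_sum => i _.
case: (F == _); last by rewrite normr0 addr_ge0.
case: (unlift _ _) => [j|]; last by rewrite normr1 lerDr.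
by rewrite normrN; apply: le_trans (pderiv_bound L0 gL _ _) _; rewrite lerDl.
Qed.

Definition NN phi: \bar R:=(\int[mm]_z ((clnorm (phi (pt g z))`^p)*jz z)%:E)%E.

Definition mfield phi:=forall A, mfun (Rsp k.+1) (fun z => phi (pt g z) A).

Lemma m_clnorm phi: mfield phi -> mfun (Rsp k.+1) (fun z => clnorm (phi (pt g z))).
Proof.
move=> H; apply: msqrt.
by apply: measurable_sum => A; apply: mfunX; exact: H.
Qed.

(** The counterpart of [bounded_op] for integrands depending on a Clifford-valued field, closed
    under finite sums and scalar factors, so that the expansion of the Clifford products can be
    followed term by term. *)
Definition good (Phi: field -> Rsp k.+1 -> R -> Rsp k.+1 -> R):=exists2 B: R, 0<=B &
 forall phi, mfield phi -> (NN phi < +oo)%E ->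
 exists Mb: Rsp k.+1 -> \bar R, [/\ mfun (Rsp k.+1) Mb, (forall z, 0<=Mb z)%E,
  (\int[mm]_z Mb z<=B%:E*NN phi)%E &
  {ae mm, forall z, [/\ conv0 (fun eps => \int[mm]_x Phi phi z eps x),
  forall eps, 0<eps -> eps<=gz g z -> ((`|\int[mm]_x Phi phi z eps x| `^ p)%:E<=Mb z)%E &
  forall eps, 0<eps -> mm.-integrable [set: Rsp k.+1] (EFin \o Phi phi z eps)]}].

Lemma good_ext Phi Psi: (forall phi z eps x, Phi phi z eps x = Psi phi z eps x) -> good Phi -> good Psi.
Proof.
move=> E; suff -> : Phi = Psi by [].
by apply/funext => phi; apply/funext => z; apply/funext => eps; apply/funext => x.
Qed.

Lemma good_op kk (h: field -> Rsp k.+1 -> R) (c: R) : bounded_op g p kk -> 0<=c ->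
 (forall phi, mfield phi -> mfun (Rsp k.+1) (h phi)) ->
 (forall phi z, `|h phi z| <= c*clnorm (phi (pt g z))) -> good (fun phi => OPf g kk (h phi)).
Proof.
move=> [B B0 HB] c0 mh hle; have p0: 0<p:=lt_trans ltr01 p1.
exists (B*c`^p); first by rewrite mulr_ge0 // powR_ge0.
move=> phi mphi foo; have mc:=m_clnorm mphi; have mj:=m_jz.
have mhp:=mh phi mphi.
(* The norm over the parameter space is bounded by the surface norm because the density [jz] is at
   least 1. *)
have Hle: (\int[mm]_z (`|h phi z| `^ p)%:E<=(c`^p)%:E*NN phi)%E.
 have m1: mfun (Rsp k.+1) (fun z => ((clnorm (phi (pt g z))`^p)*jz z)%:E).
  apply/mEFinP; apply: mfunM => //; exact: (mcomp (measurable_powR p)).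
 have m2:=m_powabs p mhp.
 have P0 z: (0<=((clnorm (phi (pt g z))`^p)*jz z)%:E)%E.
  by rewrite lee_fin mulr_ge0 ?powR_ge0 // (le_trans ler01 (jz_ge1 z)).
 rewrite /NN -ge0_integralZl_EFin ?powR_ge0 //.
 apply: ge0_le_integral => //.
 - exact: measurable_funeM.
 - move=> z _; rewrite -EFinM lee_fin.
  apply: (le_via ((c*clnorm (phi (pt g z)))`^p)).
  apply: ge0_ler_powR; rewrite ?nnegrE ?(ltW p0) ?mulr_ge0 ?sqrtr_ge0 //.
  rewrite powRM ?sqrtr_ge0 // ler_wpM2l ?powR_ge0 // ler_peMr ?powR_ge0 //; exact: jz_ge1.
have hoo: (\int[mm]_z (`|h phi z| `^ p)%:E < +oo)%E.
 by apply: le_lt_trans Hle _; rewrite lte_mul_pinfty ?lee_fin ?powR_ge0.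
have [Mb [mM M0 IM HM]]:=HB _ mhp hoo; exists Mb; split => //.
by apply: le_trans IM _; rewrite EFinM -muleA; apply: lee_wpmul2l; rewrite ?lee_fin.
Qed.

Lemma good0: good (fun _ _ _ _ => 0).
Proof.
have p0: 0<p:=lt_trans ltr01 p1.
exists 0 => // phi _ _; exists (fun=> 0%E); split => //.
 by rewrite integral0 mul0e.
apply: aeW => z; rewrite (_: (fun eps => _) = fun=> 0).
 split=> [|eps _ _|eps _]; first exact: is_cvg_cst.
  by rewrite /Rintegral integral0 /= normr0 powR0 // gt_eqF.
 exact: integrable0.
by apply/funext => eps; rewrite /Rintegral integral0.
Qed.

Lemma goodD Phi Psi: good Phi -> good Psi -> good (fun phi z eps x => Phi phi z eps x+Psi phi z eps x).
Proof.
move=> [B B0 HB] [B' B'0 HB']; have p0: 0<p:=lt_trans ltr01 p1.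
exists (2`^p*(B+B')); first by rewrite mulr_ge0 ?powR_ge0 // addr_ge0.
move=> phi mphi foo; have [M [mM M0 IM aM]]:=HB phi mphi foo; have [M' [mM' M'0 IM' aM']]:=HB' phi mphi foo.
exists (fun z => (2`^p)%:E*(M z+M' z))%E; split.
- apply: measurable_funeM; exact: emeasurable_funD.
- by move=> z; rewrite mule_ge0 ?lee_fin ?powR_ge0 // adde_ge0.
- rewrite ge0_integralZl_EFin ?powR_ge0 //; last 2 first.
  by move=> z _; exact: adde_ge0.
  exact: emeasurable_funD.
 rewrite ge0_integralD // EFinM -muleA; apply: lee_wpmul2l; first by rewrite lee_fin powR_ge0.
 by rewrite EFinD ge0_muleDl ?lee_fin //; exact: leeD.
apply: (ae_sub _ (ae_and aM aM')) => z [[c1 b1 i1] [c2 b2 i2]].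
have E eps: 0<eps -> \int[mm]_x (Phi phi z eps x+Psi phi z eps x) =
  \int[mm]_x Phi phi z eps x + \int[mm]_x Psi phi z eps x.
 by move=> e0; rewrite -RintegralD //; [exact: i1|exact: i2].
split.
- by apply: (conv0_near ltr01 (fun e e0 _ => E e e0)); exact: conv0D.
- move=> eps e0 eG; rewrite E // -[in X in `|_+X|](opprK (\int[mm]_x Psi phi z eps x)).
 apply: (le_via (2`^p*(`|\int[mm]_x Phi phi z eps x| `^ p + `|\int[mm]_x Psi phi z eps x| `^ p))%:E).
  by rewrite lee_fin -[in leRHS](normrN (\int[mm]_x Psi phi z eps x)); apply: powRB_le; exact: ltW.
 rewrite EFinM; apply: lee_wpmul2l; first by rewrite lee_fin powR_ge0.
 by rewrite EFinD; apply: leeD; [exact: b1|exact: b2].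
- move=> eps e0; have:=integrableD measurableT (i1 eps e0) (i2 eps e0); exact.
Qed.

Lemma goodZ (c: R) Phi: good Phi -> good (fun phi z eps x => c*Phi phi z eps x).
Proof.
move=> [B B0 HB]; have p0: 0<p:=lt_trans ltr01 p1.
exists (`|c| `^ p*B); first by rewrite mulr_ge0 ?powR_ge0.
move=> phi mphi foo; have [M [mM M0 IM aM]]:=HB phi mphi foo.
exists (fun z => (`|c| `^ p)%:E*M z)%E; split.
- exact: measurable_funeM.
- by move=> z; rewrite mule_ge0 ?lee_fin ?powR_ge0.
- rewrite ge0_integralZl_EFin ?powR_ge0 // EFinM -muleA; apply: lee_wpmul2l => //.
apply: (ae_sub _ aM) => z [c1 b1 i1].
have E eps: 0<eps -> \int[mm]_x (c*Phi phi z eps x) = c * \int[mm]_x Phi phi z eps x.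
 by move=> e0; rewrite RintegralZl //; exact: i1.
split.
- by apply: (conv0_near ltr01 (fun e e0 _ => E e e0)); exact: conv0M.
- move=> eps e0 eG; rewrite E // normrM powRM // EFinM; apply: lee_wpmul2l; last exact: b1.
 by rewrite lee_fin powR_ge0.
- move=> eps e0; have:=integrableZl measurableT c (i1 eps e0); exact.
Qed.

Lemma good_sum (I: finType) (Phi: I -> field -> Rsp k.+1 -> R -> Rsp k.+1 -> R) :
 (forall i, good (Phi i)) -> good (fun phi z eps x => \sum_i Phi i phi z eps x).
Proof.
move=> H; elim: (index_enum I) => [|i r IH].
 by apply: good_ext good0 => phi z eps x; rewrite big_nil.
by apply: good_ext (goodD (H i) IH) => phi z eps x; rewrite big_cons.
Qed.

Lemma good_if (b: bool) Phi: good Phi -> good (fun phi z eps x => if b then Phi phi z eps x else 0).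
Proof. by case: b => // _; exact: good0. Qed.

Definition integrand (C: {set 'I_k.+3}) phi z eps x: R :=
 (eps<=enorm (pt g x-pt g z))%R%:R*(pt g z 0 ord_max^+k.+1 *
  clsub (clmul (clmul (kerE (pt g x) (pt g z)) (clvec (unormal g (rs x)))) (phi (pt g x)))
  (clmul (clmul (kerF (pt g x) (pt g z)) (clhat (clvec (unormal g (rs x))))) (clhat (phi (pt g x)))) C)*jz x.

Lemma good_integrand C: good (integrand C).
Proof.
pose c:=\sum_(i<k.+3) (L+1).
have c0: 0<=c by apply: sumr_ge0 => i _; rewrite addr_ge0.
have HE: good (fun phi z eps x => (eps<=enorm (pt g x-pt g z))%R%:R*(pt g z 0 ord_max^+k.+1) *
  clmul (clmul (kerE (pt g x) (pt g z)) (clvec (unormal g (rs x)))) (phi (pt g x)) C*jz x).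
 apply: (good_ext (fun phi z eps x => esym (clmul_vec_expand _ _ _ _ _ _ _))).
 apply: good_sum => A; apply: good_sum => B; apply: good_if; apply: goodZ.
 apply: good_sum => D; apply: good_sum => F; apply: good_if; apply: goodZ.
 apply: good_sum => i; apply: good_if.
 have := @good_op _ (fun phi x => nuz x F*phi (pt g x) B) c (kE_bounded_op L0 gL g0 i p1) c0.
 move/(_ (fun phi mphi => mfunM (m_nuz F) (mphi B))).
 have hle (phi: field) z: `|nuz z F*phi (pt g z) B| <= c*clnorm (phi (pt g z)).
  by rewrite normrM; apply: ler_pM => //; [exact: nuz_le|exact: clnorm_ge].
 by move/(_ hle); apply: good_ext => phi z eps x; rewrite /OPf /kE /nuz !mulrA.
have HF: good (fun phi z eps x => (eps<=enorm (pt g x-pt g z))%R%:R*(pt g z 0 ord_max^+k.+1) *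
  clmul (clmul (kerF (pt g x) (pt g z)) (clhat (clvec (unormal g (rs x))))) (clhat (phi (pt g x))) C*jz x).
 apply: (good_ext (fun phi z eps x => esym (clmul_vec_expand _ _ _ _ _ _ _))).
 apply: good_sum => A; apply: good_sum => B; apply: good_if; apply: goodZ.
 apply: good_sum => D; apply: good_sum => F; apply: good_if; apply: goodZ.
 apply: good_sum => i; apply: good_if.
 have := @good_op _ (fun phi x => clhat (nuz x) F*clhat (phi (pt g x)) B) c (kF_bounded_op L0 gL g0 i p1) c0.
 have mhat (phi: field) : mfield phi ->
  mfun (Rsp k.+1) (fun x => clhat (nuz x) F*clhat (phi (pt g x)) B).
  move=> mphi; have n1:=m_nuz F; have n2:=mphi B.
  by rewrite /clhat; apply: mfunM; [case: (ord_max \in F)|case: (ord_max \in B)] => //;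
  exact: mfunN.
 move/(_ mhat).
 have hle (phi: field) z: `|clhat (nuz z) F*clhat (phi (pt g z)) B| <= c*clnorm (phi (pt g z)).
  by rewrite normrM !clhat_norm; apply: ler_pM => //; [exact: nuz_le|exact: clnorm_ge].
 move/(_ hle); apply: good_ext => phi z eps x.
 (* The hat only changes signs of coefficients, so it commutes with the real factor [jz x]. *)
 have nE: clhat (nuz x) F = clhat (clvec (unormal g (rs x))) F*jz x.
  by rewrite /clhat /nuz; case: ifP; rewrite ?mulNr.
 by rewrite /OPf /kF nE !mulrA.
apply: good_ext (goodD HE (goodZ (-1) HF)) => phi z eps x.
by rewrite /integrand /clsub; ring.
Qed.

Lemma TintE phi z eps C: Tint g phi (pt g z) eps C = \int[mm]_x integrand C phi z eps x.
Proof.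
rewrite /Tint /surfint /Rintegral; congr fine.
change (@lebn R k.+2.-1) with (@lebn R k.+1); rewrite -lebmE [LHS]integral_mkcond.
apply: eq_integral => t _; rewrite patchE /integrand.
case: ifPn => [/set_mem /= H|]; first by rewrite H mul1r.
by move/negP => H; rewrite (_: (_<=_) = false) ?mul0r //; apply/negP => K; apply: H; exact/mem_set.
Qed.

(** The bound is available only for radii up to the height [G], which suffices for the limit at
    0. *)
Lemma lim_powR_le (u: R -> R) (G: R) (b: \bar R) : 0<G -> conv0 u ->
 (forall eps, 0<eps -> eps<=G -> ((`|u eps| `^ p)%:E<=b)%E) ->
 ((`|lim (u @ 0^'+)| `^ p)%:E<=b)%E.
Proof.
move=> G0 cu ub; have p0: 0<p:=lt_trans ltr01 p1.
case: b ub => [b| |] ub; last 2 first; first exact: leey.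
 by have:=ub G G0 (lexx _).
have b0: 0<=b by have:=ub G G0 (lexx _); rewrite lee_fin; apply: le_trans; exact: powR_ge0.
have bE: (b`^p^-1)`^p = b by rewrite -powRrM mulVf ?gt_eqF // powRr1.
have ule eps: 0<eps -> eps<=G -> `|u eps| <= b`^p^-1.
 move=> e0 eG; have:=ub eps e0 eG; rewrite lee_fin => H.
 rewrite -[leLHS]powRr1 // -(mulfV (lt0r_neq0 p0)) powRrM; apply: ge0_ler_powR; rewrite ?nnegrE ?powR_ge0 //.
 by rewrite invr_ge0 ltW.
rewrite lee_fin -[leRHS]bE; apply: ge0_ler_powR; rewrite ?nnegrE ?powR_ge0 ?(ltW p0) //.
rewrite ler_norml; apply/andP; split.
 apply: limr_ge => //; near=> eps.
 have /andP[] : - (b`^p^-1)<=u eps<=b`^p^-1; last by [].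
 by rewrite -ler_norml; apply: ule; near: eps; [exact: nbhs_right_gt|exact: nbhs_right_le].
apply: limr_le => //; near=> eps.
have /andP[] : - (b`^p^-1)<=u eps<=b`^p^-1; last by [].
by rewrite -ler_norml; apply: ule; near: eps; [exact: nbhs_right_gt|exact: nbhs_right_le].
Unshelve. all: by end_near. Qed.

Lemma surfintE phi: surfint g setT (fun (w: 'rV[R]_k.+3) _ => (powR (clnorm (phi w)) p)%:E) = NN phi.
Proof.
rewrite /surfint (_: [set t | _] = setT); last by apply/seteqP; split.
by change (@lebn R k.+2.-1) with (@lebn R k.+1); rewrite -lebmE.
Qed.

Lemma TSigma_bounded: exists C: R, forall phi, inLp g p phi ->
 sigma_ae g (PVexists g phi) /\ (NN (TSigma g phi)<=C%:E*NN phi)%E.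
Proof.
have p0: 0<p:=lt_trans ltr01 p1.
have [J J0 HJ]:=jz_le.
have /choice[B HB] : forall C, exists B: R, 0<=B /\ forall phi, mfield phi -> (NN phi < +oo)%E ->
 exists Mb: Rsp k.+1 -> \bar R, [/\ mfun (Rsp k.+1) Mb, (forall z, 0<=Mb z)%E,
  (\int[mm]_z Mb z<=B%:E*NN phi)%E &
  {ae mm, forall z, [/\ conv0 (fun eps => \int[mm]_x integrand C phi z eps x),
  forall eps, 0<eps -> eps<=gz g z -> ((`|\int[mm]_x integrand C phi z eps x| `^ p)%:E<=Mb z)%E &
  forall eps, 0<eps -> mm.-integrable [set: Rsp k.+1] (EFin \o integrand C phi z eps)]}].
 by move=> C; have [B B0 HB]:=good_integrand C; exists B.
pose a: R:=2^+k.+1/omega R k.+3.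
(* [J] bounds the surface density, the power of the cardinality comes from comparing the Clifford
   norm with the sum of the coefficients, and [a] is the normalising constant of [TSigma]. *)
pose K: R:=J*(#|{set 'I_k.+3}|%:R`^p * `|a| `^ p).
have K0: 0<=K by rewrite !mulr_ge0 ?powR_ge0.
exists (K * \sum_C B C) => phi [mphi]; rewrite surfintE => foo.
have /choice[Mb HM] : forall C, exists Mb: Rsp k.+1 -> \bar R,
  [/\ mfun (Rsp k.+1) Mb, (forall z, 0<=Mb z)%E,
  (\int[mm]_z Mb z<=(B C)%:E*NN phi)%E &
  {ae mm, forall z, [/\ conv0 (fun eps => \int[mm]_x integrand C phi z eps x),
  forall eps, 0<eps -> eps<=gz g z -> ((`|\int[mm]_x integrand C phi z eps x| `^ p)%:E<=Mb z)%E &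
  forall eps, 0<eps -> mm.-integrable [set: Rsp k.+1] (EFin \o integrand C phi z eps)]}].
 by move=> C; have [_ H]:=HB C; exact: H.
have aeall: {ae mm, forall z, forall C, conv0 (fun eps => Tint g phi (pt g z) eps C) /\
  ((`|lim ((fun eps => Tint g phi (pt g z) eps C) @ 0^'+)| `^ p)%:E<=Mb C z)%E}.
 apply: ae_forall_fin => C; have [_ _ _ aC]:=HM C.
 apply: (ae_sub _ aC) => z [c1 b1 _].
 have -> : (fun eps => Tint g phi (pt g z) eps C) = (fun eps => \int[mm]_x integrand C phi z eps x).
  by apply/funext => eps; rewrite TintE.
 by split => //; apply: lim_powR_le b1 => //; exact: g0.
split.
 rewrite /sigma_ae; change (@lebn R k.+2.-1) with (@lebn R k.+1); rewrite -lebmE.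
 by apply: (ae_sub _ aeall) => z H C; have []:=H C.
have mS: mfun (Rsp k.+1) (fun z => \sum_C Mb C z)%E.
 by apply: emeasurable_sum => C; have []:=HM C.
have M0 C z: (0<=Mb C z)%E by have [_ H _ _]:=HM C; exact: H.
apply: (le_via (\int[mm]_z (K%:E * \sum_C Mb C z))%E).
 apply: ae_le_integral.
 - move=> z; rewrite lee_fin mulr_ge0 ?powR_ge0 // (le_trans ler01 (jz_ge1 z)) //.
 - exact: measurable_funeM.
 - by move=> z; rewrite mule_ge0 ?lee_fin // sume_ge0.
 apply: (ae_sub _ aeall) => z H.
 set l:=fun C => lim ((fun eps => Tint g phi (pt g z) eps C) @ 0^'+) in H.
 have TE C: `|TSigma g phi (pt g z) C| = `|a| * `|l C| by rewrite -normrM.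
 apply: (le_via (K * \sum_C `|l C| `^ p)%:E).
  rewrite lee_fin mulrC /K -[leRHS]mulrA; apply: ler_pM; rewrite ?powR_ge0 //.
  exact: le_trans ler01 (jz_ge1 z).
  apply: (le_via ((\sum_C `|TSigma g phi (pt g z) C|)`^p)).
  by apply: ge0_ler_powR; rewrite ?nnegrE ?(ltW p0) ?sqrtr_ge0 ?sumr_ge0 //; exact: clnorm_le_sum.
  apply: le_trans (powR_sum_le p0 _) _ => //.
  rewrite -mulrA; apply: ler_wpM2l; first exact: powR_ge0.
  rewrite mulr_sumr; apply: ler_sum => C _.
  by rewrite TE powRM.
 rewrite EFinM; apply: lee_wpmul2l; first by rewrite lee_fin.
 by rewrite -sumEFin; apply: lee_sum => C _; have []:=H C.
rewrite ge0_integralZl_EFin //; last by move=> z _; exact: sume_ge0.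
rewrite (EFinM K) -muleA; apply: lee_wpmul2l; first by rewrite lee_fin.
rewrite ge0_integral_sum //; last by move=> C; have []:=HM C.
rewrite -sumEFin ge0_sume_distrl; last by move=> C _; rewrite lee_fin; have []:=HB C.
by apply: lee_sum => C _; have []:=HM C.
Qed.

End Surface.

(* n = m.+1 ; Sigma = {(x', g x')} ; phi is only used on Sigma *)
Theorem theorem8 (R : realType) (m : nat) (g : 'rV[R]_m -> R) :
 (2 < m.+1)%N ->
 lipschitz g ->
 (forall x' : 'rV[R]_m, 0 < (graphpt g x') 0 ord_max) ->
 (exists2 delta : R, 0 < delta & forall (x' : 'rV[R]_m) (z : 'rV[R]_m.+1),
  z 0 ord_max = 0 -> delta <= enorm (graphpt g x' - z)) ->
 forall p : R, 1 < p ->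
 exists C : R, forall phi : 'rV[R]_m.+1 -> Cl R m.+1,
  inLp g p phi ->
  sigma_ae g (PVexists g phi) /\
  (surfint g setT (fun y _ => (powR (clnorm (TSigma g phi y)) p)%:E)
  <= C%:E * surfint g setT (fun x _ => (powR (clnorm (phi x)) p)%:E))%E.
Proof.
case: m g => [|[|k]] // g _ glip g0' _ p p1.
have [L L0 gL] := lipschitz_bound glip.
have g0 x : 0 < g x by have := g0' x; rewrite mxE unlift_none.
have [C HC] := TSigma_bounded L0 gL g0 p1; exists C => phi phiL.
by rewrite !surfintE; exact: HC.
Qed.
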